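(* Let $n,l,d\in\mathbb N$, $1<p_1,\dots,p_l<\infty$, $\frac1p=\frac1{p_1}+\cdots+\frac1{p_l}$, $1<u<\infty$ with $\frac1u+\frac1{u'}=1$, and $0<s_1,\dots,s_d<\infty$. Suppose that $$\|T_m(f_1,\dots,f_l)\|_{L^p(\mathbb R^{dn})}\lesssim \mathcal A^u_{s_1,\dots,s_d}[m]\prod_{i=1}^l\|f_i\|_{L^{p_i}(\mathbb R^{dn})}$$ holds for all $m$ with $\mathcal A^u_{s_1,\dots,s_d}[m]<\infty$ and all Schwartz $f_i$ on $\mathbb R^{dn}$. Then necessarily $$\min\Big\{\frac{s_1}n,\dots,\frac{s_d}n\Big\}\ge \max\Big\{\max_I\Big(\frac1p-\frac12-\sum_{i\in I}\big(\tfrac1{p_i}-\tfrac12\big)\Big),\ \max_I\Big(\frac1p-\frac1{u'}-\sum_{i\in I}\big(\tfrac1{p_i}-\tfrac1u\big)\Big)\Big\}$$ and $$\min\Big\{\frac{s_1}n,\dots,\frac{s_d}n\Big\}>\max\Big\{\frac lu,\ \frac1p-\frac1{u'}\Big\},$$ where the maxima run over all subsets $I\subseteq\{1,\dots,l\}$.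
   Context: Fourier transform $\widehat f(\xi)=\int f(x)e^{-2\pi i\langle x,\xi\rangle}dx$. For $i=1,\dots,l$ write $\xi_i=(\xi_{i,1},\dots,\xi_{i,d})\in\mathbb R^{dn}$, $\xi_{i,j}\in\mathbb R^n$, and for $j=1,\dots,d$ let $\vec{\xi^j}=(\xi_{1,j},\dots,\xi_{l,j})\in\mathbb R^{ln}$. $T_m(f_1,\dots,f_l)(x)=\int m(\xi_1,\dots,\xi_l)\prod_{i}\widehat{f_i}(\xi_i)e^{2\pi i\langle x,\xi_1+\cdots+\xi_l\rangle}d\xi_1\cdots d\xi_l$, $x\in\mathbb R^{dn}$. $\Theta_j$ are fixed Schwartz functions on $\mathbb R^{ln}$ with $\widehat{\Theta_j}$ supported in $\{1/2\le|\vec{\xi^j}|\le2\}$. $\|F\|_{L^u_{s_1,\dots,s_d}}=\|[\prod_j(1+4\pi^2|\vec{\xi^j}|^2)^{s_j/2}\widehat F]^\vee\|_{L^u((\mathbb R^{ln})^d)}$ and $\mathcal A^u_{s_1,\dots,s_d}[m]=\sup_{k_1,\dots,k_d\in\mathbb Z}\|m(2^{k_1}\vec{\xi^1},\dots,2^{k_d}\vec{\xi^d})\widehat{\Theta_1}(\vec{\xi^1})\cdots\widehat{\Theta_d}(\vec{\xi^d})\|_{L^u_{s_1,\dots,s_d}}$. *)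

(* Defs.v *)
From mathcomp Require Import all_boot all_order all_algebra.
From mathcomp Require Import all_classical all_reals all_analysis.
From mathcomp Require Export complex.
Export Order.TTheory GRing.Theory Num.Theory.

Set Implicit Arguments.
Unset Strict Implicit.
Unset Printing Implicit Defensive.

Local Open Scope classical_set_scope.
Local Open Scope ring_scope.
Local Open Scope complex_scope.

Section Defs.
Variable R : realType.
Local Notation C := (R[i]).

Definition cre (z : C) : R := let: a +i* _ := z in a.
Definition cim (z : C) : R := let: _ +i* b := z in b.
Definition cabs (z : C) : R := Num.sqrt (cre z ^+ 2 + cim z ^+ 2).
Definition cexpi (t : R) : C := cos t +i* sin t.
Definition cR (r : R) : C := r +i* 0.

Definition upd (I : finType) (x : I -> R) (i : I) (t : R) : I -> R :=
  fun k => if k == i then t else x k.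
Definition dotp (I : finType) (x y : I -> R) : R := \sum_k x k * y k.
Definition sqnorm (I : finType) (x : I -> R) : R := \sum_k x k ^+ 2.
Definition enorm (I : finType) (x : I -> R) : R := Num.sqrt (sqnorm x).

(* Borel sigma-algebra of R^I: generated by the coordinate cylinders *)
Definition coord_gen (I : finType) : set (set (I -> R)) :=
  [set B | exists k : I, exists A : set R,
      measurable A /\ B = (fun x : I -> R => x k) @^-1` A].
Definition rmeasurable (I : finType) (g : (I -> R) -> R) : Prop :=
  forall B : set R, measurable B ->
    smallest (sigma_algebra setT) (@coord_gen I) (g @^-1` B).
Definition cmeasurable (I : finType) (g : (I -> R) -> C) : Prop :=
  rmeasurable (fun x => cre (g x)) /\ rmeasurable (fun x => cim (g x)).

(* Lebesgue integral over R^I, computed as the iterated one-dimensional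
   Lebesgue integral over the coordinates (Tonelli/Fubini) *)
Fixpoint iter_int (I : finType) (s : seq I) (f : (I -> R) -> \bar R)
    (x : I -> R) : \bar R :=
  match s with
  | [::] => f x
  | i :: s' => (\int[@lebesgue_measure R]_t iter_int s' f (upd x i t))%E
  end.
Definition integ (I : finType) (f : (I -> R) -> \bar R) : \bar R :=
  iter_int (enum I) f (fun _ => 0).
Definition Rint (I : finType) (h : (I -> R) -> R) : R :=
  fine (integ (fun x => (h x)%:E)).
Definition Cint (I : finType) (g : (I -> R) -> C) : C :=
  Rint (fun x => cre (g x)) +i* Rint (fun x => cim (g x)).

Definition Lpnorm (I : finType) (p : R) (g : (I -> R) -> C) : \bar R :=
  poweR (integ (fun x => (powR (cabs (g x)) p)%:E)) p^-1.

Definition integrable (I : finType) (g : (I -> R) -> C) : Prop :=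
  cmeasurable g /\ (integ (fun x => (cabs (g x))%:E) < +oo)%E.

Definition FT (I : finType) (g : (I -> R) -> C) : (I -> R) -> C :=
  fun xi => Cint (fun x => g x * cexpi (- (2 * pi * dotp x xi))).

Definition pderiv (I : finType) (i : I) (f : (I -> R) -> R) : (I -> R) -> R :=
  fun x => derive1 (fun t => f (upd x i t)) (x i).
Fixpoint dpart (I : finType) (s : seq I) (f : (I -> R) -> R) : (I -> R) -> R :=
  match s with [::] => f | i :: s' => pderiv i (dpart s' f) end.
(* all iterated partial derivatives exist everywhere and are rapidly
   decreasing (this forces smoothness: bounded partials give continuity) *)
Definition rSchwartz (I : finType) (f : (I -> R) -> R) : Prop :=
  (forall (s : seq I) (i : I) (x : I -> R),
      derivable (fun t => dpart s f (upd x i t)) (x i) 1) /\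
  (forall (s : seq I) (N : nat), exists M : R,
      forall x, (1 + sqnorm x) ^+ N * `|dpart s f x| <= M).
Definition Schwartz (I : finType) (g : (I -> R) -> C) : Prop :=
  rSchwartz (fun x => cre (g x)) /\ rSchwartz (fun x => cim (g x)).

(* R^{dn}: coordinates (j,k), j < d, k < n.
   multiplier variable (xi_1,...,xi_l) in R^{ldn}: coordinates (i,(j,k)). *)
Definition ptJ (d n : nat) := ('I_d * 'I_n)%type.
Definition ptK (l d n : nat) := ('I_l * ('I_d * 'I_n))%type.

Definition xi_i (l d n : nat) (xi : ptK l d n -> R) (i : 'I_l) :
  ptJ d n -> R := fun jk => xi (i, jk).
Definition xi_sum (l d n : nat) (xi : ptK l d n -> R) : ptJ d n -> R :=
  fun jk => \sum_(i < l) xi (i, jk).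

Definition Tm (l d n : nat) (m : (ptK l d n -> R) -> C)
    (f : 'I_l -> (ptJ d n -> R) -> C) : (ptJ d n -> R) -> C :=
  fun x => Cint (fun xi : ptK l d n -> R =>
    m xi * (\prod_(i < l) FT (f i) (xi_i xi i))
         * cexpi (2 * pi * dotp x (xi_sum xi))).

Definition vblock (l d n : nat) (xi : ptK l d n -> R) (j : 'I_d) :
  ('I_l * 'I_n) -> R := fun ik => xi (ik.1, (j, ik.2)).
Definition dil (l d n : nat) (k : 'I_d -> int) (xi : ptK l d n -> R) :
  ptK l d n -> R := fun ijk => (2 : R) ^ (k ijk.2.1) * xi ijk.

Definition Fm (l d n : nat) (Theta : 'I_d -> (('I_l * 'I_n) -> R) -> C)
    (m : (ptK l d n -> R) -> C) (k : 'I_d -> int) : (ptK l d n -> R) -> C :=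
  fun xi => m (dil k xi) * \prod_(j < d) FT (Theta j) (vblock xi j).

Definition weight (l d n : nat) (s : 'I_d -> R) (eta : ptK l d n -> R) : R :=
  \prod_(j < d) powR (1 + 4 * pi ^+ 2 * sqnorm (vblock eta j)) (s j / 2).

(* ||F||_{L^u_{s_1..s_d}} = || [weight * \hat F]^vee ||_{L^u}, the inverse
   Fourier transform being taken in the sense of tempered distributions:
   G = [weight * \hat F]^vee  iff  <G, \hat phi> = <F, (weight phi)^> for
   all Schwartz phi.  (F compactly supported, taken in L^1.)  The value is
   +oo when no such G exists. *)
Definition sobnorm (l d n : nat) (u : R) (s : 'I_d -> R)
    (F : (ptK l d n -> R) -> C) : \bar R :=
  ereal_inf [set Lpnorm u G | G in
    [set G : (ptK l d n -> R) -> C |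
       integrable F /\ cmeasurable G /\
       forall phi : (ptK l d n -> R) -> C, Schwartz phi ->
         Cint (fun x => G x * FT phi x)
         = Cint (fun x => F x * FT (fun y => cR (weight s y) * phi y) x)]].

Definition Anorm (l d n : nat) (u : R) (s : 'I_d -> R)
    (Theta : 'I_d -> (('I_l * 'I_n) -> R) -> C)
    (m : (ptK l d n -> R) -> C) : \bar R :=
  ereal_sup [set sobnorm u s (Fm Theta m k) | k in [set: 'I_d -> int]].

End Defs.

(* Main.v *)
(** Fix a block [j0] and test the hypothesis on multipliers that depend on the
    frequencies of that block only and on functions that are complex Gaussians,
    so that [T_m] of them is again an explicit Gaussian.  The multiplier norm is
    bounded above by writing (1 - Laplacian)^(s/2) as classical derivatives
    followed by a subordinated heat semigroup: only the size of the derivatives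
    of the multiplier on the dyadic annuli matters.
    Multipliers concentrated, at scale [1/N], near the hyperplane where the sum
    of the frequencies vanishes give the second family of non-strict
    inequalities as [N] tends to infinity; chirps [exp (- pi i N sg^2)], [sg] that
    sum, give the first one.
    The strict inequalities come from adding up [r] bumps of sparse scales: at
    the critical exponent the multiplier norm grows only like [r^(1/u)] (gliding
    hump), while the left-hand side grows like [r] for bumps centered at a point
    of the annulus ([l/u < s/n]) and like [r^(1/p)] for bumps at the hyperplane
    ([1/p - 1/u' < s/n], where equality forces [p < u]). *)
From HB Require Import structures.
Require Import Defs.
From mathcomp Require Import all_boot all_order all_algebra.
From mathcomp Require Import all_classical all_reals all_analysis.
From mathcomp Require Import complex.
From mathcomp Require Import measurable_realfun lebesgue_integral_under.
From mathcomp Require Import ring lra zify.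
Import Order.TTheory GRing.Theory Num.Theory.
Import numFieldNormedType.Exports.
Set Implicit Arguments.
Unset Strict Implicit.
Unset Printing Implicit Defensive.
Local Open Scope classical_set_scope.
Local Open Scope ring_scope.
Local Open Scope complex_scope.

(** The multiplier norm contains an infimum over functions [G], so an upper bound needs only one
    explicit [G] whose Fourier transform is the weight times that of [F]. The heat formula for
    [(1 - Laplacian)^al] with [0 < al < 1] produces it in [L^1] and bounds its [L^u] norm by
    Minkowski's inequality alone, with no multiplier theorem on [L^u]. The obstacle is the supremum
    over dilations: every estimate has to be uniform in a scale [rho = 2^k], Gaussian decay paying
    for large [rho]. What is free is how the integrand of [T_m] is split between multiplier and
    inputs. The product of [m] with the input transforms is prescribed as a Gaussian in sheared
    coordinates, one of which is a sum of frequencies, and the multiplier is the quotient by the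
    input transforms. The quotient must still decay in every direction; this fixes constants such as
    [4 l + 2] and [6 N^2]. For a single Gaussian the norms of output and inputs are exact powers of
    a parameter and the multiplier norm is at most such a power, so a necessary condition is a
    comparison of two exponents. *)

Lemma le_of_eq (disp : Order.disp_t) (T : porderType disp) (x y : T) : x = y -> (x <= y)%O.
Proof. by move=> ->. Qed.

(** * Lebesgue measure on R^K for a finite index set K *)

Section A.
Variables (R : realType).
Local Notation leb := (@lebesgue_measure R).
Local Notation RT := (measurableTypeR R).
Import HBNNSimple.

Section space.
Variable K : finType.
(** Alias carrying the cylinder sigma-algebra, so that [rmeasurable] becomes ordinary measurability
    on a measurable type. *)
Definition fspace := g_sigma_algebraType (@coord_gen R K).
HB.instance Definition _ := Measurable.on fspace.

Lemma rmeasurableP (g : (K -> R) -> R) :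
  rmeasurable g <-> measurable_fun [set: fspace] (g : fspace -> R).
Proof.
split=> [mg _ B mB|mg B mB]; first by rewrite setTI; exact: mg.
by have := mg measurableT B mB; rewrite setTI.
Qed.

Lemma measurable_coord (k : K) : measurable_fun [set: fspace] (fun x : fspace => x k).
Proof.
by apply/rmeasurableP => B mB; apply: sub_sigma_algebra; exists k, B.
Qed.

Lemma measurable_fspace d (T : measurableType d) (f : T -> fspace) :
  (forall k, measurable_fun setT (fun t => f t k)) -> measurable_fun setT f.
Proof.
move=> mf; apply: (@measurability _ _ T fspace setT f (@coord_gen R K)) => //.
move=> _ [B [k [A [mA ->]]] <-]; rewrite setTI -comp_preimage.
by have := mf k measurableT A mA; rewrite setTI.
Qed.

Lemma measurable_upd (i : K) :
  measurable_fun setT (fun z : fspace * R => upd z.1 i z.2 : fspace).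
Proof.
apply: measurable_fspace => k; rewrite /upd; case: eqP => _ /=.
  exact: measurable_snd.
exact: measurableT_comp (measurable_coord k) measurable_fst.
Qed.

Lemma measurable_upd1 (i : K) (x : fspace) :
  measurable_fun setT (fun t : R => upd x i t : fspace).
Proof.
apply: measurable_fspace => k; rewrite /upd; case: eqP => _ //=.
Qed.

Lemma upd_upd (x : K -> R) i s t : upd (upd x i s) i t = upd x i t.
Proof. by apply/funext => k; rewrite /upd; case: eqP. Qed.

Lemma updC (x : K -> R) i j s t : i != j ->
  upd (upd x i s) j t = upd (upd x j t) i s.
Proof.
move=> ij; apply/funext => k; rewrite /upd; case: eqP => // ->.
by rewrite eq_sym (negbTE ij).
Qed.

Lemma upd_id (x : K -> R) i : upd x i (x i) = x.
Proof. by apply/funext => k; rewrite /upd; case: eqP => // ->. Qed.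

Local Open Scope ereal_scope.

Lemma iter_int_ge0 s (f : (K -> R) -> \bar R) :
  (forall x, 0 <= f x) -> forall x, 0 <= iter_int s f x.
Proof. by move=> f0; elim: s => //= i s IH x; apply: integral_ge0 => t _. Qed.

Lemma measurable_iter_int s (f : fspace -> \bar R) :
  (forall x, 0 <= f x) -> measurable_fun [set: fspace] f ->
  measurable_fun [set: fspace] (iter_int s f).
Proof.
move=> f0 mf; elim: s => //= i s IH.
pose F (z : fspace * RT) := iter_int s f (upd z.1 i z.2).
apply: (@measurable_fun_fubini_tonelli_F _ _ _ _ R leb F) => [|z].
  exact: measurableT_comp IH (measurable_upd i).
exact: iter_int_ge0.
Qed.

Lemma eq_iter_int s (f g : (K -> R) -> \bar R) : f =1 g -> iter_int s f =1 iter_int s g.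
Proof. by move=> fg x; have -> : f = g by apply/funext. Qed.

Lemma iter_int_cat s1 s2 (f : (K -> R) -> \bar R) :
  iter_int (s1 ++ s2) f = iter_int s1 (iter_int s2 f).
Proof. by elim: s1 => //= i s ->. Qed.

(** Tonelli in the two outer coordinates; the integral over the remaining ones is a nonnegative
    measurable function of that pair. *)
Lemma iter_int_swap i j s (f : fspace -> \bar R) :
  (forall x, 0 <= f x) -> measurable_fun [set: fspace] f ->
  iter_int [:: i, j & s] f = iter_int [:: j, i & s] f.
Proof.
move=> f0 mf; apply/funext => x /=.
have [->//|ij] := eqVneq i j.
pose F (z : RT * RT) := iter_int s f (upd (upd x i z.1) j z.2).
have mF : measurable_fun setT F.
  apply: (@measurableT_comp _ _ _ _ fspace _ (iter_int s f)).
    exact: measurable_iter_int.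
  apply: measurable_fspace => k; rewrite /upd; case: eqP => _ /=.
    exact: measurable_snd.
  by case: eqP => _ //=; exact: measurable_fst.
have F0 z : 0 <= F z by exact: iter_int_ge0.
transitivity (\int[leb]_t \int[leb]_r F (t, r)); first reflexivity.
rewrite (@fubini_tonelli _ _ _ _ R leb leb F mF F0).
by apply: eq_integral => t _; apply: eq_integral => r _; rewrite /F /= updC.
Qed.

Lemma iter_int_perm s s' (f : fspace -> \bar R) :
  (forall x, 0 <= f x) -> measurable_fun [set: fspace] f ->
  perm_eq s s' -> iter_int s f = iter_int s' f.
Proof.
move=> f0 mf; elim: s s' => [|i s IH] s' ss'.
  by move: ss'; rewrite perm_sym => /perm_nilP ->.
have is' : i \in s' by rewrite -(perm_mem ss') mem_head.
case/path.splitPr: is' ss' => [p q] ss'.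
have sp : perm_eq s (p ++ q).
  by rewrite -(perm_cons i) (perm_trans ss') // perm_catC /= perm_cons perm_catC.
transitivity (iter_int (i :: (p ++ q)) f).
  by apply/funext => x /=; rewrite (IH _ sp).
elim: p {ss' sp} => //= j p IHp.
have := @iter_int_swap i j (p ++ q) f f0 mf => /= ->.
by apply/funext => x; rewrite -IHp.
Qed.

Lemma iter_int_congr s (f : (K -> R) -> \bar R) x y :
  (forall k, k \notin s -> x k = y k) -> iter_int s f x = iter_int s f y.
Proof.
elim: s x y => [|i s IH] x y xy /=.
  by congr f; apply/funext => k; apply: xy.
apply: eq_integral => t _; apply: IH => k ks; rewrite /upd.
by case: eqP => // /eqP ki; apply: xy; rewrite inE negb_or ki.
Qed.

Lemma iter_intD s (f g : fspace -> \bar R) :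
  (forall x, 0 <= f x) -> measurable_fun [set: fspace] f ->
  (forall x, 0 <= g x) -> measurable_fun [set: fspace] g ->
  iter_int s (fun x => f x + g x) = (fun x => iter_int s f x + iter_int s g x).
Proof.
move=> f0 mf g0 mg; elim: s => //= i s ->; apply/funext => x /=.
rewrite ge0_integralD //.
- by move=> t _; exact: iter_int_ge0.
- apply: (@measurableT_comp _ _ _ _ fspace _ (iter_int s f)) => //.
    exact: measurable_iter_int.
  exact: measurable_upd1.
- by move=> t _; exact: iter_int_ge0.
- apply: (@measurableT_comp _ _ _ _ fspace _ (iter_int s g)) => //.
    exact: measurable_iter_int.
  exact: measurable_upd1.
Qed.

Lemma measurable_iter_int1 s i (f : fspace -> \bar R) x :
  (forall x, 0 <= f x) -> measurable_fun [set: fspace] f ->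
  measurable_fun setT (fun t : R => iter_int s f (upd x i t)).
Proof.
move=> f0 mf; apply: (@measurableT_comp _ _ _ _ fspace _ (iter_int s f)) => //.
  exact: measurable_iter_int.
exact: measurable_upd1.
Qed.

Lemma iter_intZ s (k : R) (f : fspace -> \bar R) : (0 <= k)%R ->
  (forall x, 0 <= f x) -> measurable_fun [set: fspace] f ->
  iter_int s (fun x => k%:E * f x) = (fun x => k%:E * iter_int s f x).
Proof.
move=> k0 f0 mf; elim: s => //= i s ->; apply/funext => x /=.
rewrite ge0_integralZl //.
- exact: measurable_iter_int1.
- by move=> t _; exact: iter_int_ge0.
Qed.

Lemma iter_int0 s (x : K -> R) : iter_int s (fun=> 0) x = 0.
Proof.
elim: s x => //= i s IH x.
by under eq_integral do rewrite IH; rewrite integral0.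
Qed.

Lemma iter_int_nneseries s (f : (fspace -> \bar R)^nat) :
  (forall n x, 0 <= f n x) -> (forall n, measurable_fun [set: fspace] (f n)) ->
  iter_int s (fun x => \sum_(n <oo) f n x) = (fun x => \sum_(n <oo) iter_int s (f n) x).
Proof.
move=> f0 mf; elim: s => //= i s ->; apply/funext => x /=.
rewrite integral_nneseries //.
- by move=> n; exact: measurable_iter_int1.
- by move=> n t _; exact: iter_int_ge0.
Qed.

Lemma iter_int_le s (f g : fspace -> \bar R) :
  (forall x, 0 <= f x) -> measurable_fun [set: fspace] f ->
  measurable_fun [set: fspace] g ->
  (forall x, f x <= g x) -> forall x, iter_int s f x <= iter_int s g x.
Proof.
move=> f0 mf mg fg; elim: s => //= i s IH x.
have g0 y : 0 <= g y by exact: le_trans (fg y).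
apply: ge0_le_integral => //.
- by move=> t _; exact: iter_int_ge0.
- exact: measurable_iter_int1.
- exact: measurable_iter_int1.
Qed.

Lemma iter_int_lim s (f : (fspace -> \bar R)^nat) :
  (forall n x, 0 <= f n x) -> (forall n, measurable_fun [set: fspace] (f n)) ->
  (forall x, {homo f^~ x : n m / (n <= m)%N >-> n <= m}) ->
  iter_int s (fun x => limn (f ^~ x)) = (fun x => limn (fun n => iter_int s (f n) x)).
Proof.
move=> f0 mf ndf; elim: s => //= i s ->; apply/funext => x /=.
rewrite monotone_convergence //.
- by move=> n; exact: measurable_iter_int1.
- by move=> n t _; exact: iter_int_ge0.
- by move=> t _ n m nm; apply: iter_int_le => // y; exact: ndf.
Qed.

(** The iterated integral of indicators. Once [integ] is known to be integration against this
    measure, the convergence and Fubini theorems for measures become available. *)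
Definition mu_fspace (A : set fspace) : \bar R := integ (fun x => (\1_A x)%:E).

Fact mu_fspace0 : mu_fspace set0 = 0.
Proof.
rewrite /mu_fspace /integ -[RHS](iter_int0 (enum K) (fun=> 0%R)).
by apply: eq_iter_int => x; rewrite indicE in_set0.
Qed.

Fact mu_fspace_ge0 A : 0 <= mu_fspace A.
Proof. by apply: iter_int_ge0 => x; rewrite lee_fin. Qed.

Fact mu_fspace_sigma_additive : semi_sigma_additive mu_fspace.
Proof.
move=> F mF tF mUF; rewrite /mu_fspace.
have mI A : measurable A -> measurable_fun [set: fspace] (fun x : fspace => (\1_A x : R)%:E).
  by move=> mA; apply/measurable_EFinP; exact: measurable_indic.
rewrite [X in _ --> X](_ : _ = \sum_(n <oo) integ (fun x => (\1_(F n) x)%:E)).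
  by apply: is_cvg_ereal_nneg_natsum => n _; exact: mu_fspace_ge0.
rewrite /integ -[RHS](congr1 (fun h => h (fun=> 0%R))
  (@iter_int_nneseries (enum K) (fun n x => (\1_(F n) x)%:E) _ _)) => [|n x|n].
- by apply: eq_iter_int => x; rewrite indic_bigcup.
- by rewrite lee_fin.
- exact: mI.
Qed.

HB.instance Definition _ := isMeasure.Build _ fspace R mu_fspace
  mu_fspace0 mu_fspace_ge0 mu_fspace_sigma_additive.

Lemma integ_sum (T : Type) (s : seq T) (f : T -> fspace -> \bar R) :
  (forall i x, 0 <= f i x) -> (forall i, measurable_fun [set: fspace] (f i)) ->
  integ (fun x => \sum_(i <- s) f i x) = \sum_(i <- s) integ (f i).
Proof.
move=> f0 mf; elim: s => [|i s IH].
  rewrite big_nil -[RHS](iter_int0 (enum K) (fun=> 0%R)).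
  by apply: eq_iter_int => x; rewrite big_nil.
rewrite big_cons -IH /integ -[RHS](congr1 (fun h => h (fun=> 0%R)) (@iter_intD _ _ _ _ _ _ _)) //.
- by apply: eq_iter_int => x; rewrite big_cons.
- by move=> x; apply: sume_ge0.
- exact: emeasurable_sum.
Qed.

(** The two sides agree on indicators by construction of the measure, hence on simple functions, and
    both commute with increasing limits. *)
Lemma integE (f : fspace -> \bar R) :
  (forall x, 0 <= f x) -> measurable_fun [set: fspace] f ->
  integ f = \int[mu_fspace]_x f x.
Proof.
move=> f0 mf; pose g := nnsfun_approx measurableT mf.
have mg n : measurable_fun [set: fspace] (fun x => (g n x)%:E).
  by apply/measurable_EFinP.
have gn0 n x : 0 <= (g n x)%:E by rewrite lee_fin.
have ndg (x : fspace) : {homo (fun n => (g n x)%:E) : n m / (n <= m)%N >-> n <= m}.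
  by move=> n m nm; rewrite lee_fin; exact/lefP/nd_nnsfun_approx.
have fE : f = fun x => limn (fun n => (g n x)%:E).
  by apply/funext => x; apply/esym/cvg_lim => //; exact: cvg_nnsfun_approx.
rewrite fE monotone_convergence //.
rewrite /integ (iter_int_lim (enum K) gn0 mg ndg).
congr (limn _); apply/funext => n.
transitivity (integ (fun x : K -> R => \sum_(r <- finmap.enum_fset (fset_set (range (g n))))
     r%:E * (\1_(g n @^-1` [set r]) x)%:E)).
  apply: eq_iter_int => x; rewrite fimfunE fsbig_finite //=.
  by rewrite -sumEFin.
have rge0 r : r \in range (g n) -> (0 <= r)%R.
  by rewrite inE => -[y _ <-].
have mI r : measurable_fun [set: fspace] (fun x : fspace => (\1_(g n @^-1` [set r]) x : R)%:E).
  by apply/measurable_EFinP; exact: measurable_indic.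
(* Only values in the range of [g n] occur. Truncation at 0 makes the summand nonnegative for every
   real [r], as additivity requires. *)
transitivity (integ (fun x : fspace => \sum_(r <- finmap.enum_fset (fset_set (range (g n))))
     (Num.max 0%R r)%:E * (\1_(g n @^-1` [set r]) x)%:E)).
  apply: eq_iter_int => x; rewrite big_seq [RHS]big_seq; apply: eq_bigr => r.
  rewrite in_fset_set // => rr; congr (_%:E * _); rewrite max_r //; exact: rge0.
rewrite (@integ_sum _ _ (fun r (x : fspace) => (Num.max 0%R r)%:E * (\1_(g n @^-1` [set r]) x)%:E)).
- rewrite integralT_nnsfun sintegralE fsbig_finite //= big_seq [RHS]big_seq.
  apply: eq_bigr => r; rewrite in_fset_set // => rr.
  rewrite /integ (@iter_intZ (enum K) (Num.max 0%R r) (fun x => (\1_(g n @^-1` [set r]) x)%:E)) //.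
  + by rewrite max_r //; exact: rge0.
  + by rewrite le_max lexx.
- by move=> r x; rewrite mule_ge0 // lee_fin // le_max lexx.
- by move=> r; exact: measurable_funeM.
Qed.

Lemma measurable_iter_int_signed s (f : fspace -> \bar R) :
  measurable_fun [set: fspace] f -> measurable_fun [set: fspace] (iter_int s f).
Proof.
move=> mf; elim: s => //= i s IH.
pose F (z : fspace * RT) := iter_int s f (upd z.1 i z.2).
have mF : measurable_fun setT F.
  exact: measurableT_comp IH (measurable_upd i).
rewrite (_ : (fun _ => _) = fun x : fspace => \int[leb]_t F^\+ (x, t) - \int[leb]_t F^\- (x, t)).
  apply: emeasurable_funB.
  - apply: (@measurable_fun_fubini_tonelli_F _ _ _ _ R leb F^\+) => //.
    exact: measurable_funepos.
  - apply: (@measurable_fun_fubini_tonelli_F _ _ _ _ R leb F^\-) => //.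
    exact: measurable_funeneg.
apply/funext => x; rewrite [LHS]integralE; congr (_ - _).
- by apply: eq_integral => t _; rewrite [LHS]funeposE [RHS]funeposE.
- by apply: eq_integral => t _; rewrite [LHS]funenegE [RHS]funenegE.
Qed.

(** For a signed function an inner iterated integral of the absolute value may be infinite, but only
    for a null set of outer values. The induction hypothesis is therefore used almost everywhere,
    which is enough under the next integral. *)
Lemma iter_int_pos_neg s (f : fspace -> \bar R) x :
  measurable_fun [set: fspace] f -> iter_int s (fun y => `|f y|) x < +oo ->
  iter_int s f x = iter_int s f^\+ x - iter_int s f^\- x.
Proof.
move=> mf; have mp : measurable_fun [set: fspace] f^\+ by exact: measurable_funepos.
have mn : measurable_fun [set: fspace] f^\- by exact: measurable_funeneg.
have ma : measurable_fun [set: fspace] (fun y => `|f y|) by exact: measurableT_comp.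
elim: s x => [|i s IH] x /=; first by move=> _; exact: (congr1 (@^~ x) (funeposneg f)).
move=> Aoo.
pose A t := iter_int s (fun y => `|f y|) (upd x i t).
pose P t := iter_int s f^\+ (upd x i t).
pose N t := iter_int s f^\- (upd x i t).
have A0 t : 0 <= A t by exact: iter_int_ge0.
have P0 t : 0 <= P t by exact: iter_int_ge0.
have N0 t : 0 <= N t by exact: iter_int_ge0.
have mA : measurable_fun setT A by exact: measurable_iter_int1.
have mP : measurable_fun setT P by exact: measurable_iter_int1.
have mN : measurable_fun setT N by exact: measurable_iter_int1.
have iA : leb.-integrable setT A.
  apply/integrableP; split => //.
  by under eq_integral do rewrite gee0_abs //.
have PA t : P t <= A t.
  by apply: iter_int_le => // y; rewrite -[leRHS]/((abse \o f) y) fune_abse leeDl.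
have NA t : N t <= A t.
  by apply: iter_int_le => // y; rewrite -[leRHS]/((abse \o f) y) fune_abse leeDr.
have iP : leb.-integrable setT P.
  by apply: le_integrable iA => // t _; rewrite !gee0_abs.
have iN : leb.-integrable setT N.
  by apply: le_integrable iA => // t _; rewrite !gee0_abs.
rewrite -integralB //.
apply: ae_eq_integral => //.
- apply: (@measurableT_comp _ _ _ _ fspace _ (iter_int s f)).
    exact: measurable_iter_int_signed.
  exact: measurable_upd1.
- exact: emeasurable_funB.
- have := integrable_ae measurableT iA; apply: filterS => t /(_ I) Afin _.
  by apply: IH; rewrite ltey_eq Afin.
Qed.

Lemma integ_fin (f : fspace -> \bar R) :
  measurable_fun [set: fspace] f -> integ (fun x => `|f x|) < +oo ->
  integ f = \int[mu_fspace]_x f x.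
Proof.
move=> mf foo; rewrite /integ (iter_int_pos_neg mf foo) [RHS]integralE.
have := @integE f^\+; rewrite /integ => -> //; last exact: measurable_funepos.
by have := @integE f^\-; rewrite /integ => -> //; exact: measurable_funeneg.
Qed.

Lemma integrable_integE (f : fspace -> \bar R) :
  (mu_fspace).-integrable setT f -> integ f = \int[mu_fspace]_x f x.
Proof.
move=> /integrableP[mf foo]; apply: integ_fin => //.
by rewrite integE //; exact: measurableT_comp.
Qed.

Lemma RintE (f : fspace -> R) :
  (mu_fspace).-integrable setT (EFin \o f) -> Defs.Rint f = (\int[mu_fspace]_x f x)%R.
Proof. by move=> fi; rewrite /Defs.Rint (integrable_integE fi). Qed.

Lemma eq_iter_int_on s (f g : (K -> R) -> \bar R) y :
  (forall x, (forall k, k \notin s -> x k = y k) -> f x = g x) ->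
  iter_int s f y = iter_int s g y.
Proof.
elim: s y => [|i s IH] y fg /=; first by apply: fg.
apply: eq_integral => t _; apply: IH => x xy; apply: fg => k.
rewrite inE negb_or => /andP[ki ks]; rewrite xy // /upd.
by rewrite (negbTE ki).
Qed.

(** The scalar [z] carries the factors of the coordinates already fixed by outer integrals; the
    induction needs it. *)
Lemma iter_int_prod s (g : K -> R -> R) (z : R) y : uniq s -> (0 <= z)%R ->
  (forall k t, 0 <= g k t)%R -> (forall k, measurable_fun setT (g k)) ->
  iter_int s (fun x => (z * \prod_(k <- s) g k (x k))%:E) y =
  z%:E * \prod_(k <- s) \int[leb]_t (g k t)%:E.
Proof.
move=> + z0 g0 mg; elim: s z z0 y => [|i s IH] z z0 y /= us.
  by rewrite !big_nil mulr1 mule1.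
have [iNs us'] := andP us.
transitivity (\int[leb]_t ((z * g i t)%:E * \prod_(k <- s) \int[leb]_t (g k t)%:E)).
  apply: eq_integral => t _; rewrite -(IH (z * g i t)%R _ (upd y i t)) //; last exact: mulr_ge0.
  apply: eq_iter_int_on => x xy; rewrite big_cons mulrA xy //.
  by rewrite /upd eqxx.
rewrite big_cons ge0_integralZr //.
- under eq_integral do rewrite EFinM.
  rewrite ge0_integralZl ?muleA //.
  + by apply/measurable_EFinP; exact: mg.
  + by move=> t _; rewrite lee_fin.
- by apply/measurable_EFinP; apply: measurable_funM => //; exact: mg.
- by move=> t _; rewrite lee_fin mulr_ge0.
- elim: (s) => [|k r IHr]; rewrite ?big_nil ?big_cons ?lee01 ?lee_fin //.
  by rewrite mule_ge0 // integral_ge0 // => t _; rewrite lee_fin.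
Qed.

Lemma integ_prod (g : K -> R -> R) :
  (forall k t, 0 <= g k t)%R -> (forall k, measurable_fun setT (g k)) ->
  integ (fun x => (\prod_k g k (x k))%:E) = \prod_k \int[leb]_t (g k t)%:E.
Proof.
move=> g0 mg; rewrite /integ.
transitivity (iter_int (enum K) (fun x => (1 * \prod_(k <- enum K) g k (x k))%:E) (fun=> 0%R)).
  by apply: eq_iter_int => x; rewrite mul1r big_enum.
rewrite iter_int_prod ?enum_uniq // mul1e.
by rewrite big_enum.
Qed.

Definition box (r : R) : set fspace := [set x | forall k, `|x k| <= r]%R.

Lemma boxE r x : (\1_(box r) x : R) = (\prod_k (\1_(`[(- r)%R, r]%classic) (x k)))%R.
Proof.
rewrite indicE; case: (boolP (x \in box r)) => [|] xr /=.
  rewrite big1 // => k _; rewrite indicE mem_set //= in_itv /= -ler_norml.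
  by move: xr; rewrite inE; exact.
have [k kr] : exists k, ~ (`|x k| <= r)%R.
  apply/existsNP => xr'; move: xr; rewrite notin_setE; exact.
rewrite (bigD1 k) //= indicE memNset ?mul0r //= in_itv /= -ler_norml; exact: kr.
Qed.

Lemma measurable_box r : measurable (box r).
Proof.
rewrite (_ : box r = \big[setI/setT]_(k <- enum K) ((fun x : fspace => x k) @^-1` `[(- r)%R, r]%classic)).
  apply: bigsetI_measurable => k _.
  by have := @measurable_coord k measurableT _ (measurable_itv `[(- r)%R, r]); rewrite setTI.
apply/seteqP; split => x; rewrite -bigcap_seq /= => h k.
  by move=> _; rewrite /= in_itv /= -ler_norml; exact: h.
by have := h k; rewrite /= mem_enum => /(_ isT); rewrite in_itv /= -ler_norml.
Qed.

Lemma mu_box r : (0 < r)%R -> mu_fspace (box r) = ((r *+ 2) ^+ #|K|)%:E.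
Proof.
move=> r0; rewrite /mu_fspace.
transitivity (integ (fun x : K -> R => (\prod_k \1_(`[(- r)%R, r]%classic) (x k) : R)%:E)).
  by apply: eq_iter_int => x; rewrite boxE.
rewrite (@integ_prod (fun _ => \1_(`[(- r)%R, r]%classic))) //=.
under eq_bigr do rewrite integral_indic //= setIT lebesgue_measure_itv /=.
under eq_bigr do rewrite lte_fin -EFinB opprK.
rewrite ifT; last by rewrite -subr_gt0 opprK addr_gt0.
by rewrite prodEFin prodr_const.
Qed.

Fact mu_fspace_sigma_finite : sigma_finite setT mu_fspace.
Proof.
exists (fun n => box n.+1%:R) => [|n].
  apply/esym/seteqP; split => // x _.
  pose M := (\sum_k `|x k|)%R.
  have [n Mn] : exists n : nat, (M <= n%:R)%R.
    by exists (Num.truncn M).+1; rewrite ltW // truncnS_gt.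
  exists n => //= k; apply: (@le_trans _ _ M); first by rewrite /M (bigD1 k) //= lerDl sumr_ge0.
  by rewrite (le_trans Mn) // ler_nat.
split; first exact: measurable_box.
by have /= -> := @mu_box n.+1%:R (ltr0Sn _ _); rewrite ltry.
Qed.

HB.instance Definition _ := Measure_isSigmaFinite.Build _ fspace R mu_fspace mu_fspace_sigma_finite.

End space.
End A.

(** * Complex-valued integrals, changes of variables, blocks of coordinates *)

Section shift1.
Variable R : realType.
Local Notation leb := (@lebesgue_measure R).
Local Notation RT := (measurableTypeR R).
Local Open Scope ereal_scope.

(** The rescaled pushforward of Lebesgue measure gives half-open intervals their length, so it is
    Lebesgue measure by uniqueness. *)
Lemma ge0_integral_affine (c a : R) (f : R -> \bar R) : (0 < c)%R ->
  measurable_fun setT f -> (forall t, 0 <= f t) ->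
  c%:E * \int[leb]_t f (c * t + a)%R = \int[leb]_t f t.
Proof.
move=> c0 mf f0.
pose phi : RT -> RT := (fun t => c * t + a)%R.
have mphi : measurable_fun setT phi.
  by apply: measurable_funD => //; exact: measurable_funM.
have cinv x y : ((x < c * y + a) = ((x - a) / c < y))%R.
  by rewrite -ltrBlDr ltr_pdivrMr // mulrC.
have cinv' x y : ((c * y + a <= x) = (y <= (x - a) / c))%R.
  by rewrite -lerBrDr ler_pdivlMr // mulrC.
pose cnn : {nonneg R} := NngNum (ltW c0).
have E A : measurable A -> leb A = mscale cnn (pushforward leb phi) A.
  apply: lebesgue_measure_unique => _ [[b d]] _ <-.
  transitivity (c%:E * leb (phi @^-1` `]b, d]%classic)); last by [].
  have -> : phi @^-1` `]b, d]%classic = `]((b - a) / c)%R, ((d - a) / c)%R]%classic.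
    apply/seteqP; split => t /=; rewrite !in_itv /= /phi => /andP[h1 h2].
      by rewrite -cinv -cinv' h1 h2.
    by rewrite cinv cinv' h1 h2.
  rewrite !lebesgue_measure_itv /= !lte_fin ltr_pM2r ?invr_gt0 // ltrD2r.
  case: ifP => bd; last by rewrite mule0.
  by rewrite -!EFinB -EFinM; congr (_%:E); field; rewrite gt_eqF.
have := @ge0_integral_pushforward _ _ RT RT R phi mphi leb setT f measurableT mf (fun y _ => f0 y).
rewrite preimage_setT /= => <-.
have /= <- // := @ge0_integral_mscale _ RT R _ setT measurableT cnn f mf.
by apply: eq_measure_integral => A mA _; symmetry; exact: (E mphi).
Qed.

Lemma ge0_integral_shift (a : R) (f : R -> \bar R) :
  measurable_fun setT f -> (forall t, 0 <= f t) ->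
  \int[leb]_t f (t + a)%R = \int[leb]_t f t.
Proof.
move=> mf f0; rewrite -[RHS](@ge0_integral_affine 1 a) // mul1e.
by under [RHS]eq_integral do rewrite mul1r.
Qed.

Lemma ge0_integral_opp (f : R -> \bar R) :
  measurable_fun setT f -> (forall t, 0 <= f t) ->
  \int[leb]_t f (- t)%R = \int[leb]_t f t.
Proof.
move=> mf f0.
have mphi : measurable_fun setT (-%R : RT -> RT) by apply: continuous_measurable_fun; exact: oppr_continuous.
have := @ge0_integral_pushforward _ _ RT RT R _ mphi leb setT f measurableT mf (fun y _ => f0 y).
rewrite preimage_setT /= => <-.
by apply: eq_measure_integral => A mA _; exact: lebesgue_measureN.
Qed.

End shift1.

Section complex_tools.
Variable R : realType.
Implicit Types z w : R[i].

Lemma creM z w : cre (z * w) = cre z * cre w - cim z * cim w.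
Proof. by case: z w => [a b] [c d]. Qed.
Lemma cimM z w : cim (z * w) = cre z * cim w + cim z * cre w.
Proof. by case: z w => [a b] [c d]. Qed.
Lemma creD z w : cre (z + w) = cre z + cre w.
Proof. by case: z w => [a b] [c d]. Qed.
Lemma cimD z w : cim (z + w) = cim z + cim w.
Proof. by case: z w => [a b] [c d]. Qed.
Lemma cplx_eq z w : cre z = cre w -> cim z = cim w -> z = w.
Proof. by case: z w => [a b] [c d] /= -> ->. Qed.

Lemma cabs_ge0 z : 0 <= cabs z. Proof. exact: sqrtr_ge0. Qed.
Lemma cabs_sqr z : cabs z ^+ 2 = cre z ^+ 2 + cim z ^+ 2.
Proof. by rewrite sqr_sqrtr // addr_ge0 // sqr_ge0. Qed.
Lemma cabsM z w : cabs (z * w) = cabs z * cabs w.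
Proof.
apply: (@pexpIrn _ 2) => //; rewrite ?nnegrE ?mulr_ge0 ?cabs_ge0 //.
by rewrite exprMn !cabs_sqr creM cimM; ring.
Qed.
Lemma cabs0 : cabs (0 : R[i]) = 0.
Proof. by rewrite /cabs /= expr0n addr0 sqrtr0. Qed.
Lemma cabs1 : cabs (1 : R[i]) = 1.
Proof. by rewrite /cabs /= expr0n expr1n addr0 sqrtr1. Qed.
Lemma cabs_prod (T : Type) (s : seq T) (f : T -> R[i]) :
  cabs (\prod_(i <- s) f i) = \prod_(i <- s) cabs (f i).
Proof. by elim: s => [|i s IH]; rewrite ?big_nil ?cabs1 // !big_cons cabsM IH. Qed.
Lemma cre_le_cabs z : `|cre z| <= cabs z.
Proof. by rewrite -sqrtr_sqr ler_wsqrtr // lerDl sqr_ge0. Qed.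
Lemma cim_le_cabs z : `|cim z| <= cabs z.
Proof. by rewrite -sqrtr_sqr ler_wsqrtr // lerDr sqr_ge0. Qed.
Lemma cabs_le z : cabs z <= `|cre z| + `|cim z|.
Proof.
rewrite -(@ler_pXn2r _ 2) ?nnegrE ?addr_ge0 ?cabs_ge0 // cabs_sqr sqrrD !real_normK ?num_real //.
by rewrite lerD2r lerDl mulrn_wge0 // mulr_ge0.
Qed.
Lemma cabs_cexpi (t : R) : cabs (cexpi t) = 1.
Proof. by rewrite /cabs /= cos2Dsin2 sqrtr1. Qed.
Lemma cabs_cR (r : R) : cabs (cR r) = `|r|.
Proof. by rewrite /cabs /= expr0n addr0 sqrtr_sqr. Qed.
Lemma cexpiD (s t : R) : cexpi (s + t) = cexpi s * cexpi t.
Proof. by apply: cplx_eq; rewrite ?creM ?cimM /= ?cosD ?sinD //; ring. Qed.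
Lemma cexpi0 : cexpi (0 : R) = 1.
Proof. by apply: cplx_eq; rewrite /= ?cos0 ?sin0. Qed.
Lemma cexpi_sum (T : Type) (s : seq T) (f : T -> R) :
  cexpi (\sum_(i <- s) f i) = \prod_(i <- s) cexpi (f i).
Proof. by elim: s => [|i s IH]; rewrite ?big_nil ?cexpi0 // !big_cons cexpiD IH. Qed.
Lemma cRM (a b : R) : cR (a * b) = cR a * cR b.
Proof. by apply: cplx_eq; rewrite ?creM ?cimM /=; ring. Qed.
Lemma cR1 : cR (1 : R) = 1. Proof. by []. Qed.
Lemma cR_prod (T : Type) (s : seq T) (f : T -> R) :
  cR (\prod_(i <- s) f i) = \prod_(i <- s) cR (f i).
Proof. by elim: s => [|i s IH]; rewrite ?big_nil ?cR1 // !big_cons cRM IH. Qed.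
End complex_tools.

(** * Integrable real and complex functions *)

Section rint.
Context d (T : measurableType d) (R : realType) (mu : {measure set T -> \bar R}).
Definition rint (f : T -> R) := mu.-integrable setT (EFin \o f).

Lemma rint_meas (f : T -> R) : rint f -> measurable_fun setT f.
Proof. by move=> /integrableP[/measurable_EFinP]. Qed.

Lemma rint_dom (f g : T -> R) : measurable_fun setT f ->
  (forall x, `|f x| <= g x) -> rint g -> rint f.
Proof.
move=> mf fg; apply: le_integrable => //; first exact/measurable_EFinP.
by move=> x _; rewrite /= lee_fin (le_trans (fg x)) // ler_norm.
Qed.

Lemma rint_abs (f : T -> R) : rint f -> rint (fun x => `|f x|).
Proof. exact: integrable_norm. Qed.
Lemma rintD (f g : T -> R) : rint f -> rint g -> rint (fun x => f x + g x).
Proof. exact: integrableD. Qed.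
Lemma rintB (f g : T -> R) : rint f -> rint g -> rint (fun x => f x - g x).
Proof. exact: integrableB. Qed.
Lemma rintZ (c : R) (f : T -> R) : rint f -> rint (fun x => c * f x).
Proof. exact: integrableZl. Qed.

Lemma eq_rint (f g : T -> R) : f =1 g -> rint f -> rint g.
Proof. by move=> /funext ->. Qed.
End rint.

Section cint.
Variables (R : realType) (K : finType).
Local Notation C := (R[i]).
Local Notation E := (fspace R K).
Local Notation mu := (@mu_fspace R K).

Definition cint (g : E -> C) := rint mu (fun x => cre (g x)) /\ rint mu (fun x => cim (g x)).

Lemma cint_meas (g : E -> C) : cint g -> cmeasurable g.
Proof. by move=> [/rint_meas h1 /rint_meas h2]; split; exact/rmeasurableP. Qed.

Lemma measurable_cabs (g : E -> C) :
  measurable_fun setT (fun x => cre (g x)) -> measurable_fun setT (fun x => cim (g x)) ->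
  measurable_fun setT (fun x => cabs (g x)).
Proof.
move=> m1 m2; apply: (measurableT_comp (continuous_measurable_fun (@sqrt_continuous R))) => //.
by apply: measurable_funD; exact: measurable_funX.
Qed.

Lemma cint_dom (g : E -> C) (h : E -> R) : cmeasurable g ->
  (forall x, cabs (g x) <= h x) -> rint mu h -> cint g.
Proof.
move=> [m1 m2] gh ih; split; (apply: (rint_dom _ _ ih); first exact/rmeasurableP) => x.
  exact: le_trans (cre_le_cabs _) (gh x).
exact: le_trans (cim_le_cabs _) (gh x).
Qed.

Lemma cint_cabs (g : E -> C) : cint g -> rint mu (fun x => cabs (g x)).
Proof.
move=> [h1 h2]; apply: rint_dom (rintD (rint_abs h1) (rint_abs h2)).
  by apply: measurable_cabs; [exact: rint_meas h1|exact: rint_meas h2].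
by move=> x; rewrite ger0_norm ?cabs_ge0 //; exact: cabs_le.
Qed.

Lemma cintZ (c : C) (g : E -> C) : cint g -> cint (fun x => c * g x).
Proof.
move=> [h1 h2]; split.
  by apply: (eq_rint (fun x => esym (creM _ _))); apply: rintB; exact: rintZ.
by apply: (eq_rint (fun x => esym (cimM _ _))); apply: rintD; exact: rintZ.
Qed.

Lemma CintE (g : E -> C) : cint g ->
  Cint g = (\int[mu]_x cre (g x)) +i* (\int[mu]_x cim (g x)).
Proof. by move=> [h1 h2]; rewrite /Cint !RintE. Qed.

Lemma CintZ (c : C) (g : E -> C) : cint g -> Cint (fun x => c * g x) = c * Cint g.
Proof.
move=> gi; rewrite (CintE (cintZ c gi)) (CintE gi); case: gi => h1 h2.
apply: cplx_eq => /=; rewrite ?creM ?cimM /=.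
  rewrite (@eq_Rintegral _ _ _ _ _ (fun x => cre c * cre (g x) - cim c * cim (g x))); last by move=> x _; rewrite creM.
  by rewrite RintegralB ?RintegralZl //; exact: rintZ.
rewrite (@eq_Rintegral _ _ _ _ _ (fun x => cre c * cim (g x) + cim c * cre (g x))); last by move=> x _; rewrite cimM.
by rewrite RintegralD ?RintegralZl //; exact: rintZ.
Qed.

Lemma CintD (f g : E -> C) : cint f -> cint g ->
  Cint (fun x => f x + g x) = Cint f + Cint g.
Proof.
move=> fi gi; have fgi : cint (fun x => f x + g x).
  case: fi gi => [f1 f2] [g1 g2]; split.
    by apply: (eq_rint (fun x => esym (creD _ _))); exact: rintD.
  by apply: (eq_rint (fun x => esym (cimD _ _))); exact: rintD.
rewrite (CintE fgi) (CintE fi) (CintE gi); case: fi gi => [f1 f2] [g1 g2].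
apply: cplx_eq => /=; rewrite -RintegralD //; apply: eq_Rintegral => x _.
  exact: creD.
exact: cimD.
Qed.

End cint.

(** * Integration along one coordinate *)

Section fubini_coordinate.
Variables (R : realType) (K : finType).
Local Notation E := (fspace R K).
Local Notation mu := (@mu_fspace R K).
Local Notation leb := (@lebesgue_measure R).
Local Open Scope ereal_scope.

Lemma enum_rem (k : K) : perm_eq (enum K) (rem k (enum K) ++ [:: k]).
Proof.
by rewrite perm_sym cats1 perm_rcons perm_sym; apply: perm_to_rem; rewrite mem_enum.
Qed.

(** The coordinate [k] can be moved to the innermost position, where the two integrands have equal
    integrals. *)
Lemma ge0_integ_coord (k : K) (f g : E -> \bar R) :
  (forall x, 0 <= f x) -> measurable_fun [set: E] f ->
  (forall x, 0 <= g x) -> measurable_fun [set: E] g ->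
  (forall y, \int[leb]_t f (upd y k t) = \int[leb]_t g (upd y k t)) ->
  \int[mu]_x f x = \int[mu]_x g x.
Proof.
move=> f0 mf g0 mg fg; rewrite -!integE // /integ.
rewrite (iter_int_perm f0 mf (enum_rem k)) (iter_int_perm g0 mg (enum_rem k)).
by rewrite !iter_int_cat; apply: eq_iter_int => y /=.
Qed.

Lemma ge0_integ_shear (k : K) (L : E -> R) (f : E -> \bar R) :
  (forall x, 0 <= f x) -> measurable_fun [set: E] f ->
  measurable_fun [set: E] L -> (forall x t, L (upd x k t) = L x) ->
  \int[mu]_x f (upd x k (x k + L x)%R) = \int[mu]_x f x.
Proof.
move=> f0 mf mL Lk; apply: (@ge0_integ_coord k) => //.
  apply: (@measurableT_comp _ _ _ _ E _ f) => //.
  apply: measurable_fspace => j; rewrite /upd; case: eqP => _.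
    by apply: measurable_funD => //; exact: measurable_coord.
  exact: measurable_coord.
move=> y; transitivity (\int[leb]_t f (upd y k (t + L y)%R)).
  by apply: eq_integral => t _; rewrite upd_upd Lk /upd eqxx.
rewrite (@ge0_integral_shift _ (L y) (fun t => f (upd y k t))) //.
by apply: (@measurableT_comp _ _ _ _ E _ f) => //; exact: measurable_upd1.
Qed.

(** The form in which integration by parts is used: along every line in direction [k] the positive
    and negative parts have the same integral, hence they have the same total integral. *)
Lemma integral_coord0 (k : K) (f : E -> R) : rint mu f ->
  (forall y, \int[leb]_t (f (upd y k t))%:E = 0) -> \int[mu]_x (f x)%:E = 0.
Proof.
move=> fi f0; have mf := measurable_int mu fi.
have := integrable_fin_num measurableT fi.
rewrite integralE /=.
have mp : measurable_fun [set: E] (EFin \o f)^\+ by exact: measurable_funepos.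
have mn : measurable_fun [set: E] (EFin \o f)^\- by exact: measurable_funeneg.
rewrite (@ge0_integ_coord k (EFin \o f)^\+ (EFin \o f)^\-) //.
  have := integral_funeneg_lt_pinfty measurableT fi.
  rewrite -ge0_fin_numE; last by apply: integral_ge0.
  by move=> h _; rewrite subee.
(* A difference equal to 0 excludes infinite values, because oo - oo is not 0 in the extended
   reals. *)
have aux (P N : \bar R) : 0 <= P -> 0 <= N -> P - N = 0 -> P = N.
  move: P N => [p| |] [n| |] //= _ _; rewrite -EFinB => -[] /eqP.
  by rewrite subr_eq0 => /eqP ->.
move=> y; apply: aux; [exact: integral_ge0|exact: integral_ge0|].
rewrite -(f0 y) [RHS]integralE; congr (_ - _); apply: eq_integral => t _.
  by rewrite !funeposE.
by rewrite !funenegE.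
Qed.

End fubini_coordinate.

(** * Transport along measure-preserving maps *)

Section transfer.
Context d (T : measurableType d) d' (T' : measurableType d') (R : realType).
Variables (mu : {measure set T -> \bar R}) (mu' : {measure set T' -> \bar R}) (phi : T -> T').
Hypothesis mphi : measurable_fun setT phi.
Hypothesis phiP : forall f : T' -> \bar R, (forall x, 0 <= f x)%E -> measurable_fun setT f ->
  (\int[mu]_x f (phi x) = \int[mu']_x f x)%E.

Lemma transfer_integral (f : T' -> \bar R) : measurable_fun setT f ->
  (\int[mu]_x f (phi x) = \int[mu']_x f x)%E.
Proof.
move=> mf; rewrite integralE [RHS]integralE; congr (_ - _)%E.
  by rewrite -phiP //; [apply: eq_integral => x _; rewrite !funeposE|exact: measurable_funepos].
by rewrite -phiP //; [apply: eq_integral => x _; rewrite !funenegE|exact: measurable_funeneg].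
Qed.

Lemma transfer_rint (f : T' -> R) : rint mu' f -> rint mu (fun x => f (phi x)).
Proof.
move=> /integrableP[mf foo]; apply/integrableP; split; first exact: (measurableT_comp mf mphi).
rewrite (phiP (f := abse \o (EFin \o f))) //; last exact: measurableT_comp.
by move=> x; exact: abse_ge0.
Qed.

Lemma transfer_Rintegral (f : T' -> R) : measurable_fun setT f ->
  \int[mu]_x f (phi x) = \int[mu']_x f x.
Proof. by move=> mf; congr fine; apply: (transfer_integral (f := EFin \o f)); exact/measurable_EFinP. Qed.
End transfer.

(** * Products over blocks of coordinates *)

Section blocks.
Variables (R : realType) (K J B : finType) (e : J -> B -> K).
Hypothesis e_bij : bijective (fun jb : J * B => e jb.1 jb.2).
Local Notation C := (R[i]).
Local Notation E := (fspace R K).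
Local Notation EB := (fspace R B).

(** The partition of coordinates is abstract because four are used: by the index [j < d], by the
    pair [(j, k)], by the component [k < n], and into single coordinates. *)
Definition blk (x : K -> R) (j : J) : B -> R := fun b => x (e j b).

Fact e_inj j b j' b' : e j b = e j' b' -> (j, b) = (j', b').
Proof. by move=> h; apply: (bij_inj e_bij). Qed.

Lemma measurable_blk j : measurable_fun [set: E] (fun x : E => blk x j : EB).
Proof. by apply: measurable_fspace => b; exact: measurable_coord. Qed.

Let bs (j : J) := [seq e j b | b <- enum B].

Lemma enum_blocks : perm_eq (enum K) (flatten [seq bs j | j <- enum J]).
Proof.
have -> : flatten [seq bs j | j <- enum J] = [seq e j b | j <- enum J, b <- enum B] by [].
apply: uniq_perm; first exact: enum_uniq.
  by apply: allpairs_uniq; rewrite ?enum_uniq // => -[j b] [j' b'] _ _ /=; exact: e_inj.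
case: e_bij => g gK Kg k; rewrite mem_enum inE; symmetry; apply/allpairsP.
by exists (g k); rewrite !mem_enum; split => //; rewrite Kg.
Qed.

Lemma iter_int_block j (s : seq B) (h : (B -> R) -> \bar R) y :
  iter_int [seq e j b | b <- s] (fun x => h (blk x j)) y = iter_int s h (blk y j).
Proof.
elim: s y => //= b s IH y; apply: eq_integral => t _; rewrite IH; congr iter_int.
apply/funext => b'; rewrite /blk /upd; case: (eqVneq b' b) => [->|bb]; first by rewrite eqxx.
by case: eqP => // /e_inj[] /eqP; rewrite (negbTE bb).
Qed.

Lemma integ_congr (h : (B -> R) -> \bar R) y : iter_int (enum B) h y = integ h.
Proof. by apply: iter_int_congr => k; rewrite mem_enum. Qed.

Lemma blk_notin (js : seq J) (x y : K -> R) j :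
  (forall k, k \notin flatten [seq bs i | i <- js] -> x k = y k) -> j \notin js ->
  blk x j = blk y j.
Proof.
move=> xy jN; apply/funext => b; apply: xy; apply/negP => /flattenP[_ /mapP[i ijs ->]].
by case/mapP => b' _ /e_inj[] ji _; rewrite ji ijs in jN.
Qed.

Lemma ge0_integ_blocks (h : J -> EB -> R) :
  (forall j x, 0 <= h j x) -> (forall j, measurable_fun setT (h j)) ->
  integ (fun x : K -> R => (\prod_j h j (blk x j))%:E) = (\prod_j integ (fun x => (h j x)%:E))%E.
Proof.
move=> h0 mh; pose f js (z : R) (x : E) := (z * \prod_(j <- js) h j (blk x j))%:E.
have mhb j : measurable_fun [set: E] (fun x : E => h j (blk x j)).
  exact: measurableT_comp (mh j) (measurable_blk j).
have mf js z : measurable_fun [set: E] (f js z).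
  by apply/measurable_EFinP; apply: measurable_funM => //; exact: measurable_prod.
have f0 js z x : 0 <= z -> (0 <= f js z x)%E.
  by move=> z0; rewrite lee_fin mulr_ge0 // prodr_ge0.
have I0 j : (0 <= integ (fun x => (h j x)%:E))%E by apply: iter_int_ge0 => x; rewrite lee_fin.
suff main js z y : uniq js -> 0 <= z ->
    iter_int (flatten [seq bs j | j <- js]) (f js z) y =
    (z%:E * \prod_(j <- js) integ (fun x => (h j x)%:E))%E.
  rewrite -big_enum -[RHS]mul1e -(main _ _ (fun=> 0)) ?enum_uniq //.
  rewrite -(iter_int_perm _ _ enum_blocks) //.
    by apply: eq_iter_int => x; rewrite /f mul1r big_enum.
  by move=> x; apply: f0.
elim: js z y => [|j js IH] z y; first by rewrite /= /f !big_nil mulr1 mule1.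
rewrite [uniq _]/= => /andP[jN us] z0.
rewrite [flatten _]/= iter_int_cat.
pose P := (\prod_(j <- js) integ (fun x => (h j x)%:E))%E.
have P0 : (0 <= P)%E by rewrite /P; elim: (js) => [|k r IHr]; rewrite ?big_nil ?big_cons ?mule_ge0 ?lee01.
(* The integral over the remaining blocks does not see the current block, so it comes out as the
   constant [P]. *)
rewrite [X in iter_int (bs j) X](_ : _ = fun x => ((z * h j (blk x j))%:E * P)%E); last first.
  apply/funext => x; rewrite -(IH _ x) //; last exact: mulr_ge0.
  apply: eq_iter_int_on => x' xx'; rewrite /f big_cons mulrA.
  by rewrite (blk_notin xx' jN).
rewrite (@iter_int_block j (enum B) (fun w => ((z * h j w)%:E * P)%E)) integ_congr.
rewrite big_cons -/P muleA integE; first last.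
- apply: emeasurable_funM => //; apply/measurable_EFinP; exact: measurable_funM.
- by move=> x; rewrite mule_ge0 // lee_fin mulr_ge0.
rewrite ge0_integralZr //; first last.
- by move=> x _; rewrite lee_fin mulr_ge0.
- by apply/measurable_EFinP; exact: measurable_funM.
congr (_ * _)%E; under eq_integral do rewrite EFinM.
rewrite ge0_integralZl //; first last.
- by move=> x _; rewrite lee_fin.
- exact/measurable_EFinP.
by rewrite integE // => [x|]; [rewrite lee_fin|exact/measurable_EFinP].
Qed.

Lemma cint_blocks (g : J -> EB -> C) : (forall j, cint (g j)) ->
  cint (fun x : E => \prod_j g j (blk x j)).
Proof.
move=> gi.
have mg j : cmeasurable (fun x : E => g j (blk x j)).
  by have [/rmeasurableP m1 /rmeasurableP m2] := cint_meas (gi j); split; apply/rmeasurableP;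
    [exact: (measurableT_comp m1 (measurable_blk j))|exact: (measurableT_comp m2 (measurable_blk j))].
have mP (s : seq J) : cmeasurable (fun x : E => \prod_(j <- s) g j (blk x j)).
  elim: s => [|j s [/rmeasurableP i1 /rmeasurableP i2]].
    by rewrite (_ : (fun _ => _) = fun=> 1); [split; apply/rmeasurableP; exact: measurable_cst|
      apply/funext => x; rewrite big_nil].
  have [/rmeasurableP m1 /rmeasurableP m2] := mg j.
  split; apply/rmeasurableP.
    rewrite (_ : (fun _ => _) = fun x => cre (g j (blk x j)) * cre (\prod_(i <- s) g i (blk x i)) -
      cim (g j (blk x j)) * cim (\prod_(i <- s) g i (blk x i))).
      by apply: measurable_funB; apply: measurable_funM.
    by apply/funext => x; rewrite big_cons creM.
  rewrite (_ : (fun _ => _) = fun x => cre (g j (blk x j)) * cim (\prod_(i <- s) g i (blk x i)) +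
    cim (g j (blk x j)) * cre (\prod_(i <- s) g i (blk x i))).
    by apply: measurable_funD; apply: measurable_funM.
  by apply/funext => x; rewrite big_cons cimM.
have mPJ : cmeasurable (fun x : E => \prod_j g j (blk x j)).
  by have := mP (enum J); rewrite (_ : (fun _ => _) = fun x : E => \prod_j g j (blk x j)) //;
    apply/funext => x; rewrite big_enum.
have mc j : measurable_fun [set: EB] (fun x => cabs (g j x)).
  by have [/rmeasurableP ? /rmeasurableP ?] := cint_meas (gi j); exact: measurable_cabs.
apply: (cint_dom (h := fun x : E => \prod_j cabs (g j (blk x j))) mPJ).
  by move=> x; rewrite cabs_prod.
have mH : measurable_fun [set: E] (fun x : E => \prod_j cabs (g j (blk x j))).
  by apply: measurable_prod => j _; exact: (measurableT_comp (mc j) (measurable_blk j)).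
apply/integrableP; split; first exact/measurable_EFinP.
have H0 (x : E) : 0 <= \prod_j cabs (g j (blk x j)) by apply: prodr_ge0 => j _; exact: cabs_ge0.
under eq_integral do rewrite /= ger0_norm //.
rewrite -integE; first last.
- exact/measurable_EFinP.
- by move=> x; rewrite lee_fin.
rewrite (ge0_integ_blocks (h := fun j x => cabs (g j x))) //; last by move=> *; exact: cabs_ge0.
have F j : integ (fun x => (cabs (g j x))%:E) \is a fin_num.
  rewrite integE; first exact: integrable_fin_num (cint_cabs (gi j)).
    by move=> x; rewrite lee_fin cabs_ge0.
  exact/measurable_EFinP.
by under eq_bigr do rewrite -(fineK (F _)); rewrite prodEFin ltry.
Qed.

(** [Cint] is defined through real parts, which are not multiplicative. The induction is therefore
    run on the real part of an arbitrary complex multiple of the product. *)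
Lemma Cint_blocks (g : J -> EB -> C) : (forall j, cint (g j)) ->
  Cint (fun x : E => \prod_j g j (blk x j)) = \prod_j Cint (g j).
Proof.
move=> gi.
(* The factor [c] absorbs the integrals of the blocks already done. At the end [c = 1] gives the
   real part and [c = - i] the imaginary part. *)
have key (c : C) js y : uniq js ->
   iter_int (flatten [seq bs j | j <- js]) (fun x => (cre (c * \prod_(j <- js) g j (blk x j)))%:E) y =
   (cre (c * \prod_(j <- js) Cint (g j)))%:E.
  elim: js c y => [|j js IH] c y; first by rewrite /= !big_nil.
  rewrite [uniq _]/= => /andP[jN us]; rewrite [flatten _]/= iter_int_cat.
  pose W := \prod_(j <- js) Cint (g j).
  rewrite [X in iter_int (bs j) X](_ : _ = fun x => (cre ((c * W) * g j (blk x j)))%:E); last first.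
    apply/funext => x; rewrite -mulrA [W * _]mulrC mulrA -(IH _ x) //.
    apply: eq_iter_int_on => x' xx'; rewrite big_cons mulrA.
    by rewrite (blk_notin xx' jN).
  rewrite (@iter_int_block j (enum B) (fun w => (cre ((c * W) * g j w))%:E)) integ_congr.
  have ci := cintZ (c * W) (gi j).
  rewrite (integrable_integE ci.1) -[LHS]fineK; last exact: integrable_fin_num ci.1.
  congr (_%:E); transitivity (cre (Cint (fun x => c * W * g j x))).
    by rewrite (CintE ci).
  by rewrite CintZ // big_cons -/W; congr cre; rewrite [Cint _ * W]mulrC mulrA.
have keyJ (c : C) : integ (fun x : K -> R => (cre (c * \prod_j g j (blk x j)))%:E) =
    (cre (c * \prod_j Cint (g j)))%:E.
  have ci := (cintZ c (cint_blocks gi)).1.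
  rewrite -(big_enum _ _ _ (fun j => Cint (g j))) /= -(key c _ (fun=> 0)) ?enum_uniq //.
  have /integrableP[mf foo] := ci.
  have ma : measurable_fun [set: E] (fun x : E => `|(cre (c * \prod_j g j (blk x j)))%:E|)%E.
    exact: measurableT_comp.
  have fE : (fun x : K -> R => (cre (c * \prod_(j <- enum J) g j (blk x j)))%:E) =
            (fun x : K -> R => (cre (c * \prod_j g j (blk x j)))%:E).
    by apply/funext => x; rewrite big_enum.
  have Aoo s : perm_eq (enum K) s ->
      (iter_int s (fun x : K -> R => `|(cre (c * \prod_j g j (blk x j)))%:E|) (fun=> 0%R) < +oo)%E.
    by move=> /(iter_int_perm _ ma) <- //; move: foo; rewrite -integE.
  rewrite fE /integ (iter_int_pos_neg mf (Aoo _ (perm_refl _))).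
  rewrite (iter_int_pos_neg mf (Aoo _ enum_blocks)).
  by rewrite !(iter_int_perm _ _ enum_blocks) //; [exact: measurable_funeneg|exact: measurable_funepos].
have N z : cim z = cre ((0 -i* 1) * z) by rewrite creM /=; ring.
apply: cplx_eq.
  transitivity (fine (integ (fun x : K -> R => (cre (1 * \prod_j g j (blk x j)))%:E))).
    by congr (fine (integ _)); apply/funext => x; rewrite mul1r.
  by rewrite (keyJ 1) mul1r.
transitivity (fine (integ (fun x : K -> R => (cre ((0 -i* 1) * \prod_j g j (blk x j)))%:E))).
  by congr (fine (integ _)); apply/funext => x; rewrite -N.
by rewrite (keyJ (0 -i* 1)) -N.
Qed.
End blocks.

(** * Chirped Gaussians in one variable *)

Section deriv_under_int.
Context d (T : measurableType d) (R : realType) (mu : {measure set T -> \bar R}).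
Variables (h c a : T -> R).
Hypothesis mc : measurable_fun setT c.
Hypothesis ma : measurable_fun setT a.
Hypothesis ih : rint mu h.
Hypothesis ihc : rint mu (fun y => h y * c y).

Lemma measurable_cosf (f : T -> R) : measurable_fun setT f ->
  measurable_fun setT (fun y => cos (f y)).
Proof. by move=> mf; apply: (measurableT_comp (continuous_measurable_fun (@continuous_cos R)) mf). Qed.
Lemma measurable_sinf (f : T -> R) : measurable_fun setT f ->
  measurable_fun setT (fun y => sin (f y)).
Proof. by move=> mf; apply: (measurableT_comp (continuous_measurable_fun (@continuous_sin R)) mf). Qed.

Let mph x : measurable_fun setT (fun y => a y + x * c y).
Proof. by apply: measurable_funD => //; exact: measurable_funM. Qed.

Lemma rint_cos (f : T -> R) : measurable_fun setT f -> rint mu (fun y => h y * cos (f y)).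
Proof.
move=> mf; apply: rint_dom (rint_abs ih).
  by apply: measurable_funM; [exact: rint_meas ih|exact: measurable_cosf].
by move=> y; rewrite normrM ler_piMr // ler_norml cos_geN1 cos_le1.
Qed.
Lemma rint_sin (f : T -> R) : measurable_fun setT f -> rint mu (fun y => h y * sin (f y)).
Proof.
move=> mf; apply: rint_dom (rint_abs ih).
  by apply: measurable_funM; [exact: rint_meas ih|exact: measurable_sinf].
by move=> y; rewrite normrM ler_piMr // ler_norml sin_geN1 sin_le1.
Qed.

Lemma is_derive_int_cos (x : R) :
  is_derive x 1 (fun x => \int[mu]_y (h y * cos (a y + x * c y)))
    (- \int[mu]_y (h y * c y * sin (a y + x * c y))).
Proof.
pose f (x : R) (y : T) := h y * cos (a y + x * c y).
have fd (x0 : R) (y : T) : is_derive x0 1 (f ^~ y) (- (h y * c y * sin (a y + x0 * c y))).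
  by rewrite /f; apply: is_derive_eq; rewrite /GRing.scale /=; ring.
have i0 x0 : rint mu (f x0) by apply: rint_cos.
have xI : `](x - 1), (x + 1)[%classic x by rewrite /= in_itv /= ltrBlDr !ltrDl ltr01.
have G0 y : 0 <= `|h y * c y| by [].
have dom x0 y : `](x - 1), (x + 1)[%classic x0 -> setT y -> `|partial1of2 f x0 y| <= `|h y * c y|.
  move=> _ _; rewrite /partial1of2 derive1E (@derive_val _ _ _ _ _ _ _ (fd x0 y)) normrN normrM.
  by rewrite ler_piMr // ler_norml sin_geN1 sin_le1.
have dd x0 y : `](x - 1), (x + 1)[%classic x0 -> setT y -> derivable (f ^~ y) x0 1.
  by move=> _ _; exact: ex_derive.
have D := @derivable_under_integral R _ T mu f setT measurableT x (x - 1) (x + 1) xI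
   (fun x0 _ => i0 x0) dd _ G0 (rint_abs ihc) dom.
have V := @differentiation_under_integral R _ T mu f setT measurableT x (x - 1) (x + 1) xI
   (fun x0 _ => i0 x0) dd _ G0 (rint_abs ihc) dom.
apply: DeriveDef => //; rewrite -derive1E V -mulN1r -RintegralZl //; last first.
  by apply: rint_dom (rint_abs ihc) => [|y];
   [apply: measurable_funM; [exact: rint_meas ihc|exact: measurable_sinf]
   |rewrite normrM ler_piMr // ler_norml sin_geN1 sin_le1].
apply: eq_Rintegral => y _; rewrite /partial1of2 derive1E (@derive_val _ _ _ _ _ _ _ (fd x y)).
by rewrite mulN1r.
Qed.
End deriv_under_int.

Section deriv_under_int2.
Context d (T : measurableType d) (R : realType) (mu : {measure set T -> \bar R}).
Variables (h c a : T -> R).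
Hypothesis mc : measurable_fun setT c.
Hypothesis ma : measurable_fun setT a.
Hypothesis ih : rint mu h.
Hypothesis ihc : rint mu (fun y => h y * c y).

(** A phase shift by [pi / 2] reduces the sine to the cosine. *)
Lemma is_derive_int_sin (x : R) :
  is_derive x 1 (fun x => \int[mu]_y (h y * sin (a y + x * c y)))
    (\int[mu]_y (h y * c y * cos (a y + x * c y))).
Proof.
have sinE (t : R) : sin t = cos (t - pi / 2) by rewrite cosB cos_pihalf sin_pihalf mulr0 add0r mulr1.
have cosE (t : R) : cos t = - sin (t - pi / 2) by rewrite sinB cos_pihalf sin_pihalf mulr0 sub0r mulr1 opprK.
have ma' : measurable_fun setT (fun y => a y - pi / 2) by exact: measurable_funB.
have := is_derive_int_cos mc ma' ih ihc x.
rewrite (_ : (fun x => _) = (fun x => \int[mu]_y (h y * sin (a y + x * c y)))); last first.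
  by apply/funext => x0; apply: eq_Rintegral => y _; rewrite sinE addrAC.
move=> H; apply: is_derive_eq; rewrite -mulN1r -RintegralZl //; last first.
  apply: rint_dom (rint_abs ihc) => [|y].
    apply: measurable_funM; [exact: rint_meas ihc|apply: measurable_sinf => //].
    by apply: measurable_funD => //; exact: measurable_funM.
  by rewrite normrM ler_piMr // ler_norml sin_geN1 sin_le1.
by apply: eq_Rintegral => y _; rewrite cosE addrAC; ring.
Qed.
End deriv_under_int2.

Lemma der_ex (R : realType) (f : R -> R) (x df : R) : is_derive x 1 f df -> derivable f x 1.
Proof. by case. Qed.
Lemma der_val (R : realType) (f : R -> R) (x df : R) : is_derive x 1 f df -> derive1 f x = df.
Proof. by case => _ <-; rewrite derive1E. Qed.

Section der_rules.
Variables (R : realType) (x : R).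
Implicit Types f g : R -> R.
Lemma der_eq f df df' : is_derive x 1 f df -> df = df' -> is_derive x 1 f df'.
Proof. by move=> h <-. Qed.
Lemma derM f g df dg : is_derive x 1 f df -> is_derive x 1 g dg ->
  is_derive x 1 (fun x => f x * g x) (df * g x + f x * dg).
Proof. by move=> h1 h2; apply: der_eq (is_deriveM h1 h2) _; rewrite /GRing.scale /= addrC; congr (_ + _); rewrite mulrC. Qed.
Lemma derD f g df dg : is_derive x 1 f df -> is_derive x 1 g dg ->
  is_derive x 1 (fun x => f x + g x) (df + dg).
Proof. by move=> h1 h2; exact: is_deriveD. Qed.
Lemma derB f g df dg : is_derive x 1 f df -> is_derive x 1 g dg ->
  is_derive x 1 (fun x => f x - g x) (df - dg).
Proof. by move=> h1 h2; exact: is_deriveB. Qed.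
Lemma der_comp f g df dg : is_derive (f x) 1 g dg -> is_derive x 1 f df ->
  is_derive x 1 (fun x => g (f x)) (dg * df).
Proof. by move=> h1 h2; exact: is_derive1_comp. Qed.
Lemma der_cos f df : is_derive x 1 f df -> is_derive x 1 (fun x => cos (f x)) (- sin (f x) * df).
Proof. by move=> h; apply: (@der_comp f cos) => //; exact: is_derive_cos. Qed.
Lemma der_sin f df : is_derive x 1 f df -> is_derive x 1 (fun x => sin (f x)) (cos (f x) * df).
Proof. by move=> h; apply: (@der_comp f sin) => //; exact: is_derive_sin. Qed.
Lemma der_exp f df : is_derive x 1 f df -> is_derive x 1 (fun x => expR (f x)) (expR (f x) * df).
Proof. by move=> h; apply: (@der_comp f expR) => //; exact: is_derive_expR. Qed.
Lemma der_cst (k : R) : is_derive x 1 (fun=> k) 0.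
Proof. exact: is_derive_cst. Qed.
Lemma der_id : is_derive x 1 (fun x : R => x) 1.
Proof. exact: is_derive_id. Qed.
Lemma der_X f df n : is_derive x 1 f df -> is_derive x 1 (fun x => f x ^+ n.+1) (n.+1%:R * f x ^+ n * df).
Proof.
move=> h; elim: n => [|n IH].
  by apply: der_eq (der_eq h _) _ => //; rewrite expr0 mulr1 mul1r.
rewrite (_ : (fun x => _) = fun x => f x * f x ^+ n.+1); last by apply/funext => y; rewrite exprS.
by apply: der_eq (derM h IH) _; rewrite [n.+2%:R]mulrS exprS; ring.
Qed.
End der_rules.

(** * Gaussian integrals over the line *)

Section gauss1.
Variable R : realType.
Local Notation leb := (@lebesgue_measure R).
Local Notation RT := (measurableTypeR R).

Lemma cont_meas (f : R -> R) : continuous f -> measurable_fun setT (f : RT -> R).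
Proof. exact: continuous_measurable_fun. Qed.

Lemma derive_cont (f f' : R -> R) : (forall x : R, is_derive x 1 f (f' x)) -> continuous f.
Proof. by move=> fd x; apply: differentiable_continuous; apply/derivable1_diffP; exact: der_ex (fd x). Qed.

Lemma gauss_cont (c : R) : continuous (fun x : R => expR (- (c * x ^+ 2))).
Proof. by apply: (@derive_cont _ (fun x => - (c * (2 * x)) * expR (- (c * x ^+ 2)))) => x; apply: is_derive_eq; rewrite /GRing.scale /=; ring. Qed.

Lemma integral_gauss (c : R) : 0 < c ->
  (\int[leb]_x (expR (- (c * x ^+ 2)))%:E)%E = (Num.sqrt (pi / c))%:E.
Proof.
move=> c0; have sc0 : 0 < Num.sqrt c by rewrite sqrtr_gt0.
have mg : measurable_fun setT (fun x : R => (gauss_fun x)%:E).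
  by apply/measurable_EFinP; exact: measurable_gauss_fun.
have := @ge0_integral_affine R (Num.sqrt c) 0 (fun x => (gauss_fun x)%:E) sc0 mg.
rewrite integralT_gauss => /(_ (fun x => _)) H.
have -> : (\int[leb]_x (expR (- (c * x ^+ 2)))%:E =
  \int[leb]_t (gauss_fun (Num.sqrt c * t + 0)%R)%:E)%E.
  by apply: eq_integral => t _; rewrite /gauss_fun addr0 exprMn sqr_sqrtr // ltW.
have := H _; rewrite sqrtrM ?pi_ge0 // sqrtrV ?(ltW c0) //.
set I := (\int[leb]_t _)%E => /(_ (fun x => _)) E.
have {}E : ((Num.sqrt c)%:E * I = (Num.sqrt pi)%:E)%E.
  by apply: E => x; rewrite lee_fin gauss_fun_ge0.
rewrite EFinM -E muleC muleA -EFinM mulVf ?mul1e // gt_eqF //.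
Qed.

Lemma rint_gauss (c : R) : 0 < c -> rint leb (fun x => expR (- (c * x ^+ 2))).
Proof.
move=> c0; apply/integrableP; split.
  by apply/measurable_EFinP; apply: cont_meas; exact: gauss_cont.
under eq_integral do rewrite /= ger0_norm ?expR_ge0 //.
by rewrite integral_gauss // ltry.
Qed.

(** Half of the exponent absorbs the polynomial through [1 + t <= exp t] with [t = c x^2 / 2]; this
    is where [2 / c] comes from. *)
Lemma gauss_poly_le (c x : R) : 0 < c ->
  (1 + x ^+ 2) * expR (- (c * x ^+ 2)) <= (1 + 2 / c) * expR (- (c / 2 * x ^+ 2)).
Proof.
move=> c0; have -> : - (c * x ^+ 2) = - (c / 2 * x ^+ 2) - (c / 2 * x ^+ 2) by field.
rewrite expRD mulrA ler_wpM2r ?expR_ge0 // expRN ler_pdivrMr ?expR_gt0 //.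
have h : c / 2 * x ^+ 2 <= expR (c / 2 * x ^+ 2) - 1.
  by rewrite lerBrDl; exact: expR_ge1Dx.
have e1 : 1 <= expR (c / 2 * x ^+ 2).
  by rewrite -expR0 ler_expR mulr_ge0 ?sqr_ge0 // divr_ge0 // ltW.
have c2 : 0 <= 2 / c by rewrite divr_ge0 // ltW.
have -> : x ^+ 2 = 2 / c * (c / 2 * x ^+ 2) by field; rewrite gt_eqF.
rewrite (_ : c / 2 * (2 / c * _) = c / 2 * x ^+ 2); last by field; rewrite gt_eqF.
rewrite [leRHS]mulrDl mul1r; apply: lerD => //.
by rewrite ler_wpM2l // (le_trans h) // lerBlDr lerDl.
Qed.

Lemma rint_gauss_poly (c : R) (p : R -> R) : 0 < c -> continuous p ->
  (forall x, `|p x| <= 1 + x ^+ 2) -> rint leb (fun x => expR (- (c * x ^+ 2)) * p x).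
Proof.
move=> c0 cp pb; have c20 : 0 < c / 2 by rewrite divr_gt0.
apply: rint_dom (rintZ (1 + 2 / c) (rint_gauss c20)).
  by apply: measurable_funM; apply: cont_meas => //; exact: gauss_cont.
move=> x; rewrite normrM (ger0_norm (expR_ge0 _)) mulrC.
by apply: le_trans (gauss_poly_le x c0); rewrite ler_wpM2r // expR_ge0.
Qed.

(** Fundamental theorem of calculus on [[-n, n]], whose boundary terms tend to 0, and dominated
    convergence. *)
Lemma integral_derive0 (f f' : R -> R) : (forall x : R, is_derive x 1 f (f' x)) ->
  continuous f' -> rint leb f' ->
  f (n%:R) @[n --> \oo] --> 0 -> f (- n%:R) @[n --> \oo] --> 0 -> \int[leb]_x f' x = 0.
Proof.
move=> fd cf' if' fp fm.
have cf := derive_cont fd.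
pose A (n : nat) := (`[- n%:R, n%:R]%classic : set R).
pose g (n : nat) x := f' x * \1_(A n) x.
have mA n : measurable (A n) by exact: measurable_itv.
have mg n : measurable_fun setT (EFin \o g n).
  apply/measurable_EFinP; apply: measurable_funM; first exact: rint_meas if'.
  exact: measurable_indic.
have gE (n : nat) : (0 < n)%N -> (\int[leb]_x (g n x)%:E = (f n%:R - f (- n%:R))%:E)%E.
  move=> n0; rewrite EFinB -(@continuous_FTC2 R f' f) //.
  - rewrite [RHS]integral_mkcond; apply: eq_integral => x _; rewrite /g patchE indicE.
    by case: ifP; rewrite ?mulr1 ?mulr0.
  - by rewrite (@lt_trans _ _ 0) ?oppr_lt0 ?ltr0n.
  - exact: continuous_subspaceT.
  - split; [by move=> x _; exact: der_ex (fd x)|exact: cvg_at_right_filter (cf _)|exact: cvg_at_left_filter (cf _)].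
  - by move=> x _; exact: der_val (fd x).
have lim1 : (\int[leb]_x (g n x)%:E @[n --> \oo] --> \int[leb]_x (f' x)%:E)%E.
  apply: (@dominated_cvg _ _ _ leb setT measurableT (fun n => EFin \o g n) (EFin \o f') (EFin \o (fun x => `|f' x|))) => //.
  - move=> x _; apply: cvg_EFin; first exact: nearW.
    apply: cvg_near_cst; exists (Num.truncn `|x|).+1 => // n /= nx.
    rewrite /g indicE mem_set ?mulr1 //= /A /= in_itv /= -ler_norml.
    by rewrite (le_trans (ltW (truncnS_gt _))) // ler_nat.
  - exact: rint_abs.
  - move=> n x _; rewrite /= lee_fin normrM ler_piMr // indicE; case: (_ \in _); rewrite ?normr1 ?normr0 //.
have lim2 : (\int[leb]_x (g n x)%:E @[n --> \oo] --> 0%:E)%E.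
  apply: (@cvg_trans _ ((fun n => (f n%:R - f (- n%:R))%:E) @ \oo)).
    apply: near_eq_cvg; exists 1%N => // n /= n0; exact/esym/gE.
  apply: cvg_EFin; first exact: nearW.
  by rewrite -[X in _ --> X](subr0 0); exact: cvgB.
by rewrite /Rintegral (cvg_unique _ lim1 lim2).
Qed.

Lemma gauss_cvg0 (c : R) (p : R -> R) (s : R) : 0 < c -> (s == 1) || (s == -1) ->
  (forall x, `|p x| <= 1 + x ^+ 2) -> expR (- (c * (s * n%:R) ^+ 2)) * p (s * n%:R) @[n --> \oo] --> 0.
Proof.
move=> c0 s1 pb; have s2 : s ^+ 2 = 1 by case/orP: s1 => /eqP ->; rewrite ?expr1n ?sqrrN ?expr1n.
apply: norm_cvg0.
pose M := (1 + 2 / c) * (2 / c).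
apply: (@squeeze_cvgr _ _ _ _ (fun=> 0) (fun n : nat => M * n.+1%:R^-1)); first last.
- by rewrite -(mulr0 M); apply: cvgMr; exact: cvg_harmonic.
- exact: cvg_cst.
exists 2%N => // n /= n1; rewrite normr_ge0 /= normrM (ger0_norm (expR_ge0 _)).
rewrite (le_trans (ler_wpM2l (expR_ge0 _) (pb _))) // mulrC (le_trans (gauss_poly_le _ c0)) //.
rewrite [leRHS](_ : _ = (1 + 2 / c) * (2 / c * n.+1%:R^-1)); last by rewrite /M; ring.
rewrite ler_wpM2l ?addr_ge0 ?divr_ge0 // ?(ltW c0) // exprMn s2 mul1r expRN.
have e0 : 0 < c / 2 * n.+1%:R by rewrite mulr_gt0 // divr_gt0.
have -> : 2 / c * n.+1%:R^-1 = (c / 2 * n.+1%:R)^-1 by field; rewrite !gt_eqF.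
rewrite lef_pV2 ?posrE ?expR_gt0 //; apply: le_trans (expR_ge1Dx _).
have n1' : (2 : R) <= n%:R by rewrite ler_nat.
have : n%:R + 1 <= n%:R ^+ 2 :> R by nra.
move/(ler_wpM2l (ltW (divr_gt0 c0 (ltr0Sn R 1)))); rewrite natr1 => h.
by rewrite (le_trans h) // lerDr.
Qed.
End gauss1.

(** * Fourier transform of a chirped Gaussian *)

Section gaussFT.
Variables (R : realType) (b g : R).
Hypothesis b0 : 0 < b.
Local Notation leb := (@lebesgue_measure R).
Local Notation RT := (measurableTypeR R).
Let pb0 : 0 < pi * b :> R. Proof. by rewrite mulr_gt0 ?pi_gt0. Qed.

Definition gex (x : R) : R := expR (- (pi * b * x ^+ 2)).
Let a (x : R) := pi * g * x ^+ 2.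
Let c (x : R) := 2 * pi * x.
Let th xi x := a x + xi * c x.

Let ma : measurable_fun setT (a : RT -> R).
Proof. by apply: measurable_funM => //; exact: measurable_funX. Qed.
Let mc : measurable_fun setT (c : RT -> R).
Proof. exact: measurable_funM. Qed.
Let mth xi : measurable_fun setT (th xi : RT -> R).
Proof. by apply: measurable_funD => //; exact: measurable_funM. Qed.

Lemma rint_gex_poly (k : nat) : (k <= 2)%N -> rint leb (fun x => gex x * x ^+ k).
Proof.
move=> k2; apply: rint_gauss_poly => //; first exact: exprn_continuous.
move=> x; rewrite normrX; have x0 := normr_ge0 x; rewrite -(real_normK (num_real x)).
by move: k2; case: k => [|[|[|]]] // _; rewrite ?expr0 ?expr1 ?lerDl ?lerDr ?sqr_ge0 //; nra.
Qed.

Lemma rint_gex : rint leb gex.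
Proof. by apply: eq_rint (rint_gex_poly (leq0n _)) => x; rewrite expr0 mulr1. Qed.

(** Real part, and next to it imaginary part, of the integral of [x^k exp(- pi b x^2) exp(i (pi g
    x^2 + 2 pi xi x))]. Integration by parts expresses order 1 through order 0, differentiation in
    [xi] turns order 0 into order 1, and the resulting linear system in [xi] is solved
    explicitly. *)
Let Cn k xi := \int[leb]_x (gex x * x ^+ k * cos (th xi x)).
Let Sn k xi := \int[leb]_x (gex x * x ^+ k * sin (th xi x)).

Let rC k xi : (k <= 2)%N -> rint leb (fun x => gex x * x ^+ k * cos (th xi x)).
Proof. by move=> k2; apply: rint_cos => //; exact: rint_gex_poly. Qed.
Let rS k xi : (k <= 2)%N -> rint leb (fun x => gex x * x ^+ k * sin (th xi x)).
Proof. by move=> k2; apply: rint_sin => //; exact: rint_gex_poly. Qed.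

Let gexd (x : R) : is_derive x 1 gex (- (2 * pi * b * x) * gex x).
Proof. by rewrite /gex; apply: is_derive_eq; rewrite /GRing.scale /=; ring. Qed.
Let thd xi (x : R) : is_derive x 1 (th xi) (2 * pi * g * x + xi * (2 * pi)).
Proof. by rewrite /th /a /c; apply: is_derive_eq; rewrite /GRing.scale /=; ring. Qed.

Let cgex : continuous gex. Proof. exact: gauss_cont. Qed.
Let cth xi : continuous (th xi). Proof. exact: derive_cont (thd xi). Qed.

Let ccos xi : continuous (fun x => cos (th xi x)).
Proof. by move=> x; apply: continuous_comp; [exact: cth|exact: continuous_cos]. Qed.
Let csin xi : continuous (fun x => sin (th xi x)).
Proof. by move=> x; apply: continuous_comp; [exact: cth|exact: continuous_sin]. Qed.

Let cvgp (p : R -> R) : (forall x, `|p x| <= 1 + x ^+ 2) ->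
  (gex n%:R * p n%:R @[n --> \oo] --> 0) /\ (gex (- n%:R) * p (- n%:R) @[n --> \oo] --> 0).
Proof.
move=> hp; split.
  by have := @gauss_cvg0 R _ p 1 pb0 _ hp; rewrite eqxx /= => /(_ isT);
     under eq_fun do rewrite mul1r.
by have := @gauss_cvg0 R _ p (-1) pb0 _ hp; rewrite eqxx orbT /= => /(_ isT);
     under eq_fun do rewrite mulN1r.
Qed.

Let trig1 (t : R) : `|t| <= 1 -> forall x : R, `|t| <= 1 + x ^+ 2.
Proof. by move=> h x; rewrite (le_trans h) // lerDl sqr_ge0. Qed.

Let cos1 (t : R) : `|cos t| <= 1. Proof. by rewrite ler_norml cos_geN1 cos_le1. Qed.
Let sin1 (t : R) : `|sin t| <= 1. Proof. by rewrite ler_norml sin_geN1 sin_le1. Qed.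

Let ibp_cos xi : b * Cn 1 xi + g * Sn 1 xi + xi * Sn 0 xi = 0.
Proof.
pose f x := gex x * cos (th xi x).
pose f' x := (- (2 * pi)) * (b * (gex x * x ^+ 1 * cos (th xi x)) + g * (gex x * x ^+ 1 * sin (th xi x))
   + xi * (gex x * x ^+ 0 * sin (th xi x))).
have fd (x : R) : is_derive x 1 f (f' x).
  by apply: der_eq (derM (gexd x) (der_cos (thd xi x))) _; rewrite /f' expr0 expr1; ring.
have r1 := rintZ b (rC xi (isT : (1 <= 2)%N)); have r2 := rintZ g (rS xi (isT : (1 <= 2)%N)).
have r3 := rintZ xi (rS xi (isT : (0 <= 2)%N)).
have [h1 h2] := cvgp (fun x => trig1 (cos1 (th xi x)) x).
have : \int[leb]_x f' x = 0; first (apply: (integral_derive0 fd) => //).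
- move=> x; apply: cvgM; first exact: cvg_cst.
  apply: cvgD; first apply: cvgD; (apply: cvgM; first exact: cvg_cst); apply: cvgM;
    by [exact: ccos|exact: csin|apply: cvgM; [exact: cgex|exact: exprn_continuous]].
- by apply: rintZ; apply: rintD => //; exact: rintD.
move/eqP; rewrite RintegralZl //; last by apply: rintD => //; exact: rintD.
rewrite RintegralD ?RintegralD ?RintegralZl //; try exact: rC; try exact: rS; try exact: rintD.
by rewrite mulf_eq0 oppr_eq0 mulf_eq0 pnatr_eq0 /= gt_eqF ?pi_gt0 //= => /eqP.
Qed.

Let ibp_sin xi : b * Sn 1 xi = g * Cn 1 xi + xi * Cn 0 xi.
Proof.
pose f x := gex x * sin (th xi x).
pose f' x := (2 * pi) * ((g * (gex x * x ^+ 1 * cos (th xi x))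
   + xi * (gex x * x ^+ 0 * cos (th xi x))) - b * (gex x * x ^+ 1 * sin (th xi x))).
have fd (x : R) : is_derive x 1 f (f' x).
  by apply: der_eq (derM (gexd x) (der_sin (thd xi x))) _; rewrite /f' expr0 expr1; ring.
have r1 := rintZ b (rS xi (isT : (1 <= 2)%N)); have r2 := rintZ g (rC xi (isT : (1 <= 2)%N)).
have r3 := rintZ xi (rC xi (isT : (0 <= 2)%N)).
have [h1 h2] := cvgp (fun x => trig1 (sin1 (th xi x)) x).
have : \int[leb]_x f' x = 0; first (apply: (integral_derive0 fd) => //).
- move=> x; apply: cvgM; first exact: cvg_cst.
  apply: cvgB; first apply: cvgD; (apply: cvgM; first exact: cvg_cst); apply: cvgM;
    by [exact: ccos|exact: csin|apply: cvgM; [exact: cgex|exact: exprn_continuous]].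
- by apply: rintZ; apply: rintB => //; exact: rintD.
move/eqP; rewrite RintegralZl //; last by apply: rintB => //; exact: rintD.
rewrite RintegralB ?RintegralD ?RintegralZl //; [|exact: rS|exact: rC|exact: rC|exact: rintD].
by rewrite mulf_eq0 mulf_eq0 pnatr_eq0 /= gt_eqF ?pi_gt0 //= subr_eq0 => /eqP.
Qed.

Let Cd (xi : R) : is_derive xi 1 (Cn 0) (- (2 * pi) * Sn 1 xi).
Proof.
have h := @is_derive_int_cos _ _ R leb (fun x => gex x * x ^+ 0) c a mc ma (rint_gex_poly (leq0n _)) _ xi.
apply: is_derive_eq.
  apply: h; apply: eq_rint (rintZ (2 * pi) (rint_gex_poly (isT : (1 <= 2)%N))) => x.
  by rewrite /c expr0; ring.
rewrite mulNr -RintegralZl //; last exact: rS.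
by congr (- _); apply: eq_Rintegral => x _; rewrite /th /c expr0 expr1; ring.
Qed.

Let Sd (xi : R) : is_derive xi 1 (Sn 0) (2 * pi * Cn 1 xi).
Proof.
have h := @is_derive_int_sin _ _ R leb (fun x => gex x * x ^+ 0) c a mc ma (rint_gex_poly (leq0n _)) _ xi.
apply: is_derive_eq.
  apply: h; apply: eq_rint (rintZ (2 * pi) (rint_gex_poly (isT : (1 <= 2)%N))) => x.
  by rewrite /c expr0; ring.
rewrite -RintegralZl //; last exact: rC.
by apply: eq_Rintegral => x _; rewrite /th /c expr0 expr1; ring.
Qed.

(** Squared modulus of [b - i g] and determinant of the system for the first moments. The transform
    of [exp(- pi (b - i g) x^2)] is a constant times [exp(- pi xi^2 / (b - i g))], whose exponent
    has real part [- pi b xi^2 / gD] and imaginary part [- pi g xi^2 / gD]. *)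
Definition gD : R := b ^+ 2 + g ^+ 2.
Lemma gD_gt0 : 0 < gD.
Proof. by rewrite ltr_pwDl ?sqr_ge0 // exprn_gt0. Qed.

Let C1E xi : gD * Cn 1 xi = - xi * (b * Sn 0 xi + g * Cn 0 xi).
Proof.
have h1 := ibp_cos xi; have h2 := ibp_sin xi.
transitivity (b * (b * Cn 1 xi + g * Sn 1 xi + xi * Sn 0 xi) - g * (b * Sn 1 xi - (g * Cn 1 xi + xi * Cn 0 xi))
  - xi * (b * Sn 0 xi + g * Cn 0 xi)); first by rewrite /gD; ring.
by rewrite h1 h2; ring.
Qed.

Let S1E xi : gD * Sn 1 xi = xi * (b * Cn 0 xi - g * Sn 0 xi).
Proof.
have h1 := ibp_cos xi; have h2 := ibp_sin xi.
transitivity (g * (b * Cn 1 xi + g * Sn 1 xi + xi * Sn 0 xi) + b * (b * Sn 1 xi - (g * Cn 1 xi + xi * Cn 0 xi))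
  + xi * (b * Cn 0 xi - g * Sn 0 xi)); first by rewrite /gD; ring.
by rewrite h1 h2; ring.
Qed.

Let Ex (xi : R) := expR (pi * b / gD * xi ^+ 2).
Let ph (xi : R) := pi * g / gD * xi ^+ 2.

(** Real and imaginary part of the integral divided by the expected Gaussian and rotated back by
    [ph]. Both have zero derivative, which replaces a uniqueness theorem for the system. *)
Let P (xi : R) := Ex xi * (Cn 0 xi * cos (ph xi) - Sn 0 xi * sin (ph xi)).
Let Q (xi : R) := Ex xi * (Sn 0 xi * cos (ph xi) + Cn 0 xi * sin (ph xi)).

Let Cd' (xi : R) : is_derive xi 1 (Cn 0) (- (2 * pi) * (xi * (b * Cn 0 xi - g * Sn 0 xi)) / gD).
Proof.
have := Cd xi; rewrite (_ : - (2 * pi) * Sn 1 xi = - (2 * pi) * (xi * (b * Cn 0 xi - g * Sn 0 xi)) / gD) //.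
by rewrite -S1E; field; rewrite gt_eqF ?gD_gt0.
Qed.
Let Sd' (xi : R) : is_derive xi 1 (Sn 0) (- (2 * pi) * (xi * (b * Sn 0 xi + g * Cn 0 xi)) / gD).
Proof.
have := Sd xi; rewrite (_ : 2 * pi * Cn 1 xi = - (2 * pi) * (xi * (b * Sn 0 xi + g * Cn 0 xi)) / gD) //.
have := C1E xi; rewrite mulNr => /(congr1 -%R); rewrite opprK => <-; field.
by rewrite gt_eqF // gD_gt0.
Qed.
Let Exd (xi : R) : is_derive xi 1 Ex (2 * pi * b * xi / gD * Ex xi).
Proof. by rewrite /Ex; apply: is_derive_eq; rewrite /GRing.scale /=; ring. Qed.
Let phd (xi : R) : is_derive xi 1 ph (2 * pi * g * xi / gD).
Proof. by rewrite /ph; apply: is_derive_eq; rewrite /GRing.scale /=; ring. Qed.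

Let Pcst xi : P xi = Cn 0 0.
Proof.
have -> : Cn 0 0 = P 0.
  by rewrite /P /Ex /ph expr0n /= !mulr0 expR0 cos0 sin0; ring.
apply: is_derive_0_is_cst => x.
apply: der_eq (derM (Exd x) (derB (derM (Cd' x) (der_cos (phd x))) (derM (Sd' x) (der_sin (phd x))))) _.
by field; rewrite gt_eqF // gD_gt0.
Qed.

Let Qcst xi : Q xi = Sn 0 0.
Proof.
have -> : Sn 0 0 = Q 0.
  by rewrite /Q /Ex /ph expr0n /= !mulr0 expR0 cos0 sin0; ring.
apply: is_derive_0_is_cst => x.
apply: der_eq (derM (Exd x) (derD (derM (Sd' x) (der_cos (phd x))) (derM (Cd' x) (der_sin (phd x))))) _.
by field; rewrite gt_eqF // gD_gt0.
Qed.

(** Together with [gV] the value at [xi = 0], which is [(b - i g)^(-1/2)]. For chirps only its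
    modulus is computed, so no branch of the complex square root is chosen. *)
Definition gU := \int[leb]_x (gex x * cos (pi * g * x ^+ 2)).
Definition gV := \int[leb]_x (gex x * sin (pi * g * x ^+ 2)).

Let C00 : Cn 0 0 = gU.
Proof. by apply: eq_Rintegral => x _; rewrite /th mul0r addr0 expr0 mulr1. Qed.
Let S00 : Sn 0 0 = gV.
Proof. by apply: eq_Rintegral => x _; rewrite /th mul0r addr0 expr0 mulr1. Qed.

Lemma gauss_FT_cos xi : \int[leb]_x (gex x * cos (pi * g * x ^+ 2 + xi * (2 * pi * x))) =
  expR (- (pi * b / gD * xi ^+ 2)) * (gU * cos (pi * g / gD * xi ^+ 2) + gV * sin (pi * g / gD * xi ^+ 2)).
Proof.
transitivity (Cn 0 xi); first by apply: eq_Rintegral => x _; rewrite expr0 mulr1.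
rewrite -C00 -S00 -(Pcst xi) -(Qcst xi) /P /Q.
have cs := cos2Dsin2 (ph xi); rewrite -/(ph xi).
transitivity ((expR (- (pi * b / gD * xi ^+ 2)) * Ex xi) * (Cn 0 xi * (cos (ph xi) ^+ 2 + sin (ph xi) ^+ 2))); last by ring.
by rewrite cs /Ex -expRD addNr expR0 mulr1 mul1r.
Qed.

Lemma gauss_FT_sin xi : \int[leb]_x (gex x * sin (pi * g * x ^+ 2 + xi * (2 * pi * x))) =
  expR (- (pi * b / gD * xi ^+ 2)) * (gV * cos (pi * g / gD * xi ^+ 2) - gU * sin (pi * g / gD * xi ^+ 2)).
Proof.
transitivity (Sn 0 xi); first by apply: eq_Rintegral => x _; rewrite expr0 mulr1.
rewrite -C00 -S00 -(Pcst xi) -(Qcst xi) /P /Q.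
have cs := cos2Dsin2 (ph xi); rewrite -/(ph xi).
transitivity ((expR (- (pi * b / gD * xi ^+ 2)) * Ex xi) * (Sn 0 xi * (cos (ph xi) ^+ 2 + sin (ph xi) ^+ 2))); last by ring.
by rewrite cs /Ex -expRD addNr expR0 mulr1 mul1r.
Qed.

(** Integrate the derivative of [x] times the chirped Gaussian. This ties the constant to the second
    moments, which are also its derivatives in [g]. *)
Lemma gU_ibp : gU = 2 * pi * (b * \int[leb]_x (gex x * x ^+ 2 * cos (pi * g * x ^+ 2))
   + g * \int[leb]_x (gex x * x ^+ 2 * sin (pi * g * x ^+ 2))).
Proof.
pose f x := gex x * (x * cos (th 0 x)).
pose f' x := gex x * x ^+ 0 * cos (th 0 x) - (2 * pi) * (b * (gex x * x ^+ 2 * cos (th 0 x)) +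
   g * (gex x * x ^+ 2 * sin (th 0 x))).
have fd (x : R) : is_derive x 1 f (f' x).
  by apply: der_eq (derM (gexd x) (derM (der_id x) (der_cos (thd 0 x)))) _; rewrite /f' expr0; ring.
have r0 := rC 0 (isT : (0 <= 2)%N).
have r1 := rintZ b (rC 0 (isT : (2 <= 2)%N)); have r2 := rintZ g (rS 0 (isT : (2 <= 2)%N)).
have xb (x t : R) : `|t| <= 1 -> `|x * t| <= 1 + x ^+ 2.
  move=> t1; rewrite normrM (le_trans (ler_piMr _ t1)) //.
  by rewrite -(real_normK (num_real x)); have := normr_ge0 x; nra.
have [h1 h2] := cvgp (fun x => xb x _ (cos1 (th 0 x))).
have : \int[leb]_x f' x = 0; first (apply: (integral_derive0 fd) => //).
- move=> x; apply: cvgB.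
    by apply: cvgM; [apply: cvgM; [exact: cgex|exact: exprn_continuous]|exact: ccos].
  apply: cvgM; first exact: cvg_cst.
  apply: cvgD; (apply: cvgM; first exact: cvg_cst); apply: cvgM;
    by [exact: ccos|exact: csin|apply: cvgM; [exact: cgex|exact: exprn_continuous]].
- by apply: rintB => //; apply: rintZ; exact: rintD.
move/eqP; rewrite RintegralB //; last by apply: rintZ; exact: rintD.
rewrite RintegralZl ?RintegralD ?RintegralZl //; [|exact: rS|exact: rC|exact: rintD].
rewrite subr_eq0 => /eqP E; rewrite -C00 /Cn E; congr (_ * (_ * _ + _ * _));
  by apply: eq_Rintegral => x _; rewrite /th mul0r addr0.
Qed.

Lemma gV_ibp : gV = 2 * pi * (b * \int[leb]_x (gex x * x ^+ 2 * sin (pi * g * x ^+ 2))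
   - g * \int[leb]_x (gex x * x ^+ 2 * cos (pi * g * x ^+ 2))).
Proof.
pose f x := gex x * (x * sin (th 0 x)).
pose f' x := gex x * x ^+ 0 * sin (th 0 x) - (2 * pi) * (b * (gex x * x ^+ 2 * sin (th 0 x)) -
   g * (gex x * x ^+ 2 * cos (th 0 x))).
have fd (x : R) : is_derive x 1 f (f' x).
  by apply: der_eq (derM (gexd x) (derM (der_id x) (der_sin (thd 0 x)))) _; rewrite /f' expr0; ring.
have r0 := rS 0 (isT : (0 <= 2)%N).
have r1 := rintZ b (rS 0 (isT : (2 <= 2)%N)); have r2 := rintZ g (rC 0 (isT : (2 <= 2)%N)).
have xb (x t : R) : `|t| <= 1 -> `|x * t| <= 1 + x ^+ 2.
  move=> t1; rewrite normrM (le_trans (ler_piMr _ t1)) //.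
  by rewrite -(real_normK (num_real x)); have := normr_ge0 x; nra.
have [h1 h2] := cvgp (fun x => xb x _ (sin1 (th 0 x))).
have : \int[leb]_x f' x = 0; first (apply: (integral_derive0 fd) => //).
- move=> x; apply: cvgB.
    by apply: cvgM; [apply: cvgM; [exact: cgex|exact: exprn_continuous]|exact: csin].
  apply: cvgM; first exact: cvg_cst.
  apply: cvgB; (apply: cvgM; first exact: cvg_cst); apply: cvgM;
    by [exact: ccos|exact: csin|apply: cvgM; [exact: cgex|exact: exprn_continuous]].
- by apply: rintB => //; apply: rintZ; exact: rintB.
move/eqP; rewrite RintegralB //; last by apply: rintZ; exact: rintB.
rewrite RintegralZl ?RintegralB ?RintegralZl //; [|exact: rC|exact: rS|exact: rintB].
rewrite subr_eq0 => /eqP E; rewrite -S00 /Sn E; congr (_ * (_ * _ - _ * _));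
  by apply: eq_Rintegral => x _; rewrite /th mul0r addr0.
Qed.
End gaussFT.

(** * Modulus of the Gaussian constant *)

Section gauss_norm.
Variables (R : realType) (b : R).
Hypothesis b0 : 0 < b.
Local Notation leb := (@lebesgue_measure R).
Local Notation RT := (measurableTypeR R).
Local Notation U := (gU b).
Local Notation V := (gV b).

Let mX (k : R) : measurable_fun setT (fun x : RT => k * x ^+ 2).
Proof. by apply: measurable_funM => //; exact: measurable_funX. Qed.

Let W2 (g : R) := (U g ^+ 2 + V g ^+ 2) ^+ 2 * (b ^+ 2 + g ^+ 2).

(** By [gU_ibp] and [gV_ibp] the left-hand side has zero derivative in the chirp rate; at rate 0 the
    integral is real and classical. *)
Lemma gauss_normE g0 : (U g0 ^+ 2 + V g0 ^+ 2) ^+ 2 * (b ^+ 2 + g0 ^+ 2) = 1.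
Proof.
have ri : rint leb (fun x : R => gex b x * (pi * x ^+ 2)).
  by apply: eq_rint (rintZ pi (rint_gex_poly b0 (isT : (2 <= 2)%N))) => x; ring.
have mz : measurable_fun setT (fun _ : RT => 0 : R) by [].
pose I2 g := \int[leb]_x (gex b x * x ^+ 2 * cos (pi * g * x ^+ 2)).
pose J2 g := \int[leb]_x (gex b x * x ^+ 2 * sin (pi * g * x ^+ 2)).
have r2c (g : R) : rint leb (fun x : R => gex b x * x ^+ 2 * cos (pi * g * x ^+ 2)).
  by apply: rint_cos => //; exact: rint_gex_poly.
have r2s (g : R) : rint leb (fun x : R => gex b x * x ^+ 2 * sin (pi * g * x ^+ 2)).
  by apply: rint_sin => //; exact: rint_gex_poly.
have Ud (g : R) : is_derive g 1 U (- (pi * J2 g)).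
  have := is_derive_int_cos (mX pi) mz (rint_gex b0) ri g.
  rewrite (_ : (fun x => _) = U); last first.
    by apply/funext => x0; apply: eq_Rintegral => y _; rewrite add0r; congr (_ * cos _); ring.
  move=> h; apply: is_derive_eq; rewrite -RintegralZl //.
    by congr (- _); apply: eq_Rintegral => y _; rewrite add0r (_ : g * _ = pi * g * y ^+ 2); ring.
  exact: r2s.
have Vd (g : R) : is_derive g 1 V (pi * I2 g).
  have := is_derive_int_sin (mX pi) mz (rint_gex b0) ri g.
  rewrite (_ : (fun x => _) = V); last first.
    by apply/funext => x0; apply: eq_Rintegral => y _; rewrite add0r; congr (_ * sin _); ring.
  move=> h; apply: is_derive_eq; rewrite -RintegralZl //.
    by apply: eq_Rintegral => y _; rewrite add0r (_ : g * _ = pi * g * y ^+ 2); ring.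
  exact: r2c.
have UE (g : R) : U g = 2 * pi * (b * I2 g + g * J2 g) by exact: gU_ibp.
have VE (g : R) : V g = 2 * pi * (b * J2 g - g * I2 g) by exact: gV_ibp.
have W2d (x : R) : is_derive x 1 W2 0.
  apply: der_eq (derM (der_X 1 (derD (der_X 1 (Ud x)) (der_X 1 (Vd x)))) (derD (der_cst x _) (der_X 1 (der_id x)))) _.
  by rewrite (UE x) (VE x); ring.
rewrite -[LHS]/(W2 g0) (is_derive_0_is_cst g0 0 W2d) /W2.
have -> : V 0 = 0.
  rewrite /gV; under eq_Rintegral do rewrite mulr0 mul0r sin0 mulr0.
  by rewrite Rintegral_cst ?mul0r.
have -> : U 0 = Num.sqrt (b^-1).
  rewrite /gU; under eq_Rintegral do rewrite mulr0 mul0r cos0 mulr1.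
  have pb : 0 < pi * b by rewrite mulr_gt0 ?pi_gt0.
  rewrite /Rintegral (integral_gauss pb) /=; congr Num.sqrt.
  by rewrite invfM mulrA divff ?mul1r // gt_eqF // pi_gt0.
rewrite sqr_sqrtr ?invr_ge0 ?ltW //; field; exact: lt0r_neq0.
Qed.
End gauss_norm.

(** * L^v norms and the integral Minkowski inequality *)

Section power_means.
Variable R : realType.

Lemma powR_div (v z c : R) : 0 < c -> 0 <= z -> (z / c) `^ v = z `^ v / c `^ v.
Proof.
move=> c0 z0; rewrite powRM ?invr_ge0 ?(ltW c0) //; congr (_ * _).
by rewrite -(powR_inv1 (ltW c0)) -powRrM mulN1r powRN.
Qed.

(** Tangent line of the power at 1, obtained from Young's inequality with second factor 1. *)
Lemma powR_tangent (v r : R) : 1 <= v -> 0 <= r -> v * r - (v - 1) <= r `^ v.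
Proof.
move=> v1 r0; have [->|vn1] := eqVneq v 1; first by rewrite powRr1 // subrr subr0 mul1r.
have {}v1 : 1 < v by rewrite lt_neqAle eq_sym vn1.
have v0 : 0 < v by rewrite (lt_trans _ v1).
have vm : 0 < v - 1 by rewrite subr_gt0.
have q0 : 0 < v / (v - 1) by rewrite divr_gt0.
have := @conjugate_powR R r 1 v (v / (v - 1)) r0 ler01 v0 q0 _.
rewrite powR1 mulr1 => h.
have {}h : r <= r `^ v / v + 1 / (v / (v - 1)) by apply: h; field; rewrite !gt_eqF.
have := ler_wpM2l (ltW v0) h.
rewrite (_ : v * (r `^ v / v + 1 / (v / (v - 1))) = r `^ v + (v - 1)); last by field; rewrite !gt_eqF.
by rewrite lerBlDr.
Qed.

Context d (T : measurableType d) (nu : {measure set T -> \bar R}).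

Lemma measurable_funV (b : T -> R) : (forall t, 0 < b t) -> measurable_fun setT b ->
  measurable_fun setT (fun t => (b t)^-1).
Proof.
move=> b0 mb; rewrite (_ : (fun t => _) = fun t => b t `^ (-1)).
  exact: (measurableT_comp (measurable_powR _) mb).
by apply/funext => t; rewrite powR_inv1 // ltW.
Qed.

(** The tangent inequality at the point [a = S / M], integrated against [rho]. Mass at most [M]
    suffices, since the mass enters through the negative constant term of the tangent. *)
Lemma jensen_weight (v M : R) (rho h : T -> R) : 1 <= v -> 0 < M ->
  (forall x, 0 <= rho x) -> (forall x, 0 <= h x) ->
  rint nu rho -> measurable_fun setT h ->
  \int[nu]_x rho x <= M -> rint nu (fun x => rho x * h x) ->
  (((\int[nu]_x (rho x * h x)) `^ v)%:E <= (M `^ (v - 1))%:E * \int[nu]_x (rho x * h x `^ v)%:E)%E.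
Proof.
move=> v1 M0 rho0 h0 irho mh rM irh.
have v0 : 0 < v by rewrite (lt_le_trans _ v1).
set S := \int[nu]_x (rho x * h x).
have S0 : 0 <= S by apply: Rintegral_ge0 => x _; exact: mulr_ge0.
have mrho := rint_meas irho.
have mhv : measurable_fun setT (fun x => rho x * h x `^ v).
  by apply: measurable_funM => //; apply: (measurableT_comp (measurable_powR _)).
have J0 : (0 <= \int[nu]_x (rho x * h x `^ v)%:E)%E.
  by apply: integral_ge0 => x _; rewrite lee_fin mulr_ge0 // powR_ge0.
have [->|Sn0] := eqVneq S 0.
  by rewrite powR0 ?gt_eqF // mule_ge0 // lee_fin powR_ge0.
have Sp : 0 < S by rewrite lt_neqAle eq_sym Sn0.
pose a := S / M.
have a0 : 0 < a by rewrite divr_gt0.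
have [Jy|Jfin] := eqVneq (\int[nu]_x (rho x * h x `^ v)%:E)%E +oo%E.
  by rewrite Jy gt0_muley ?leey // lte_fin powR_gt0.
have irhv : rint nu (fun x => rho x * h x `^ v).
  apply/integrableP; split; first exact/measurable_EFinP.
  under eq_integral => x _ do rewrite /= ger0_norm ?mulr_ge0 ?powR_ge0 //.
  by rewrite ltey.
have pw x : v * a `^ (v - 1) * (rho x * h x) - (v - 1) * a `^ v * rho x <= rho x * h x `^ v.
  have := powR_tangent v1 (divr_ge0 (h0 x) (ltW a0)).
  move/(ler_wpM2l (mulr_ge0 (rho0 x) (powR_ge0 a v))).
  rewrite [leRHS](_ : _ = rho x * h x `^ v); last first.
    by rewrite -mulrA -(powRM v (ltW a0) (divr_ge0 (h0 x) (ltW a0))) (mulrC a) divfK ?gt_eqF.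
  apply: le_trans; rewrite -(mulr_powRB1 (ltW a0) v0); apply: le_of_eq.
  by field; rewrite gt_eqF.
have key : v * a `^ (v - 1) * S - (v - 1) * a `^ v * \int[nu]_x rho x <= \int[nu]_x (rho x * h x `^ v).
  rewrite /S -!RintegralZl // -RintegralB //; [|exact: rintZ|exact: rintZ].
  by apply: le_Rintegral => //; apply: rintB; exact: rintZ.
have -> : (\int[nu]_x (rho x * h x `^ v)%:E)%E = (\int[nu]_x (rho x * h x `^ v))%:E.
  by rewrite fineK //; exact: integrable_fin_num irhv.
rewrite -EFinM lee_fin.
have aM : S = a * M by rewrite divfK // gt_eqF.
have key2 : a `^ v * M <= \int[nu]_x (rho x * h x `^ v).
  apply: le_trans key; rewrite aM.
  have -> : v * a `^ (v - 1) * (a * M) = v * a `^ v * M.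
    by rewrite -(mulr_powRB1 (ltW a0) v0); ring.
  have : (v - 1) * a `^ v * \int[nu]_x rho x <= (v - 1) * a `^ v * M.
    by rewrite ler_wpM2l // mulr_ge0 ?powR_ge0 // subr_ge0.
  lra.
rewrite aM powRM ?(ltW a0) ?(ltW M0) // -(mulr_powRB1 (ltW M0) v0).
rewrite [leLHS](_ : _ = M `^ (v - 1) * (a `^ v * M)); last by ring.
by rewrite ler_wpM2l // powR_ge0.
Qed.
End power_means.

Section meas_param.
Context d1 (X : measurableType d1) d2 (Y : measurableType d2) (R : realType).
Variable m2 : {sigma_finite_measure set Y -> \bar R}.

Lemma measurable_Rint_param (F : X * Y -> R) : measurable_fun setT F ->
  measurable_fun setT (fun x => \int[m2]_y F (x, y)).
Proof.
move=> mF; apply: (measurableT_comp (f := fine)) => //.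
have mE : measurable_fun setT (EFin \o F) by exact/measurable_EFinP.
rewrite (_ : (fun x => _) = fun x => (\int[m2]_y (EFin \o F)^\+ (x, y) - \int[m2]_y (EFin \o F)^\- (x, y))%E).
  apply: emeasurable_funB.
    by apply: measurable_fun_fubini_tonelli_F => //; exact: measurable_funepos.
  by apply: measurable_fun_fubini_tonelli_F => //; exact: measurable_funeneg.
apply/funext => x; rewrite integralE; congr (_ - _)%E; apply: eq_integral => y _.
  by rewrite !funeposE.
by rewrite !funenegE.
Qed.
End meas_param.

Section fubini_real.
Context d1 (X : measurableType d1) d2 (Y : measurableType d2) (R : realType).
Variables (m1 : {sigma_finite_measure set X -> \bar R}) (m2 : {sigma_finite_measure set Y -> \bar R}).

Lemma rint_prod (F : X * Y -> R) : measurable_fun setT F ->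
  (\int[m1]_x \int[m2]_y (`|F (x, y)|)%:E < +oo)%E -> rint (m1 \x m2)%E F.
Proof.
move=> mF Foo; apply/integrable12ltyP => //.
exact/measurable_EFinP.
Qed.

Lemma Rintegral_fubini (F : X * Y -> R) : rint (m1 \x m2)%E F ->
  (forall x, rint m2 (fun y => F (x, y))) -> (forall y, rint m1 (fun x => F (x, y))) ->
  \int[m1]_x (\int[m2]_y F (x, y)) = \int[m2]_y (\int[m1]_x F (x, y)).
Proof.
move=> iF i2 i1; rewrite /Rintegral; congr fine.
have := Fubini iF; rewrite /fubini_F /fubini_G /= => E.
transitivity (\int[m1]_x \int[m2]_y (F (x, y))%:E)%E.
  by apply: eq_integral => x _; rewrite fineK //; exact: integrable_fin_num (i2 x).
rewrite E; apply: eq_integral => y _; rewrite fineK //; exact: integrable_fin_num (i1 y).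
Qed.

Lemma rint_fubini_l (F : X * Y -> R) : rint (m1 \x m2)%E F ->
  (forall x, rint m2 (fun y => F (x, y))) -> rint m1 (fun x => \int[m2]_y F (x, y)).
Proof.
move=> iF i2; have := integrable_fubini_F iF; rewrite /fubini_F /=.
apply: eq_integrable => // x _; rewrite /= fineK //; exact: integrable_fin_num (i2 x).
Qed.
End fubini_real.

(** * Minkowski inequalities *)

Section pint.
Context d (X : measurableType d) (R : realType) (mu : {measure set X -> \bar R}).
(** The [v]-th power of the [L^v] norm. Norm bounds are written [pint v f <= b ^ v] with a real [b],
    so that no root of an extended real is ever taken. *)
Definition pint (v : R) (f : X -> R) : \bar R := (\int[mu]_x (`|f x| `^ v)%:E)%E.

Lemma measurable_powf (v : R) (f : X -> R) : measurable_fun setT f ->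
  measurable_fun setT (fun x => (`|f x| `^ v)%:E).
Proof.
move=> mf; apply/measurable_EFinP; apply: (measurableT_comp (measurable_powR _)).
exact: measurableT_comp.
Qed.

Lemma pint_le (v : R) (f g : X -> R) : 0 <= v -> measurable_fun setT f -> measurable_fun setT g ->
  (forall x, `|f x| <= `|g x|) -> (pint v f <= pint v g)%E.
Proof.
move=> v0 mf mg fg; apply: ge0_le_integral => //; try exact: measurable_powf.
by move=> x _; rewrite lee_fin ge0_ler_powR // ?nnegrE.
Qed.

Lemma pintZ (v c b : R) (f : X -> R) : 0 <= v -> 0 <= c -> 0 <= b -> measurable_fun setT f ->
  (pint v f <= (b `^ v)%:E)%E -> (pint v (fun x => (c * f x)%R) <= ((c * b) `^ v)%:E)%E.
Proof.
move=> v0 c0 b0 mf fb; rewrite /pint.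
rewrite (eq_integral (fun x => (c `^ v)%:E * (`|f x| `^ v)%:E)%E); last first.
  by move=> x _; rewrite normrM (ger0_norm c0) powRM.
rewrite ge0_integralZl ?lee_fin ?powR_ge0 //; last exact: measurable_powf.
by rewrite powRM // EFinM lee_wpmul2l // lee_fin powR_ge0.
Qed.

(** Convexity of the power at the points [x / a] and [y / b] with weights proportional to [a] and
    [b]. When [a] and [b] are the two norms this is Minkowski's inequality before integration. *)
Lemma powR_convex2 (v a b x y : R) : 1 <= v -> 0 < a -> 0 < b -> 0 <= x -> 0 <= y ->
  (x + y) `^ v <= (a + b) `^ v * (a / (a + b) * (x / a) `^ v + b / (a + b) * (y / b) `^ v).
Proof.
move=> v1 a0 b0 x0 y0; have ab : 0 < a + b by rewrite addr_gt0.
have v0 : 0 < v by rewrite (lt_le_trans _ v1).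
have x' : 0 <= x / a by rewrite divr_ge0 // ltW.
have y' : 0 <= y / b by rewrite divr_ge0 // ltW.
pose w := (x + y) / (a + b).
have w0 : 0 <= w by rewrite divr_ge0 ?addr_ge0 // ltW.
have -> : x + y = (a + b) * w by rewrite mulrC divfK // gt_eqF.
rewrite powRM ?(ltW ab) // ler_wpM2l ?powR_ge0 //.
have [wz|wn] := eqVneq w 0.
  by rewrite wz powR0 ?gt_eqF // addr_ge0 // mulr_ge0 ?powR_ge0 // divr_ge0 // ltW.
have wp : 0 < w by rewrite lt_neqAle eq_sym wn.
have T (z : R) : 0 <= z -> w `^ v * (v * (z / w) - (v - 1)) <= z `^ v.
  move=> z0; have := powR_tangent v1 (divr_ge0 z0 w0).
  move/(ler_wpM2l (powR_ge0 w v)) => h; apply: (le_trans h).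
  apply: le_of_eq.
  by rewrite (powR_div v wp z0) mulrC divfK // gt_eqF // powR_gt0.
have hx := ler_wpM2l (divr_ge0 (ltW a0) (ltW ab)) (T _ x').
have hy := ler_wpM2l (divr_ge0 (ltW b0) (ltW ab)) (T _ y').
apply: le_trans (lerD hx hy); apply: le_of_eq.
transitivity (w `^ v * (v * ((x + y) / (a + b) / w) - (v - 1))).
  by rewrite -/w divff //; ring.
field; rewrite !gt_eqF //.
Qed.

Lemma pintD (v a b : R) (f g : X -> R) : 1 <= v -> 0 < a -> 0 < b ->
  measurable_fun setT f -> measurable_fun setT g ->
  (pint v f <= (a `^ v)%:E)%E -> (pint v g <= (b `^ v)%:E)%E ->
  (pint v (fun x => (f x + g x)%R) <= ((a + b) `^ v)%:E)%E.
Proof.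
move=> v1 a0 b0 mf mg fa gb; have ab : 0 < a + b by rewrite addr_gt0.
have v0 : 0 < v by rewrite (lt_le_trans _ v1).
pose p := (a + b) `^ v * (a / (a + b)) / a `^ v.
pose q := (a + b) `^ v * (b / (a + b)) / b `^ v.
have p0 : 0 <= p by rewrite divr_ge0 ?powR_ge0 // mulr_ge0 ?powR_ge0 // divr_ge0 // ltW.
have q0 : 0 <= q by rewrite divr_ge0 ?powR_ge0 // mulr_ge0 ?powR_ge0 // divr_ge0 // ltW.
apply: (@le_trans _ _ (\int[mu]_x (p%:E * (`|f x| `^ v)%:E + q%:E * (`|g x| `^ v)%:E))%E).
  apply: ge0_le_integral => //.
  - exact: measurable_powf (measurable_funD mf mg).
  - by apply: emeasurable_funD; apply: measurable_funeM; exact: measurable_powf.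
  move=> x _; rewrite -!EFinM -EFinD lee_fin.
  have h := powR_convex2 v1 a0 b0 (normr_ge0 (f x)) (normr_ge0 (g x)).
  apply: le_trans (le_trans h _).
    by rewrite ge0_ler_powR ?nnegrE ?addr_ge0 ?ler_normD // ltW.
  by rewrite !powR_div // /p /q; apply: le_of_eq; ring.
have mf' := measurable_powf v mf; have mg' := measurable_powf v mg.
rewrite ge0_integralD //; first last.
- exact: measurable_funeM.
- by move=> x _; rewrite mule_ge0 ?lee_fin ?powR_ge0.
- exact: measurable_funeM.
- by move=> x _; rewrite mule_ge0 ?lee_fin ?powR_ge0.
rewrite !ge0_integralZl ?lee_fin //.
apply: (@le_trans _ _ (p%:E * (a `^ v)%:E + q%:E * (b `^ v)%:E)%E).
  by apply: leeD; rewrite lee_wpmul2l ?lee_fin.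
rewrite -!EFinM -EFinD lee_fin /p /q !divfK ?gt_eqF ?powR_gt0 //.
rewrite -mulrDr -mulrDl divff ?gt_eqF ?mulr1 //.
Qed.

Lemma pint1 (f : X -> R) : pint 1 f = (\int[mu]_x (`|f x|)%:E)%E.
Proof. by apply: eq_integral => x _; rewrite powRr1. Qed.

Lemma pint1_rint (f : X -> R) : measurable_fun setT f -> (pint 1 f < +oo)%E -> rint mu f.
Proof. by move=> mf; rewrite pint1 => h; apply/integrableP; split => //; exact/measurable_EFinP. Qed.
End pint.

Section minkowski_param.
Context d (T : measurableType d) d' (X : measurableType d') (R : realType).
Variables (nu : {sigma_finite_measure set T -> \bar R}) (mu : {sigma_finite_measure set X -> \bar R}).

(** [b t] bounds the norm of the slice at [t]. Weighted Jensen with weight [k b] is applied to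
    [|F| / b], followed by Tonelli; no duality is involved and [v = 1] is included. *)
Lemma minkowski_param (v M : R) (k b : T -> R) (F : T * X -> R) : 1 <= v -> 0 < M ->
  (forall t, 0 <= k t) -> (forall t, 0 < b t) -> measurable_fun setT b ->
  rint nu (fun t => k t * b t) -> \int[nu]_t (k t * b t) <= M ->
  measurable_fun setT k ->
  measurable_fun setT F -> (forall x, rint nu (fun t => k t * F (t, x))) ->
  (forall t, pint mu v (fun x => F (t, x)) <= (b t `^ v)%:E)%E ->
  (pint mu v (fun x => (\int[nu]_t (k t * F (t, x)))%R) <= (M `^ v)%:E)%E.
Proof.
move=> v1 M0 k0 b0 mb ikb kbM mk mF ikF pF.
have v0 : 0 < v by rewrite (lt_le_trans _ v1).
have mFx x : measurable_fun setT (fun t => F (t, x)).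
  exact: (measurableT_comp mF (measurable_pair2 x)).
pose W (z : X * T) := (k z.2 * b z.2 * (`|F (z.2, z.1)| / b z.2) `^ v)%:E.
have W0 z : (0 <= W z)%E.
  by rewrite lee_fin !mulr_ge0 ?powR_ge0 // ltW.
have mW : measurable_fun setT W.
  apply/measurable_EFinP; apply: measurable_funM.
    by apply: measurable_funM; [exact: (measurableT_comp mk)|exact: (measurableT_comp mb)].
  apply: (measurableT_comp (measurable_powR _)); apply: measurable_funM.
    apply: measurableT_comp => //; apply: (measurableT_comp mF).
    by apply: measurable_fun_pair.
  exact: (measurableT_comp (measurable_funV b0 mb)).
have step x : ((`|(\int[nu]_t (k t * F (t, x)))%R| `^ v)%:E <= (M `^ (v - 1))%:E * \int[nu]_t W (x, t))%E.
  have h0 t : 0 <= `|F (t, x)| / b t by rewrite divr_ge0 // ltW.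
  have mh : measurable_fun setT (fun t => `|F (t, x)| / b t).
    apply: measurable_funM; first exact: measurableT_comp.
    exact: measurable_funV.
  have E t : k t * b t * (`|F (t, x)| / b t) = `|k t * F (t, x)|.
    by rewrite normrM (ger0_norm (k0 t)); field; rewrite gt_eqF.
  have ir : rint nu (fun t => k t * b t * (`|F (t, x)| / b t)).
    by apply: eq_rint (rint_abs (ikF x)) => t; rewrite E.
  have := jensen_weight v1 M0 (fun t => mulr_ge0 (k0 t) (ltW (b0 t))) h0 ikb mh kbM ir.
  apply: le_trans; rewrite lee_fin; apply: ge0_ler_powR; rewrite ?nnegrE ?(ltW v0) //.
    by apply: Rintegral_ge0 => t _; rewrite E.
  by apply: le_trans (le_normr_Rintegral _ (ikF x)) _ => //; under [leRHS]eq_Rintegral do rewrite E.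
apply: (@le_trans _ _ (\int[mu]_x ((M `^ (v - 1))%:E * \int[nu]_t W (x, t)))%E).
  apply: ge0_le_integral => //.
  - apply/measurable_EFinP; apply: (measurableT_comp (measurable_powR _)).
    apply: measurableT_comp => //.
    apply: (@measurable_Rint_param _ X _ T R nu (fun z => k z.2 * F (z.2, z.1))).
    apply: measurable_funM; first exact: (measurableT_comp mk).
    by apply: (measurableT_comp mF); exact: measurable_fun_pair.
  - apply: measurable_funeM; exact: measurable_fun_fubini_tonelli_F.
rewrite ge0_integralZl //; first last.
- by rewrite lee_fin powR_ge0.
- by move=> x _; exact: integral_ge0.
- exact: measurable_fun_fubini_tonelli_F.
rewrite (@fubini_tonelli _ _ X T R mu nu W mW W0).
apply: (@le_trans _ _ ((M `^ (v - 1))%:E * \int[nu]_t (k t * b t)%:E)%E).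
  rewrite lee_wpmul2l ?lee_fin ?powR_ge0 //.
  apply: ge0_le_integral => //.
  - by move=> t _; exact: integral_ge0.
  - exact: measurable_fun_fubini_tonelli_G.
  - by apply/measurable_EFinP; exact: measurable_funM.
  move=> t _; rewrite /W /=.
  have E x : ((k t * b t * (`|F (t, x)| / b t) `^ v)%:E = (k t * b t / b t `^ v)%:E * (`|F (t, x)| `^ v)%:E)%E.
    rewrite -EFinM powRM ?invr_ge0 ?(ltW (b0 t)) // -powR_inv1 ?(ltW (b0 t)) // -powRrM mulrC mulN1r powRN.
    by congr (_%:E); ring.
  under eq_integral do rewrite E.
  have mFt : measurable_fun setT (fun x => (`|F (t, x)| `^ v)%:E).
    apply/measurable_EFinP; apply: (measurableT_comp (measurable_powR _)); apply: measurableT_comp => //.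
    exact: (measurableT_comp mF (measurable_pair1 t)).
  have c0 : 0 <= k t * b t / b t `^ v by rewrite divr_ge0 ?powR_ge0 // mulr_ge0 // ltW.
  rewrite ge0_integralZl ?lee_fin //.
  apply: (@le_trans _ _ ((k t * b t / b t `^ v)%:E * (b t `^ v)%:E)%E).
    by rewrite lee_wpmul2l ?lee_fin //; exact: pF.
  by rewrite -EFinM divfK // gt_eqF // powR_gt0.
have -> : (\int[nu]_t (k t * b t)%:E)%E = (\int[nu]_t (k t * b t))%:E.
  by rewrite fineK //; exact: integrable_fin_num ikb.
rewrite -EFinM lee_fin -(mulr_powRB1 (ltW M0) v0) mulrC.
by rewrite ler_wpM2r // powR_ge0.
Qed.
End minkowski_param.

(** * The heat semigroup in one coordinate *)

Section heat1.
Variables (R : realType) (K : finType).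
Local Notation E := (fspace R K).
Local Notation mu := (@mu_fspace R K).
Local Notation leb := (@lebesgue_measure R).
Local Notation RT := (measurableTypeR R).
Implicit Types (c : K) (B : E -> R).

Definition shc c (h : R) (x : E) : E := upd x c (x c + h).

Lemma measurable_shc_param d (T : measurableType d) c (h : T -> R) :
  measurable_fun setT h -> measurable_fun setT (fun z : T * E => shc c (h z.1) z.2).
Proof.
move=> mh; apply: measurable_fspace => k; rewrite /shc /upd; case: eqP => _.
  apply: measurable_funD; last exact: (measurableT_comp mh).
  exact: (measurableT_comp (measurable_coord c) measurable_snd).
exact: (measurableT_comp (measurable_coord k) measurable_snd).
Qed.

Lemma measurable_shc c h : measurable_fun setT (shc c h).
Proof.
apply: measurable_fspace => k; rewrite /shc /upd; case: eqP => _; last exact: measurable_coord.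
by apply: measurable_funD => //; exact: measurable_coord.
Qed.

Lemma shcP c h (f : E -> \bar R) : (forall x, 0 <= f x)%E -> measurable_fun setT f ->
  (\int[mu]_x f (shc c h x) = \int[mu]_x f x)%E.
Proof. by move=> f0 mf; exact: (@ge0_integ_shear R K c (fun=> h)). Qed.

Lemma shc0 c x : shc c 0 x = x.
Proof. by rewrite /shc addr0 upd_id. Qed.

Lemma shc_shc c h k x : shc c h (shc c k x) = shc c (k + h) x.
Proof. by rewrite /shc upd_upd /upd eqxx addrA. Qed.

Lemma pint_shc v c h B : measurable_fun setT B -> pint mu v (fun x => B (shc c h x)) = pint mu v B.
Proof.
move=> mB; rewrite /pint.
apply: (@shcP c h (fun x => (`|B x| `^ v)%:E)) => [x|]; first by rewrite lee_fin powR_ge0.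
exact: measurable_powf.
Qed.

Definition bounded B (S : R) := forall x, `|B x| <= S.

Lemma integral_gex1 : \int[leb]_z gex 1 z = 1.
Proof.
have p0 : (0 : R) < pi * 1 by rewrite mulr1 pi_gt0.
by rewrite /Rintegral /gex (integral_gauss p0) /= mulr1 divff ?sqrtr1 // gt_eqF // pi_gt0.
Qed.

Lemma gex_ge0 (b z : R) : 0 <= gex b z. Proof. exact: expR_ge0. Qed.
Lemma measurable_gex (b : R) : measurable_fun setT (gex b : RT -> R).
Proof. by apply: cont_meas; exact: gauss_cont. Qed.
Lemma rint_gex1 : rint leb (gex (1 : R)). Proof. exact: rint_gex. Qed.

(** Convolution in coordinate [c] with a Gaussian of width [a]: the one-variable heat semigroup at
    time [a^2 / (4 pi)], with symbol [exp(- pi a^2 y_c^2)]. *)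
Definition heat1 c (a : R) B : E -> R := fun x => \int[leb]_z (gex 1 z * B (shc c (a * z) x)).

Lemma measurable_shcz c a B : measurable_fun setT B ->
  measurable_fun setT (fun z : RT * E => B (shc c (a * z.1) z.2)).
Proof.
move=> mB; apply: (measurableT_comp mB).
by apply: (@measurable_shc_param _ RT c (fun z => a * z)); exact: measurable_funM.
Qed.

Lemma rint_bounded_mul d (T : measurableType d) (nu : {measure set T -> \bar R}) (k f : T -> R) (S : R) :
  rint nu k -> measurable_fun setT f -> (forall t, `|f t| <= S) -> rint nu (fun t => k t * f t).
Proof.
move=> ik mf fS; apply: rint_dom (rintZ S (rint_abs ik)).
  by apply: measurable_funM => //; exact: rint_meas ik.
by move=> t; rewrite normrM mulrC ler_wpM2r.
Qed.

Lemma rint_heat1 c a B S x : measurable_fun setT B -> bounded B S ->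
  rint leb (fun z => gex 1 z * B (shc c (a * z) x)).
Proof.
move=> mB BS; apply: rint_bounded_mul rint_gex1 _ _; last by move=> z; exact: BS.
exact: (measurableT_comp (measurable_shcz c a mB) (measurable_pair2 x)).
Qed.

Lemma measurable_heat1_param d (T : measurableType d) c (a : T -> R) (B : T * E -> R) :
  measurable_fun setT a -> measurable_fun setT B ->
  measurable_fun setT (fun z : T * E => heat1 c (a z.1) (fun x => B (z.1, x)) z.2).
Proof.
move=> ma mB.
apply: (@measurable_Rint_param _ (T * E)%type _ RT R leb (fun w => gex 1 w.2 * B (w.1.1, shc c (a w.1.1 * w.2) w.1.2))).
apply: measurable_funM.
  exact: (measurableT_comp (measurable_gex 1)).
apply: (measurableT_comp mB); apply: measurable_fun_pair.
  exact: (measurableT_comp measurable_fst measurable_fst).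
apply: measurable_fspace => k; rewrite /shc /upd; case: eqP => _; last first.
  exact: (measurableT_comp (measurable_coord k) (measurableT_comp measurable_snd measurable_fst)).
apply: measurable_funD.
  exact: (measurableT_comp (measurable_coord c) (measurableT_comp measurable_snd measurable_fst)).
by apply: measurable_funM => //; exact: (measurableT_comp ma (measurableT_comp measurable_fst measurable_fst)).
Qed.

Lemma measurable_heat1 c a B : measurable_fun setT B -> measurable_fun setT (heat1 c a B).
Proof.
move=> mB; have h := @measurable_heat1_param _ RT c (fun=> a) (fun z => B z.2) _ _.
have {}h := h (measurable_cst _) (measurableT_comp mB measurable_snd).
exact: (measurableT_comp h (measurable_pair1 (0 : RT))).
Qed.

Lemma bounded_heat1 c a B S : measurable_fun setT B -> bounded B S -> bounded (heat1 c a B) S.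
Proof.
move=> mB BS x; have S0 : 0 <= S by apply: le_trans (BS x).
have ir := rint_heat1 c a x mB BS.
apply: le_trans (le_normr_Rintegral _ ir) _ => //.
have e : \int[leb]_z (S * gex 1 z) = S by rewrite RintegralZl ?integral_gex1 ?mulr1 //; exact: rint_gex1.
rewrite -[leRHS]e; apply: le_Rintegral => //; [exact: rint_abs|exact: rintZ rint_gex1|].
by move=> z _; rewrite normrM (ger0_norm (gex_ge0 _ _)) mulrC ler_wpM2r ?gex_ge0 //; exact: BS.
Qed.

Lemma pint_heat1 v c a B S (b : R) : 1 <= v -> 0 < b -> measurable_fun setT B -> bounded B S ->
  (pint mu v B <= (b `^ v)%:E)%E -> (pint mu v (heat1 c a B) <= (b `^ v)%:E)%E.
Proof.
move=> v1 b0 mB BS pB; rewrite /heat1.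
apply: (@minkowski_param _ RT _ E R leb mu v b (gex 1) (fun=> b) (fun z => B (shc c (a * z.1) z.2)) v1 b0).
- exact: gex_ge0.
- by [].
- exact: measurable_cst.
- by apply: eq_rint (rintZ b rint_gex1) => z; rewrite mulrC.
- by rewrite RintegralZr ?integral_gex1 ?mul1r //; exact: rint_gex1.
- exact: measurable_gex.
- exact: measurable_shcz.
- by move=> x; exact: rint_heat1 mB BS.
- by move=> t; rewrite /= pint_shc.
Qed.

Lemma heat1B c a B G S S' x : measurable_fun setT B -> bounded B S -> measurable_fun setT G -> bounded G S' ->
  heat1 c a (fun y => B y - G y) x = heat1 c a B x - heat1 c a G x.
Proof.
move=> mB BS mG GS; rewrite /heat1 -RintegralB //; [|exact: rint_heat1 mB BS|exact: rint_heat1 mG GS].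
by apply: eq_Rintegral => z _; rewrite mulrBr.
Qed.

Lemma rint_heat1_int c a B S : measurable_fun setT B -> bounded B S -> rint mu B -> rint mu (heat1 c a B).
Proof.
move=> mB BS iB; apply: pint1_rint; first exact: measurable_heat1.
have /integrableP[_ /=] := iB; rewrite -pint1 => Boo.
have P0 : (0 <= pint mu 1 B)%E by apply: integral_ge0 => x _; rewrite lee_fin powR_ge0.
have F : pint mu 1 B \is a fin_num by rewrite ge0_fin_numE.
have b0 : 0 < fine (pint mu 1 B) + 1 by rewrite ltr_wpDl // fine_ge0.
apply: le_lt_trans (@pint_heat1 1 c a B S _ _ b0 mB BS _) _ => //; last exact: ltry.
by rewrite powRr1 ?(ltW b0) // EFinD fineK // leeDl // lee_fin.
Qed.

(** Real character. A variable phase covers cosine and sine at once, so Fourier symbols are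
    identified by real integrals. *)
Definition chr (y : E) (th : R) (x : E) : R := cos (2 * pi * dotp x y + th).

Lemma dotp_shc (y x : E) c h : dotp (shc c h x) y = dotp x y + h * y c.
Proof.
rewrite /dotp (bigD1 c) //= [in RHS](bigD1 c) //= /shc /upd eqxx.
rewrite (eq_bigr (fun i => x i * y i)); last by move=> i /negbTE ->.
ring.
Qed.

Lemma measurable_dotp (y : E) : measurable_fun setT (fun x : E => dotp x y).
Proof. by apply: measurable_sum => k; apply: measurable_funM => //; exact: measurable_coord. Qed.

Lemma measurable_chr y th : measurable_fun setT (chr y th).
Proof.
apply: measurable_cosf; apply: measurable_funD => //; apply: measurable_funM => //.
exact: measurable_dotp.
Qed.

Lemma chr_le1 y th x : `|chr y th x| <= 1.
Proof. by rewrite ler_norml cos_geN1 cos_le1. Qed.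

Lemma chr_shc y th c h x : chr y th (shc c h x) = chr y (th + 2 * pi * (h * y c)) x.
Proof. by rewrite /chr dotp_shc; congr cos; ring. Qed.

Lemma chrD y th s x : chr y (th + s) x = chr y th x * cos s + chr y (th + pi / 2) x * sin s.
Proof.
rewrite /chr !addrA cosD (cosD _ (pi / 2)) cos_pihalf sin_pihalf; ring.
Qed.

Lemma rint_chr B y th : rint mu B -> rint mu (fun x => B x * chr y th x).
Proof. by move=> iB; apply: (rint_bounded_mul (S := 1)) => //; [exact: measurable_chr|exact: chr_le1]. Qed.

Lemma two_pi_cancel (s z : R) : s * z = 0 * z ^+ 2 + s / (2 * pi) * (2 * pi * z).
Proof.
have p0 : (2 * pi : R) != 0 by rewrite gt_eqF // mulr_gt0 // pi_gt0.
by rewrite mul0r add0r mulrA divfK.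
Qed.

Lemma gex1_cos (s : R) : \int[leb]_z (gex 1 z * cos (s * z)) = expR (- (s ^+ 2 / (4 * pi))).
Proof.
have := @gauss_FT_cos R 1 0 ltr01 (s / (2 * pi)).
rewrite /gU /gV; under [in RHS]eq_Rintegral do rewrite mulr0 mul0r cos0 mulr1.
under [X in _ + X * _]eq_Rintegral do rewrite mulr0 mul0r sin0 mulr0.
rewrite integral_gex1 Rintegral_cst // mul0r mul0r addr0 !(mulr0, mul0r) cos0 !mulr1.
rewrite /gD expr1n expr0n /= addr0 divr1 => h.
transitivity (\int[leb]_x (gex 1 x * cos (0 * x ^+ 2 + s / (2 * pi) * (2 * pi * x)))).
  by apply: eq_Rintegral => z _; congr (_ * cos _); exact: two_pi_cancel.
rewrite h; congr (expR (- _)).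
have : (pi : R) != 0 by rewrite gt_eqF // pi_gt0.
by move: (pi : R) => q q0; field.
Qed.

Lemma gex1_sin (s : R) : \int[leb]_z (gex 1 z * sin (s * z)) = 0.
Proof.
have := @gauss_FT_sin R 1 0 ltr01 (s / (2 * pi)).
rewrite /gV; under [X in _ * (X * _ - _)]eq_Rintegral do rewrite mulr0 mul0r sin0 mulr0.
rewrite Rintegral_cst // !(mulr0, mul0r) sin0 mulr0 subr0 mulr0 => h.
rewrite -[RHS]h; apply: eq_Rintegral => z _; congr (_ * sin _); exact: two_pi_cancel.
Qed.

(** Fubini moves the Gaussian average onto the character, where translation only shifts the phase.
    The cosine part gives the symbol and the sine part vanishes because the Gaussian is even. *)
Lemma heat1_chr c a B S y th : measurable_fun setT B -> bounded B S -> rint mu B ->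
  \int[mu]_x (heat1 c a B x * chr y th x) =
  expR (- (pi * a ^+ 2 * y c ^+ 2)) * \int[mu]_x (B x * chr y th x).
Proof.
move=> mB BS iB.
pose F (w : E * RT) := gex 1 w.2 * (B (shc c (a * w.2) w.1) * chr y th w.1).
have mF : measurable_fun setT F.
  apply: measurable_funM; first exact: (measurableT_comp (measurable_gex 1)).
  apply: measurable_funM; last exact: (measurableT_comp (measurable_chr y th)).
  have sw : measurable_fun setT (fun w : E * RT => (w.2, w.1)) by exact: measurable_swap.
  exact: (measurableT_comp (measurable_shcz c a mB) sw).
have iz z : rint mu (fun x => F (x, z)).
  rewrite /F /=; apply: rintZ; apply: rint_chr.
  exact: (transfer_rint (@measurable_shc c (a * z)) (@shcP c (a * z))).
have ix x : rint leb (fun z => F (x, z)).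
  by apply: eq_rint (rintZ (chr y th x) (rint_heat1 c a x mB BS)) => z; rewrite /F /=; ring.
have iF : rint (mu \x leb)%E F.
  apply: rint_prod; first exact: mF.
  have mEF : measurable_fun setT (fun w : E * RT => (`|F w|)%:E) by apply/measurable_EFinP; exact: measurableT_comp.
  rewrite (@fubini_tonelli _ _ E RT R mu leb (fun w => (`|F w|)%:E)) //=.
  apply: (@le_lt_trans _ _ (\int[leb]_z ((gex 1 z)%:E * pint mu 1 B))%E).
    apply: ge0_le_integral => //.
    - by move=> z _; apply: integral_ge0.
    - exact: (@measurable_fun_fubini_tonelli_G _ _ E RT R mu (fun w => (`|F w|)%:E)).
    - apply: emeasurable_funM => //; apply/measurable_EFinP; exact: measurable_gex.
    move=> z _; rewrite -(pint_shc 1 c (a * z) mB) pint1 -ge0_integralZl ?lee_fin ?gex_ge0 //; last first.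
      by apply/measurable_EFinP; apply: measurableT_comp => //; exact: (measurableT_comp mB (@measurable_shc c _)).
    apply: ge0_le_integral => //.
    - exact: (measurableT_comp mEF (measurable_pair2 z)).
    - apply: measurable_funeM; apply/measurable_EFinP; apply: measurableT_comp => //.
      exact: (measurableT_comp mB (@measurable_shc c _)).
    move=> x _; rewrite -EFinM lee_fin /F /= !normrM (ger0_norm (gex_ge0 _ _)).
    by rewrite ler_wpM2l ?gex_ge0 // ler_piMr // chr_le1.
  rewrite ge0_integralZr //.
  - rewrite lte_mul_pinfty //.
    + by apply: integral_ge0 => z _; rewrite lee_fin gex_ge0.
    + exact: integrable_fin_num rint_gex1.
    + by rewrite pint1; have /integrableP[] := iB.
  - by apply/measurable_EFinP; exact: measurable_gex.
  - by move=> z _; rewrite lee_fin gex_ge0.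
  - by apply: integral_ge0 => x _; rewrite lee_fin powR_ge0.
transitivity (\int[mu]_x (\int[leb]_z F (x, z))).
  apply: eq_Rintegral => x _; rewrite /heat1 -RintegralZr //; last exact: rint_heat1 mB BS.
  by apply: eq_Rintegral => z _; rewrite /F /=; ring.
rewrite (Rintegral_fubini iF ix iz).
set I0 := \int[mu]_x (B x * chr y th x).
pose J0 := \int[mu]_x (B x * chr y (th + pi / 2) x).
pose s := - (2 * pi * a * y c).
have inner z : \int[mu]_x F (x, z) = gex 1 z * (cos (s * z) * I0 + sin (s * z) * J0).
  rewrite /F /= RintegralZl //; last by apply: rint_chr; exact: (transfer_rint (@measurable_shc c (a * z)) (@shcP c (a * z))).
  congr (_ * _).
  have := @transfer_Rintegral _ _ _ _ R mu mu (shc c (a * z)) (@shcP c (a * z))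
     (fun x => B x * chr y th (shc c (- (a * z)) x)).
  rewrite (_ : (fun x => B (shc c (a * z) x) * _) = fun x => B (shc c (a * z) x) * chr y th x); last first.
    by apply/funext => x; rewrite shc_shc subrr shc0.
  move=> ->; last first.
    by apply: measurable_funM => //; exact: (measurableT_comp (measurable_chr y th) (@measurable_shc c _)).
  rewrite /I0 /J0 -!RintegralZl ?(rint_chr) //; [|exact: rint_chr|exact: rint_chr].
  rewrite -RintegralD //; [|by apply: rintZ; exact: rint_chr|by apply: rintZ; exact: rint_chr].
  apply: eq_Rintegral => x _; rewrite chr_shc chrD.
  by rewrite (_ : 2 * pi * (- (a * z) * y c) = s * z); [ring|rewrite /s; ring].
under eq_Rintegral do rewrite inner.
have ic : rint leb (fun z => gex 1 z * cos (s * z)).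
  apply: rint_cos; [exact: rint_gex1|exact: measurable_funM].
have is' : rint leb (fun z => gex 1 z * sin (s * z)).
  apply: rint_sin; [exact: rint_gex1|exact: measurable_funM].
rewrite (_ : (fun z => _) = fun z => I0 * (gex 1 z * cos (s * z)) + J0 * (gex 1 z * sin (s * z))); last first.
  by apply/funext => z; ring.
rewrite RintegralD ?RintegralZl //; [|exact: rintZ|exact: rintZ].
rewrite gex1_cos gex1_sin mulr0 addr0 mulrC; congr (expR (- _) * _).
rewrite /s; have : (pi : R) != 0 by rewrite gt_eqF // pi_gt0.
by move: (pi : R) => q q0; field.
Qed.
End heat1.

(** * Functions with bounded coordinate derivatives *)

Section smooth.
Variables (R : realType) (K : finType).
Local Notation E := (fspace R K).
Local Notation leb := (@lebesgue_measure R).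
Local Notation RT := (measurableTypeR R).
Implicit Types (c : K) (f : E -> R).

Definition sder f := forall (s : seq K) c (x : E), derivable (fun t => dpart s f (upd x c t)) (x c) 1.
Definition sbdd f := sder f /\ forall s : seq K, exists M, bounded (dpart s f) M.

Lemma dpart_cat (s t : seq K) f : dpart (s ++ t) f = dpart s (dpart t f).
Proof. by elim: s => //= c s ->. Qed.

Lemma sder_dpart s f : sder f -> sder (dpart s f).
Proof. by move=> h t c x; rewrite -dpart_cat; exact: h. Qed.

Lemma sbdd_dpart s f : sbdd f -> sbdd (dpart s f).
Proof. by move=> [h1 h2]; split; [exact: sder_dpart|move=> t; rewrite -dpart_cat]. Qed.

Lemma pderivE c f x t : pderiv c f (upd x c t) = derive1 (fun t => f (upd x c t)) t.
Proof.
rewrite /pderiv (_ : upd x c t c = t); last by rewrite /upd eqxx.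
by congr (derive1 _ t); apply/funext => t0; rewrite upd_upd.
Qed.

Lemma sder_upd f s c x (t : R) : sder f ->
  is_derive t 1 (fun t => dpart s f (upd x c t)) (dpart (c :: s) f (upd x c t)).
Proof.
move=> h; have := h s c (upd x c t); rewrite {3}/upd eqxx.
rewrite (_ : (fun t0 => _) = fun t0 => dpart s f (upd x c t0)); last first.
  by apply/funext => t0; rewrite upd_upd.
move=> dt; apply: DeriveDef => //=.
by rewrite pderivE derive1E.
Qed.

Lemma sder_shc f s c x (h r : R) : sder f ->
  is_derive r 1 (fun r => dpart s f (shc c (r * h) x)) (h * dpart (c :: s) f (shc c (r * h) x)).
Proof.
move=> sf; rewrite mulrC.
apply: (@der_comp R r (fun r => x c + r * h) (fun t => dpart s f (upd x c t))).
  exact: sder_upd.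
by apply: der_eq (derD (der_cst _ _) (derM (der_id _) (der_cst _ _))) _; ring.
Qed.

Lemma sder_lip f s c x h M : sder f -> bounded (dpart (c :: s) f) M ->
  `|dpart s f (shc c h x) - dpart s f x| <= M * `|h|.
Proof.
move=> sf bM; pose g r := dpart s f (shc c (r * h) x).
have dg (r : R) := sder_shc s c x h r sf.
have dg' (r : R) : r \in `]0, 1[ -> is_derive r 1 g (h * dpart (c :: s) f (shc c (r * h) x)).
  by move=> _; exact: dg.
have [r _] := MVT ltr01 dg' (continuous_subspaceT (derive_cont dg)).
rewrite /g mul1r mul0r shc0 subr0 mulr1 => ->.
by rewrite normrM mulrC ler_wpM2r //; exact: bM.
Qed.

Lemma lip_all f M x y : sder f -> (forall c, bounded (dpart [:: c] f) M) ->
  `|f x - f y| <= M * \sum_k `|x k - y k|.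
Proof.
move=> sf bM.
suff P (s : seq K) : forall x : E, (forall k, k \notin s -> x k = y k) -> uniq s ->
    `|f x - f y| <= M * \sum_(k <- s) `|x k - y k|.
  by have := P (enum K) x _ (enum_uniq K); rewrite big_enum; apply => k; rewrite mem_enum.
elim: s => [|c s IH] {}x xy us.
  by rewrite big_nil mulr0 (_ : x = y) ?subrr ?normr0 //; apply/funext => k; exact: xy.
have /andP[cs us'] : (c \notin s) && uniq s := us.
pose z : E := shc c (y c - x c) x.
have zE : z = upd x c (y c) by rewrite /z /shc addrC subrK.
have M1 : `|f z - f x| <= M * `|x c - y c|.
  by rewrite distrC [`|x c - _|]distrC; have := @sder_lip f [::] c x (y c - x c) M sf (bM c); rewrite distrC.
have M2 : `|f z - f y| <= M * \sum_(k <- s) `|z k - y k|.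
  apply: IH => // k ks; rewrite zE /upd; case: eqP => [->//|/eqP kc].
  by apply: xy; rewrite inE negb_or kc.
have -> : f x - f y = - (f z - f x) + (f z - f y) by ring.
apply: le_trans (ler_normD _ _) _; rewrite normrN big_cons mulrDr; apply: lerD => //.
apply: (le_trans M2); apply: le_of_eq; congr (_ * _).
apply: eq_big_seq => k ks; rewrite zE /upd; case: eqP => // kc; by rewrite -kc ks in cs.
Qed.

Lemma sbdd_lip f : sbdd f -> exists M, forall x y, `|f x - f y| <= M * \sum_k `|x k - y k|.
Proof.
move=> [sf bf]; have [M hM] := choice (fun c => bf [:: c]).
exists (\sum_c `|M c|) => x y; apply: lip_all => // c z.
apply: le_trans (hM c z) _; rewrite (bigD1 c) //= (le_trans (ler_norm _)) // lerDl.
by rewrite sumr_ge0.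
Qed.

(** Rounding down to the grid of mesh [1 / (n + 1)]. Any function composed with it is constant on
    each of countably many coordinate boxes, hence measurable for the cylinder sigma-algebra. *)
Definition rnd (n : nat) (x : E) : E := fun k => (Num.floor (x k * n.+1%:R))%:~R / n.+1%:R.

Lemma rnd_le n (x : E) k : `|rnd n x k - x k| <= n.+1%:R^-1.
Proof.
have /andP[h1 h2] := floor_itv (x k * n.+1%:R).
rewrite /rnd; set j := (Num.floor _)%:~R in h1 *.
rewrite distrC ger0_norm; last by rewrite subr_ge0 ler_pdivrMr.
rewrite lerBlDr -[X in X + _]mul1r -mulrDl ler_pdivlMr // [1 + _]addrC; move: h2; rewrite intrD; exact: ltW.
Qed.

Lemma measurable_rnd n (f : E -> R) : measurable_fun setT (fun x => f (rnd n x)).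
Proof.
move=> _ Y mY; rewrite setTI.
pose q (j : {ffun K -> int}) : E := fun k => (j k)%:~R / n.+1%:R.
pose A (j : {ffun K -> int}) : set E :=
  [set x | f (q j) \in Y] `&` [set x | forall k, Num.floor (x k * n.+1%:R) = j k].
rewrite (_ : _ @^-1` _ = \bigcup_j A j); last first.
  apply/seteqP; split => [x /= fx|x /= [j _ [/= ]]].
    exists [ffun k => Num.floor (x k * n.+1%:R)] => //; split => /=; last by move=> k; rewrite ffunE.
    rewrite inE (_ : q _ = rnd n x) //; apply/funext => k; by rewrite /q ffunE.
  rewrite inE => fj xj; rewrite (_ : rnd n x = q j) //.
  by apply/funext => k; rewrite /rnd xj.
apply: countable_bigcupT_measurable; first exact: countableP.
move=> j; apply: measurableI.
  case: (boolP (f (q j) \in Y)) => h.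
    rewrite (_ : [set x | _] = setT) //; exact/seteqP.
  by rewrite (_ : [set x | _] = set0) //; apply/seteqP; split => x //=; rewrite /= (negbTE h).
rewrite (_ : [set x | _] = \bigcap_(k in [set: K]) ((fun x : E => x k) @^-1` [set t | Num.floor (t * n.+1%:R) = j k])); last first.
  by apply/seteqP; split => x /= h k; [move=> _; exact: h|exact: (h k I)].
apply: fin_bigcap_measurable => // k _.
rewrite (_ : [set t | _] = `[(j k)%:~R / n.+1%:R, ((j k + 1)%:~R / n.+1%:R)[%classic); last first.
  apply/seteqP; split => t /=; rewrite in_itv /= ler_pdivrMr // ltr_pdivlMr //.
    by move=> <-; exact: floor_itv.
  by move=> h; exact: floor_def.
rewrite -[X in measurable X]setTI; exact: measurable_coord.
Qed.

(** Bounded first derivatives make [f] Lipschitz, so its values at rounded points converge to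
    [f]. *)
Lemma sbdd_meas f : sbdd f -> measurable_fun setT f.
Proof.
move=> /sbdd_lip[M fM].
apply: (@measurable_fun_cvg _ E R setT (fun n x => f (rnd n x))); first by move=> n; exact: measurable_rnd.
move=> x _; rewrite (_ : (fun n => _) = fun n => f x + (f (rnd n x) - f x)); last first.
  by apply/funext => n; rewrite addrC subrK.
suff h : (f x + (f (rnd n x) - f x)) @[n --> \oo] --> f x + 0 by rewrite addr0 in h.
apply: cvgD; first exact: cvg_cst.
apply: norm_cvg0; apply: (@squeeze_cvgr _ _ _ _ (fun=> 0) (fun n : nat => `|M| * #|K|%:R * n.+1%:R^-1)); first last.
- by rewrite -(mulr0 (`|M| * #|K|%:R)); apply: cvgMr; exact: cvg_harmonic.
- exact: cvg_cst.
apply: nearW => n; rewrite normr_ge0 /=; apply: le_trans (fM _ _) _.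
have S0 : 0 <= \sum_k `|rnd n x k - x k| by rewrite sumr_ge0.
apply: le_trans (ler_wpM2r S0 (ler_norm M)) _.
rewrite -mulrA ler_wpM2l // -[#|K|]sum1_card natr_sum mulr_suml.
by apply: ler_sum => k _; rewrite mul1r rnd_le.
Qed.

(** Peano kernel of the second order Taylor remainder. *)
Definition kap (r : R) : R := (1 - r) * \1_(`[0, 1]%classic) r.

Lemma kap_ge0 r : 0 <= kap r.
Proof.
rewrite /kap indicE; case: (boolP (r \in _)) => h; rewrite ?mulr0 ?mulr1 //.
by move: h; rewrite inE /= in_itv /= => /andP[_ h]; rewrite subr_ge0.
Qed.

Lemma measurable_kap : measurable_fun setT (kap : RT -> R).
Proof.
apply: measurable_funM; first by apply: measurable_funB.
exact: measurable_indic.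
Qed.

Lemma integral_01 : (\int[leb]_r (\1_(`[0%R, 1%R]%classic : set RT) r)%:E = 1)%E.
Proof.
rewrite integral_indic // setIT.
have h := @lebesgue_measure_itv R `[0%R, 1%R].
by rewrite /= lte_fin ltr01 oppr0 adde0 in h.
Qed.

Lemma rint_01 : rint leb (fun r => \1_(`[0, 1]%classic) r : R).
Proof.
apply/integrableP; split; first by apply/measurable_EFinP; exact: measurable_indic.
rewrite (eq_integral (fun r : RT => (\1_(`[0, 1]%classic : set RT) r)%:E)); first by rewrite integral_01 ltry.
by move=> r _ /=; rewrite ger0_norm.
Qed.

Lemma kap_le r : kap r <= \1_(`[0, 1]%classic) r.
Proof.
rewrite /kap indicE; case: (boolP (r \in _)) => h; rewrite ?mulr0 ?mulr1 //.
by move: h; rewrite inE /= in_itv /= => /andP[h _]; rewrite gerBl.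
Qed.

Lemma rint_kap : rint leb kap.
Proof.
apply: rint_dom rint_01; first exact: measurable_kap.
by move=> r; rewrite ger0_norm ?kap_ge0 // kap_le.
Qed.

Lemma integral_kap_le1 : \int[leb]_r kap r <= 1.
Proof.
apply: (@le_trans _ _ (\int[leb]_r (\1_(`[0, 1]%classic) r : R))).
  by apply: le_Rintegral => //; [exact: rint_kap|exact: rint_01|move=> r _; exact: kap_le].
by rewrite /Rintegral integral_01.
Qed.

(** The remainder is kept as an average of translated second derivatives, so that Minkowski's
    inequality bounds it in every [L^v]. *)
Lemma taylor2 f c x h : sbdd f ->
  f (shc c h x) - f x - h * dpart [:: c] f x =
  h ^+ 2 * \int[leb]_r (kap r * dpart [:: c; c] f (shc c (r * h) x)).
Proof.
move=> [sf bf].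
pose G (r : R) := f (shc c (r * h) x) + (1 - r) * (h * dpart [:: c] f (shc c (r * h) x)).
pose g (r : R) := (1 - r) * (h ^+ 2 * dpart [:: c; c] f (shc c (r * h) x)).
have dG (r : R) : is_derive r 1 G (g r).
  apply: der_eq (derD (@sder_shc f [::] c x h r sf) (derM (derB (der_cst _ _) (der_id _))
    (derM (der_cst _ _) (@sder_shc f [:: c] c x h r sf)))) _.
  by rewrite /g; ring.
have cg : continuous g.
  have dg (r : R) : is_derive r 1 g ((0 - 1) * (h ^+ 2 * dpart [:: c; c] f (shc c (r * h) x)) +
      (1 - r) * (0 * dpart [:: c; c] f (shc c (r * h) x) + h ^+ 2 * (h * dpart [:: c; c; c] f (shc c (r * h) x)))).
    exact: (derM (derB (der_cst _ _) (der_id _)) (derM (der_cst _ _) (@sder_shc f [:: c; c] c x h r sf))).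
  exact: derive_cont dg.
have := @continuous_FTC2 R g G 0 1 ltr01.
rewrite [G 1]/G [G 0]/G !mul1r subrr mul0r addr0 mul0r shc0 subr0 mul1r => FT.
have {}FT : (\int[leb]_(r in `[0%R, 1%R]) (g r)%:E = (f (shc c h x) - f x - h * dpart [:: c] f x)%:E)%E.
  rewrite FT.
  - by rewrite -EFinB opprD addrA.
  - exact: continuous_subspaceT.
  - have cG := derive_cont dG.
    split; [by move=> r _; exact: der_ex (dG r)|exact: cvg_at_right_filter (cG _)|exact: cvg_at_left_filter (cG _)].
  - by move=> r _; exact: der_val (dG r).
have <- : fine (\int[leb]_(r in `[0%R, 1%R]) (g r)%:E) = f (shc c h x) - f x - h * dpart [:: c] f x by rewrite FT.
rewrite -RintegralZl //; last first.
  have [M bM] := bf [:: c; c].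
  apply: rint_bounded_mul rint_kap _ (fun r => bM _).
  have mD : measurable_fun setT (dpart [:: c; c] f : E -> R) by apply: sbdd_meas; exact: sbdd_dpart.
  apply: (measurableT_comp mD); apply: (@measurable_fspace R K _ RT) => k; rewrite /shc /upd; case: eqP => _.
    by apply: measurable_funD => //; exact: measurable_funM.
  exact: measurable_cst.
rewrite integral_mkcond; congr fine; apply: eq_integral => r _; rewrite patchE /kap indicE /g.
by case: ifP => _; congr EFin; rewrite /= ?mulr1 ?mulr0 ?mul0r ?mulr0 //; ring.
Qed.
End smooth.

(** * Second order estimates for the heat semigroup *)

Section heat_diff.
Variables (R : realType) (K : finType).
Local Notation E := (fspace R K).
Local Notation mu := (@mu_fspace R K).
Local Notation leb := (@lebesgue_measure R).
Local Notation RT := (measurableTypeR R).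
Implicit Types (c : K) (B : E -> R).

Lemma Rintegral_opp (f : RT -> R) : measurable_fun setT f ->
  \int[leb]_x f (- x) = \int[leb]_x f x.
Proof.
move=> mf; apply: (@transfer_Rintegral _ RT _ RT R leb leb (fun x => - x)) => // g g0 mg.
exact: ge0_integral_opp.
Qed.

Lemma Rintegral_shift (h : R) (f : RT -> R) : measurable_fun setT f ->
  \int[leb]_x f (x + h) = \int[leb]_x f x.
Proof.
move=> mf; apply: (@transfer_Rintegral _ RT _ RT R leb leb (fun x => x + h)) => // g g0 mg.
exact: ge0_integral_shift.
Qed.

Lemma rint_shift (h : R) (f : RT -> R) : rint leb f -> rint leb (fun x => f (x + h)).
Proof.
apply: (@transfer_rint _ RT _ RT R leb leb (fun x => x + h)); first exact: measurable_funD.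
by move=> g g0 mg; exact: ge0_integral_shift.
Qed.

Lemma rint_gex1k k : (k <= 2)%N -> rint leb (fun z => gex (1 : R) z * z ^+ k).
Proof. by move=> k2; exact: rint_gex_poly. Qed.

Lemma gex1_z : \int[leb]_z (gex (1 : R) z * z) = 0.
Proof.
have mf : measurable_fun setT (fun z : RT => gex (1 : R) z * z).
  by apply: measurable_funM => //; exact: measurable_gex.
have := Rintegral_opp mf.
have -> : \int[leb]_z (gex (1 : R) (- z) * - z) = - \int[leb]_z (gex (1 : R) z * z).
  rewrite -[RHS]mulN1r -RintegralZl //; last exact: (@rint_gex1k 1).
  by apply: eq_Rintegral => z _; rewrite /gex sqrrN; ring.
set I := (\int[leb]_z _); lra.
Qed.

(** Second moment of the Gaussian, enlarged by 1 so that positivity is immediate. *)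
Definition m2 : R := \int[leb]_z (gex (1 : R) z * z ^+ 2) + 1.

Lemma m2_gt0 : 0 < m2.
Proof. by rewrite ltr_wpDl // Rintegral_ge0 // => z _; rewrite mulr_ge0 ?gex_ge0 // sqr_ge0. Qed.

(** Second order Taylor remainder in direction [c] divided by [h^2]. *)
Definition QQ c B (h : R) (x : E) := \int[leb]_r (kap r * dpart [:: c; c] B (shc c (r * h) x)).

Lemma measurable_dcc c B : sbdd B -> measurable_fun setT (dpart [:: c; c] B : E -> R).
Proof. by move=> sB; apply: sbdd_meas; exact: sbdd_dpart. Qed.

Lemma measurable_shc_ax (a : R) c B : measurable_fun setT B ->
  measurable_fun setT (fun z : RT * E => B (shc c (z.1 * a) z.2)).
Proof.
move=> mB; apply: eq_measurable_fun (measurable_shcz c a mB) => z _.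
by rewrite mulrC.
Qed.

Lemma rint_kap_mul c B (S h : R) x : sbdd B -> bounded (dpart [:: c; c] B) S ->
  rint leb (fun r => kap r * dpart [:: c; c] B (shc c (r * h) x)).
Proof.
move=> sB bS; apply: rint_bounded_mul (rint_kap R) _ (fun r => bS _).
exact: (measurableT_comp (measurable_shc_ax h c (measurable_dcc c sB)) (measurable_pair2 x)).
Qed.

Lemma bounded_QQ c B (S h : R) x : sbdd B -> bounded (dpart [:: c; c] B) S -> `|QQ c B h x| <= S.
Proof.
move=> sB bS; have S0 : 0 <= S by apply: le_trans (bS x).
have ir := rint_kap_mul h x sB bS.
apply: le_trans (le_normr_Rintegral _ ir) _ => //.
apply: (@le_trans _ _ (\int[leb]_r (S * kap r))).
  apply: le_Rintegral => //; [exact: rint_abs|exact: rintZ (rint_kap R)|].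
  by move=> z _; rewrite normrM (ger0_norm (kap_ge0 _)) mulrC ler_wpM2r ?kap_ge0 //; exact: bS.
rewrite RintegralZl //; last exact: rint_kap.
by rewrite ler_piMr // integral_kap_le1.
Qed.

Lemma measurable_QQ c B : sbdd B -> measurable_fun setT (fun z : RT * E => QQ c B z.1 z.2).
Proof.
move=> sB.
apply: (@measurable_Rint_param _ (RT * E)%type _ RT R leb
  (fun w => kap w.2 * dpart [:: c; c] B (shc c (w.2 * w.1.1) w.1.2))).
apply: measurable_funM; first exact: (measurableT_comp (@measurable_kap R) measurable_snd).
apply: (measurableT_comp (measurable_dcc c sB)).
apply: measurable_fspace => k; rewrite /shc /upd; case: eqP => _; last first.
  exact: (measurableT_comp (measurable_coord k) (measurableT_comp measurable_snd measurable_fst)).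
apply: measurable_funD.
  exact: (measurableT_comp (measurable_coord c) (measurableT_comp measurable_snd measurable_fst)).
by apply: measurable_funM => //; exact: (measurableT_comp measurable_fst measurable_fst).
Qed.

Lemma pint_QQ v c B (S h b : R) : 1 <= v -> 0 < b -> sbdd B -> bounded (dpart [:: c; c] B) S ->
  (pint mu v (dpart [:: c; c] B) <= (b `^ v)%:E)%E -> (pint mu v (QQ c B h) <= (b `^ v)%:E)%E.
Proof.
move=> v1 b0 sB bS pB; rewrite /QQ.
apply: (@minkowski_param _ RT _ E R leb mu v b (@kap R) (fun=> b)
  (fun z => dpart [:: c; c] B (shc c (z.1 * h) z.2)) v1 b0).
- exact: kap_ge0.
- by [].
- exact: measurable_cst.
- by apply: eq_rint (rintZ b (rint_kap R)) => z; rewrite mulrC.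
- rewrite RintegralZr //; last exact: rint_kap.
  by rewrite ler_piMl ?integral_kap_le1 // ltW.
- exact: measurable_kap.
- by apply: measurable_shc_ax; exact: measurable_dcc.
- by move=> x; exact: rint_kap_mul sB bS.
- by move=> t /=; rewrite (pint_shc v c _ (measurable_dcc c sB)).
Qed.

Lemma measurable_QQz c B a : sbdd B -> measurable_fun setT (fun z : RT * E => QQ c B (a * z.1) z.2).
Proof.
move=> sB; apply: (measurableT_comp (f := fun z : RT * E => QQ c B z.1 z.2) (measurable_QQ c sB) (g := fun z : RT * E => (a * z.1, z.2) : RT * E)).
apply: measurable_fun_pair => //; exact: measurable_funM.
Qed.

Lemma rint_gQQ c B (S a : R) x : sbdd B -> bounded (dpart [:: c; c] B) S ->
  rint leb (fun z => gex 1 z * z ^+ 2 * QQ c B (a * z) x).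
Proof.
move=> sB bS; apply: rint_bounded_mul (rint_gex1k (leqnn 2)) _ (fun z => bounded_QQ _ _ sB bS).
exact: (measurableT_comp (measurable_QQz c a sB) (measurable_pair2 x)).
Qed.

(** The first order Taylor term integrates to 0 against the even Gaussian, which leaves the factor
    [a^2]. *)
Lemma heat1_sub c B (S S2 a : R) x : sbdd B -> bounded B S -> bounded (dpart [:: c; c] B) S2 ->
  heat1 c a B x - B x = a ^+ 2 * \int[leb]_z (gex 1 z * z ^+ 2 * QQ c B (a * z) x).
Proof.
move=> sB bS bS2; have ir := rint_gQQ a x sB bS2.
rewrite /heat1 (_ : \int[leb]_z (gex 1 z * B (shc c (a * z) x)) =
  \int[leb]_z ((B x * gex 1 z + a * dpart [:: c] B x * (gex 1 z * z)) + a ^+ 2 * (gex 1 z * z ^+ 2 * QQ c B (a * z) x))); last first.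
  apply: eq_Rintegral => z _; rewrite (_ : B (shc c (a * z) x) = B x + a * z * dpart [:: c] B x + (a * z) ^+ 2 * QQ c B (a * z) x); first ring.
  by rewrite -taylor2 //; ring.
have i1 : rint leb (fun z => B x * gex 1 z) by apply: rintZ; exact: rint_gex1.
have i2 : rint leb (fun z => a * dpart [:: c] B x * (gex 1 z * z)) by apply: rintZ; exact: (@rint_gex1k 1).
rewrite RintegralD //; [|exact: rintD|exact: rintZ].
rewrite RintegralD // !RintegralZl //; [|exact: (@rint_gex1k 1)|exact: rint_gex1].
by rewrite integral_gex1 gex1_z mulr1 mulr0 addr0 addrC addKr.
Qed.

Lemma heat1_sub_bd c B (S S2 a : R) x : sbdd B -> bounded B S -> bounded (dpart [:: c; c] B) S2 ->
  `|heat1 c a B x - B x| <= a ^+ 2 * (m2 * S2).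
Proof.
move=> sB bS bS2; have S0 : 0 <= S2 by apply: le_trans (bS2 x).
rewrite (heat1_sub a x sB bS bS2) normrM ger0_norm ?sqr_ge0 // ler_wpM2l ?sqr_ge0 //.
have ir := rint_gQQ a x sB bS2.
apply: le_trans (le_normr_Rintegral _ ir) _ => //.
apply: (@le_trans _ _ (\int[leb]_z (S2 * (gex 1 z * z ^+ 2)))).
  apply: le_Rintegral => //; [exact: rint_abs|by apply: rintZ; exact: rint_gex1k|].
  move=> z _; have k0 : 0 <= gex 1 z * z ^+ 2 by rewrite mulr_ge0 ?gex_ge0 ?sqr_ge0.
  by rewrite normrM (ger0_norm k0) mulrC ler_wpM2r //; exact: bounded_QQ bS2.
rewrite RintegralZl //; last exact: rint_gex1k.
by rewrite mulrC ler_wpM2r // lerDl.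
Qed.

Lemma heat1_sub_pint v c B (S S2 a b : R) : 1 <= v -> 0 < b -> sbdd B -> bounded B S ->
  bounded (dpart [:: c; c] B) S2 -> (pint mu v (dpart [:: c; c] B) <= (b `^ v)%:E)%E ->
  (pint mu v (fun x => (heat1 c a B x - B x)%R) <= ((a ^+ 2 * (m2 * b)) `^ v)%:E)%E.
Proof.
move=> v1 b0 sB bS bS2 pB.
have v0 : 0 <= v by rewrite (le_trans _ v1).
have M0 : 0 < m2 * b by rewrite mulr_gt0 // m2_gt0.
rewrite (_ : (fun x => _) = fun x => a ^+ 2 * \int[leb]_z (gex 1 z * z ^+ 2 * QQ c B (a * z) x)); last first.
  by apply/funext => x; exact: heat1_sub bS2.
apply: pintZ => //; [exact: sqr_ge0|exact: ltW| |].
  apply: (@measurable_Rint_param _ E _ RT R leb (fun w => gex 1 w.2 * w.2 ^+ 2 * QQ c B (a * w.2) w.1)).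
  apply: measurable_funM.
    apply: measurable_funM; first exact: (measurableT_comp (measurable_gex 1)).
    exact: (measurableT_comp (f := fun z : RT => z ^+ 2) _ measurable_snd).
  exact: (measurableT_comp (measurable_QQz c a sB) (@measurable_swap _ _ E RT)).
have ig := rint_gex1k (leqnn 2).
apply: (@minkowski_param _ RT _ E R leb mu v (m2 * b) (fun z => gex 1 z * z ^+ 2) (fun=> b)
  (fun z => QQ c B (a * z.1) z.2) v1 M0).
- by move=> z; rewrite mulr_ge0 ?gex_ge0 ?sqr_ge0.
- by [].
- exact: measurable_cst.
- by apply: eq_rint (rintZ b ig) => z; rewrite mulrC.
- by rewrite RintegralZr // ler_wpM2r ?(ltW b0) // lerDl.
- exact: rint_meas ig.
- exact: measurable_QQz.
- by move=> x; exact: rint_gQQ bS2.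
- by move=> t /=; exact: pint_QQ bS2 _.
Qed.

(** Over [enum K] this is the heat semigroup in all variables, built one coordinate at a time. *)
Definition heatl (cs : seq K) (a : R) B : E -> R := foldr (fun c G => heat1 c a G) B cs.

Section heatl_basic.
Variables (B : E -> R) (S : R).
Hypotheses (mB : measurable_fun setT B) (bS : bounded B S).

Lemma measurable_heatl cs a : measurable_fun setT (heatl cs a B).
Proof. by elim: cs => //= c cs IH; exact: measurable_heat1. Qed.

Lemma bounded_heatl cs a : bounded (heatl cs a B) S.
Proof. by elim: cs => //= c cs IH; apply: bounded_heat1 IH; exact: measurable_heatl. Qed.

Lemma rint_heatl cs a : rint mu B -> rint mu (heatl cs a B).
Proof.
move=> iB; elim: cs => //= c cs IH; apply: (@rint_heat1_int R K c a _ S) IH.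
  exact: measurable_heatl.
exact: bounded_heatl.
Qed.

Lemma pint_heatl v b cs a : 1 <= v -> 0 < b -> (pint mu v B <= (b `^ v)%:E)%E ->
  (pint mu v (heatl cs a B) <= (b `^ v)%:E)%E.
Proof.
move=> v1 b0 pB; elim: cs => [|c cs IH] /=; first exact: pB.
exact: pint_heat1 v1 b0 (measurable_heatl cs a) (bounded_heatl cs a) IH.
Qed.

Lemma heatl_chr cs a y th : rint mu B ->
  \int[mu]_x (heatl cs a B x * chr y th x) =
  expR (- (pi * a ^+ 2 * \sum_(c <- cs) y c ^+ 2)) * \int[mu]_x (B x * chr y th x).
Proof.
move=> iB; elim: cs => [|c cs IH] /=.
  by rewrite big_nil mulr0 oppr0 expR0 mul1r.
rewrite (@heat1_chr R K c a _ S y th).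
- by rewrite IH mulrA -expRD big_cons; congr (expR _ * _); ring.
- exact: measurable_heatl.
- exact: bounded_heatl.
- exact: rint_heatl.
Qed.

Lemma measurable_heatl_param d (T : measurableType d) (a : T -> R) cs : measurable_fun setT a ->
  measurable_fun setT (fun z : T * E => heatl cs (a z.1) B z.2).
Proof.
move=> ma; elim: cs => [|c cs IH] /=; first exact: (measurableT_comp mB).
exact: (@measurable_heat1_param R K d T c a (fun z => heatl cs (a z.1) B z.2)).
Qed.

Lemma heatl_sub_bd (cs : seq K) (a s : R) : (forall c, bounded (fun x => heat1 c a B x - B x) s) ->
  bounded (fun x => heatl cs a B x - B x) ((size cs)%:R * s).
Proof.
move=> h; elim: cs => [|c cs IH] x /=; first by rewrite subrr normr0 mul0r.
have -> : heat1 c a (heatl cs a B) x - B x =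
  (heat1 c a B x - B x) + heat1 c a (fun y => heatl cs a B y - B y) x.
  rewrite (@heat1B R K c a _ _ S S) //; [ring|exact: measurable_heatl|exact: bounded_heatl].
apply: le_trans (ler_normD _ _) _; rewrite -natr1 mulrDl mul1r addrC; apply: lerD; last exact: h.
apply: bounded_heat1 => //.
by apply: measurable_funB => //; exact: measurable_heatl.
Qed.

(** Telescoping, since each coordinate step is a contraction. The extra 1 in [(size cs).+1] keeps
    the bound positive for the empty list, as [pintD] asks for positive bounds. *)
Lemma heatl_sub_pint v (cs : seq K) (a s : R) : 1 <= v -> 0 < s ->
  (forall c, pint mu v (fun x => (heat1 c a B x - B x)%R) <= (s `^ v)%:E)%E ->
  (pint mu v (fun x => (heatl cs a B x - B x)%R) <= (((size cs).+1%:R * s) `^ v)%:E)%E.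
Proof.
move=> v1 s0 h; have v0 : 0 < v by rewrite (lt_le_trans _ v1).
elim: cs => [|c cs IH] /=.
  rewrite /pint (eq_integral (fun=> 0%:E)) ?integral0 ?lee_fin ?powR_ge0 // => x _.
  by rewrite subrr normr0 powR0 // gt_eqF.
have -> : (fun x => heat1 c a (heatl cs a B) x - B x) = fun x =>
  (heat1 c a B x - B x) + heat1 c a (fun y => heatl cs a B y - B y) x.
  apply/funext => x.
  rewrite (@heat1B R K c a _ _ S S) //; [ring|exact: measurable_heatl|exact: bounded_heatl].
have md : measurable_fun setT (fun y => heatl cs a B y - B y).
  by apply: measurable_funB => //; exact: measurable_heatl.
rewrite -[(size cs).+2%:R]natr1 mulrDl mul1r addrC.
have n0 : 0 < (size cs).+1%:R * s by rewrite mulr_gt0 // ltr0n.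
have mh := @measurable_funB _ _ _ setT _ _ (measurable_heat1 c a mB) mB.
apply: (pintD v1 s0 n0 mh (measurable_heat1 c a md) (h c)).
apply: (@pint_heat1 R K v c a _ (S + S) _ v1 n0 md _ IH).
move=> x; apply: le_trans (ler_normB _ _) _; apply: lerD => //; exact: bounded_heatl.
Qed.
End heatl_basic.
End heat_diff.

(** * Fractional powers of 1 - Laplacian *)

Section lop.
Variables (R : realType) (K : finType).
Local Notation E := (fspace R K).
Local Notation mu := (@mu_fspace R K).
Local Notation leb := (@lebesgue_measure R).
Local Notation RT := (measurableTypeR R).
Implicit Types (c : K) (B : E -> R) (q al lam : R).

(** Chosen so that [pi (hsc q)^2 = 4 pi^2 exp q]: a Gaussian of this width is the heat kernel at
    time [t = exp q]. Logarithmic time turns every rescaling into a translation. *)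
Definition hsc q : R := 2 * Num.sqrt pi * expR (q / 2).
Lemma hsc_sqr q : hsc q ^+ 2 = 4 * pi * expR q.
Proof.
have e : expR (q / 2) ^+ 2 = expR q by rewrite expr2 -expRD; congr expR; field.
by rewrite /hsc !exprMn e sqr_sqrtr ?pi_ge0 //; ring.
Qed.

Lemma measurable_hsc : measurable_fun setT (hsc : RT -> R).
Proof.
apply: cont_meas.
exact: (derive_cont (fun q : R => derM (der_cst _ _) (der_exp (derM (der_id _) (der_cst _ _))))).
Qed.

Lemma measurable_expexp : measurable_fun setT ((fun q => expR (- expR q)) : RT -> R).
Proof.
apply: cont_meas.
have d (q : R) : is_derive q 1 (fun q : R => expR (0 - expR q)) _ :=
  der_exp (derB (der_cst _ _) (der_exp (der_id _))).
have := derive_cont d; rewrite (_ : (fun q => expR (0 - expR q)) = fun q => expR (- expR q)) //.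
by apply/funext => q; rewrite sub0r.
Qed.

(** The operator [1 - exp(- t (1 - Laplacian))] at time [t = exp q]. *)
Definition Dq B q (x : E) : R := B x - expR (- expR q) * heatl (enum K) (hsc q) B x.
(** The first summand comes from the Taylor estimate; 3 covers both the trivial bound 2 for large
    times and the factor [1 - exp(- t)] for small ones. *)
Definition CD : R := #|K|.+1%:R * (4 * pi * m2 R) + 3.
(** Crossover at time [t = exp q] between the trivial bound and the second order bound, for a
    function each derivative of which costs [lam]. *)
Definition mnl (lam q : R) : R := Num.min 1 (lam ^+ 2 * expR q).

Lemma CD_gt0 : 0 < CD.
Proof. by rewrite ltr_wpDl // !mulr_ge0 // ?pi_ge0 // ltW // m2_gt0. Qed.

Lemma mnl_gt0 lam q : 0 < lam -> 0 < mnl lam q.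
Proof. by move=> l0; rewrite /mnl lt_min ltr01 mulr_gt0 ?exprn_gt0 ?expR_gt0. Qed.

Lemma one_sub_exp_le (t : R) : 0 <= t -> 1 - expR (- t) <= t.
Proof. by move=> t0; have := expR_ge1Dx (- t); lra. Qed.

Lemma exp_opp_le1 (t : R) : 0 <= t -> expR (- t) <= 1.
Proof. by move=> t0; rewrite -[leRHS]expR0 ler_expR oppr_le0. Qed.

Lemma exp_opp_lt1 (t : R) : 0 < t -> expR (- t) < 1.
Proof. by move=> t0; rewrite -[ltRHS]expR0 ltr_expR oppr_lt0. Qed.

Lemma sbdd_bounded B : sbdd B -> exists S, bounded B S.
Proof. by move=> [_ /(_ [::])]. Qed.

Lemma le_powRE (v x y : R) : 0 <= v -> 0 <= x -> x <= y -> ((x `^ v)%:E <= (y `^ v)%:E)%E.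
Proof. by move=> v0 x0 xy; rewrite lee_fin ge0_ler_powR // nnegrE (le_trans x0 xy). Qed.

(** When [lam^2 t >= 1] contractivity of the semigroup is enough. Otherwise the operator is split
    into the increment of the heat semigroup, of size [t lam^2], and [1 - exp(- t) <= t]. *)
Lemma Dq_pint v (b lam q : R) B : 1 <= v -> 0 < b -> 1 <= lam -> sbdd B ->
  (pint mu v B <= (b `^ v)%:E)%E ->
  (forall c, pint mu v (dpart [:: c; c] B) <= ((lam ^+ 2 * b) `^ v)%:E)%E ->
  (pint mu v (Dq B q) <= ((CD * b * mnl lam q) `^ v)%:E)%E.
Proof.
move=> v1 b0 l1 sB pB pB2; have v0 : 0 <= v by rewrite (le_trans _ v1).
have l0 : 0 < lam by rewrite (lt_le_trans _ l1).
have [S bS] := sbdd_bounded sB; have mB := sbdd_meas sB.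
set t := expR q; have t0 : 0 < t by exact: expR_gt0.
have mH := @measurable_heatl R K B mB (enum K) (hsc q).
have pH := @pint_heatl R K B S mB bS v b (enum K) (hsc q) v1 b0 pB.
have e0 : 0 < expR (- t) by exact: expR_gt0.
have s20 : 0 < lam ^+ 2 * b by rewrite mulr_gt0 // exprn_gt0.
pose s := hsc q ^+ 2 * (m2 R * (lam ^+ 2 * b)).
have s0 : 0 < s by rewrite mulr_gt0 ?hsc_sqr ?mulr_gt0 ?pi_gt0 ?m2_gt0.
rewrite /mnl; case: (leP 1 (lam ^+ 2 * expR q)) => lq.
  rewrite mulr1; apply: (@le_trans _ _ (((b + b) `^ v)%:E)%E).
    have -> : Dq B q = fun x => B x + (- expR (- t)) * heatl (enum K) (hsc q) B x.
      by apply/funext => x; rewrite /Dq mulNr.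
    apply: (pintD v1 b0 b0 mB _ pB); first exact: measurable_funM.
    apply: le_trans pH; apply: (pint_le mu v0 _ mH) => [|x]; first exact: measurable_funM.
    by rewrite normrM normrN (ger0_norm (ltW e0)) ler_piMl // exp_opp_le1 // ltW.
  apply: le_powRE => //; first by rewrite addr_ge0 // ltW.
  have : 0 <= #|K|.+1%:R * (4 * pi * m2 R) by rewrite !mulr_ge0 // ?pi_ge0 // ltW // m2_gt0.
  by rewrite /CD; nra.
have hs := @heatl_sub_pint R K B S mB bS v (enum K) (hsc q) s v1 s0 _.
have {}hs : (pint mu v (fun x => (heatl (enum K) (hsc q) B x - B x)%R) <= ((#|K|.+1%:R * s) `^ v)%:E)%E.
  rewrite cardE; apply: hs => c; have [S2 bS2] := (sB.2 [:: c; c]).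
  exact: (heat1_sub_pint (hsc q) v1 s20 sB bS bS2).
have -> : Dq B q = fun x => expR (- t) * (- (heatl (enum K) (hsc q) B x - B x)) + (1 - expR (- t)) * B x.
  by apply/funext => x; rewrite /Dq -/t; ring.
have n0 : 0 < #|K|.+1%:R * s by rewrite mulr_gt0 // ltr0n.
have md := @measurable_funB _ _ _ setT _ _ mH mB.
have mdN : measurable_fun setT (fun x => - (heatl (enum K) (hsc q) B x - B x)) by exact: (measurableT_comp _ md).
have et : expR (- t) < 1 by exact: exp_opp_lt1.
have e1 : 0 < 1 - expR (- t) by rewrite subr_gt0.
apply: (@le_trans _ _ (((expR (- t) * (#|K|.+1%:R * s) + (1 - expR (- t)) * b) `^ v)%:E)%E).
  apply: (pintD v1 (mulr_gt0 e0 n0) (mulr_gt0 e1 b0)).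
  - exact: measurable_funM.
  - exact: measurable_funM.
  - apply: (pintZ v0 (ltW e0) (ltW n0) mdN).
    by apply: le_trans hs; apply: (pint_le mu v0 mdN md) => x; rewrite normrN.
  - exact: (pintZ v0 (ltW e1) (ltW b0) mB).
apply: le_powRE => //; first by rewrite addr_ge0 // mulr_ge0 // ltW.
have -> : CD * b * (lam ^+ 2 * expR q) =
    #|K|.+1%:R * (4 * pi * m2 R) * b * (lam ^+ 2 * t) + 3 * b * (lam ^+ 2 * t).
  by rewrite /CD -/t; move: (_%:R * _) => N1; ring.
apply: lerD.
  rewrite /s hsc_sqr -/t; apply: (@le_trans _ _ (1 * (#|K|.+1%:R * (4 * pi * t * (m2 R * (lam ^+ 2 * b)))))).
    by rewrite ler_wpM2r ?(ltW et) // ltW // -/t -hsc_sqr.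
  by apply: le_of_eq; ring.
apply: (@le_trans _ _ (t * b)); first by rewrite ler_wpM2r ?one_sub_exp_le // ltW.
have l2 : 1 <= lam ^+ 2 by rewrite exprn_ege1.
have tb : 0 < t * b by rewrite mulr_gt0.
rewrite -(ler_pM2l tb) mulr1 in l2.
rewrite (_ : 3 * b * (lam ^+ 2 * t) = 3 * (t * b * lam ^+ 2)); last ring.
lra.
Qed.

Lemma Dq_bd (S q : R) B x : sbdd B -> bounded B S -> (forall c, bounded (dpart [:: c; c] B) S) ->
  `|Dq B q x| <= CD * S * mnl 1 q.
Proof.
move=> sB bS bS2; have mB := sbdd_meas sB.
have S0 : 0 <= S by apply: le_trans (bS x).
set t := expR q; have t0 : 0 < t by exact: expR_gt0.
have bH := @bounded_heatl R K B S mB bS (enum K) (hsc q).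
have e0 : 0 < expR (- t) by exact: expR_gt0.
have et : expR (- t) < 1 by exact: exp_opp_lt1.
have k0 : 0 <= #|K|%:R * (4 * pi * m2 R) by rewrite !mulr_ge0 // ?pi_ge0 // ltW // m2_gt0.
have k1 : #|K|%:R * (4 * pi * m2 R) <= #|K|.+1%:R * (4 * pi * m2 R).
  by rewrite ler_wpM2r ?ler_nat // !mulr_ge0 // ?pi_ge0 // ltW // m2_gt0.
rewrite /mnl expr1n mul1r -/t; case: (leP 1 t) => lq.
  rewrite mulr1 /Dq; apply: le_trans (ler_normB _ _) _.
  apply: (@le_trans _ _ (S + 1 * S)); last by rewrite /CD; nra.
  apply: lerD; first exact: bS.
  by rewrite normrM ger0_norm ?(ltW e0) // ler_pM ?(ltW et) // ltW.
have -> : Dq B q x = expR (- t) * (- (heatl (enum K) (hsc q) B x - B x)) + (1 - expR (- t)) * B x.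
  by rewrite /Dq -/t; ring.
have hs : `|heatl (enum K) (hsc q) B x - B x| <= #|K|%:R * (hsc q ^+ 2 * (m2 R * S)).
  rewrite cardE; apply: (@heatl_sub_bd R K B S mB bS (enum K) (hsc q) _ _ x) => c z.
  exact: (heat1_sub_bd (hsc q) z sB bS).
rewrite hsc_sqr -/t in hs.
apply: le_trans (ler_normD _ _) _; rewrite !normrM normrN.
rewrite (ger0_norm (ltW e0)) (@ger0_norm _ (1 - _)) ?subr_ge0 ?(ltW et) //.
have h1 : expR (- t) * `|heatl (enum K) (hsc q) B x - B x| <= #|K|%:R * (4 * pi * t * (m2 R * S)).
  by apply: le_trans hs; rewrite ler_piMl // ltW.
have h2 : (1 - expR (- t)) * `|B x| <= t * S.
  by apply: ler_pM => //; [rewrite subr_ge0 ltW|exact: one_sub_exp_le (ltW t0)].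
apply: le_trans (lerD h1 h2) _.
have -> : #|K|%:R * (4 * pi * t * (m2 R * S)) = (#|K|%:R * (4 * pi * m2 R)) * (S * t) by ring.
have : 0 <= S * t by rewrite mulr_ge0 // ltW.
by rewrite /CD; nra.
Qed.

Lemma measurable_Dq B : measurable_fun setT B ->
  measurable_fun setT (fun z : RT * E => Dq B z.1 z.2).
Proof.
move=> mB; apply: measurable_funB; first exact: (measurableT_comp mB).
apply: measurable_funM.
  exact: (measurableT_comp measurable_expexp measurable_fst).
exact: (@measurable_heatl_param R K B mB _ RT hsc (enum K) measurable_hsc).
Qed.

(** This is [t^(- al)] for [t = exp q], while [dq] is [dt / t]. *)
Definition eal (al : R) q : R := expR (- (al * q)).
Lemma eal_gt0 al q : 0 < eal al q. Proof. exact: expR_gt0. Qed.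

Lemma measurable_eal al : measurable_fun setT (eal al : RT -> R).
Proof.
apply: cont_meas.
have d (q : R) : is_derive q 1 (fun q : R => expR (0 - al * q)) _ :=
  der_exp (derB (der_cst _ _) (derM (der_cst _ _) (der_id _))).
have := derive_cont d; rewrite (_ : (fun q => expR (0 - al * q)) = eal al) //.
by apply/funext => q; rewrite sub0r.
Qed.

Lemma measurable_mnl lam : measurable_fun setT (mnl lam : RT -> R).
Proof.
apply: measurable_minr => //; apply: measurable_funM => //; exact: measurable_expR.
Qed.

Lemma rint_pdf (r : R) : 0 < r -> rint leb (fun x : RT => exponential_pdf r x).
Proof. by move=> r0; exact: integrable_exponential_pdf. Qed.

(** The integrand decays like [exp(- al q)] to the right and like [exp((1 - al) q)] to the left;
    both rates are positive exactly when [0 < al < 1]. *)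
Lemma exp_mn_le al q : 0 < al < 1 ->
  eal al q * mnl 1 q <= al^-1 * exponential_pdf al q + (1 - al)^-1 * exponential_pdf (1 - al) (- q).
Proof.
move=> /andP[a0 a1]; have b0 : 0 < 1 - al by rewrite subr_gt0.
have P r x : 0 < r -> 0 <= r^-1 * exponential_pdf r x.
  by move=> r0; rewrite mulr_ge0 ?invr_ge0 ?(ltW r0) // exponential_pdf_ge0 // ltW.
case: (leP 0 q) => q0.
  rewrite -[leLHS]addr0; apply: lerD; last exact: P.
  rewrite (exponential_pdfE _ q0) mulKf ?gt_eqF //.
  by rewrite /eal mulNr ler_piMr ?expR_ge0 // /mnl ge_min lexx.
rewrite -[leLHS]add0r; apply: lerD; first exact: P.
rewrite exponential_pdfE ?oppr_ge0 ?(ltW q0) // mulKf ?gt_eqF //.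
apply: (@le_trans _ _ (eal al q * expR q)).
  by rewrite ler_wpM2l ?(ltW (eal_gt0 _ _)) // /mnl expr1n mul1r ge_min lexx orbT.
by rewrite /eal -expRD ler_expR; apply: le_of_eq; ring.
Qed.

Lemma rint_eal al : 0 < al < 1 -> rint leb (fun q => eal al q * mnl 1 q).
Proof.
move=> h; have /andP[a0 a1] := h; have b0 : 0 < 1 - al by rewrite subr_gt0.
have i2 : rint leb (fun q : RT => exponential_pdf (1 - al) (- q)).
  apply: (@transfer_rint _ RT _ RT R leb leb (fun x => - x)) (rint_pdf b0).
    by apply: cont_meas; exact: opp_continuous.
  by move=> g g0 mg; exact: ge0_integral_opp.
apply: rint_dom (rintD (rintZ al^-1 (rint_pdf a0)) (rintZ (1 - al)^-1 i2)).
  by apply: measurable_funM; [exact: measurable_eal|exact: measurable_mnl].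
move=> q; rewrite ger0_norm; first exact: exp_mn_le.
by rewrite mulr_ge0 // ltW // ?eal_gt0 // mnl_gt0.
Qed.

Lemma rint_eal_exp al : 0 < al < 1 -> rint leb (fun q => eal al q * (1 - expR (- expR q))).
Proof.
move=> h; apply: rint_dom (rint_eal h).
  apply: measurable_funM; first exact: measurable_eal.
  apply: measurable_funB => //.
  exact: measurable_expexp.
move=> q; have t0 := expR_gt0 q.
rewrite ger0_norm; last by rewrite mulr_ge0 ?(ltW (eal_gt0 _ _)) // subr_ge0 exp_opp_le1 // ltW.
rewrite ler_wpM2l ?(ltW (eal_gt0 _ _)) // /mnl expr1n mul1r le_min one_sub_exp_le ?(ltW t0) //.
by rewrite gerBl expR_ge0.
Qed.

(** Normalising constant of the formula [A^al = cal^-1 * (integral of t^(- al) (1 - exp(- t A)) dt /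
    t)]. *)
Definition cal al : R := \int[leb]_q (eal al q * (1 - expR (- expR q))).
Definition Kal al : R := \int[leb]_q (eal al q * mnl 1 q) + 1.

Lemma cal_gt0 al : 0 < al < 1 -> 0 < cal al.
Proof.
move=> h; have /andP[a0 a1] := h.
pose c0 : R := eal al 1 * (1 - expR (- 1)).
have c00 : 0 < c0 by rewrite mulr_gt0 ?eal_gt0 // subr_gt0 exp_opp_lt1.
apply: (lt_le_trans c00); rewrite /cal.
have -> : c0 = \int[leb]_q (c0 * \1_(`[0, 1]%classic) q).
  by rewrite RintegralZl //; [rewrite /Rintegral integral_01 mulr1|exact: rint_01].
apply: le_Rintegral => //; [by apply: rintZ; exact: rint_01|exact: rint_eal_exp|].
move=> q _; rewrite indicE; case: (boolP (q \in _)) => [|_].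
  rewrite inE /= in_itv /= => /andP[q0 q1]; rewrite mulr1 /c0; apply: ler_pM.
  - exact: expR_ge0.
  - by rewrite subr_ge0 exp_opp_le1.
  - by rewrite ler_expR lerN2 ler_wpM2l // ltW.
  - by rewrite lerB // ler_expR lerN2 -expR0 ler_expR.
by rewrite mulr0 mulr_ge0 ?expR_ge0 // subr_ge0 exp_opp_le1 // expR_ge0.
Qed.

Lemma Kal_gt0 al : 0 < Kal al.
Proof.
rewrite ltr_wpDl // Rintegral_ge0 // => q _.
by rewrite mulr_ge0 ?expR_ge0 // ltW // mnl_gt0.
Qed.

Lemma eal_shift al h q : eal al q = expR (al * h) * eal al (q + h).
Proof. by rewrite /eal -expRD; congr expR; ring. Qed.

Lemma mnl_shift lam q : 0 < lam -> mnl lam q = mnl 1 (q + ln (lam ^+ 2)).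
Proof. by move=> l0; rewrite /mnl expRD lnK ?posrE ?exprn_gt0 // expr1n mul1r mulrC. Qed.

Lemma exp_ln_powR al (x : R) : 0 < x -> expR (al * ln x) = x `^ al.
Proof. by move=> x0; rewrite /powR gt_eqF. Qed.

Lemma rint_eal_lam al lam : 0 < al < 1 -> 0 < lam -> rint leb (fun q => eal al q * mnl lam q).
Proof.
move=> h l0; apply: eq_rint (rintZ (expR (al * ln (lam ^+ 2))) (rint_shift (ln (lam ^+ 2)) (rint_eal h))) => q.
by rewrite (mnl_shift q l0) [in RHS](eal_shift al (ln (lam ^+ 2)) q) mulrA.
Qed.

Lemma integral_eal_lam al lam : 0 < al < 1 -> 0 < lam ->
  \int[leb]_q (eal al q * mnl lam q) = (lam ^+ 2) `^ al * \int[leb]_q (eal al q * mnl 1 q).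
Proof.
move=> h l0; rewrite -(Rintegral_shift (ln (lam ^+ 2)) (rint_meas (rint_eal h))).
rewrite -RintegralZl //; last exact: (rint_shift (ln (lam ^+ 2)) (rint_eal h)).
apply: eq_Rintegral => q _.
by rewrite mnl_shift // (eal_shift al (ln (lam ^+ 2)) q) exp_ln_powR ?exprn_gt0 // mulrA.
Qed.

(** Write [exp q * A] as [exp (q + ln A)] and translate [q]. *)
Lemma integral_eal_exp al (A : R) : 0 < al < 1 -> 0 < A ->
  \int[leb]_q (eal al q * (1 - expR (- (expR q * A)))) = A `^ al * cal al.
Proof.
move=> h l0; rewrite /cal -(Rintegral_shift (ln A) (rint_meas (rint_eal_exp h))).
rewrite -RintegralZl //; last exact: (rint_shift (ln A) (rint_eal_exp h)).
apply: eq_Rintegral => q _.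
by rewrite (eal_shift al (ln A) q) exp_ln_powR // mulrA expRD lnK.
Qed.

(** The fractional power [(1 - Laplacian)^al], obtained by putting the operator for [A] in the
    scalar formula normalised by [cal]. *)
Definition Lop al B (x : E) : R := (cal al)^-1 * \int[leb]_q (eal al q * Dq B q x).

Lemma sbdd_bound2 B : sbdd B -> exists S, bounded B S /\ forall c, bounded (dpart [:: c; c] B) S.
Proof.
move=> [_ bf]; have [M hM] := choice (fun c => bf [:: c; c]); have [S0 hS] := bf [::].
have P : 0 <= \sum_c `|M c| by rewrite sumr_ge0.
exists (`|S0| + \sum_c `|M c|); split => [x|c x].
  by apply: le_trans (hS x) _; rewrite (le_trans (ler_norm _)) // lerDl.
apply: le_trans (hM c x) _; rewrite (bigD1 c) //= (le_trans (ler_norm _)) //.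
by rewrite addrCA lerDl addr_ge0 // sumr_ge0.
Qed.

Lemma rint_Dq al B x : 0 < al < 1 -> sbdd B -> rint leb (fun q => eal al q * Dq B q x).
Proof.
move=> h sB; have [S [bS bS2]] := sbdd_bound2 sB.
apply: rint_dom (rintZ (CD * S) (rint_eal h)).
  apply: measurable_funM; first exact: measurable_eal.
  exact: (measurableT_comp (measurable_Dq (sbdd_meas sB)) (measurable_pair2 x)).
move=> q; rewrite normrM (gtr0_norm (eal_gt0 _ _)) mulrCA.
by rewrite ler_wpM2l ?(ltW (eal_gt0 _ _)) //; exact: Dq_bd.
Qed.

Lemma measurable_Lop al B : sbdd B -> measurable_fun setT (Lop al B).
Proof.
move=> sB; apply: measurable_funM => //.
apply: (@measurable_Rint_param _ E _ RT R leb (fun w => eal al w.2 * Dq B w.2 w.1)).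
apply: measurable_funM; first exact: (measurableT_comp (@measurable_eal al) measurable_snd).
exact: (measurableT_comp (measurable_Dq (sbdd_meas sB)) (@measurable_swap _ _ E RT)).
Qed.

(** Interpolation between [B] and its second derivatives: integrating the crossover [mnl lam]
    against [t^(- al)] gives [lam^(2 al)] after a translation of [q]. *)
Lemma Lop_pint v al (b lam : R) B : 1 <= v -> 0 < al < 1 -> 0 < b -> 1 <= lam -> sbdd B ->
  (pint mu v B <= (b `^ v)%:E)%E ->
  (forall c, pint mu v (dpart [:: c; c] B) <= ((lam ^+ 2 * b) `^ v)%:E)%E ->
  (pint mu v (Lop al B) <= (((cal al)^-1 * (CD * b * ((lam ^+ 2) `^ al * Kal al))) `^ v)%:E)%E.
Proof.
move=> v1 h b0 l1 sB pB pB2; have v0 : 0 <= v by rewrite (le_trans _ v1).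
have l0 : 0 < lam by rewrite (lt_le_trans _ l1).
have c0 := cal_gt0 h; have K0 := Kal_gt0 al.
have L0 : 0 < (lam ^+ 2) `^ al by rewrite powR_gt0 // exprn_gt0.
have M0 : 0 < CD * b * ((lam ^+ 2) `^ al * Kal al) by rewrite !mulr_gt0 // CD_gt0.
have mD := measurable_Dq (sbdd_meas sB).
have P0 q : 0 < CD * b * mnl lam q by rewrite !mulr_gt0 ?CD_gt0 ?mnl_gt0.
have ir : rint leb (fun q => eal al q * (CD * b * mnl lam q)).
  by apply: eq_rint (rintZ (CD * b) (rint_eal_lam h l0)) => q; rewrite mulrCA.
apply: (pintZ v0 _ (ltW M0)); first by rewrite invr_ge0 ltW.
  apply: (@measurable_Rint_param _ E _ RT R leb (fun w => eal al w.2 * Dq B w.2 w.1)).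
  apply: measurable_funM; first exact: (measurableT_comp (@measurable_eal al) measurable_snd).
  exact: (measurableT_comp mD (@measurable_swap _ _ E RT)).
apply: (@minkowski_param _ RT _ E R leb mu v _ (eal al) (fun q => CD * b * mnl lam q)
  (fun z => Dq B z.1 z.2) v1 M0).
- by move=> q; rewrite ltW // eal_gt0.
- exact: P0.
- by apply: measurable_funM => //; exact: measurable_mnl.
- exact: ir.
- rewrite (_ : (fun q => _) = fun q => CD * b * (eal al q * mnl lam q)); last by apply/funext => q; rewrite mulrCA.
  rewrite RintegralZl //; last exact: rint_eal_lam.
  rewrite integral_eal_lam // !ler_wpM2l ?mulr_ge0 ?(ltW CD_gt0) ?(ltW b0) ?(ltW L0) // lerDl //.
- exact: measurable_eal.
- exact: mD.
- by move=> x; exact: rint_Dq.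
- by move=> q /=; exact: Dq_pint.
Qed.
End lop.

(** * Fourier symbol of the fractional power *)

Section lop2.
Variables (R : realType) (K : finType).
Local Notation E := (fspace R K).
Local Notation mu := (@mu_fspace R K).
Local Notation leb := (@lebesgue_measure R).
Local Notation RT := (measurableTypeR R).
Implicit Types (c : K) (B : E -> R) (q al lam : R).

Lemma sqnorm_ge0 (y : K -> R) : 0 <= sqnorm y.
Proof. by apply: sumr_ge0 => c _; rewrite sqr_ge0. Qed.

Lemma pint_fin_bound B : rint mu B -> (pint mu 1 B <= ((fine (pint mu 1 B)) )%:E)%E /\ 0 <= fine (pint mu 1 B).
Proof.
move=> /integrableP[_ /=]; rewrite -pint1 => Boo.
have P0 : (0 <= pint mu 1 B)%E by apply: integral_ge0 => x _; rewrite lee_fin powR_ge0.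
by rewrite fineK ?ge0_fin_numE // fine_ge0.
Qed.

Lemma pint_common B : rint mu B -> (forall c, rint mu (dpart [:: c; c] B)) ->
  exists b : R, [/\ 0 < b, (pint mu 1 B <= (b `^ 1)%:E)%E &
    forall c, (pint mu 1 (dpart [:: c; c] B) <= (b `^ 1)%:E)%E].
Proof.
move=> iB iB2; have [h0 p0] := pint_fin_bound iB.
pose S := \sum_c fine (pint mu 1 (dpart [:: c; c] B)).
have S0 : 0 <= S by apply: sumr_ge0 => c _; have [] := pint_fin_bound (iB2 c).
have b0 : 0 < fine (pint mu 1 B) + S + 1 by rewrite ltr_wpDl // addr_ge0.
exists (fine (pint mu 1 B) + S + 1); split => //.
  by apply: le_trans h0 _; rewrite (powRr1 (ltW b0)) lee_fin -addrA lerDl addr_ge0.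
move=> c; have [h p] := pint_fin_bound (iB2 c).
apply: le_trans h _; rewrite (powRr1 (ltW b0)) lee_fin /S (bigD1 c) //= addrAC addrC.
rewrite -!addrA lerDl !addr_ge0 //.
by apply: sumr_ge0 => c' _; have [] := pint_fin_bound (iB2 c').
Qed.

Lemma Lop_rint al B : 0 < al < 1 -> sbdd B -> rint mu B ->
  (forall c, rint mu (dpart [:: c; c] B)) -> rint mu (Lop al B).
Proof.
move=> h sB iB iB2; have [b [b0 pB pB2]] := pint_common iB iB2.
apply: pint1_rint; first exact: measurable_Lop.
have pB3 c : (pint mu 1 (dpart [:: c; c] B) <= ((1 ^+ 2 * b) `^ 1)%:E)%E by rewrite expr1n mul1r; exact: pB2.
by apply: le_lt_trans (Lop_pint (lexx 1) h b0 (lexx 1) sB pB pB3) _; rewrite ltry.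
Qed.

(** [Dq_pint] with [v = 1] and [lam = 1] makes the double integral in [x] and [q] absolutely
    convergent; Fubini then reduces the claim to the scalar formula with [A = 1 + 4 pi^2 |y|^2]. *)
Lemma Lop_chr al B y th : 0 < al < 1 -> sbdd B -> rint mu B ->
  (forall c, rint mu (dpart [:: c; c] B)) ->
  \int[mu]_x (Lop al B x * chr y th x) =
  (1 + 4 * pi ^+ 2 * sqnorm y) `^ al * \int[mu]_x (B x * chr y th x).
Proof.
move=> h sB iB iB2; have [b [b0 pB pB2]] := pint_common iB iB2.
have pB3 c : (pint mu 1 (dpart [:: c; c] B) <= ((1 ^+ 2 * b) `^ 1)%:E)%E by rewrite expr1n mul1r; exact: pB2.
have mB := sbdd_meas sB; have [S bS] := sbdd_bounded sB.
have mD := measurable_Dq mB.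
have mDs : measurable_fun setT (fun w : E * RT => Dq B w.2 w.1).
  exact: (measurableT_comp mD (@measurable_swap _ _ E RT)).
pose F (w : E * RT) := eal al w.2 * (Dq B w.2 w.1 * chr y th w.1).
have mF : measurable_fun setT F.
  apply: measurable_funM; first exact: (measurableT_comp (@measurable_eal R al) measurable_snd).
  by apply: measurable_funM; [exact: mDs|exact: (measurableT_comp (measurable_chr y th) measurable_fst)].
have iH q : rint mu (heatl (enum K) (hsc q) B) := @rint_heatl R K B S mB bS (enum K) (hsc q) iB.
have iDq q : rint mu (Dq B q) := rintB iB (rintZ (expR (- expR q)) (iH q)).
have iz q : rint mu (fun x => F (x, q)).
  exact: (rintZ (eal al q) (rint_chr y th (iDq q))).
have ix x : rint leb (fun q => F (x, q)).
  by apply: eq_rint (rintZ (chr y th x) (rint_Dq x h sB)) => q; rewrite /F /=; ring.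
have ie := rint_eal h.
have iF : rint (mu \x leb)%E F.
  apply: rint_prod; first exact: mF.
  have mEF : measurable_fun setT (fun w : E * RT => (`|F w|)%:E) by apply/measurable_EFinP; exact: measurableT_comp.
  rewrite (@fubini_tonelli _ _ E RT R mu leb (fun w => (`|F w|)%:E) mEF) //=.
  apply: (@le_lt_trans _ _ (\int[leb]_q (((CD R K * b) * (eal al q * mnl 1 q))%:E))%E).
    apply: ge0_le_integral => //.
    - by move=> z _; apply: integral_ge0.
    - exact: (@measurable_fun_fubini_tonelli_G _ _ E RT R mu (fun w => (`|F w|)%:E)).
    - by apply/measurable_EFinP; exact: rint_meas (rintZ _ ie).
    move=> q _; have pD := Dq_pint q (lexx 1) b0 (lexx 1) sB pB pB3.
    have k0 : 0 <= CD R K * b * mnl 1 q by rewrite !mulr_ge0 ?(ltW b0) ?(ltW (CD_gt0 _ _)) // ltW // mnl_gt0.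
    rewrite powRr1 // in pD.
    rewrite (_ : CD R K * b * (eal al q * mnl 1 q) = eal al q * (CD R K * b * mnl 1 q)); last ring.
    rewrite EFinM; apply: (@le_trans _ _ ((eal al q)%:E * pint mu 1 (Dq B q))%E); last first.
      by apply: lee_wpmul2l; [rewrite lee_fin ltW // eal_gt0|exact: pD].
    have mq : measurable_fun setT (fun x => (`|Dq B q x|)%:E).
      by apply/measurable_EFinP; apply: measurableT_comp => //; exact: rint_meas (iDq q).
    rewrite pint1 -ge0_integralZl ?lee_fin ?(ltW (eal_gt0 _ _)) //.
    apply: ge0_le_integral => //.
    - exact: (measurableT_comp mEF (measurable_pair2 q)).
    - exact: measurable_funeM.
    move=> x _; rewrite -EFinM lee_fin /F /= !normrM (gtr0_norm (eal_gt0 _ _)).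
    by rewrite ler_wpM2l ?(ltW (eal_gt0 _ _)) // ler_piMr // chr_le1.
  apply: (@le_lt_trans _ _ (\int[leb]_q `|(CD R K * b * (eal al q * mnl 1 q))%:E|)%E).
    apply: ge0_le_integral => //.
    - move=> q _; rewrite lee_fin !mulr_ge0 ?(ltW b0) ?(ltW (CD_gt0 _ _)) ?(ltW (eal_gt0 _ _)) //.
      by rewrite ltW // mnl_gt0.
    - by apply/measurable_EFinP; exact: rint_meas (rintZ _ ie).
    - by apply: measurableT_comp => //; apply/measurable_EFinP; exact: rint_meas (rintZ _ ie).
    by move=> q _; rewrite lee_fin ler_norm.
  by have /integrableP[] := rintZ (CD R K * b) ie.
have c0 := cal_gt0 h.
set A := 1 + 4 * pi ^+ 2 * sqnorm y.
have A0 : 0 < A.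
  by rewrite ltr_wpDr // mulr_ge0 ?sqnorm_ge0 // mulr_ge0 // sqr_ge0.
transitivity ((cal al)^-1 * \int[mu]_x (\int[leb]_q F (x, q))).
  rewrite -RintegralZl //; last exact: (rint_fubini_l iF).
  apply: eq_Rintegral => x _; rewrite /Lop -mulrA; congr (_ * _).
  rewrite -RintegralZr //; last exact: rint_Dq.
  by apply: eq_Rintegral => q _; rewrite /F /=; ring.
rewrite (Rintegral_fubini iF ix iz).
set I0 := \int[mu]_x (B x * chr y th x).
(* The heat symbol and the factor [exp(- t)] combine into [exp(- t A)]. *)
have inner q : \int[mu]_x F (x, q) = eal al q * (1 - expR (- (expR q * A))) * I0.
  rewrite /F /= RintegralZl //; last exact: rint_chr.
  rewrite -mulrA; congr (_ * _).
  have iBc := rint_chr y th iB; have iHc := rint_chr y th (iH q).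
  transitivity (\int[mu]_x (B x * chr y th x - expR (- expR q) * (heatl (enum K) (hsc q) B x * chr y th x))).
    by apply: eq_Rintegral => x _; rewrite /Dq; ring.
  rewrite RintegralB //; last exact: rintZ.
  rewrite RintegralZl // (@heatl_chr R K B S mB bS) // -/I0 mulrBl mul1r; congr (_ - _).
  rewrite mulrA -expRD hsc_sqr; congr (expR _ * _).
  rewrite big_enum /= /A /sqnorm; ring.
under eq_Rintegral do rewrite inner.
rewrite RintegralZr //; last first.
  apply: rint_dom (rint_eal_lam h (_ : 0 < Num.sqrt A)); last by rewrite sqrtr_gt0.
    apply: measurable_funM; first exact: measurable_eal.
    apply: cont_meas.
    have d (q : R) : is_derive q 1 (fun q : R => 1 - expR (0 - expR q * A)) _ :=
      derB (der_cst _ _) (der_exp (derB (der_cst _ _) (derM (der_exp (der_id _)) (der_cst _ _)))).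
    have := derive_cont d; rewrite (_ : (fun q => 1 - expR (0 - expR q * A)) = fun q => 1 - expR (- (expR q * A))) //.
    by apply/funext => q; rewrite sub0r.
  move=> q; have t0 : 0 < expR q * A by rewrite mulr_gt0 // expR_gt0.
  rewrite ger0_norm; last by rewrite mulr_ge0 ?(ltW (eal_gt0 _ _)) // subr_ge0 exp_opp_le1 // ltW.
  rewrite ler_wpM2l ?(ltW (eal_gt0 _ _)) // /mnl sqr_sqrtr ?(ltW A0) // le_min [A * _]mulrC.
  by rewrite one_sub_exp_le ?(ltW t0) // gerBl expR_ge0.
by rewrite integral_eal_exp // mulrA mulrCA mulVf ?mulr1 // gt_eqF.
Qed.
End lop2.

(** * Compact support, integration by parts, integer powers *)

Section cbox.
Variables (R : realType) (K : finType).
Local Notation E := (fspace R K).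
Local Notation mu := (@mu_fspace R K).
Local Notation leb := (@lebesgue_measure R).
Local Notation RT := (measurableTypeR R).
Implicit Types (c : K) (f : E -> R) (r : R).

Definition outbox r (x : E) := exists k, r < `|x k|.
Definition cbox r f := forall x, outbox r x -> f x = 0.

Lemma pderiv_loc (O : E -> Prop) f c x : (forall z, O z -> f z = 0) ->
  (\forall t \near x c, O (upd x c t)) -> pderiv c f x = 0.
Proof.
move=> fO xO; rewrite /pderiv derive1E (near_eq_derive (g := cst 0)) ?derive_cst //.
by near=> t; apply: fO; near: t.
Unshelve. all: by end_near. Qed.

Lemma outbox_near r x c : outbox r x -> \forall t \near x c, outbox r (upd x c t).
Proof.
move=> [k xk]; case: (eqVneq k c) => [kc|kc]; last first.
  by apply/nbhs_ballP; exists 1 => //= t _; exists k; rewrite /upd (negbTE kc).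
subst k; apply/nbhs_ballP; exists (`|x c| - r) => /=; first by rewrite subr_gt0.
move=> t; rewrite /ball /= => xt; exists c; rewrite /upd eqxx.
have := ler_dist_dist (x c) t; have := ler_norm (`|x c| - `|t|).
lra.
Qed.

Lemma cbox_pderiv r f c : cbox r f -> cbox r (pderiv c f).
Proof. by move=> fr x xO; apply: (pderiv_loc fr); exact: outbox_near. Qed.

Lemma cbox_dpart r f s : cbox r f -> cbox r (dpart s f).
Proof. by move=> fr; elim: s => //= c s; exact: cbox_pderiv. Qed.

Lemma rint_box r : 0 < r -> rint mu (\1_(@box R K r) : E -> R).
Proof.
move=> r0; apply/integrableP; split; first by apply/measurable_EFinP; apply: measurable_indic; exact: measurable_box.
rewrite (eq_integral (fun x : E => (\1_(@box R K r) x)%:E)).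
  have mb := @measurable_box R K r.
  by rewrite integral_indic // setIT; have /= -> := mu_box K r0; rewrite ltry.
by move=> x _ /=; rewrite ger0_norm.
Qed.

Lemma cbox_le r f M x : cbox r f -> bounded f M -> `|f x| <= `|M| * (\1_(@box R K r) x).
Proof.
move=> fr fM; rewrite indicE; case: (boolP (x \in _)) => h.
  by rewrite mulr1 (le_trans (fM x)) // ler_norm.
rewrite fr ?normr0 ?mulr0 //; apply: contrapT => no; move: h; rewrite notin_setE; apply => k.
by rewrite leNgt; apply/negP => xk; apply: no; exists k.
Qed.

Lemma rint_cbox r f : 0 < r -> sbdd f -> cbox r f -> rint mu f.
Proof.
move=> r0 sf fr; have [M fM] := sbdd_bounded sf.
apply: rint_dom (rintZ `|M| (rint_box r0)); first exact: sbdd_meas.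
by move=> x; exact: cbox_le.
Qed.

Lemma dotp_upd (x y : E) c t : dotp (upd x c t) y = dotp (upd x c 0) y + t * y c.
Proof.
rewrite /dotp (bigD1 c) //= [X in _ = X + _](bigD1 c) //= /upd !eqxx mul0r add0r addrC; congr (_ + _).
by apply: eq_bigr => k /negbTE ->.
Qed.

(** On each line in direction [c] the integrand is the derivative of a function with compact
    support. Differentiating the character multiplies it by [2 pi y_c] and advances its phase by
    [pi / 2]. *)
Lemma dpart_ibp r f c y th : 0 < r -> sbdd f -> cbox r f ->
  \int[mu]_x (dpart [:: c] f x * chr y th x) = - (2 * pi * y c) * \int[mu]_x (f x * chr y (th + pi / 2) x).
Proof.
move=> r0 sf fr.
have sf' := sbdd_dpart [:: c] sf; have fr' := cbox_dpart [:: c] fr.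
have i1 := rint_chr y th (rint_cbox r0 sf' fr').
have i2 := rintZ (2 * pi * y c) (rint_chr y (th + pi / 2) (rint_cbox r0 sf fr)).
have := @integral_coord0 R K c _ (rintD i1 i2).
suff H (y0 : E) : (\int[leb]_t (dpart [:: c] f (upd y0 c t) * chr y th (upd y0 c t) +
    2 * pi * y c * (f (upd y0 c t) * chr y (th + pi / 2) (upd y0 c t)))%:E = 0)%E.
  move=> /(_ H) => h0.
  have := congr1 fine h0; rewrite -/(Rintegral _ _ _) RintegralD // RintegralZl //; last exact: rint_chr (rint_cbox r0 sf fr).
  by move=> h; rewrite mulNr; apply/eqP; rewrite -addr_eq0; apply/eqP.
pose C0 := 2 * pi * dotp (upd y0 c 0) y + th.
pose w := 2 * pi * y c.
have chrE t th' : chr y (th + th') (upd y0 c t) = cos (C0 + th' + w * t).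
  by rewrite /chr dotp_upd /C0 /w; congr cos; ring.
pose g t := f (upd y0 c t) * cos (C0 + w * t).
pose g' t := dpart [:: c] f (upd y0 c t) * cos (C0 + w * t) + f (upd y0 c t) * ((0 - sin (C0 + w * t)) * w).
have dl (t : R) : is_derive t 1 (fun t => C0 + w * t) w.
  by apply: der_eq (derD (der_cst _ _) (derM (der_cst _ _) (der_id _))) _; ring.
have dg (t : R) : is_derive t 1 g (g' t).
  apply: der_eq (derM (@sder_upd R K f [::] c y0 t sf.1) (der_cos (dl t))) _.
  by rewrite /g' sub0r.
have cg' : continuous g'.
  exact: (derive_cont (fun t : R => derD (derM (@sder_upd R K f [:: c] c y0 t sf.1) (der_cos (dl t)))
    (derM (@sder_upd R K f [::] c y0 t sf.1) (derM (derB (der_cst _ _) (der_sin (dl t))) (der_cst _ _))))).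
have out t : r < `|t| -> outbox r (upd y0 c t) by move=> rt; exists c; rewrite /upd eqxx.
have ig' : rint leb g'.
  have [M fM] := sbdd_bounded sf; have [M' fM'] := sbdd_bounded sf'.
  have i01 : rint leb (fun t => (`|M'| + `|M| * `|w|) * \1_(`[-r, r]%classic) t : R).
    apply: rintZ; apply/integrableP; split; first by apply/measurable_EFinP; exact: measurable_indic.
    rewrite (eq_integral (fun t : RT => (\1_(`[-r, r]%classic : set RT) t)%:E)); last by move=> t _ /=; rewrite ger0_norm.
    rewrite integral_indic // setIT.
    have h := @lebesgue_measure_itv R `[-r, r]; rewrite /= in h.
    apply: (@eq_ind_r _ _ (fun z => (z < +oo)%E) _ _ h).
    by case: ifP => _; rewrite ?ltry // -EFinD ltry.
  apply: rint_dom i01; first exact: cont_meas.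
  move=> t; rewrite indicE; case: (boolP (t \in _)) => h.
    rewrite mulr1 /g'; apply: le_trans (ler_normD _ _) _; apply: lerD.
      rewrite normrM -[leRHS]mulr1; apply: ler_pM => //; first by rewrite (le_trans (fM' _)) // ler_norm.
      by rewrite ler_norml cos_geN1 cos_le1.
    rewrite sub0r !normrM normrN; apply: ler_pM => //; first by rewrite (le_trans (fM _)) // ler_norm.
    by rewrite ler_piMl // ler_norml sin_geN1 sin_le1.
  have rt : r < `|t|.
    rewrite ltNge; apply/negP => tr; move: h; rewrite notin_setE /= in_itv /=; apply.
    by rewrite -ler_norml.
  by rewrite /g' fr' ?fr ?mul0r ?addr0 ?normr0 ?mulr0 //; exact: out.
have gz t : r < `|t| -> g t = 0 by move=> rt; rewrite /g fr ?mul0r //; exact: out.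
have limg (s : R) : `|s| = 1 -> g (s * n%:R) @[n --> \oo] --> 0.
  move=> s1; apply: cvg_near_cst; exists (Num.truncn r).+1 => // n /= rn; apply: gz.
  by rewrite normrM s1 mul1r ger0_norm // (lt_le_trans (truncnS_gt _)) // ler_nat.
have I0 := integral_derive0 dg cg' ig'.
have /I0 : g n%:R @[n --> \oo] --> 0.
  have := limg 1 (normr1 _); rewrite (_ : (fun n : nat => g (1 * n%:R)) = fun n : nat => g n%:R) //.
  by apply/funext => n; rewrite mul1r.
have l2 : g (- n%:R) @[n --> \oo] --> 0.
  have := limg (-1) _; rewrite normrN1 (_ : (fun n : nat => g (-1 * n%:R)) = fun n : nat => g (- n%:R)); first exact.
  by apply/funext => n; rewrite mulN1r.
move=> /(_ l2) h.
have fin := integrable_fin_num measurableT ig'.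
transitivity (\int[leb]_t (EFin \o g') t)%E; last first.
  by rewrite -[LHS]fineK //; congr EFin.
apply: eq_integral => t _ /=; congr EFin.
have := chrE t 0; have := chrE t (pi / 2); rewrite !addr0 /g' => -> ->.
by rewrite [C0 + pi / 2 + _]addrAC cosDpihalf; rewrite /w /=; ring.
Qed.

Lemma chr_pi y th (x : E) : chr y (th + pi) x = - chr y th x.
Proof. by rewrite /chr addrA cosDpi. Qed.

Lemma dpart2_chr r f c y th : 0 < r -> sbdd f -> cbox r f ->
  \int[mu]_x (dpart [:: c; c] f x * chr y th x) = - (4 * pi ^+ 2 * y c ^+ 2) * \int[mu]_x (f x * chr y th x).
Proof.
move=> r0 sf fr.
rewrite (@dpart_ibp r (dpart [:: c] f) c y th r0 (sbdd_dpart _ sf) (cbox_dpart _ fr)) (dpart_ibp _ _ _ r0 sf fr).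
rewrite -addrA -splitr.
rewrite (_ : (fun x => f x * chr y (th + pi) x) = fun x => -1 * (f x * chr y th x)); last first.
  by apply/funext => x; rewrite chr_pi; ring.
by rewrite RintegralZl; [ring|exact: measurableT|exact: rint_chr (rint_cbox r0 sf fr)].
Qed.

(** A constant coefficient differential operator, encoded as a list of weighted words of
    coordinates. *)
Definition lcomb (W : seq (R * seq K)) f (x : E) := \sum_(i <- W) i.1 * dpart i.2 f x.

Lemma sder_lcomb_dpart W f s : sder f ->
  dpart s (lcomb W f) = fun x => \sum_(i <- W) i.1 * dpart (s ++ i.2) f x.
Proof.
move=> sf; elim: s => //= c s ->; apply/funext => x.
have d (t : R) : is_derive t 1 (fun t => \sum_(i <- W) i.1 * dpart (s ++ i.2) f (upd x c t))
   (\sum_(i <- W) i.1 * dpart (c :: s ++ i.2) f (upd x c t)).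
  elim: W => [|i W IH].
    rewrite big_nil (_ : (fun t => _) = fun=> 0); last by apply/funext => z; rewrite big_nil.
    exact: der_cst.
  rewrite big_cons (_ : (fun t => \sum_(_ <- _ :: _) _) = fun t => i.1 * dpart (s ++ i.2) f (upd x c t) +
     \sum_(i <- W) i.1 * dpart (s ++ i.2) f (upd x c t)); last by apply/funext => z; rewrite big_cons.
  apply: derD IH; apply: der_eq (derM (der_cst _ _) (sder_upd _ _ _ _ sf)) _.
  by rewrite mul0r add0r.
have := der_val (d (x c)); rewrite /pderiv upd_id => <-.
by [].
Qed.

Lemma sbdd_lcomb W f : sbdd f -> sbdd (lcomb W f).
Proof.
move=> [sf bf]; split => [s c x|s]; rewrite sder_lcomb_dpart //.
  elim: W => [|i W IH].
    rewrite (_ : (fun t => _) = fun=> 0); last by apply/funext => z; rewrite big_nil.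
    exact: der_ex (der_cst _ _).
  rewrite (_ : (fun t => _) = fun t => i.1 * dpart (s ++ i.2) f (upd x c t) +
     \sum_(i <- W) i.1 * dpart (s ++ i.2) f (upd x c t)); last by apply/funext => z; rewrite big_cons.
  apply: derivableD IH; apply: derivableM; first exact: der_ex (der_cst _ _).
  exact: sf.
elim: W => [|i W [M IH]]; first by exists 0 => x; rewrite big_nil normr0.
have [M' bM'] := bf (s ++ i.2).
exists (`|i.1| * M' + M) => x; rewrite big_cons (le_trans (ler_normD _ _)) //.
by apply: lerD (IH x); rewrite normrM ler_wpM2l //; exact: bM'.
Qed.

Lemma cbox_lcomb r W f : cbox r f -> cbox r (lcomb W f).
Proof.
move=> fr x xO; rewrite /lcomb big1 // => i _.
by rewrite (cbox_dpart i.2 fr xO) mulr0.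
Qed.

(** Expansion of [(1 - Laplacian)^k]: each step keeps a word, or negates its weight and prefixes a
    repeated letter. *)
Fixpoint lapw (k : nat) : seq (R * seq K) :=
  if k is k'.+1 then lapw k' ++ [seq (- i.1, c :: c :: i.2) | i <- lapw k', c <- enum K] else [:: (1, [::])].

Lemma size_lapw k i : i \in lapw k -> (size i.2 <= k.*2)%N.
Proof.
elim: k i => [|k IH] i /=; first by rewrite inE => /eqP ->.
rewrite mem_cat => /orP[/IH h|/allpairsP[[j c] /= [/IH h _ ->]] /=].
  by rewrite (leq_trans h) // doubleS ltnW.
by rewrite doubleS !ltnS.
Qed.

Lemma lcomb_chr r W f y th : 0 < r -> sbdd f -> cbox r f ->
  \int[mu]_x (lcomb W f x * chr y th x) = \sum_(i <- W) i.1 * \int[mu]_x (dpart i.2 f x * chr y th x).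
Proof.
move=> r0 sf fr; elim: W => [|i W IH].
  rewrite big_nil (_ : (fun x => _) = fun=> 0); first by rewrite Rintegral_cst // mul0r.
  by apply/funext => x; rewrite /lcomb big_nil mul0r.
have id W' : rint mu (fun x => lcomb W' f x * chr y th x).
  by apply: rint_chr; apply: (rint_cbox r0); [exact: sbdd_lcomb|exact: cbox_lcomb].
have ii : rint mu (fun x => dpart i.2 f x * chr y th x).
  by apply: rint_chr; apply: (rint_cbox r0); [exact: sbdd_dpart|exact: cbox_dpart].
rewrite big_cons -IH.
transitivity (\int[mu]_x (i.1 * (dpart i.2 f x * chr y th x) + lcomb W f x * chr y th x)).
  by apply: eq_Rintegral => x _; rewrite /lcomb big_cons; ring.
rewrite RintegralD; [|exact: measurableT|exact: rintZ|exact: id].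
by rewrite RintegralZl.
Qed.

Lemma lapw_chr k r f y th : 0 < r -> sbdd f -> cbox r f ->
  \int[mu]_x (lcomb (lapw k) f x * chr y th x) =
  (1 + 4 * pi ^+ 2 * sqnorm y) ^+ k * \int[mu]_x (f x * chr y th x).
Proof.
move=> r0 sf fr; rewrite (lcomb_chr _ _ _ r0 sf fr); elim: k => [|k IH] /=.
  by rewrite big_seq1 /= expr0.
rewrite big_cat /= big_allpairs_dep /=.
rewrite [X in _ + X](eq_bigr (fun i => 4 * pi ^+ 2 * sqnorm y * (i.1 * \int[mu]_x (dpart i.2 f x * chr y th x)))).
  by rewrite -mulr_sumr IH [in RHS]exprSr; ring.
move=> i _.
rewrite (eq_bigr (fun c => 4 * pi ^+ 2 * (i.1 * \int[mu]_x (dpart i.2 f x * chr y th x)) * y c ^+ 2)).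
  by rewrite -mulr_sumr big_enum /= /sqnorm; ring.
move=> c _; have := @dpart2_chr r (dpart i.2 f) c y th r0 (sbdd_dpart _ sf) (cbox_dpart _ fr).
by rewrite /= => ->; ring.
Qed.

(** The coefficients and their sum are enlarged by 1 so that all bounds passed to [pintD] are
    positive. *)
Lemma pint_lcomb v W f (b : R) : 1 <= v -> 0 < b -> sbdd f ->
  (forall i, i \in W -> pint mu v (dpart i.2 f) <= (b `^ v)%:E)%E ->
  (pint mu v (lcomb W f) <= (((\sum_(i <- W) (`|i.1| + 1) + 1) * b) `^ v)%:E)%E.
Proof.
move=> v1 b0 sf; have v0 : 0 < v by rewrite (lt_le_trans _ v1).
elim: W => [|i W IH] h.
  rewrite /pint (eq_integral (fun=> 0%:E)) ?integral0 ?lee_fin ?powR_ge0 // => x _.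
  by rewrite /lcomb big_nil normr0 powR0 // gt_eqF.
have S0 : 0 < \sum_(i <- W) (`|i.1| + 1) + 1 by rewrite ltr_wpDl // sumr_ge0 // => j _; rewrite addr_ge0.
have i0 : 0 < `|i.1| + 1 by rewrite ltr_wpDl.
have mi : measurable_fun setT (dpart i.2 f : E -> R) by apply: sbdd_meas; exact: sbdd_dpart.
rewrite (_ : lcomb _ _ = fun x => i.1 * dpart i.2 f x + lcomb W f x); last first.
  by apply/funext => x; rewrite /lcomb big_cons.
rewrite big_cons -addrA mulrDl.
apply: (pintD v1 (mulr_gt0 i0 b0) (mulr_gt0 S0 b0)).
- exact: measurable_funM.
- by apply: sbdd_meas; exact: sbdd_lcomb.
- apply: (@le_trans _ _ (pint mu v (fun x => (`|i.1| + 1) * dpart i.2 f x))).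
    apply: (pint_le mu (ltW v0)); [exact: measurable_funM|exact: measurable_funM|].
    by move=> x; rewrite !normrM ler_wpM2r // [leRHS]ger0_norm ?(ltW i0) // lerDl.
  by apply: (pintZ (ltW v0) (ltW i0) (ltW b0) mi); apply: h; rewrite inE eqxx.
by apply: IH => j jW; apply: h; rewrite inE jW orbT.
Qed.
End cbox.

(** * Powers of arbitrary positive order *)

Section klop.
Variables (R : realType) (K : finType).
Local Notation E := (fspace R K).
Local Notation mu := (@mu_fspace R K).
Implicit Types (c : K) (f : E -> R) (r : R).

(** [s / 2] is the integer [sint s] plus [sfrac s], with [0 <= sfrac s < 1] for positive [s]. The
    value 0 needs its own case because the integral formula diverges there. *)
Definition sint (s : R) : nat := Num.truncn (s / 2).
Definition sfrac (s : R) : R := s / 2 - (sint s)%:R.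

(* (1 - Laplacian)^(s/2), classical integer part followed by a subordinated heat semigroup *)
Definition LL (s : R) f : E -> R :=
  if sfrac s == 0 then lcomb (lapw R K (sint s)) f else Lop (sfrac s) (lcomb (lapw R K (sint s)) f).

Lemma sfrac_itv s : 0 < s -> sfrac s != 0 -> 0 < sfrac s < 1.
Proof.
move=> s0 n0; have s20 : 0 <= s / 2 by rewrite divr_ge0 // ltW.
have /andP[h1 h2] := truncn_itv s20.
rewrite lt_neqAle eq_sym n0 subr_ge0 h1 /= ltrBlDr addrC natr1; exact: h2.
Qed.

Section LL.
Variables (s r : R) (f : E -> R).
Hypotheses (s0 : 0 < s) (r0 : 0 < r) (sf : sbdd f) (fr : cbox r f).
Local Notation B := (lcomb (lapw R K (sint s)) f).

Let sB : sbdd B := sbdd_lcomb _ sf.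
Let cB : cbox r B := cbox_lcomb _ fr.
Let iB : rint mu B := rint_cbox r0 sB cB.
Let iB2 c : rint mu (dpart [:: c; c] B) := rint_cbox r0 (sbdd_dpart _ sB) (cbox_dpart _ cB).

Lemma LL_rint : rint mu (LL s f).
Proof.
rewrite /LL; case: eqP => [_|/eqP n0]; first exact: iB.
exact: Lop_rint (sfrac_itv s0 n0) sB iB iB2.
Qed.

Lemma LL_chr y th : \int[mu]_x (LL s f x * chr y th x) =
  (1 + 4 * pi ^+ 2 * sqnorm y) `^ (s / 2) * \int[mu]_x (f x * chr y th x).
Proof.
have A1 : 1 <= 1 + 4 * pi ^+ 2 * sqnorm y by rewrite lerDl mulr_ge0 ?sqnorm_ge0 // mulr_ge0 // sqr_ge0.
have A0 : 0 < 1 + 4 * pi ^+ 2 * sqnorm y by rewrite (lt_le_trans _ A1).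
have -> : s / 2 = sfrac s + (sint s)%:R by rewrite /sfrac subrK.
rewrite powRD ?(gt_eqF A0) ?implybT // powR_mulrn ?(ltW A0) // -mulrA -(lapw_chr _ _ _ r0 sf fr).
rewrite /LL; case: eqP => [->|/eqP n0]; first by rewrite powRr0 mul1r.
exact: Lop_chr (sfrac_itv s0 n0) sB iB iB2.
Qed.
End LL.

Definition SW (k : nat) : R := \sum_(i <- lapw R K k) (`|i.1| + 1) + 1.
Lemma SW_gt0 k : 0 < SW k.
Proof. by rewrite ltr_wpDl // sumr_ge0 // => j _; rewrite addr_ge0. Qed.

(** If each derivative costs a factor [lam], then [(1 - Laplacian)^(s/2)] costs [lam^s]. The
    fractional part consumes two derivatives beyond the integer part, hence the bound on word
    length. The constant is fixed before [v], [f] and [lam], which is what uniformity in the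
    dilation rests on. *)
Lemma LL_pint (s : R) : 0 < s -> exists C : R, 0 < C /\ forall v f (r lam b : R),
  1 <= v -> 0 < r -> sbdd f -> cbox r f -> 0 < b -> 1 <= lam ->
  (forall w, (size w <= (sint s).*2.+2)%N -> pint mu v (dpart w f) <= ((lam ^+ size w * b) `^ v)%:E)%E ->
  (pint mu v (LL s f) <= ((C * lam `^ s * b) `^ v)%:E)%E.
Proof.
move=> s0; set k := sint s.
pose C1 := (cal (sfrac s))^-1 * CD R K * Kal (sfrac s) * SW k.
exists (SW k + `|C1|); split; first by rewrite ltr_wpDr // SW_gt0.
move=> v f r lam b v1 r0 sf fr b0 l1 H.
have v0 : 0 <= v by rewrite (le_trans _ v1).
have l0 : 0 < lam by rewrite (lt_le_trans _ l1).
have e0 m : 0 < lam ^+ m by rewrite exprn_gt0.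
have emono m m' : (m <= m')%N -> lam ^+ m <= lam ^+ m' by move=> h; rewrite ler_weXn2l.
have W0 := SW_gt0 k.
have pB : (pint mu v (lcomb (lapw R K k) f) <= ((SW k * (lam ^+ k.*2 * b)) `^ v)%:E)%E.
  apply: pint_lcomb => //; first by rewrite mulr_gt0.
  move=> i /size_lapw si; apply: le_trans (H _ _) _; first by rewrite (leq_trans si) // -addn2 leq_addr.
  by apply: le_powRE => //; [rewrite mulr_ge0 // ltW|rewrite ler_wpM2r ?(ltW b0) // emono].
have s2E : s = 2 * sfrac s + (k.*2)%:R.
  by rewrite /sfrac -/k -mul2n natrM mulrBr mulrCA divff ?mulr1 ?subrK.
have lamE : lam `^ s = (lam ^+ 2) `^ sfrac s * lam ^+ k.*2.
  rewrite {1}s2E powRD ?(gt_eqF l0) ?implybT // powR_mulrn ?(ltW l0) //; congr (_ * _).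
  by rewrite powRrM powR_mulrn ?(ltW l0).
rewrite /LL -/k; case: eqP => [z|/eqP n0].
  apply: le_trans pB _; apply: le_powRE => //; first by rewrite !mulr_ge0 ?ltW.
  by rewrite lamE z powRr0 mul1r mulrA ler_wpM2r ?(ltW b0) // ler_wpM2r ?(ltW (e0 _)) // lerDl.
have h := sfrac_itv s0 n0.
have sB : sbdd (lcomb (lapw R K k) f) := sbdd_lcomb _ sf.
have b'0 : 0 < SW k * (lam ^+ k.*2 * b) by rewrite !mulr_gt0.
have pB2 c : (pint mu v (dpart [:: c; c] (lcomb (lapw R K k) f)) <= ((lam ^+ 2 * (SW k * (lam ^+ k.*2 * b))) `^ v)%:E)%E.
  pose W' := [seq (i.1, c :: c :: i.2) | i <- lapw R K k].
  rewrite (sder_lcomb_dpart _ _ sf.1) (_ : (fun x => _) = lcomb W' f); last first.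
    by apply/funext => x; rewrite /lcomb big_map.
  have -> : lam ^+ 2 * (SW k * (lam ^+ k.*2 * b)) = (\sum_(i <- W') (`|i.1| + 1) + 1) * (lam ^+ k.*2.+2 * b).
    by rewrite big_map /SW [lam ^+ k.*2.+2]exprS [lam ^+ k.*2.+1]exprS /=; ring.
  apply: pint_lcomb => //; first by rewrite mulr_gt0.
  move=> i /mapP[j /size_lapw sj ->]; apply: (le_trans (H (c :: c :: j.2) _)) => //.
  by apply: le_powRE => //; [rewrite mulr_ge0 // ltW|rewrite ler_wpM2r ?(ltW b0) // emono].
apply: le_trans (Lop_pint v1 h b'0 l1 sB pB pB2) _.
have c0 := cal_gt0 h; have K0 := Kal_gt0 (sfrac s); have CD0 := CD_gt0 R K.
have p0 : 0 < (lam ^+ 2) `^ sfrac s by rewrite powR_gt0.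
apply: le_powRE => //.
  by rewrite !mulr_ge0 ?invr_ge0 // ltW.
rewrite lamE (_ : (cal (sfrac s))^-1 * _ = C1 * ((lam ^+ 2) `^ sfrac s * lam ^+ k.*2) * b); last by rewrite /C1; ring.
rewrite ler_wpM2r ?(ltW b0) // ler_wpM2r //; first by rewrite mulr_ge0 // ltW.
by rewrite (le_trans (ler_norm C1)) // lerDr ltW.
Qed.
End klop.

(** * Complex functions and the multiplication formula *)

Section cmeas.
Context d (T : measurableType d) (R : realType).
Definition cmf (g : T -> R[i]) := measurable_fun setT (fun x => cre (g x)) /\ measurable_fun setT (fun x => cim (g x)).

Lemma cmfM g h : cmf g -> cmf h -> cmf (fun x => g x * h x).
Proof.
move=> [g1 g2] [h1 h2]; split.
  rewrite (_ : (fun x => _) = fun x => cre (g x) * cre (h x) - cim (g x) * cim (h x)); last by apply/funext => x; rewrite creM.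
  by apply: measurable_funB; exact: measurable_funM.
rewrite (_ : (fun x => _) = fun x => cre (g x) * cim (h x) + cim (g x) * cre (h x)); last by apply/funext => x; rewrite cimM.
by apply: measurable_funD; exact: measurable_funM.
Qed.

Lemma cmf_cexpi (f : T -> R) : measurable_fun setT f -> cmf (fun x => cexpi (f x)).
Proof. by move=> mf; split; [exact: measurable_cosf|exact: measurable_sinf]. Qed.

Lemma cmf_cR (f : T -> R) : measurable_fun setT f -> cmf (fun x => cR (f x)).
Proof. by move=> mf; split. Qed.
End cmeas.

Lemma cmf_comp d (T : measurableType d) d' (T' : measurableType d') (R : realType) (g : T' -> R[i]) (h : T -> T') :
  cmf g -> measurable_fun setT h -> cmf (fun x => g (h x)).
Proof. by move=> [g1 g2] mh; split; [exact: (measurableT_comp g1)|exact: (measurableT_comp g2)]. Qed.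

Section mult.
Variables (R : realType) (K : finType).
Local Notation E := (fspace R K).
Local Notation mu := (@mu_fspace R K).
Local Notation C := (R[i]).

Lemma cmeasurableP (g : E -> C) : cmf g <-> cmeasurable g.
Proof. by split=> -[h1 h2]; split; exact/rmeasurableP. Qed.

Lemma cint_cmf (g : E -> C) : cint g -> cmf g.
Proof. by move=> [/rint_meas h1 /rint_meas h2]. Qed.

Lemma cint_mul_bdd (g : E -> C) (h : E -> C) : cint g -> cmf h -> (forall x, cabs (h x) <= 1) ->
  cint (fun x => g x * h x).
Proof.
move=> gi mh h1; apply: (cint_dom _ _ (cint_cabs gi)).
  by apply/cmeasurableP; apply: cmfM => //; exact: cint_cmf.
by move=> x; rewrite cabsM ler_piMr // cabs_ge0.
Qed.

Lemma cint_fourier (g : E -> C) (y : E) (a : R) : cint g -> cint (fun x => g x * cexpi (a * dotp x y)).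
Proof.
move=> gi; apply: cint_mul_bdd => //; last by move=> x; rewrite cabs_cexpi.
by apply: cmf_cexpi; apply: measurable_funM => //; exact: measurable_dotp.
Qed.

Lemma dotpC (x y : E) : dotp x y = dotp y x.
Proof. by apply: eq_bigr => k _; rewrite mulrC. Qed.

Lemma rint_prod_dom (F : E * E -> R) (g h : E -> R) : rint mu g -> rint mu h ->
  (forall x, 0 <= g x) -> (forall x, 0 <= h x) -> measurable_fun setT F ->
  (forall z, `|F z| <= g z.1 * h z.2) ->
  [/\ rint (mu \x mu)%E F, forall x, rint mu (fun y => F (x, y)) & forall y, rint mu (fun x => F (x, y))].
Proof.
move=> ig ih g0 h0 mF Fgh; split.
- apply: rint_prod; first exact: mF.
  apply: (@le_lt_trans _ _ (\int[mu]_x ((g x)%:E * \int[mu]_y (h y)%:E))%E).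
    apply: ge0_le_integral => //.
    + by move=> x _; apply: integral_ge0.
    + apply: (@measurable_fun_fubini_tonelli_F _ _ E E R mu (fun w => (`|F w|)%:E)) => //.
      by apply/measurable_EFinP; exact: measurableT_comp.
    + apply: emeasurable_funM => //; apply/measurable_EFinP; exact: rint_meas ig.
    move=> x _; rewrite -ge0_integralZl ?lee_fin //; [|by apply/measurable_EFinP; exact: rint_meas ih|by move=> z _; rewrite lee_fin].
    apply: ge0_le_integral => //.
    + apply/measurable_EFinP; apply: measurableT_comp => //.
      exact: (measurableT_comp mF (measurable_pair1 x)).
    + by apply: measurable_funeM; apply/measurable_EFinP; exact: rint_meas ih.
    by move=> y _; rewrite -EFinM lee_fin; exact: (Fgh (x, y)).
  rewrite ge0_integralZr //.
  + rewrite lte_mul_pinfty //.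
    * by apply: integral_ge0 => x _; rewrite lee_fin.
    * exact: integrable_fin_num ig.
    * by have := integrable_fin_num measurableT ih; rewrite ge0_fin_numE // integral_ge0 // => x _; rewrite lee_fin.
  + by apply/measurable_EFinP; exact: rint_meas ig.
  + by move=> x _; rewrite lee_fin.
  + by apply: integral_ge0 => x _; rewrite lee_fin.
- move=> x; apply: rint_dom (rintZ (g x) ih); last by move=> y; exact: (Fgh (x, y)).
  exact: (measurableT_comp mF (measurable_pair1 x)).
- move=> y; apply: rint_dom (rintZ (h y) ig); last by move=> x; rewrite mulrC; exact: (Fgh (x, y)).
  exact: (measurableT_comp mF (measurable_pair2 y)).
Qed.

Lemma Cint_fubini (H : E * E -> C) (g h : E -> R) : cmf H -> rint mu g -> rint mu h ->
  (forall x, 0 <= g x) -> (forall x, 0 <= h x) ->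
  (forall z, cabs (H z) <= g z.1 * h z.2) ->
  Cint (fun x => Cint (fun y => H (x, y))) = Cint (fun y => Cint (fun x => H (x, y))).
Proof.
move=> [mH1 mH2] ig ih g0 h0 Hgh.
have sw (F : E * E -> R) : measurable_fun setT F -> (forall z, `|F z| <= g z.1 * h z.2) -> rint mu (fun y => \int[mu]_x F (x, y)).
  move=> mF Fgh.
  have [] := @rint_prod_dom (fun z => F (z.2, z.1)) h g ih ig h0 g0.
  - exact: (measurableT_comp mF (@measurable_swap _ _ E E)).
  - by move=> z; rewrite mulrC; exact: (Fgh (z.2, z.1)).
  by move=> iF' i2 _; exact: (rint_fubini_l iF' i2).
have [i1 i1x i1y] := rint_prod_dom ig ih g0 h0 mH1 (fun z => le_trans (cre_le_cabs _) (Hgh z)).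
have [i2 i2x i2y] := rint_prod_dom ig ih g0 h0 mH2 (fun z => le_trans (cim_le_cabs _) (Hgh z)).
have o1 : cint (fun x => Cint (fun y => H (x, y))).
  have e x : Cint (fun y => H (x, y)) = (\int[mu]_y cre (H (x, y))) +i* (\int[mu]_y cim (H (x, y))).
    by rewrite CintE.
  by rewrite (funext e); split => /=; [exact: (rint_fubini_l i1 i1x)|exact: (rint_fubini_l i2 i2x)].
have o2 : cint (fun y => Cint (fun x => H (x, y))).
  have e y : Cint (fun x => H (x, y)) = (\int[mu]_x cre (H (x, y))) +i* (\int[mu]_x cim (H (x, y))).
    by rewrite CintE.
  rewrite (funext e); split => /=.
    exact: (sw (fun z => cre (H z)) mH1 (fun z => le_trans (cre_le_cabs _) (Hgh z))).
  exact: (sw (fun z => cim (H z)) mH2 (fun z => le_trans (cim_le_cabs _) (Hgh z))).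
rewrite (CintE o1) (CintE o2); congr (_ +i* _).
  transitivity (\int[mu]_x \int[mu]_y cre (H (x, y))).
    by apply: eq_Rintegral => x _; rewrite CintE.
  rewrite (Rintegral_fubini i1 i1x i1y).
  by apply: eq_Rintegral => y _; rewrite CintE.
transitivity (\int[mu]_x \int[mu]_y cim (H (x, y))).
  by apply: eq_Rintegral => x _; rewrite CintE.
rewrite (Rintegral_fubini i2 i2x i2y).
by apply: eq_Rintegral => y _; rewrite CintE.
Qed.

Lemma measurable_dotp2 : measurable_fun setT (fun z : E * E => dotp z.1 z.2).
Proof.
apply: measurable_sum => k; apply: measurable_funM.
  exact: (measurableT_comp (measurable_coord k) measurable_fst).
exact: (measurableT_comp (measurable_coord k) measurable_snd).
Qed.

(** Fubini for the product of two integrable functions and a unimodular kernel that is symmetric in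
    its two variables. *)
Lemma fourier_mult (G phi : E -> C) : cint G -> cint phi ->
  Cint (fun x => G x * FT phi x) = Cint (fun y => FT G y * phi y).
Proof.
move=> iG iphi.
pose H (z : E * E) := G z.1 * phi z.2 * cexpi (- (2 * pi) * dotp z.1 z.2).
have h := @Cint_fubini H (fun x => cabs (G x)) (fun y => cabs (phi y)).
have eFT f y : cint f -> FT f y = Cint (fun x => f x * cexpi (- (2 * pi) * dotp x y)).
  by move=> _; congr Cint; apply/funext => x; rewrite mulNr.
rewrite -[LHS](_ : Cint (fun x => Cint (fun y => H (x, y))) = _); last first.
  congr Cint; apply/funext => x; rewrite eFT // -CintZ; last exact: cint_fourier.
  by congr Cint; apply/funext => y; rewrite /H /= dotpC mulrA.
rewrite h.
- congr Cint; apply/funext => y; rewrite eFT // mulrC -CintZ; last exact: cint_fourier.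
  by congr Cint; apply/funext => x; rewrite /H /= mulrCA mulrA.
- apply: cmfM.
    by apply: cmfM; apply: cmf_comp; [exact: cint_cmf| |exact: cint_cmf|].
  by apply: cmf_cexpi; apply: measurable_funM => //; exact: measurable_dotp2.
- exact: cint_cabs.
- exact: cint_cabs.
- by move=> x; exact: cabs_ge0.
- by move=> x; exact: cabs_ge0.
- by move=> z; rewrite /H !cabsM cabs_cexpi mulr1.
Qed.

(** The test identity in [sobnorm]: by the multiplication formula both sides pair [phi] with the
    weight times the transform of [F]. An integrable [G] with the right Fourier transform is thus
    admissible in the infimum. *)
Lemma weight_test (G F phi : E -> C) (w : E -> R) : cint G -> cint F -> cint phi ->
  cint (fun y => cR (w y) * phi y) -> (forall y, FT G y = cR (w y) * FT F y) ->
  Cint (fun x => G x * FT phi x) = Cint (fun x => F x * FT (fun y => cR (w y) * phi y) x).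
Proof.
move=> iG iF iphi iw GF; rewrite fourier_mult // [RHS]fourier_mult //.
by congr Cint; apply/funext => y; rewrite GF mulrCA mulrA.
Qed.

Definition cLL (s : R) (F : E -> C) : E -> C := fun x =>
  LL s (fun x => cre (F x)) x +i* LL s (fun x => cim (F x)) x.

Definition csbdd (F : E -> C) := sbdd (fun x => cre (F x)) /\ sbdd (fun x => cim (F x)).
Definition ccbox (r : R) (F : E -> C) := cbox r (fun x => cre (F x)) /\ cbox r (fun x => cim (F x)).

Lemma FT_chr (g : E -> C) y : cint g -> FT g y =
  (\int[mu]_x (cre (g x) * chr y 0 x) - \int[mu]_x (cim (g x) * chr y (pi / 2) x)) +i*
  (\int[mu]_x (cim (g x) * chr y 0 x) + \int[mu]_x (cre (g x) * chr y (pi / 2) x)).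
Proof.
move=> gi; have [g1 g2] := gi.
have i : cint (fun x => g x * cexpi (- (2 * pi) * dotp x y)) by exact: cint_fourier.
rewrite /FT (_ : (fun x => _) = fun x => g x * cexpi (- (2 * pi) * dotp x y)); last first.
  by apply/funext => x; rewrite mulNr.
rewrite (CintE i); congr (_ +i* _).
  rewrite -RintegralB //; [|exact: rint_chr|exact: rint_chr].
  apply: eq_Rintegral => x _; rewrite creM /cexpi /= /chr addr0 mulNr cosN sinN cosDpihalf; ring.
rewrite -RintegralD //; [|exact: rint_chr|exact: rint_chr].
apply: eq_Rintegral => x _; rewrite cimM /cexpi /= /chr addr0 mulNr cosN sinN cosDpihalf; ring.
Qed.

Lemma cLL_cint (s r : R) F : 0 < s -> 0 < r -> csbdd F -> ccbox r F -> cint (cLL s F).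
Proof. by move=> s0 r0 [F1 F2] [c1 c2]; split => /=; exact: LL_rint s0 r0 _ _. Qed.

Lemma ccbox_cint (r : R) F : 0 < r -> csbdd F -> ccbox r F -> cint F.
Proof. by move=> r0 [F1 F2] [c1 c2]; split => /=; exact: rint_cbox r0 _ _. Qed.

Lemma cplx_scale (A a b c d : R) :
  (A * a - A * b) +i* (A * c + A * d) = cR A * ((a - b) +i* (c + d)) :> C.
Proof. by apply: cplx_eq; rewrite ?creM ?cimM /=; ring. Qed.

Lemma FT_cLL (s r : R) F y : 0 < s -> 0 < r -> csbdd F -> ccbox r F ->
  FT (cLL s F) y = cR ((1 + 4 * pi ^+ 2 * sqnorm y) `^ (s / 2)) * FT F y.
Proof.
move=> s0 r0 sF cF; rewrite FT_chr; last exact: cLL_cint cF.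
rewrite (FT_chr _ (ccbox_cint r0 sF cF)); case: sF cF => [F1 F2] [c1 c2].
rewrite /cLL /= !(LL_chr s0 r0 F1 c1) !(LL_chr s0 r0 F2 c2).
exact: cplx_scale.
Qed.
End mult.

(** * Fourier transforms of Schwartz functions *)

Section schwartz.
Variables (R : realType) (K : finType).
Local Notation E := (fspace R K).
Local Notation mu := (@mu_fspace R K).
Local Notation leb := (@lebesgue_measure R).
Local Notation RT := (measurableTypeR R).
Local Notation C := (R[i]).
Implicit Types (c : K) (f g : E -> R).

Lemma rSchwartz_sbdd f : rSchwartz f -> sbdd f.
Proof.
move=> [h1 h2]; split; first exact: h1.
by move=> s; have [M hM] := h2 s 0%N; exists M => x; have := hM x; rewrite expr0 mul1r.
Qed.

Lemma rint_oneDsqrV : rint leb (fun t : RT => (1 + t ^+ 2)^-1 : R).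
Proof.
pose g (t : RT) : R := (1 + t ^+ 2)^-1 * \1_(`[0, +oo[%classic) t.
have mV : measurable_fun setT ((fun t => (1 + t ^+ 2)^-1 : R) : RT -> R).
  by apply: cont_meas; exact: continuous_oneDsqrV.
have g0 t : 0 <= g t by rewrite mulr_ge0 // invr_ge0 addr_ge0 // sqr_ge0.
have ig : rint leb g.
  apply/integrableP; split.
    by apply/measurable_EFinP; apply: measurable_funM => //; exact: measurable_indic.
  have -> : (\int[leb]_x `|(EFin \o g) x| = \int[leb]_(x in `[0%R, +oo[) ((oneDsqr x)^-1)%:E)%E.
    rewrite [RHS]integral_mkcond; apply: eq_integral => t _ /=; rewrite ger0_norm // patchE /g indicE.
    by case: ifP; rewrite ?mulr1 ?mulr0.
  by rewrite integral0y_oneDsqr ltry.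
have ig' : rint leb (fun t => g (- t)).
  apply: (@transfer_rint _ RT _ RT R leb leb (fun x => - x)) ig.
    by apply: cont_meas; exact: opp_continuous.
  by move=> h h0 mh; exact: ge0_integral_opp.
apply: rint_dom (rintD ig ig') => // t; rewrite ger0_norm; last by rewrite invr_ge0 addr_ge0 // sqr_ge0.
case: (leP 0 t) => t0.
  rewrite (_ : _^-1 = g t) ?lerDl //; rewrite /g indicE mem_set ?mulr1 //=; by rewrite in_itv /= t0.
rewrite (_ : _^-1 = g (- t)) ?lerDr //; rewrite /g sqrrN indicE mem_set ?mulr1 //=.
by rewrite in_itv /= oppr_ge0 ltW.
Qed.

Lemma rint_coord_prod (g : RT -> R) : (forall t, 0 <= g t) -> rint leb g ->
  rint mu (fun x : E => \prod_k g (x k)).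
Proof.
move=> g0 ig; have mg := rint_meas ig.
have mP : measurable_fun setT (fun x : E => \prod_k g (x k)).
  by apply: measurable_prod => k _; exact: (measurableT_comp mg (measurable_coord k)).
have P0 (x : E) : 0 <= \prod_k g (x k) by rewrite prodr_ge0.
apply/integrableP; split; first exact/measurable_EFinP.
rewrite (eq_integral (fun x : E => (\prod_k g (x k))%:E)); last by move=> x _ /=; rewrite ger0_norm.
rewrite -integE; [|by move=> x; rewrite lee_fin|exact/measurable_EFinP].
rewrite (@integ_prod R K (fun=> g)) //.
have e : (\int[leb]_t (g t)%:E = (\int[leb]_t g t)%:E)%E.
  by rewrite fineK //; exact: (integrable_fin_num measurableT ig).
rewrite e.
by rewrite prodEFin ltry.
Qed.

Lemma prod_oneD_le (x : E) : \prod_k (1 + x k ^+ 2) <= (1 + sqnorm x) ^+ #|K|.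
Proof.
rewrite -prodr_const; apply: ler_prod => k _; rewrite addr_ge0 ?sqr_ge0 //=.
by rewrite lerD2l /sqnorm (bigD1 k) //= lerDl sumr_ge0 // => j _; rewrite sqr_ge0.
Qed.

(** The product of the [1 + x_k^2] is at most [(1 + |x|^2)^#|K|], so decay of order [N + #|K|]
    leaves a product of integrable functions of one variable. *)
Lemma rSchwartz_rint f (p : E -> R) (M : R) (N : nat) : rSchwartz f -> measurable_fun setT p ->
  (forall x, `|p x| <= M * (1 + sqnorm x) ^+ N) -> rint mu (fun x => p x * f x).
Proof.
move=> sf mp pM; have [M' hM'] := sf.2 [::] (N + #|K|)%N.
have i0 := rint_coord_prod (fun t => _ : 0 <= (1 + t ^+ 2)^-1) rint_oneDsqrV.
apply: rint_dom (rintZ (`|M| * M') (i0 _)).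
- by apply: measurable_funM => //; apply: sbdd_meas; exact: rSchwartz_sbdd.
- move=> x; have := hM' x; rewrite /= exprD.
  set A := 1 + sqnorm x; have A0 : 0 < A by rewrite ltr_wpDr // sqnorm_ge0.
  set P := \prod_k _; pose Q := \prod_k (1 + x k ^+ 2).
  have Q0 : 0 < Q by apply: prodr_gt0 => k _; rewrite ltr_wpDr // sqr_ge0.
  have PQ : P = Q^-1 by rewrite /P /Q prodfV.
  move=> h; rewrite normrM.
  have h1 : `|p x| <= `|M| * A ^+ N by apply: le_trans (pM x) _; rewrite ler_wpM2r ?exprn_ge0 ?(ltW A0) // ler_norm.
  apply: (@le_trans _ _ (`|M| * A ^+ N * `|f x|)); first by rewrite ler_wpM2r.
  rewrite -!mulrA ler_wpM2l // PQ ler_pdivlMr //; apply: le_trans h.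
  rewrite [leRHS]mulrAC ler_wpM2l ?mulr_ge0 ?exprn_ge0 ?(ltW A0) //.
  exact: prod_oneD_le.
by move=> t; rewrite invr_ge0 addr_ge0 // sqr_ge0.
Qed.

Lemma measurable_sqnorm : measurable_fun setT (fun x : E => sqnorm x).
Proof.
by apply: measurable_sum => k; apply: (measurableT_comp (exprn_measurable 2)); exact: measurable_coord.
Qed.

(** Factor produced when a character is differentiated in [y] along the word [w]; each letter also
    advances the phase by [pi / 2]. *)
Definition moment (w : seq K) (x : E) : R := \prod_(c <- w) (2 * pi * x c).

Lemma measurable_moment w : measurable_fun setT (moment w).
Proof.
apply: measurable_prod => c _; apply: measurable_funM => //; exact: measurable_coord.
Qed.

Lemma moment_le w x : `|moment w x| <= (2 * pi) ^+ size w * (1 + sqnorm x) ^+ size w.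
Proof.
have p0 : 0 <= 2 * pi :> R by rewrite mulr_ge0 // pi_ge0.
elim: w => [|c w IH] /=; first by rewrite /moment big_nil !expr0 normr1 mul1r.
rewrite /moment big_cons normrM !exprS mulrACA; apply: ler_pM => //.
rewrite normrM (ger0_norm p0) ler_wpM2l //.
have h : x c ^+ 2 <= sqnorm x by rewrite /sqnorm (bigD1 c) //= lerDl sumr_ge0 // => j _; rewrite sqr_ge0.
have := sqr_ge0 (`|x c| - 1); rewrite sqrrB expr1n mulr1 real_normK ?num_real //.
have : 0 <= x c ^+ 2 by rewrite sqr_ge0.
lra.
Qed.

Definition moments f := forall w, rint mu (fun x => moment w x * f x).
Lemma rSchwartz_moments f : rSchwartz f -> moments f.
Proof. by move=> sf w; apply: (rSchwartz_rint sf (measurable_moment w)) => x; exact: moment_le. Qed.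

Definition chrint f th (y : E) := \int[mu]_x (f x * chr y th x).

Lemma der_chrint g th c (y : E) (t : R) : rint mu g -> rint mu (fun x => 2 * pi * x c * g x) ->
  is_derive t 1 (fun t => chrint g th (upd y c t)) (chrint (fun x => 2 * pi * x c * g x) (th + pi / 2) (upd y c t)).
Proof.
move=> ig igc.
pose a (x : E) := 2 * pi * dotp x (upd y c 0) + th.
pose cc (x : E) := 2 * pi * x c.
have ma : measurable_fun setT a.
  by apply: measurable_funD => //; apply: measurable_funM => //; exact: measurable_dotp.
have mc : measurable_fun setT cc by apply: measurable_funM => //; exact: measurable_coord.
have igc' : rint mu (fun x => g x * cc x) by apply: eq_rint igc => x; rewrite mulrC.
have dE (x : E) t0 : dotp x (upd y c t0) = dotp x (upd y c 0) + t0 * x c.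
  by rewrite dotpC dotp_upd dotpC.
have := is_derive_int_cos mc ma ig igc' t.
rewrite (_ : (fun t0 => \int[mu]_x (g x * cos (a x + t0 * cc x))) = fun t => chrint g th (upd y c t)); last first.
  apply/funext => t0; apply: eq_Rintegral => x _; rewrite /chr dE /a /cc; congr (_ * cos _); ring.
move=> h; apply: der_eq h _.
have im : rint mu (fun x => g x * cc x * sin (a x + t * cc x)).
  by apply: (rint_sin igc'); apply: measurable_funD => //; exact: measurable_funM.
rewrite -mulN1r -RintegralZl //; apply: eq_Rintegral => x _; rewrite /chr dE addrA cosDpihalf /a /cc.
rewrite (_ : 2 * pi * (dotp x (upd y c 0) + t * x c) + th = 2 * pi * dotp x (upd y c 0) + th + t * (2 * pi * x c)); last ring.
ring.
Qed.

Lemma dpart_chrint f th w : moments f ->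
  dpart w (chrint f th) = chrint (fun x => moment w x * f x) (th + (size w)%:R * (pi / 2)).
Proof.
move=> mf; elim: w => [|c w IH].
  apply/funext => y; rewrite /= mul0r addr0; apply: eq_Rintegral => x _.
  by rewrite /moment big_nil mul1r.
have h x : 2 * pi * x c * (moment w x * f x) = moment (c :: w) x * f x.
  by rewrite /moment big_cons mulrA.
have i2 : rint mu (fun x => 2 * pi * x c * (moment w x * f x)) by apply: eq_rint (mf (c :: w)) => x; rewrite h.
rewrite /= IH; apply/funext => y; rewrite -[y in LHS](upd_id y c) pderivE.
rewrite (der_val (der_chrint _ y (y c) (mf w) i2)) upd_id (funext h); congr chrint.
by rewrite -natr1; ring.
Qed.

Lemma sbdd_chrint f th : moments f -> sbdd (chrint f th).
Proof.
move=> mf; split => [s c x|s]; rewrite dpart_chrint //.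
  apply: der_ex (der_chrint _ x (x c) (mf s) _).
  by apply: eq_rint (mf (c :: s)) => z; rewrite /moment big_cons mulrA.
exists (\int[mu]_x `|moment s x * f x|) => y.
apply: le_trans (le_normr_Rintegral _ (rint_chr _ _ (mf s))) _ => //.
apply: le_Rintegral => //; [exact: rint_abs (rint_chr _ _ (mf s))|exact: rint_abs (mf s)|].
by move=> x _; rewrite normrM ler_piMr // chr_le1.
Qed.

Lemma dpartD f g s : sder f -> sder g -> dpart s (fun x => f x + g x) = fun x => dpart s f x + dpart s g x.
Proof.
move=> sf sg; elim: s => //= c s ->; apply/funext => x.
by rewrite {1}/pderiv (der_val (derD (sder_upd s c x (x c) sf) (sder_upd s c x (x c) sg))) upd_id.
Qed.

Lemma sbddD f g : sbdd f -> sbdd g -> sbdd (fun x => f x + g x).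
Proof.
move=> [sf bf] [sg bg]; split => [s c x|s]; rewrite dpartD //.
  exact: derivableD (sf s c x) (sg s c x).
have [M hM] := bf s; have [M' hM'] := bg s; exists (M + M') => x.
by apply: le_trans (ler_normD _ _) _; apply: lerD; [exact: hM|exact: hM'].
Qed.

Lemma Schwartz_cint (g : E -> C) : Schwartz g -> cint g.
Proof.
move=> [g1 g2]; split.
  apply: eq_rint (rSchwartz_moments g1 [::]) => x; by rewrite /moment big_nil mul1r.
apply: eq_rint (rSchwartz_moments g2 [::]) => x; by rewrite /moment big_nil mul1r.
Qed.

Lemma Schwartz_cint_w (g : E -> C) (w : E -> R) M N : Schwartz g -> measurable_fun setT w ->
  (forall x, `|w x| <= M * (1 + sqnorm x) ^+ N) -> cint (fun x => cR (w x) * g x).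
Proof.
move=> [g1 g2] mw wM; split.
  by apply: eq_rint (rSchwartz_rint g1 mw wM) => x; rewrite creM /cR /= mul0r subr0.
by apply: eq_rint (rSchwartz_rint g2 mw wM) => x; rewrite cimM /cR /= mul0r addr0.
Qed.

Lemma csbdd_FT (g : E -> C) : Schwartz g -> csbdd (FT g).
Proof.
move=> sg; have gi := Schwartz_cint sg; case: sg => g1 g2.
have m1 := rSchwartz_moments g1; have m2 := rSchwartz_moments g2.
have [i1 i2] := gi.
split.
  (* The minus sign of the second integral is absorbed by a phase shift of [pi], so a rule for sums
     is enough. *)
  rewrite (_ : (fun x => cre _) = fun y => chrint (fun x => cre (g x)) 0 y + chrint (fun x => cim (g x)) (pi / 2 + pi) y).
    by apply: sbddD; exact: sbdd_chrint.
  apply/funext => y; rewrite FT_chr //=; congr (_ + _); rewrite -mulN1r /chrint -RintegralZl //; last exact: rint_chr.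
  by apply: eq_Rintegral => x _; rewrite chr_pi; ring.
rewrite (_ : (fun x => cim _) = fun y => chrint (fun x => cim (g x)) 0 y + chrint (fun x => cre (g x)) (pi / 2) y).
  by apply: sbddD; exact: sbdd_chrint.
by apply/funext => y; rewrite FT_chr.
Qed.

Lemma coord_le_enorm (x : E) k : `|x k| <= enorm x.
Proof.
rewrite -sqrtr_sqr /enorm ler_wsqrtr // /sqnorm (bigD1 k) //= lerDl sumr_ge0 // => j _.
by rewrite sqr_ge0.
Qed.

Lemma ccbox_FT (g : E -> C) : (forall eta, FT g eta != 0 -> 1 / 2 <= enorm eta <= 2) -> ccbox 2 (FT g).
Proof.
move=> h; suff z x : outbox 2 x -> FT g x = 0 by split=> x /z ->.
move=> [k xk]; apply/eqP; apply: contraT => /h /andP[_]; rewrite leNgt.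
by rewrite (lt_le_trans xk (coord_le_enorm x k)).
Qed.
End schwartz.

(** * Upper bounds for the multiplier norm *)

Lemma powR_prod (R : realType) (T : Type) (s : seq T) (F : T -> R) (v : R) : (forall t, 0 <= F t) ->
  (\prod_(t <- s) F t) `^ v = \prod_(t <- s) F t `^ v.
Proof.
move=> F0; elim: s => [|t s IH]; first by rewrite !big_nil powR1.
by rewrite !big_cons powRM ?IH // prodr_ge0.
Qed.

Section words.
Variables (R : realType) (K : finType).
Local Notation E := (fspace R K).
Local Notation mu := (@mu_fspace R K).
Implicit Types (f : E -> R).

Lemma words_bound (M : seq K -> R) m : exists S : R, 0 < S /\ forall w, (size w <= m)%N -> M w <= S.
Proof.
pose S := \sum_(k < m.+1) \sum_(t : k.-tuple K) `|M (tval t)|.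
have S0 (P : pred 'I_m.+1) : 0 <= \sum_(k < m.+1 | P k) \sum_(t : k.-tuple K) `|M (tval t)|.
  by apply: sumr_ge0 => k _; exact: sumr_ge0.
exists (S + 1); split; first by rewrite ltr_wpDl // S0.
move=> w wm; apply: le_trans (ler_norm _) _.
have wm' : (size w < m.+1)%N by [].
rewrite /S (bigD1 (Ordinal wm')) //= (bigD1 (in_tuple w)) //= -!addrA lerDl.
by rewrite !addr_ge0 // sumr_ge0.
Qed.

Lemma sbdd_unif f m : sbdd f -> exists M : R, 0 < M /\ forall w, (size w <= m)%N -> bounded (dpart w f) M.
Proof.
move=> [_ bf]; have [M hM] := choice bf; have [S [S0 hS]] := words_bound M m.
by exists S; split => // w wm x; exact: le_trans (hM w x) (hS w wm).
Qed.

Definition boxvol (r v : R) : R := ((r *+ 2) ^+ #|K|) `^ v^-1.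
Lemma boxvol_gt0 r v : 0 < r -> 0 < boxvol r v.
Proof. by move=> r0; rewrite powR_gt0 // exprn_gt0 // mulrn_wgt0. Qed.

Lemma pint_box v r (M : R) f : 0 < v -> 0 < r -> 0 < M -> measurable_fun setT f -> bounded f M ->
  cbox r f -> (pint mu v f <= ((M * boxvol r v) `^ v)%:E)%E.
Proof.
move=> v0 r0 M0 mf fM fr; have V0 : 0 < (r *+ 2) ^+ #|K| by rewrite exprn_gt0 // mulrn_wgt0.
have mb := @measurable_box R K r.
have mi : measurable_fun setT (\1_(@box R K r) : E -> R) by exact: measurable_indic.
apply: (@le_trans _ _ (pint mu v (fun x => M * \1_(@box R K r) x))).
  apply: (pint_le mu (ltW v0) mf); first exact: measurable_funM.
  move=> x; have := cbox_le x fr fM; rewrite (ger0_norm (ltW M0)) => h.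
  by rewrite [leRHS]ger0_norm // mulr_ge0 // ltW.
apply: pintZ; [exact: ltW|exact: ltW|exact: powR_ge0|exact: mi|].
rewrite /boxvol -powRrM mulVf ?gt_eqF // powRr1 ?(ltW V0) // /pint.
rewrite (eq_integral (fun x : E => (\1_(@box R K r) x)%:E)).
  by rewrite integral_indic // setIT; have /= -> := mu_box K r0.
move=> x _; rewrite indicE; case: (x \in _) => /=; rewrite ?normr1 ?powR1 // normr0 powR0 // gt_eqF //.
Qed.

Lemma LL_pint_fin s v r f : 0 < s -> 1 <= v -> 0 < r -> sbdd f -> cbox r f ->
  exists b : R, 0 < b /\ (pint mu v (LL s f) <= (b `^ v)%:E)%E.
Proof.
move=> s0 v1 r0 sf fr; have [C0 [C00 hC]] := @LL_pint R K s s0.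
have v0 : 0 < v by rewrite (lt_le_trans _ v1).
have [M [M0 hM]] := sbdd_unif (sint s).*2.+2 sf.
have b0 : 0 < M * boxvol r v by rewrite mulr_gt0 // boxvol_gt0.
exists (C0 * 1 `^ s * (M * boxvol r v)); split; first by rewrite powR1 mulr1 mulr_gt0.
apply: (hC v f r 1 (M * boxvol r v) v1 r0 sf fr b0 (lexx 1)) => w sw.
rewrite expr1n mul1r; apply: (pint_box v0 r0 M0 _ (hM w sw) (cbox_dpart w fr)).
exact: sbdd_meas (sbdd_dpart w sf).
Qed.

Lemma cpint_le (u a b : R) (G : E -> R[i]) : 1 <= u -> 0 < a -> 0 < b -> cint G ->
  (pint mu u (fun x => cre (G x)) <= (a `^ u)%:E)%E -> (pint mu u (fun x => cim (G x)) <= (b `^ u)%:E)%E ->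
  (integ (fun x => (cabs (G x) `^ u)%:E) <= ((a + b) `^ u)%:E)%E.
Proof.
move=> u1 a0 b0 iG pa pb; have u0 : 0 <= u by rewrite (le_trans _ u1).
have [m1 m2] := cint_cmf iG.
have mG := rint_meas (cint_cabs iG).
have m1' : measurable_fun setT (fun x : E => `|cre (G x)|) by exact: measurableT_comp.
have m2' : measurable_fun setT (fun x : E => `|cim (G x)|) by exact: measurableT_comp.
rewrite integE; [|by move=> x; rewrite lee_fin powR_ge0|]; last first.
  by apply/measurable_EFinP; exact: (measurableT_comp (measurable_powR _) mG).
apply: (@le_trans _ _ (pint mu u (fun x => `|cre (G x)| + `|cim (G x)|))).
  apply: (@le_trans _ _ (pint mu u (fun x => cabs (G x)))).
    apply: le_of_eq; apply: eq_integral => x _.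
    by rewrite ger0_norm // cabs_ge0.
  apply: (pint_le mu u0 mG); first exact: measurable_funD.
  by move=> x; rewrite ger0_norm ?cabs_ge0 // [leRHS]ger0_norm ?addr_ge0 // cabs_le.
apply: (pintD u1 a0 b0 m1' m2').
  by apply: le_trans pa; apply: (pint_le mu u0 m1' m1) => x; rewrite normr_id.
by apply: le_trans pb; apply: (pint_le mu u0 m2' m2) => x; rewrite normr_id.
Qed.
End words.

(** * Factorisation of the multiplier norm over blocks *)

Section tensor.
Variables (R : realType) (l d n : nat).
Local Notation C := (R[i]).
Local Notation K := (ptK l d n).
Local Notation B := ('I_l * 'I_n)%type.
Local Notation E := (fspace R K).
Local Notation EB := (fspace R B).

Definition be (j : 'I_d) (b : B) : K := (b.1, (j, b.2)).
Lemma be_bij : bijective (fun jb : 'I_d * B => be jb.1 jb.2).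
Proof.
exists (fun k : K => (k.2.1, (k.1, k.2.2))); first by case=> j [i k].
by case=> i [j k].
Qed.

Lemma big_blocks (F : K -> R) : \sum_k F k = \sum_j \sum_(b : B) F (be j b).
Proof. by rewrite (reindex (fun jb : 'I_d * B => be jb.1 jb.2)) ?pair_bigA //; exact: onW_bij be_bij. Qed.

Lemma dotp_blocks (x y : E) : dotp x y = \sum_j dotp (vblock x j) (vblock y j).
Proof. by rewrite /dotp big_blocks. Qed.

Lemma sqnorm_blocks (x : E) : sqnorm x = \sum_j sqnorm (vblock x j).
Proof. by rewrite /sqnorm big_blocks. Qed.

Lemma FT_blocks (g : 'I_d -> EB -> C) y : (forall j, cint (g j)) ->
  FT (fun x : E => \prod_j g j (vblock x j)) y = \prod_j FT (g j) (vblock y j).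
Proof.
move=> ig; rewrite /FT.
rewrite -(@Cint_blocks R K 'I_d B be be_bij (fun j b => g j b * cexpi (- (2 * pi * dotp b (vblock y j))))).
  congr Cint; apply/funext => x; rewrite big_split /= -cexpi_sum; congr (_ * cexpi _).
  by rewrite dotp_blocks mulr_sumr sumrN.
move=> j; rewrite (_ : (fun b => _) = fun b => g j b * cexpi (- (2 * pi) * dotp b (vblock y j))).
  exact: cint_fourier.
by apply/funext => b; rewrite mulNr.
Qed.

Definition wt1 (s : R) (y : EB) : R := (1 + 4 * pi ^+ 2 * sqnorm y) `^ (s / 2).

Lemma weightE (s : 'I_d -> R) (y : E) : weight s y = \prod_j wt1 (s j) (vblock y j).
Proof. by []. Qed.

Lemma measurable_weight (s : 'I_d -> R) : measurable_fun setT (fun y : E => weight s y).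
Proof.
apply: measurable_prod => j _; apply: (measurableT_comp (measurable_powR _)).
apply: measurable_funD => //; apply: measurable_funM => //.
exact: (measurableT_comp (@measurable_sqnorm R B) (@measurable_blk R K 'I_d B be j)).
Qed.

Lemma weight_le (s : 'I_d -> R) : exists M N, forall y : E, `|weight s y| <= M * (1 + sqnorm y) ^+ N.
Proof.
pose a : R := 1 + 4 * pi ^+ 2; have a1 : 1 <= a by rewrite lerDl mulr_ge0 // sqr_ge0.
pose N (j : 'I_d) := (Num.truncn (s j / 2)).+1.
exists (\prod_j a ^+ N j), (\sum_j N j)%N => y.
rewrite ger0_norm; last by apply: prodr_ge0 => j _; exact: powR_ge0.
rewrite -prodrXr -big_split /=; apply: ler_prod => j _; rewrite powR_ge0 /= -exprMn.
have A1 (x : EB) : 1 <= 1 + 4 * pi ^+ 2 * sqnorm x by rewrite lerDl mulr_ge0 ?sqnorm_ge0 // mulr_ge0 // sqr_ge0.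
have S1 : sqnorm (vblock y j) <= sqnorm y.
  by rewrite sqnorm_blocks (bigD1 j) //= lerDl sumr_ge0 // => i _; exact: sqnorm_ge0.
apply: (@le_trans _ _ ((1 + 4 * pi ^+ 2 * sqnorm (vblock y j)) `^ (N j)%:R)).
  by rewrite ler_powR // ltW // truncnS_gt.
rewrite powR_mulrn; last by rewrite (le_trans _ (A1 _)).
apply: lerXn2r; rewrite ?nnegrE.
- by rewrite (le_trans _ (A1 _)).
- by rewrite mulr_ge0 ?(le_trans _ a1) // addr_ge0 // sqnorm_ge0.
have p0 : 0 <= 4 * pi ^+ 2 :> R by rewrite mulr_ge0 // sqr_ge0.
have := sqnorm_ge0 y; move: S1 p0; rewrite /a.
move: (sqnorm _) (sqnorm y) (4 * pi ^+ 2) => p q t; nra.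
Qed.

(** Weight, Fourier transform and [L^u] norm all factor over the blocks, so the tensor product of
    the block solutions is admissible in the infimum. *)
Lemma sobnorm_le (u : R) (s : 'I_d -> R) (F G : 'I_d -> EB -> C) :
  (forall j, cint (F j)) -> (forall j, cint (G j)) ->
  (forall j y, FT (G j) y = cR (wt1 (s j) y) * FT (F j) y) ->
  (sobnorm u s (fun xi : E => (\prod_j F j (vblock xi j))%R) <=
   poweR (\prod_j integ (fun x : EB => (cabs (G j x) `^ u)%:E)) u^-1)%E.
Proof.
move=> iF iG GF; apply: ereal_inf_lbound; exists (fun xi : E => \prod_j G j (vblock xi j)).
  have iFt : cint (fun xi : E => \prod_j F j (vblock xi j)) := @cint_blocks R K 'I_d B be be_bij F iF.
  have iGt : cint (fun xi : E => \prod_j G j (vblock xi j)) := @cint_blocks R K 'I_d B be be_bij G iG.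
  split; last split; [|exact: cint_meas|].
    split; first exact: cint_meas.
    have iA := cint_cabs iFt.
    rewrite integE; [|by move=> x; rewrite lee_fin cabs_ge0|by apply/measurable_EFinP; exact: rint_meas iA].
    by have := integrable_fin_num measurableT iA; rewrite ge0_fin_numE // integral_ge0 // => x _; rewrite lee_fin cabs_ge0.
  move=> phi sphi; have [M [N wM]] := weight_le s.
  apply: weight_test => //.
  - exact: Schwartz_cint.
  - exact: (Schwartz_cint_w sphi (measurable_weight s) wM).
  move=> y; rewrite !FT_blocks // weightE cR_prod -big_split /=.
  by apply: eq_bigr => j _; exact: GF.
rewrite /Lpnorm; congr poweR.
rewrite -(@ge0_integ_blocks R K 'I_d B be be_bij (fun j x => cabs (G j x) `^ u)).
- congr integ; apply/funext => x; congr EFin; rewrite cabs_prod.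
  by apply: powR_prod => j; exact: cabs_ge0.
- by move=> j x; exact: powR_ge0.
- by move=> j; apply: (measurableT_comp (measurable_powR _)); exact: rint_meas (cint_cabs (iG j)).
Qed.

Section anorm.
Variables (u : R) (s : 'I_d -> R) (Theta : 'I_d -> EB -> C).
Hypotheses (u1 : 1 < u) (s0 : forall j, 0 < s j) (Ts : forall j, Schwartz (Theta j)).
Hypothesis Tsupp : forall j eta, FT (Theta j) eta != 0 -> 1 / 2 <= enorm eta <= 2.

Lemma cLL_FT_fin j : (integ (fun x : EB => (cabs (cLL (s j) (FT (Theta j)) x) `^ u)%:E) < +oo)%E.
Proof.
have cF := csbdd_FT (Ts j); have bF := ccbox_FT (@Tsupp j).
have [c1 c2] := cF; have [b1 b2] := bF.
have t0 : (0 : R) < 2 by [].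
have [a [a0 pa]] := LL_pint_fin (s0 j) (ltW u1) t0 c1 b1.
have [b [b0 pb]] := LL_pint_fin (s0 j) (ltW u1) t0 c2 b2.
have iG := cLL_cint (s0 j) t0 cF bF.
by apply: le_lt_trans (cpint_le (ltW u1) a0 b0 iG pa pb) _; rewrite ltry.
Qed.

Definition blockF (m0 : EB -> C) (j : 'I_d) (k : int) (x : EB) : C :=
  m0 (fun b => 2 ^ k * x b) * FT (Theta j) x.

(** A block other than [j0] sees only the transform of [Theta j], whatever the dilation, and
    contributes a fixed finite factor. What remains is a bound [D] on block [j0], the same for all
    [k]. *)
Lemma Anorm_le (j0 : 'I_d) : exists CT : R, 0 < CT /\ forall (m0 : EB -> C) (m : E -> C) (D : R),
  (forall xi, m xi = m0 (vblock xi j0)) -> 0 < D ->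
  (forall k : int, exists G0 : EB -> C, [/\ cint (blockF m0 j0 k), cint G0,
     forall y, FT G0 y = cR (wt1 (s j0) y) * FT (blockF m0 j0 k) y &
     (integ (fun x : EB => (cabs (G0 x) `^ u)%:E) <= (D `^ u)%:E)%E]) ->
  (Anorm u s Theta m <= (CT * D)%:E)%E.
Proof.
pose A j := fine (integ (fun x : EB => (cabs (cLL (s j) (FT (Theta j)) x) `^ u)%:E)).
have u0 : 0 < u by rewrite (lt_trans _ u1).
have I0 j : (0 <= integ (fun x : EB => (cabs (cLL (s j) (FT (Theta j)) x) `^ u)%:E))%E.
  by apply: iter_int_ge0 => x; rewrite lee_fin powR_ge0.
have A0 j : 0 <= A j by rewrite fine_ge0.
have P0 : 0 <= \prod_(j | j != j0) A j by apply: prodr_ge0.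
exists ((\prod_(j | j != j0) A j + 1) `^ u^-1); split; first by rewrite powR_gt0 // ltr_wpDl.
move=> m0 m D mE D0 H; apply: ub_ereal_sup => _ [k _ <-].
have [G0 [iF iG FG pG]] := H (k j0).
pose F j := if j == j0 then blockF m0 j0 (k j0) else FT (Theta j).
pose G j := if j == j0 then G0 else cLL (s j) (FT (Theta j)).
have t0 : (0 : R) < 2 by [].
have -> : Fm Theta m k = fun xi : E => \prod_j F j (vblock xi j).
  apply/funext => xi; rewrite /Fm mE [in RHS](bigD1 j0) //= {1}/F eqxx /blockF -mulrA; congr (_ * _).
  rewrite (bigD1 j0) //=; congr (_ * _); apply: eq_bigr => j /negbTE jj; by rewrite /F jj.
apply: (le_trans (@sobnorm_le u s F G _ _ _)).
- move=> j; rewrite /F; case: eqP => // _; exact: ccbox_cint t0 (csbdd_FT (Ts j)) (ccbox_FT (@Tsupp j)).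
- move=> j; rewrite /G; case: eqP => // _; exact: cLL_cint (s0 j) t0 (csbdd_FT (Ts j)) (ccbox_FT (@Tsupp j)).
- move=> j y; rewrite /F /G; case: eqP => [->//|_].
  exact: FT_cLL (s0 j) t0 (csbdd_FT (Ts j)) (ccbox_FT (@Tsupp j)).
set P := \prod_(j | j != j0) A j in P0 *.
have H1 : (\prod_j integ (fun x : EB => (cabs (G j x) `^ u)%:E) <= ((P + 1) * D `^ u)%:E)%E.
  rewrite (bigD1 j0) //= {1}/G eqxx.
  rewrite (eq_bigr (fun j => (A j)%:E)); last first.
    move=> j /negbTE jj; rewrite /G jj /A fineK // ge0_fin_numE //; exact: cLL_FT_fin.
  rewrite prodEFin -/P muleC EFinM; apply: lee_pmul => //.
  - by apply: iter_int_ge0 => x; rewrite lee_fin powR_ge0.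
  - by rewrite lee_fin lerDl.
apply: (@le_trans _ _ (poweR (((P + 1) * D `^ u)%:E) u^-1)).
  apply: gt0_ler_poweR => //.
  - by rewrite invr_ge0 ltW.
  - rewrite in_itv /= leey andbT; apply: prode_ge0 => j _.
    by apply: iter_int_ge0 => x; rewrite lee_fin powR_ge0.
  - by rewrite in_itv /= leey andbT lee_fin mulr_ge0 ?powR_ge0 // addr_ge0.
rewrite poweR_EFin powRM ?powR_ge0 ?addr_ge0 // -powRrM mulfV ?gt_eqF // (powRr1 (ltW D0)).
exact: lexx.
Qed.
End anorm.
End tensor.

(** * Derivatives of exponentials of quadratic forms *)

Section annulus.
Variables (R : realType) (K : finType).
Local Notation E := (fspace R K).
Implicit Types (f : E -> R).

Lemma sqr_coord_le (x : E) k : x k ^+ 2 <= sqnorm x.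
Proof. by rewrite /sqnorm (bigD1 k) //= lerDl sumr_ge0 // => j _; rewrite sqr_ge0. Qed.

Definition ann : set E := [set x | 1 / 4 <= sqnorm x <= 4].

Lemma measurable_ann : measurable ann.
Proof.
have := @measurable_sqnorm R K measurableT `[1 / 4, 4]%classic (measurable_itv _).
rewrite setTI; congr measurable; apply/seteqP; split => x /=; rewrite in_itv //.
Qed.

Lemma sqnorm_upd (x : E) c t : sqnorm (upd x c t) = sqnorm (upd x c 0) + t ^+ 2.
Proof.
rewrite /sqnorm (bigD1 c) //= [X in _ = X + _](bigD1 c) //= /upd !eqxx expr0n add0r addrC; congr (_ + _).
by apply: eq_bigr => k /negbTE ->.
Qed.

Lemma nann_near x c : ~ ann x -> \forall t \near x c, ~ ann (upd x c t).
Proof.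
move=> nx.
have cq : continuous (fun t : R => sqnorm (upd x c 0) + t ^+ 2).
  exact: (derive_cont (fun t : R => derD (der_cst _ _) (der_X 1 (der_id t)))).
have e : sqnorm (upd x c 0) + x c ^+ 2 = sqnorm x by rewrite -sqnorm_upd upd_id.
have [h|h] : sqnorm x < 1 / 4 \/ 4 < sqnorm x.
  case: (ltP (sqnorm x) (1 / 4)) => h; first by left.
  by right; rewrite ltNge; apply/negP => h'; apply: nx; rewrite /ann /= h h'.
  rewrite -e in h; near=> t; rewrite /ann /= sqnorm_upd => /andP[h1 _]; move: h1; apply/negP; rewrite -ltNge.
  near: t; exact: (cvgr_lt _ (cq (x c)) _ h).
rewrite -e in h; near=> t; rewrite /ann /= sqnorm_upd => /andP[_ h1]; move: h1; apply/negP; rewrite -ltNge.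
near: t; exact: (cvgr_gt _ (cq (x c)) _ h).
Unshelve. all: by end_near. Qed.

Definition aoff f := forall x, ~ ann x -> f x = 0.

Lemma aoff_dpart f w : aoff f -> aoff (dpart w f).
Proof.
move=> h; elim: w => //= c w IH x nx; apply: (pderiv_loc IH); exact: nann_near.
Qed.

Lemma aoff_cbox f : aoff f -> cbox 2 f.
Proof.
move=> h x [k xk]; apply: h; rewrite /ann /= => /andP[_ x4].
have := le_trans (sqr_coord_le x k) x4; rewrite -real_normK ?num_real //.
by move: xk; move: `|x k| => a; nra.
Qed.

Lemma ann_FT (g : E -> R[i]) : (forall eta, FT g eta != 0 -> 1 / 2 <= enorm eta <= 2) ->
  aoff (fun x => cre (FT g x)) /\ aoff (fun x => cim (FT g x)).
Proof.
move=> h; suff z x : ~ ann x -> FT g x = 0 by split=> x /z ->.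
move=> nx; apply/eqP; apply: contraT => /h /andP[h1 h2]; exfalso; apply: nx.
have e0 : 0 <= enorm x by rewrite sqrtr_ge0.
rewrite /ann /=; have <- : enorm x ^+ 2 = sqnorm x by rewrite /enorm sqr_sqrtr // sqnorm_ge0.
move: h1 h2 e0; move: (enorm x) => a *; apply/andP; split; nra.
Qed.
End annulus.

Lemma der_sum (R : realType) (T : Type) (s : seq T) (F : T -> R -> R) (dF : T -> R) (t : R) :
  (forall i, is_derive t 1 (F i) (dF i)) -> is_derive t 1 (fun t => \sum_(i <- s) F i t) (\sum_(i <- s) dF i).
Proof.
move=> h; elim: s => [|i s IH].
  rewrite big_nil (_ : (fun t => _) = fun=> 0); last by apply/funext => z; rewrite big_nil.
  exact: der_cst.
rewrite big_cons (_ : (fun t => _) = fun t => F i t + \sum_(j <- s) F j t); last by apply/funext => z; rewrite big_cons.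
exact: derD.
Qed.

Section quad.
Variables (R : realType) (K : finType).
Local Notation E := (fspace R K).
(** An item [(a, w, c)] stands for [a (x.w - c)^2]. Lists of items encode the quadratic polynomials
    of exponents and phases; [qd] and [qh] are their first and second derivatives. *)
Definition qitem := (R * (K -> R) * R)%type.
Implicit Types (L : seq qitem) (i : qitem).

Definition lin i (x : E) : R := dotp x i.1.2 - i.2.
Definition qf L (x : E) : R := \sum_(i <- L) i.1.1 * lin i x ^+ 2.
Definition qd L c (x : E) : R := \sum_(i <- L) i.1.1 * (2 * lin i x * i.1.2 c).
Definition qh L (c' c : K) : R := \sum_(i <- L) i.1.1 * (2 * i.1.2 c * i.1.2 c').

Lemma der_lin i x c (t : R) : is_derive t 1 (fun t => lin i (upd x c t)) (i.1.2 c).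
Proof.
rewrite /lin (_ : (fun t => _) = fun t => dotp (upd x c 0) i.1.2 + t * i.1.2 c - i.2).
  by apply: der_eq (derB (derD (der_cst _ _) (derM (der_id _) (der_cst _ _))) (der_cst _ _)) _; ring.
by apply/funext => z; rewrite dotp_upd.
Qed.

Lemma der_qf L x c (t : R) : is_derive t 1 (fun t => qf L (upd x c t)) (qd L c (upd x c t)).
Proof.
rewrite /qf /qd; apply: (@der_sum R qitem L (fun i t => i.1.1 * lin i (upd x c t) ^+ 2)
  (fun i => i.1.1 * (2 * lin i (upd x c t) * i.1.2 c))) => i.
apply: der_eq (derM (der_cst _ _) (der_X 1 (der_lin i x c t))) _.
by rewrite expr1; ring.
Qed.

Lemma der_qd L c' x c (t : R) : is_derive t 1 (fun t => qd L c' (upd x c t)) (qh L c' c).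
Proof.
rewrite /qd /qh; apply: (@der_sum R qitem L (fun i t => i.1.1 * (2 * lin i (upd x c t) * i.1.2 c'))
  (fun i => i.1.1 * (2 * i.1.2 c * i.1.2 c'))) => i.
apply: der_eq (derM (der_cst _ _) (derM (derM (der_cst _ _) (der_lin i x c t)) (der_cst _ _))) _.
ring.
Qed.

Variables (Lq Lp : seq qitem) (th : R) (T : E -> R).
Hypothesis sT : sbdd T.

(** Real form of [exp(- Q + i P)]. A derivative multiplies by [- dQ], or multiplies by [dP] and
    raises [j], so the family is closed up to polynomial factors. *)
Definition Ee (j : nat) (x : E) : R := expR (- qf Lq x) * cos (qf Lp x + th + j%:R * (pi / 2)).

Lemma der_Ee j x c (t : R) : is_derive t 1 (fun t => Ee j (upd x c t))
  (- qd Lq c (upd x c t) * Ee j (upd x c t) + qd Lp c (upd x c t) * Ee j.+1 (upd x c t)).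
Proof.
have d1 : is_derive t 1 (fun t => expR (- qf Lq (upd x c t))) (expR (- qf Lq (upd x c t)) * - qd Lq c (upd x c t)).
  rewrite (_ : (fun t => _) = fun t => expR (0 - qf Lq (upd x c t))); last by apply/funext => z; rewrite sub0r.
  by apply: der_eq (der_exp (derB (der_cst _ _) (der_qf Lq x c t))) _; rewrite !sub0r.
have d2 := der_cos (derD (derD (der_qf Lp x c t) (der_cst t th)) (der_cst t (j%:R * (pi / 2)))).
apply: der_eq (derM d1 d2) _.
have e : qf Lp (upd x c t) + th + j.+1%:R * (pi / 2) = qf Lp (upd x c t) + th + j%:R * (pi / 2) + pi / 2.
  by rewrite -natr1; ring.
rewrite /Ee e cosDpihalf; ring.
Qed.

(** Symbolic polynomial factor: the boolean selects the exponent or the phase, one letter means a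
    first derivative, two letters a second one. Third derivatives of a quadratic vanish, so these
    symbols suffice. *)
Definition gen := (bool * K * option K)%type.
Definition geval (g : gen) (x : E) : R :=
  match g with
  | (true, c, None) => - qd Lq c x
  | (false, c, None) => qd Lp c x
  | (true, c, Some c') => - qh Lq c c'
  | (false, c, Some c') => qh Lp c c'
  end.
Definition gsev (gs : seq gen) (x : E) : R := \prod_(g <- gs) geval g x.
Lemma gsev_cons g gs x : gsev (g :: gs) x = geval g x * gsev gs x.
Proof. by rewrite /gsev big_cons. Qed.

Fixpoint gder (c : K) (gs : seq gen) : seq (seq gen) :=
  match gs with
  | [::] => [::]
  | g :: gs' => (if g.2 is None then [:: (g.1, Some c) :: gs'] else [::]) ++ [seq g :: h | h <- gder c gs']
  end.

Lemma der_geval g x c (t : R) : is_derive t 1 (fun t => geval g (upd x c t))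
  (if g.2 is None then geval (g.1, Some c) (upd x c t) else 0).
Proof.
case: g => [[[] c1] [c2|]] /=; [exact: der_cst| |exact: der_cst|exact: der_qd].
rewrite (_ : (fun t => _) = fun t => 0 - qd Lq c1 (upd x c t)); last by apply/funext => z; rewrite sub0r.
by apply: der_eq (derB (der_cst _ _) (der_qd Lq c1 x c t)) _; rewrite sub0r.
Qed.

Lemma der_gsev gs x c (t : R) : is_derive t 1 (fun t => gsev gs (upd x c t))
  (\sum_(h <- gder c gs) gsev h (upd x c t)).
Proof.
elim: gs => [|g gs IH].
  rewrite big_nil (_ : (fun t => _) = fun=> 1); last by apply/funext => z; rewrite /gsev big_nil.
  exact: der_cst.
rewrite (_ : (fun t => _) = fun t => geval g (upd x c t) * gsev gs (upd x c t)); last first.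
  by apply/funext => z; rewrite /gsev big_cons.
apply: der_eq (derM (der_geval g x c t) IH) _.
rewrite /= big_cat big_map /=; congr (_ + _).
  by case: g => [[b c1] [c2|]] /=; rewrite ?big_nil ?mul0r // big_seq1 /gsev big_cons.
by rewrite mulr_sumr; apply: eq_bigr => h _; rewrite /gsev big_cons.
Qed.

(** Phase index of [Ee], list of polynomial factors, and word applied to the cutoff [T]. *)
Definition term := (nat * seq gen * seq K)%type.
Definition teval (a : term) (x : E) : R := Ee a.1.1 x * gsev a.1.2 x * dpart a.2 T x.
Definition tder (c : K) (a : term) : seq term :=
  [:: (a.1.1, (true, c, None) :: a.1.2, a.2), (a.1.1.+1, (false, c, None) :: a.1.2, a.2), (a.1, c :: a.2)
   & [seq (a.1.1, h, a.2) | h <- gder c a.1.2]].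

Lemma der_teval a x c (t : R) : is_derive t 1 (fun t => teval a (upd x c t))
  (\sum_(b <- tder c a) teval b (upd x c t)).
Proof.
have := derM (derM (der_Ee a.1.1 x c t) (der_gsev a.1.2 x c t)) (sder_upd a.2 c x t sT.1).
move=> h; apply: der_eq h _; rewrite /tder !big_cons big_map /teval /= !gsev_cons /=.
rewrite [in RHS](eq_bigr (fun h => Ee a.1.1 (upd x c t) * dpart a.2 T (upd x c t) * gsev h (upd x c t))); last by move=> h _; rewrite mulrAC.
by rewrite -mulr_sumr; ring.
Qed.

Fixpoint terms (w : seq K) : seq term :=
  if w is c :: w' then flatten [seq tder c a | a <- terms w'] else [:: (0%N, [::], [::])].

Definition EF (x : E) : R := Ee 0 x * T x.

Lemma dpart_EF w : dpart w EF = fun x => \sum_(a <- terms w) teval a x.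
Proof.
elim: w => [|c w IH].
  by apply/funext => x; rewrite /= big_seq1 /teval /EF /gsev big_nil mulr1.
rewrite /= IH; apply/funext => x; rewrite /pderiv.
have d : is_derive (x c) 1 (fun t => \sum_(a <- terms w) teval a (upd x c t))
   (\sum_(a <- terms w) \sum_(b <- tder c a) teval b (upd x c (x c))).
  exact: (@der_sum R term (terms w) (fun a t => teval a (upd x c t)) (fun a => \sum_(b <- tder c a) teval b (upd x c (x c)))
     (x c) (fun a => der_teval a x c (x c))).
by rewrite (der_val d) big_flatten big_map /= upd_id.
Qed.

Lemma sder_EF : sder EF.
Proof.
move=> s c x; rewrite dpart_EF.
exact: der_ex (@der_sum R term (terms s) (fun a t => teval a (upd x c t)) (fun a => \sum_(b <- tder c a) teval b (upd x c (x c)))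
     (x c) (fun a => der_teval a x c (x c))).
Qed.

Definition gdeg (g : gen) : nat := if g.2 is None then 1 else 2.
Definition tdeg (a : term) : nat := (\sum_(g <- a.1.2) gdeg g + size a.2)%N.

Lemma gder_deg c gs h : h \in gder c gs -> (\sum_(g <- h) gdeg g = (\sum_(g <- gs) gdeg g).+1)%N.
Proof.
elim: gs h => //= g gs IH h; rewrite mem_cat => /orP[|/mapP[h' /IH e ->]].
  case: g => [g' [c'|]] //=; rewrite inE => /eqP ->; by rewrite !big_cons /gdeg /= addSn add1n.
by rewrite !big_cons e addnS.
Qed.

(** Every derivative is spent exactly once: on the exponential, creating a first order factor; on
    such a factor, raising its order; or on the cutoff. Hence no term contains more than [size w]
    powers of [lam]. *)
Lemma terms_deg w a : a \in terms w -> tdeg a = size w.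
Proof.
elim: w a => [|c w IH] a /=; first by rewrite inE => /eqP ->; rewrite /tdeg big_nil.
move=> /flattenP[_ /mapP[b /IH e ->]]; rewrite /tder !inE => /or4P[/eqP->|/eqP->|/eqP->|/mapP[h /gder_deg hd ->]];
  rewrite -e /tdeg /= ?big_cons ?hd ?addnS ?addSn ?add0n //.
Qed.

Lemma size_gs (gs : seq gen) : (size gs <= \sum_(g <- gs) gdeg g)%N.
Proof.
elim: gs => //= g gs IH; rewrite big_cons -add1n leq_add //.
by case: g => [g' [c'|]].
Qed.

Variables (lam c0 : R) (Y : E -> R).
Hypotheses (l1 : 1 <= lam) (c01 : 1 <= c0).
Hypothesis Y0 : forall x, 0 <= Y x.
Hypothesis Qge : forall x, ann x -> 2 * Y x <= qf Lq x.
Hypothesis Qd : forall x c, ann x -> `|qd Lq c x| <= lam * (c0 * (1 + Y x)).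
Hypothesis Pd : forall x c, ann x -> `|qd Lp c x| <= lam * (c0 * (1 + Y x)).
Hypothesis Qh : forall x c c', ann x -> `|qh Lq c c'| <= lam ^+ 2 * (c0 * (1 + Y x)).
Hypothesis Ph : forall x c c', ann x -> `|qh Lp c c'| <= lam ^+ 2 * (c0 * (1 + Y x)).

Lemma geval_le g x : ann x -> `|geval g x| <= lam ^+ gdeg g * (c0 * (1 + Y x)).
Proof.
by move=> ax; case: g => [[[] c1] [c2|]] /=; rewrite ?normrN ?expr1; auto.
Qed.

Lemma gsev_le gs x : ann x -> `|gsev gs x| <= lam ^+ (\sum_(g <- gs) gdeg g) * (c0 * (1 + Y x)) ^+ size gs.
Proof.
move=> ax; have z0 : 0 <= c0 * (1 + Y x) by rewrite mulr_ge0 ?addr_ge0 ?Y0 // (le_trans _ c01).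
elim: gs => [|g gs IH]; first by rewrite /gsev !big_nil normr1 !expr0 mulr1.
rewrite /gsev !big_cons normrM exprD exprS mulrACA; apply: ler_pM => //; exact: geval_le.
Qed.

(** Raise [1 + y / k <= exp (y / k)] to the power [k]. *)
Lemma expX_le (y : R) k : 0 <= y -> (1 + y) ^+ k <= (k ^ k)%:R * expR y.
Proof.
move=> y0; case: k => [|k]; first by rewrite expr0 expn0 mul1r -[leLHS]expR0 ler_expR.
have k0 : 0 < k.+1%:R :> R by rewrite ltr0n.
have -> : expR y = expR (y / k.+1%:R) ^+ k.+1.
  by rewrite -expRM_natl mulrC divfK // gt_eqF.
rewrite natrX -exprMn; apply: lerXn2r; rewrite ?nnegrE ?addr_ge0 ?mulr_ge0 ?expR_ge0 //.
apply: (@le_trans _ _ (k.+1%:R * (1 + y / k.+1%:R))); last by rewrite ler_wpM2l ?(ltW k0) // expR_ge1Dx.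
by rewrite mulrDr mulr1 mulrCA divff ?gt_eqF // mulr1 lerD2r ler1n.
Qed.

(** Of the decay [exp(- 2 Y)], one half absorbs the powers of [1 + Y] coming from the polynomial
    factors and the other half remains. *)
Lemma teval_le w a x M : ann x -> a \in terms w -> `|dpart a.2 T x| <= M ->
  `|teval a x| <= lam ^+ size w * (c0 ^+ size w * ((size w ^ size w)%:R) * M * expR (- Y x)).
Proof.
move=> ax aw TM; have dg := terms_deg aw.
have l0 : 0 < lam by rewrite (lt_le_trans _ l1).
have y0 := Y0 x; have c00 : 0 < c0 by rewrite (lt_le_trans _ c01).
have z1 : 1 <= c0 * (1 + Y x) by rewrite -[leLHS]mulr1 ler_pM // lerDl.
have z0 : 0 <= c0 * (1 + Y x) by rewrite (le_trans _ z1).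
rewrite /teval 2!normrM.
have h1 : `|Ee a.1.1 x| <= expR (- (2 * Y x)).
  rewrite /Ee normrM (ger0_norm (expR_ge0 _)) -[leRHS]mulr1; apply: ler_pM; rewrite ?expR_ge0 //.
    by rewrite ler_expR lerN2; exact: Qge.
  by rewrite ler_norml cos_geN1 cos_le1.
have h2 : `|gsev a.1.2 x| <= lam ^+ size w * (c0 ^+ size w * ((size w ^ size w)%:R * expR (Y x))).
  apply: le_trans (gsev_le _ ax) _; apply: ler_pM; rewrite ?exprn_ge0 ?(ltW l0) //.
    by rewrite ler_weXn2l // -dg /tdeg leq_addr.
  apply: (@le_trans _ _ ((c0 * (1 + Y x)) ^+ size w)).
    by rewrite ler_weXn2l // -dg /tdeg (leq_trans (size_gs _)) // leq_addr.
  by rewrite exprMn ler_wpM2l ?exprn_ge0 ?(ltW c00) // expX_le.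
apply: (@le_trans _ _ (expR (- (2 * Y x)) * (lam ^+ size w * (c0 ^+ size w * ((size w ^ size w)%:R * expR (Y x)))) * M)).
  by rewrite ler_pM ?mulr_ge0 // ler_pM.
rewrite (_ : expR (- Y x) = expR (- (2 * Y x)) * expR (Y x)); last by rewrite -expRD; congr expR; ring.
by apply: le_of_eq; ring.
Qed.
End quad.

Lemma sum_seq_le (R : realType) (T : eqType) (s : seq T) (F : T -> R) (X : R) :
  (forall a, a \in s -> F a <= X) -> \sum_(a <- s) F a <= (size s)%:R * X.
Proof.
elim: s => [|a s IH] h; first by rewrite big_nil mul0r.
rewrite big_cons /= -natr1 mulrDl mul1r addrC; apply: lerD; last by apply: h; rewrite inE eqxx.
by apply: IH => b bs; apply: h; rewrite inE bs orbT.
Qed.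

Section efll.
Variables (R : realType) (K : finType).
Local Notation E := (fspace R K).
Local Notation mu := (@mu_fspace R K).
Local Notation C := (R[i]).
Implicit Types (f T : E -> R) (L : seq (qitem R K)).

(** [lam] is the cost of a derivative, up to factors [1 + Y] that the exponential absorbs. The
    conditions are imposed on the annulus because everything is multiplied by a cutoff supported
    there. *)
Definition qcond (Lq Lp : seq (qitem R K)) (lam c0 : R) (Y : E -> R) :=
  [/\ 1 <= lam, measurable_fun setT Y, forall x, 0 <= Y x, forall x, ann x -> 2 * Y x <= qf Lq x &
   [/\ forall x c, ann x -> `|qd Lq c x| <= lam * (c0 * (1 + Y x)),
     forall x c, ann x -> `|qd Lp c x| <= lam * (c0 * (1 + Y x)),
     forall x c c', ann x -> `|qh Lq c c'| <= lam ^+ 2 * (c0 * (1 + Y x)) &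
     forall x c c', ann x -> `|qh Lp c c'| <= lam ^+ 2 * (c0 * (1 + Y x))]].

Definition annY (Y : E -> R) (x : E) : R := \1_(@ann R K) x * expR (- Y x).

(** The constant depends only on [s], [c0] and the cutoff. The quadratic forms, and with them the
    dilation, enter through [lam] and the norm of [annY Y] alone. *)
Lemma EF_LL (s c0 : R) T : 0 < s -> 1 <= c0 -> sbdd T -> aoff T ->
  exists C0 : R, 0 < C0 /\ forall Lq Lp th lam Y, qcond Lq Lp lam c0 Y ->
   [/\ sbdd (EF Lq Lp th T), aoff (EF Lq Lp th T) & forall v b, 1 <= v -> 0 < b ->
     (pint mu v (annY Y) <= (b `^ v)%:E)%E ->
     (pint mu v (LL s (EF Lq Lp th T)) <= ((C0 * lam `^ s * b) `^ v)%:E)%E].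
Proof.
move=> s0 c01 sT aT; have [C0 [C00 hC]] := @LL_pint R K s s0.
have [M hM] := choice (fun m => sbdd_unif m sT).
pose D (w : seq K) : R := (size (terms w))%:R * (c0 ^+ size w * ((size w ^ size w)%:R) * M (size w)).
have [S [S0 hS]] := words_bound D (sint s).*2.+2.
exists (C0 * S); split; first exact: mulr_gt0.
move=> Lq Lp th lam Y [l1 mY Y0 Qge [Qd Pd Qh Ph]].
have l0 : 0 < lam by rewrite (lt_le_trans _ l1).
have sF : sder (EF Lq Lp th T) by exact: sder_EF.
have aF : aoff (EF Lq Lp th T) by move=> x nx; rewrite /EF aT // mulr0.
have key w x : `|dpart w (EF Lq Lp th T) x| <= lam ^+ size w * D w * annY Y x.
  have [ax|nx] := pselect (ann x); last first.
    by rewrite (aoff_dpart w aF nx) normr0 /annY indicE memNset // mul0r mulr0.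
  rewrite /annY indicE mem_set // mul1r (dpart_EF _ _ _ sT).
  apply: le_trans (ler_norm_sum _ _ _) _.
  rewrite (_ : _ * D w * _ = (size (terms w))%:R *
    (lam ^+ size w * (c0 ^+ size w * (size w ^ size w)%:R * M (size w) * expR (- Y x)))); last by rewrite /D; ring.
  apply: sum_seq_le => a aw.
  apply: (@teval_le R K Lq Lp th T lam c0 Y l1 c01 Y0 Qge Qd Pd Qh Ph w a x (M (size w)) ax aw).
  have [_ hT] := hM (size w); apply: hT; have := terms_deg aw; rewrite /tdeg => <-.
  exact: leq_addl.
have D0 w : 0 <= D w.
  by have [M0 _] := hM (size w); rewrite !mulr_ge0 ?exprn_ge0 ?(le_trans _ c01) // ltW.
have Y1 x : annY Y x <= 1.
  rewrite /annY indicE; case: (x \in _); rewrite ?mul0r ?mul1r //.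
  by rewrite -[leRHS]expR0 ler_expR oppr_le0.
have mA : measurable_fun setT (annY Y).
  apply: measurable_funM; first by apply: measurable_indic; exact: measurable_ann.
  apply: (measurableT_comp (@measurable_expR R)); exact: measurableT_comp.
have A0 x : 0 <= annY Y x by rewrite mulr_ge0 // expR_ge0.
have sbF : sbdd (EF Lq Lp th T).
  split; first exact: sF.
  move=> w; exists (lam ^+ size w * D w) => x; apply: le_trans (key w x) _.
  by rewrite ler_piMr // mulr_ge0 // exprn_ge0 // ltW.
split => // v b v1 b0 pA; have v0 : 0 <= v by rewrite (le_trans _ v1).
have b'0 : 0 < S * b by exact: mulr_gt0.
rewrite (_ : C0 * S * lam `^ s * b = C0 * lam `^ s * (S * b)); last ring.
apply: (hC v _ 2 lam (S * b) v1 _ sbF (aoff_cbox aF) b'0 l1) => // w sw.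
apply: (@le_trans _ _ (pint mu v (fun x => lam ^+ size w * S * annY Y x))).
  apply: (pint_le mu v0); [exact: sbdd_meas (sbdd_dpart w sbF)|exact: measurable_funM|].
  move=> x; rewrite [leRHS]ger0_norm; last by rewrite !mulr_ge0 ?exprn_ge0 // ltW.
  by apply: le_trans (key w x) _; rewrite ler_wpM2r // ler_wpM2l ?exprn_ge0 ?(ltW l0) // hS.
rewrite mulrA; apply: (pintZ v0 _ (ltW b0) mA pA).
by rewrite mulr_ge0 ?exprn_ge0 // ltW.
Qed.

(* F and its image G under the Fourier multiplier (1 + 4 pi^2 |y|^2)^(s/2) *)
Definition GP (s : R) (F G : E -> C) :=
  [/\ cint F, cint G & forall y, FT G y = cR ((1 + 4 * pi ^+ 2 * sqnorm y) `^ (s / 2)) * FT F y].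

Lemma cintD (F G : E -> C) : cint F -> cint G -> cint (fun x => F x + G x).
Proof.
move=> [f1 f2] [g1 g2]; split.
  by apply: (eq_rint (fun x => esym (creD _ _))); exact: rintD.
by apply: (eq_rint (fun x => esym (cimD _ _))); exact: rintD.
Qed.

Lemma FT_add (F G : E -> C) y : cint F -> cint G -> FT (fun x => F x + G x) y = FT F y + FT G y.
Proof.
move=> iF iG; rewrite /FT.
have e (H : E -> C) : (fun x => H x * cexpi (- (2 * pi * dotp x y))) = (fun x => H x * cexpi (- (2 * pi) * dotp x y)).
  by apply/funext => x; rewrite mulNr.
rewrite -CintD; [|by rewrite e; exact: cint_fourier|by rewrite e; exact: cint_fourier].
by congr Cint; apply/funext => x; rewrite mulrDl.
Qed.

Lemma FT_scale (a : C) (F : E -> C) y : cint F -> FT (fun x => a * F x) y = a * FT F y.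
Proof.
move=> iF; rewrite /FT -CintZ; last first.
  rewrite (_ : (fun x => _) = (fun x => F x * cexpi (- (2 * pi) * dotp x y))); first exact: cint_fourier.
  by apply/funext => x; rewrite mulNr.
by congr Cint; apply/funext => x; rewrite mulrA.
Qed.

Lemma GP_add s F G F' G' : GP s F G -> GP s F' G' -> GP s (fun x => F x + F' x) (fun x => G x + G' x).
Proof.
move=> [h1 h2 h3] [k1 k2 k3]; split; [exact: cintD|exact: cintD|].
by move=> y; rewrite !FT_add // h3 k3 mulrDr.
Qed.

Lemma GP_scale s a F G : GP s F G -> GP s (fun x => a * F x) (fun x => a * G x).
Proof.
move=> [h1 h2 h3]; split; [exact: cintZ|exact: cintZ|].
by move=> y; rewrite !FT_scale // h3 mulrCA.
Qed.

Lemma GP_real s f : 0 < s -> sbdd f -> cbox 2 f -> GP s (fun x => cR (f x)) (fun x => cR (LL s f x)).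
Proof.
move=> s0 sf bf; have t0 : (0 : R) < 2 by [].
have z : rint mu (fun=> 0 : R) by have := rintZ 0 (rint_cbox t0 sf bf); apply: eq_rint => x; rewrite mul0r.
have i1 : cint (fun x => cR (f x)) by split; [exact: rint_cbox t0 sf bf|exact: z].
have i2 : cint (fun x => cR (LL s f x)) by split; [exact: LL_rint s0 t0 sf bf|exact: z].
split => // y; rewrite (FT_chr _ i1) (FT_chr _ i2) /cR /=.
have z0 th : \int[mu]_x (0 * chr y th x) = 0.
  rewrite (_ : (fun x => _) = fun=> 0 : R); first by rewrite Rintegral_cst // mul0r.
  by apply/funext => x; rewrite mul0r.
rewrite !z0 !(LL_chr s0 t0 sf bf) !subr0 !add0r.
apply: cplx_eq; rewrite ?creM ?cimM /=; ring.
Qed.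

Lemma cabsD (z w : C) : cabs (z + w) <= cabs z + cabs w.
Proof.
have z0 := cabs_ge0 z; have w0 := cabs_ge0 w; have s0 := cabs_ge0 (z + w).
have ez := cabs_sqr z; have ew := cabs_sqr w; have es := cabs_sqr (z + w).
rewrite creD cimD in es.
rewrite -(@ler_pXn2r _ 2) ?nnegrE ?addr_ge0 // es [leRHS]sqrrD ez ew.
have : cre z * cre w + cim z * cim w <= cabs z * cabs w.
  apply: le_trans (ler_norm _) _; rewrite -(@ler_pXn2r _ 2) ?nnegrE ?mulr_ge0 //.
  rewrite real_normK ?num_real // exprMn ez ew.
  have := sqr_ge0 (cre z * cim w - cim z * cre w).
  move: (cre z) (cim z) (cre w) (cim w) => a b c d; nra.
move: (cabs z) (cabs w) (cre z) (cim z) (cre w) (cim w) => A B a b c d; nra.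
Qed.

Lemma cpintD (v a b : R) (F G : E -> C) : 1 <= v -> 0 < a -> 0 < b -> cint F -> cint G ->
  (pint mu v (fun x => cabs (F x)) <= (a `^ v)%:E)%E -> (pint mu v (fun x => cabs (G x)) <= (b `^ v)%:E)%E ->
  (pint mu v (fun x => cabs (F x + G x)%R) <= ((a + b) `^ v)%:E)%E.
Proof.
move=> v1 a0 b0 iF iG pa pb; have v0 : 0 <= v by rewrite (le_trans _ v1).
have mF := rint_meas (cint_cabs iF); have mG := rint_meas (cint_cabs iG).
apply: le_trans (pintD v1 a0 b0 mF mG pa pb).
apply: (pint_le mu v0); [exact: rint_meas (cint_cabs (cintD iF iG))|exact: measurable_funD|].
by move=> x; rewrite !ger0_norm ?addr_ge0 ?cabs_ge0 // cabsD.
Qed.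

Lemma cpintZ (v : R) (a : C) (b : R) (F : E -> C) : 1 <= v -> 0 <= b -> cint F ->
  (pint mu v (fun x => cabs (F x)) <= (b `^ v)%:E)%E ->
  (pint mu v (fun x => cabs (a * F x)%R) <= ((cabs a * b) `^ v)%:E)%E.
Proof.
move=> v1 b0 iF pb; have v0 : 0 <= v by rewrite (le_trans _ v1).
rewrite (_ : (fun x => _) = fun x => cabs a * cabs (F x)); last by apply/funext => x; rewrite cabsM.
by apply: pintZ => //; [exact: cabs_ge0|exact: rint_meas (cint_cabs iF)].
Qed.

(** The real and imaginary parts of a complex Gaussian times a complex cutoff are sums of four real
    functions of the form [EF], sines being cosines with phase shifted by [pi / 2]. *)
Lemma gauss_block (s c0 : R) (Th : E -> C) : 0 < s -> 1 <= c0 -> Schwartz Th ->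
  (forall eta, FT Th eta != 0 -> 1 / 2 <= enorm eta <= 2) ->
  exists C0 : R, 0 < C0 /\ forall Lq Lp lam Y, qcond Lq Lp lam c0 Y ->
   exists G : E -> C, GP s (fun x => cR (expR (- qf Lq x)) * cexpi (qf Lp x) * FT Th x) G /\
    forall v b, 1 <= v -> 0 < b -> (pint mu v (annY Y) <= (b `^ v)%:E)%E ->
     (pint mu v (fun x => cabs (G x)) <= ((C0 * lam `^ s * b) `^ v)%:E)%E.
Proof.
move=> s0 c01 sTh supp.
have [sr si] := csbdd_FT sTh; have [ar ai] := ann_FT supp.
have [C1 [C10 h1]] := EF_LL s0 c01 sr ar; have [C2 [C20 h2]] := EF_LL s0 c01 si ai.
exists ((C1 + C2) + (C2 + C1)); split; first by rewrite !addr_gt0.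
move=> Lq Lp lam Y qc; have [l1 _ _ _ _] := qc.
have l0 : 0 < lam by rewrite (lt_le_trans _ l1).
have [s1 a1 p1] := h1 Lq Lp 0 lam Y qc; have [s2 a2 p2] := h2 Lq Lp (pi / 2) lam Y qc.
have [s3 a3 p3] := h2 Lq Lp 0 lam Y qc; have [s4 a4 p4] := h1 Lq Lp (- (pi / 2)) lam Y qc.
have g1 := GP_real s0 s1 (aoff_cbox a1); have g2 := GP_real s0 s2 (aoff_cbox a2).
have g3 := GP_real s0 s3 (aoff_cbox a3); have g4 := GP_real s0 s4 (aoff_cbox a4).
have gI := GP_scale (0 +i* 1) (GP_add g3 g4).
have gA := GP_add (GP_add g1 g2) gI.
eexists; split.
  move: gA; rewrite (_ : (fun x => _ + _) = (fun x => cR (expR (- qf Lq x)) * cexpi (qf Lp x) * FT Th x)); first exact.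
  apply/funext => x; rewrite /EF /Ee mul0r !addr0 cosDpihalf.
  have -> : cos (qf Lp x - pi / 2) = sin (qf Lp x) by rewrite cosB cos_pihalf sin_pihalf mulr0 add0r mulr1.
  by apply: cplx_eq; rewrite !(creD, cimD, creM, cimM) /=; ring.
move=> v b v1 b0 pA; have e0 : 0 < lam `^ s by rewrite powR_gt0.
have [i1 i2 i3 i4] : [/\ cint (fun x => cR (LL s (EF Lq Lp 0 (fun x => cre (FT Th x))) x)),
   cint (fun x => cR (LL s (EF Lq Lp (pi / 2) (fun x => cim (FT Th x))) x)),
   cint (fun x => cR (LL s (EF Lq Lp 0 (fun x => cim (FT Th x))) x)) &
   cint (fun x => cR (LL s (EF Lq Lp (- (pi / 2)) (fun x => cre (FT Th x))) x))].
  by split; [have [] := g1|have [] := g2|have [] := g3|have [] := g4].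
have P a : 0 < a -> 0 < a * lam `^ s * b by move=> a0; rewrite !mulr_gt0.
have cr f : pint mu v (fun x => cabs (cR (f x))) = pint mu v f.
  by rewrite /pint; apply: eq_integral => x _; rewrite cabs_cR normr_id.
have q1 := p1 v b v1 b0 pA; have q2 := p2 v b v1 b0 pA.
have q3 := p3 v b v1 b0 pA; have q4 := p4 v b v1 b0 pA.
rewrite -cr in q1; rewrite -cr in q2; rewrite -cr in q3; rewrite -cr in q4.
have r1 := cpintD v1 (P _ C10) (P _ C20) i1 i2 q1 q2.
have r2 := cpintD v1 (P _ C20) (P _ C10) i3 i4 q3 q4.
have P1 := addr_gt0 (P _ C10) (P _ C20); have P2 := addr_gt0 (P _ C20) (P _ C10).
have r3 := cpintZ (0 +i* 1) v1 (ltW P2) (cintD i3 i4) r2.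
have cI : cabs (0 +i* 1 : C) = 1 by rewrite /cabs /= expr0n expr1n add0r sqrtr1.
rewrite cI mul1r in r3.
have := cpintD v1 P1 P2 (cintD i1 i2) (cintZ (0 +i* 1) (cintD i3 i4)) r1 r3.
by congr (_ <= (_ `^ v)%:E)%E; ring.
Qed.
End efll.

(** * Gaussian test functions *)

Section onedim.
Variables (R : realType).
Local Notation C := (R[i]).
Local Notation leb := (@lebesgue_measure R).
Local Notation RT := (measurableTypeR R).

Definition c1int (g : RT -> C) := rint leb (fun t => cre (g t)) /\ rint leb (fun t => cim (g t)).
Definition C1 (g : RT -> C) : C := (\int[leb]_t cre (g t)) +i* (\int[leb]_t cim (g t)).

Section prod.
Variable K : finType.
Local Notation E := (fspace R K).

Lemma integ_unit (f : R -> \bar R) : integ (fun x : unit -> R => f (x tt)) = (\int[leb]_t f t)%E.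
Proof.
by rewrite /integ enumT unlock /=; apply: eq_integral => t _; rewrite /upd eqxx.
Qed.

Lemma transfer_unit (f : RT -> \bar R) : (forall t, 0 <= f t)%E -> measurable_fun setT f ->
  (\int[@mu_fspace R unit]_x f (x tt) = \int[leb]_t f t)%E.
Proof.
move=> f0 mf; rewrite -integE //; last exact: (measurableT_comp mf (measurable_coord tt)).
exact: integ_unit.
Qed.

Lemma cint_unit (g : RT -> C) : c1int g -> cint (fun x : fspace R unit => g (x tt)).
Proof.
move=> [g1 g2]; split.
  exact: (@transfer_rint _ (fspace R unit) _ RT R (@mu_fspace R unit) leb (fun x => x tt) (measurable_coord tt) transfer_unit (fun t => cre (g t)) g1).
exact: (@transfer_rint _ (fspace R unit) _ RT R (@mu_fspace R unit) leb (fun x => x tt) (measurable_coord tt) transfer_unit (fun t => cim (g t)) g2).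
Qed.

Lemma Cint_unit (g : RT -> C) : c1int g -> Cint (fun x : fspace R unit => g (x tt)) = C1 g.
Proof.
move=> gi; rewrite (CintE (cint_unit gi)); case: gi => g1 g2.
by rewrite /C1 (transfer_Rintegral transfer_unit (rint_meas g1)) (transfer_Rintegral transfer_unit (rint_meas g2)).
Qed.

Let ku (k : K) (_ : unit) : K := k.
Let ku_bij : bijective (fun jb : K * unit => ku jb.1 jb.2).
Proof. by exists (fun k => (k, tt)) => // -[k []]. Qed.

Lemma cint_prod1 (g : K -> RT -> C) : (forall k, c1int (g k)) -> cint (fun x : E => \prod_k g k (x k)).
Proof. by move=> gi; exact: (@cint_blocks R K K unit ku ku_bij (fun k x => g k (x tt)) (fun k => cint_unit (gi k))). Qed.

Lemma Cint_prod1 (g : K -> RT -> C) : (forall k, c1int (g k)) ->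
  Cint (fun x : E => \prod_k g k (x k)) = \prod_k C1 (g k).
Proof.
move=> gi; rewrite (@Cint_blocks R K K unit ku ku_bij (fun k x => g k (x tt)) (fun k => cint_unit (gi k))).
by apply: eq_bigr => k _; exact: Cint_unit.
Qed.
End prod.

Lemma c1int_dom (g : RT -> C) (h : RT -> R) : cmf g -> rint leb h -> (forall t, cabs (g t) <= h t) -> c1int g.
Proof.
move=> [m1 m2] ih gh; split; apply: (rint_dom _ _ ih) => // t.
  exact: le_trans (cre_le_cabs _) (gh t).
exact: le_trans (cim_le_cabs _) (gh t).
Qed.

Lemma C1Z (a : C) (g : RT -> C) : c1int g -> C1 (fun t => a * g t) = a * C1 g.
Proof.
move=> [g1 g2]; rewrite /C1; apply: cplx_eq; rewrite ?creM ?cimM /=.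
  rewrite (_ : (fun t => _) = fun t => cre a * cre (g t) - cim a * cim (g t)); last by apply/funext => t; rewrite creM.
  by rewrite RintegralB ?RintegralZl //; exact: rintZ.
rewrite (_ : (fun t => _) = fun t => cre a * cim (g t) + cim a * cre (g t)); last by apply/funext => t; rewrite cimM.
by rewrite RintegralD ?RintegralZl //; exact: rintZ.
Qed.

(* Gaussian exp (- pi b t^2 + i (pi g t^2 + 2 pi c t)) *)
Definition hg (b g c t : R) : C := cR (gex b t) * cexpi (pi * g * t ^+ 2 + c * (2 * pi * t)).
Definition kap2 (b g : R) : C := gU b g +i* gV b g.
Definition hgF (b g xi : R) : C :=
  kap2 b g * (cR (expR (- (pi * b / gD b g * xi ^+ 2))) * cexpi (- (pi * g / gD b g * xi ^+ 2))).

Lemma cmf_hg b g c : cmf (hg b g c : RT -> C).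
Proof.
apply: cmfM; first by apply: cmf_cR; exact: measurable_gex.
by apply: cmf_cexpi; apply: measurable_funD; apply: measurable_funM => //.
Qed.

Lemma c1int_hg b g c : 0 < b -> c1int (hg b g c).
Proof.
move=> b0; apply: (c1int_dom (cmf_hg b g c) (rint_gex b0)) => t.
by rewrite /hg cabsM cabs_cR cabs_cexpi mulr1 ger0_norm ?gex_ge0.
Qed.

Lemma C1_hg b g c : 0 < b -> C1 (hg b g c) = hgF b g c.
Proof.
move=> b0; rewrite /C1.
transitivity ((\int[leb]_x (gex b x * cos (pi * g * x ^+ 2 + c * (2 * pi * x)))) +i*
   (\int[leb]_x (gex b x * sin (pi * g * x ^+ 2 + c * (2 * pi * x))))).
  congr (_ +i* _); apply: eq_Rintegral => t _; rewrite /hg ?creM ?cimM /cR /cexpi /=; ring.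
rewrite (@gauss_FT_cos R b g b0) (@gauss_FT_sin R b g b0).
apply: cplx_eq; rewrite /hgF /kap2 !(creM, cimM) /cR /cexpi /= cosN sinN; ring.
Qed.

Lemma hg_exp b g c t x : hg b g c t * cexpi (2 * pi * (x * t)) = hg b g (c + x) t.
Proof. by rewrite /hg -mulrA -cexpiD; congr (_ * cexpi _); ring. Qed.

Lemma cabs_kap2 b g : 0 < b -> cabs (kap2 b g) = gD b g `^ (- (1 / 4)).
Proof.
move=> b0; have D0 := gD_gt0 g b0.
have h := @gauss_normE R b b0 g.
have k0 := cabs_ge0 (kap2 b g).
have e : cabs (kap2 b g) ^+ 4 * gD b g = 1.
  by rewrite (_ : 4 = 2 * 2)%N // exprM cabs_sqr /kap2 /=; exact: h.
have e2 : cabs (kap2 b g) ^+ 4 = (gD b g)^-1.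
  by apply: (mulIf (lt0r_neq0 D0)); rewrite e mulVf ?gt_eqF.
have -> : cabs (kap2 b g) = (cabs (kap2 b g) ^+ 4) `^ (1 / 4).
  by rewrite -powR_mulrn // -powRrM mulrC divfK // powRr1.
by rewrite e2 -powR_inv1 ?ltW // -powRrM mulN1r.
Qed.

Lemma cabs_hgF b g xi : 0 < b ->
  cabs (hgF b g xi) = gD b g `^ (- (1 / 4)) * expR (- (pi * b / gD b g * xi ^+ 2)).
Proof. by move=> b0; rewrite /hgF !cabsM cabs_kap2 // cabs_cR cabs_cexpi mulr1 ger0_norm ?expR_ge0. Qed.

Lemma integral_gex (b : R) : 0 < b -> (\int[leb]_t (gex b t)%:E = ((b `^ (- (1 / 2)))%:E))%E.
Proof.
move=> b0; have p0 : (0 : R) < pi * b by rewrite mulr_gt0 // pi_gt0.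
rewrite /gex (integral_gauss p0); congr EFin.
rewrite -powR12_sqrt; last by rewrite divr_ge0 ?pi_ge0 // ltW.
have -> : pi / (pi * b) = b^-1 by rewrite invfM mulrA divff ?mul1r // gt_eqF // pi_gt0.
by rewrite -powR_inv1 ?ltW // -powRrM mulN1r div1r.
Qed.
End onedim.

(** * Gaussian inputs and their norms *)

Section cgauss.
Variables (R : realType) (K : finType).
Local Notation C := (R[i]).
Local Notation E := (fspace R K).
Variables (b g c : K -> R).
Hypothesis b0 : forall k, 0 < b k.

Definition cgauss (x : E) : C := \prod_k hg (b k) (g k) (c k) (x k).

Lemma FT_cgauss xi : FT cgauss xi = \prod_k hgF (b k) (g k) (c k - xi k).
Proof.
rewrite /FT.
transitivity (Cint (fun x : E => \prod_k hg (b k) (g k) (c k - xi k) (x k))).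
  congr Cint; apply/funext => x; rewrite /cgauss (_ : - _ = \sum_k 2 * pi * (- xi k * x k)).
    by rewrite cexpi_sum -big_split /=; apply: eq_bigr => k _; rewrite hg_exp.
  by rewrite -mulr_sumr -mulrN /dotp -sumrN; congr (_ * _); apply: eq_bigr => k _; ring.
rewrite (@Cint_prod1 R K (fun k => hg (b k) (g k) (c k - xi k))); last by move=> k; exact: c1int_hg.
by apply: eq_bigr => k _; exact: C1_hg.
Qed.

Lemma cabs_cgauss x : cabs (cgauss x) = \prod_k gex (b k) (x k).
Proof.
rewrite /cgauss cabs_prod; apply: eq_bigr => k _.
by rewrite /hg cabsM cabs_cR cabs_cexpi mulr1 ger0_norm ?gex_ge0.
Qed.
End cgauss.

Lemma integ_gauss_prod (R : realType) (K : finType) (A p : R) (b : K -> R) : 0 <= A -> 0 < p ->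
  (forall k, 0 < b k) ->
  integ (fun x : K -> R => ((A * \prod_k gex (b k) (x k)) `^ p)%:E) =
  (A `^ p * \prod_k (b k * p) `^ (- (1 / 2)))%:E.
Proof.
move=> A0 p0 b0.
have e (x : K -> R) : (A * \prod_k gex (b k) (x k)) `^ p = A `^ p * \prod_k gex (b k * p) (x k).
  rewrite powRM ?prodr_ge0 // => [|k _]; last exact: gex_ge0.
  congr (_ * _); rewrite powR_prod => [|k]; last exact: gex_ge0.
  by apply: eq_bigr => k _; rewrite /gex /powR gt_eqF ?expR_gt0 // expRK; congr expR; ring.
have m (k : K) : measurable_fun setT (gex (b k * p) : measurableTypeR R -> R) by exact: measurable_gex.
have P0 (x : K -> R) : 0 <= \prod_k gex (b k * p) (x k) by apply: prodr_ge0 => k _; exact: gex_ge0.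
have mP : measurable_fun setT (fun x : fspace R K => (\prod_k gex (b k * p) (x k))%:E).
  by apply/measurable_EFinP; apply: measurable_prod => k _; exact: (measurableT_comp (m k) (measurable_coord k)).
rewrite (_ : (fun x => _) = fun x : fspace R K => ((A `^ p)%:E * (\prod_k gex (b k * p) (x k))%:E)%E); last first.
  by apply/funext => x; rewrite e EFinM.
rewrite integE; [|by move=> x; rewrite mule_ge0 ?lee_fin ?powR_ge0|exact: measurable_funeM].
rewrite ge0_integralZl ?lee_fin ?powR_ge0 //; last by move=> x _; rewrite lee_fin.
rewrite EFinM -integE; [|by move=> x; rewrite lee_fin|exact: mP].
rewrite (@integ_prod R K (fun k => gex (b k * p))) //; last by move=> k t; exact: gex_ge0.
congr (_ * _)%E; rewrite -prodEFin; apply: eq_bigr => k _; apply: integral_gex.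
by rewrite mulr_gt0.
Qed.

(** * Gaussians are Schwartz functions *)

Section gauss_schwartz.
Variables (R : realType) (K : finType).
Local Notation E := (fspace R K).
Implicit Types (L : seq (qitem R K)).

Lemma dpart_one (s : seq K) : dpart s (fun=> 1 : R) = fun=> if s is [::] then 1 else 0.
Proof.
elim: s => //= c s ->; apply/funext => x; rewrite /pderiv.
exact: der_val (der_cst _ _).
Qed.

Lemma sbdd_one : sbdd (fun _ : E => 1 : R).
Proof.
split => [s c x|s]; rewrite dpart_one; first exact: der_ex (der_cst _ _).
by exists 1 => x; case: s => [|? ?]; rewrite ?normr1 ?normr0.
Qed.

Lemma coord_le (x : E) k : `|x k| <= 1 + sqnorm x.
Proof.
have h : x k ^+ 2 <= sqnorm x by rewrite /sqnorm (bigD1 k) //= lerDl sumr_ge0 // => j _; rewrite sqr_ge0.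
have := sqr_ge0 (`|x k| - 1); rewrite sqrrB expr1n mulr1 real_normK ?num_real //.
have : 0 <= x k ^+ 2 by rewrite sqr_ge0.
lra.
Qed.

Lemma lin_le (i : qitem R K) : exists B : R, forall x, `|lin i x| <= B * (1 + sqnorm x).
Proof.
exists (\sum_k `|i.1.2 k| + `|i.2|) => x; rewrite /lin.
have y1 : 1 <= 1 + sqnorm x by rewrite lerDl sqnorm_ge0.
apply: le_trans (ler_normB _ _) _; rewrite mulrDl; apply: lerD; last by rewrite ler_peMr.
apply: le_trans (ler_norm_sum _ _ _) _; rewrite mulr_suml; apply: ler_sum => k _.
by rewrite normrM mulrC ler_wpM2l // coord_le.
Qed.

Lemma qd_le L c : exists B : R, forall x, `|qd L c x| <= B * (1 + sqnorm x).
Proof.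
elim: L => [|i L [B IH]]; first by exists 0 => x; rewrite /qd big_nil normr0 mul0r.
have [B' hB'] := lin_le i.
exists (`|i.1.1| * (2 * B' * `|i.1.2 c|) + B) => x; rewrite /qd big_cons [leRHS]mulrDl.
apply: le_trans (ler_normD _ _) _; apply: lerD; last exact: IH.
rewrite !normrM -!mulrA ler_wpM2l // (@ger0_norm _ 2) // ler_wpM2l // mulrA mulrAC.
by rewrite ler_wpM2r.
Qed.

Lemma geval_bound Lq Lp : exists B : R, 1 <= B /\ forall g (x : E), `|geval Lq Lp g x| <= B * (1 + sqnorm x).
Proof.
have ex g : exists B : R, forall x, `|geval Lq Lp g x| <= B * (1 + sqnorm x).
  have y1 (x : E) : 1 <= 1 + sqnorm x by rewrite lerDl sqnorm_ge0.
  case: g => [[[] c] [c'|]] /=.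
  - by exists `|qh Lq c c'| => x; rewrite normrN ler_peMr.
  - by have [B hB] := qd_le Lq c; exists B => x; rewrite normrN.
  - by exists `|qh Lp c c'| => x; rewrite ler_peMr.
  - exact: qd_le.
have [B hB] := choice ex.
have S0 : 0 <= \sum_(g : gen K) `|B g| by exact: sumr_ge0.
exists (1 + \sum_(g : gen K) `|B g|); split; first by rewrite lerDl.
move=> g x; apply: le_trans (hB g x) _; rewrite ler_wpM2r ?addr_ge0 ?sqnorm_ge0 //.
rewrite (bigD1 g) //= addrCA (le_trans (ler_norm _)) // lerDl addr_ge0 //.
exact: sumr_ge0.
Qed.

Lemma exp_poly_le (be y : R) k : 0 < be <= 1 -> 0 <= y ->
  (1 + y) ^+ k * expR (- (be * y)) <= (be ^-1) ^+ k * (k ^ k)%:R.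
Proof.
move=> /andP[b0 b1] y0.
have by0 : 0 <= be * y by rewrite mulr_ge0 // ltW.
have := expX_le k by0; rewrite -(ler_pM2r (expR_gt0 (- (be * y)))) -mulrA -expRD subrr expR0 mulr1.
move=> h; apply: le_trans (_ : (be ^-1) ^+ k * ((1 + be * y) ^+ k * expR (- (be * y))) <= _); last first.
  by rewrite ler_wpM2l // exprn_ge0 // invr_ge0 ltW.
rewrite mulrA -exprMn ler_wpM2r ?expR_ge0 //; apply: lerXn2r; rewrite ?nnegrE ?addr_ge0 //.
  by rewrite mulr_ge0 ?invr_ge0 ?addr_ge0 // ltW.
rewrite mulrDr mulr1 mulKf ?gt_eqF // lerD2r -[leLHS]invr1.
by rewrite lef_pV2 ?posrE.
Qed.

Lemma gauss_Schwartz Lq Lp th be : 0 < be -> (forall x : E, be * sqnorm x <= qf Lq x) ->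
  rSchwartz (EF Lq Lp th (fun _ : E => 1)).
Proof.
move=> be0 hq; have s1 := sbdd_one; split; first exact: sder_EF.
move=> s N; have [B [B1 hB]] := geval_bound Lq Lp.
pose be' := Num.min be 1.
have be'0 : 0 < be' <= 1 by rewrite /be' lt_min be0 ltr01 /= ge_min lexx orbT.
have /andP[b0 b1] := be'0.
pose k := (N + size s)%N.
exists ((size (terms s))%:R * (B ^+ size s * ((be'^-1) ^+ k * (k ^ k)%:R))) => x.
have y0 := sqnorm_ge0 x; set y := sqnorm x in y0 *.
have z1 : 1 <= B * (1 + y) by rewrite -[leLHS]mulr1 ler_pM // lerDl.
have y1 : 0 <= 1 + y by rewrite addr_ge0.
rewrite (dpart_EF _ _ _ s1); apply: (@le_trans _ _ ((1 + y) ^+ N * \sum_(a <- terms s) `|teval Lq Lp th (fun=> 1) a x|)).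
  by rewrite ler_wpM2l ?exprn_ge0 // ler_norm_sum.
rewrite mulr_sumr; apply: sum_seq_le => a aw; have dg := terms_deg aw.
rewrite /teval 2!normrM.
have h1 : `|Ee Lq Lp th a.1.1 x| <= expR (- (be' * y)).
  rewrite /Ee normrM (ger0_norm (expR_ge0 _)) -[leRHS]mulr1; apply: ler_pM; rewrite ?expR_ge0 //.
    by rewrite ler_expR lerN2; apply: le_trans (hq x); rewrite ler_wpM2r // /be' ge_min lexx.
  by rewrite ler_norml cos_geN1 cos_le1.
have h2 : `|gsev Lq Lp a.1.2 x| <= (B * (1 + y)) ^+ size s.
  apply: (@le_trans _ _ ((B * (1 + y)) ^+ size a.1.2)).
    elim: (a.1.2) => [|g gs IH]; first by rewrite /gsev big_nil normr1 expr0.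
    by rewrite gsev_cons normrM /= exprS ler_pM // hB.
  by rewrite ler_weXn2l // -dg /tdeg (leq_trans (size_gs _)) // leq_addr.
have h3 : `|dpart a.2 (fun=> 1) x| <= 1.
  by rewrite dpart_one; case: (a.2) => [|? ?]; rewrite ?normr1 ?normr0.
apply: (@le_trans _ _ ((1 + y) ^+ N * (expR (- (be' * y)) * (B * (1 + y)) ^+ size s * 1))).
  rewrite ler_wpM2l ?exprn_ge0 //; apply: ler_pM => //.
  exact: ler_pM.
rewrite mulr1 exprMn.
rewrite (_ : _ * _ = B ^+ size s * ((1 + y) ^+ k * expR (- (be' * y)))); last by rewrite /k exprD; ring.
by rewrite ler_wpM2l ?exprn_ge0 ?(le_trans _ B1) // exp_poly_le.
Qed.

Definition dlt (k : K) : K -> R := fun k' => (k' == k)%:R.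
Lemma dotp_dlt (x : E) k : dotp x (dlt k) = x k.
Proof.
rewrite /dotp (bigD1 k) //= /dlt eqxx mulr1 big1 ?addr0 // => j /negbTE ->.
by rewrite mulr0.
Qed.

Lemma cgauss_Schwartz (b g c : K -> R) : (forall k, 0 < b k) -> Schwartz (cgauss b g c).
Proof.
move=> b0.
pose Lq := [seq (pi * b k, dlt k, 0) | k <- index_enum K] : seq (qitem R K).
(* Quadratic lists have no linear items, so the linear phase is a difference of squares: [2 pi c t =
   (pi / 2) c ((t + 1)^2 - (t - 1)^2)]. *)
pose Lp := [seq (pi * g k, dlt k, 0) | k <- index_enum K] ++ ([seq (pi / 2 * c k, dlt k, -1) | k <- index_enum K] ++
   [seq (- (pi / 2 * c k), dlt k, 1) | k <- index_enum K]) : seq (qitem R K).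
have Qe x : qf Lq x = \sum_k pi * b k * x k ^+ 2.
  by rewrite /qf big_map /=; apply: eq_bigr => k _; rewrite /lin /= dotp_dlt subr0.
have Pe x : qf Lp x = \sum_k (pi * g k * x k ^+ 2 + c k * (2 * pi * x k)).
  rewrite /qf /Lp big_cat big_cat /= !big_map /= -big_split -big_split /=; apply: eq_bigr => k _.
  by rewrite /lin /= dotp_dlt; field.
have ce x : cgauss b g c x = cR (expR (- qf Lq x)) * cexpi (qf Lp x).
  rewrite Qe Pe cexpi_sum -sumrN expR_sum cR_prod -big_split /=; apply: eq_bigr => k _.
  by rewrite /hg /gex.
have [be [be0 hbe]] : exists be : R, 0 < be /\ forall x, be * sqnorm x <= qf Lq x.
  pose S := \sum_k (pi * b k)^-1.
  have p0 k : 0 < (pi * b k)^-1 by rewrite invr_gt0 mulr_gt0 // pi_gt0.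
  have S0 : 0 <= S by apply: sumr_ge0 => k _; exact: ltW.
  have S1 : 0 < S + 1 by rewrite ltr_wpDl.
  exists (S + 1)^-1; split; first by rewrite invr_gt0.
  move=> x; rewrite Qe /sqnorm mulr_sumr; apply: ler_sum => k _; rewrite ler_wpM2r ?sqr_ge0 //.
  rewrite -[leRHS]invrK lef_pV2 ?posrE // /S (bigD1 k) //= -addrA lerDl addr_ge0 //.
  by apply: sumr_ge0 => j _; exact: ltW.
have := @gauss_Schwartz Lq Lp; move=> h; split.
  rewrite (_ : (fun x => _) = EF Lq Lp 0 (fun=> 1)); first exact: h be0 hbe.
  apply/funext => x; rewrite ce creM /cR /cexpi /= mul0r subr0 /EF /Ee mul0r !addr0 mulr1 //.
rewrite (_ : (fun x => _) = EF Lq Lp (- (pi / 2)) (fun=> 1)); first exact: h be0 hbe.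
apply/funext => x; rewrite ce cimM /cR /cexpi /= mul0r addr0 /EF /Ee mul0r !addr0 mulr1.
by rewrite cosB cos_pihalf sin_pihalf mulr0 add0r mulr1.
Qed.
End gauss_schwartz.

Lemma Cint_sum (R : realType) (K : finType) (T : Type) (s : seq T) (F : T -> fspace R K -> R[i]) :
  (forall t, cint (F t)) -> cint (fun x => \sum_(t <- s) F t x) /\
  Cint (fun x => \sum_(t <- s) F t x) = \sum_(t <- s) Cint (F t).
Proof.
move=> iF; elim: s => [|t s [IH1 IH2]].
  have z : cint (fun _ : fspace R K => 0 : R[i]).
    have r0 : rint (@mu_fspace R K) (fun=> 0 : R).
      by apply: eq_rint (integrable0 (@mu_fspace R K) setT) => x.
    by split.
  rewrite (_ : (fun x => _) = fun=> 0); last by apply/funext => x; rewrite big_nil.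
  split => //; rewrite big_nil (CintE z) /=.
  by apply: cplx_eq => /=; rewrite Rintegral_cst // mul0r.
rewrite (_ : (fun x => _) = fun x => F t x + \sum_(t <- s) F t x); last by apply/funext => x; rewrite big_cons.
by split; [exact: cintD|rewrite CintD // IH2 big_cons].
Qed.

(** * Shear towards a sum of frequencies *)

Section shear.
Variables (R : realType) (L : finType) (i0 : L) (J : pred L).
Hypothesis Ji0 : J i0.
Local Notation C := (R[i]).
Local Notation E := (fspace R L).
Local Notation mu := (@mu_fspace R L).
Local Notation RT := (measurableTypeR R).

(** Measure-preserving change of variables that makes the sum over [J] the coordinate [i0]. *)
Definition shr (x : E) : E := upd x i0 (x i0 + \sum_(i | J i && (i != i0)) x i).

Lemma shr_sum (x : E) : shr x i0 = \sum_(i | J i) x i.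
Proof. by rewrite /shr /upd eqxx [RHS](bigD1 i0). Qed.

Lemma shr_neq (x : E) i : i != i0 -> shr x i = x i.
Proof. by rewrite /shr /upd => /negbTE ->. Qed.

Lemma measurable_shrL : measurable_fun setT (fun x : E => \sum_(i | J i && (i != i0)) x i).
Proof.
rewrite (_ : (fun x => _) = fun x : E => \sum_i (if J i && (i != i0) then x i else 0)); last first.
  by apply/funext => x; rewrite big_mkcond.
by apply: measurable_sum => i; case: (J i && _); [exact: measurable_coord|exact: measurable_cst].
Qed.

Lemma measurable_shr : measurable_fun setT shr.
Proof.
apply: measurable_fspace => k; rewrite /shr /upd; case: eqP => _; last exact: measurable_coord.
by apply: measurable_funD; [exact: measurable_coord|exact: measurable_shrL].
Qed.

Lemma shrP (f : E -> \bar R) : (forall x, 0 <= f x)%E -> measurable_fun setT f ->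
  (\int[mu]_x f (shr x) = \int[mu]_x f x)%E.
Proof.
move=> f0 mf; apply: (@ge0_integ_shear R L i0 (fun x => \sum_(i | J i && (i != i0)) x i)) => //.
  exact: measurable_shrL.
move=> x t; apply: eq_bigr => i /andP[_ /negbTE ni]; by rewrite /upd ni.
Qed.

Lemma cint_shr (H : E -> C) : cint H -> cint (fun x => H (shr x)) /\ Cint (fun x => H (shr x)) = Cint H.
Proof.
move=> iH; have [h1 h2] := iH.
have i1 := transfer_rint measurable_shr shrP h1; have i2 := transfer_rint measurable_shr shrP h2.
split; first by split.
rewrite (CintE iH) (@CintE R L (fun x => H (shr x))); last by split.
by rewrite (transfer_Rintegral shrP (rint_meas h1)) (transfer_Rintegral shrP (rint_meas h2)).
Qed.

Variables (G0 : RT -> C) (g : L -> RT -> C).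
Hypotheses (iG0 : c1int G0) (ig : forall i, c1int (g i)).

(** Shape prescribed for the product of multiplier and input transforms: a profile [G0] of the sum
    over [J], and separate profiles in the variables other than [i0]. *)
Definition shM (eta : E) : C := G0 (\sum_(i | J i) eta i) * \prod_(i | i != i0) g i (eta i).

Lemma c1int_exp (h : RT -> C) (x : R) : c1int h -> c1int (fun t => h t * cexpi (x * t)).
Proof.
move=> ih; have mh : cmf h by case: ih => /rint_meas m1 /rint_meas m2.
have ia : rint (@lebesgue_measure R) (fun t => `|cre (h t)| + `|cim (h t)|).
  by case: ih => h1 h2; apply: rintD; exact: rint_abs.
apply: (c1int_dom _ ia).
  by apply: cmfM => //; apply: cmf_cexpi; exact: measurable_funM.
by move=> t; rewrite cabsM cabs_cexpi mulr1 cabs_le.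
Qed.

(** The total frequency is the sum over [J] plus the variables outside [J]. After the shear the
    variables of [J] other than [i0] carry no oscillation and contribute constants in [x]. *)
Lemma shM_int (x : R) :
  cint shM /\ Cint (fun eta => shM eta * cexpi (2 * pi * (x * \sum_i eta i))) =
  C1 (fun t => G0 t * cexpi (2 * pi * (x * t))) *
  \prod_(i | i != i0) (if J i then C1 (g i) else C1 (fun t => g i t * cexpi (2 * pi * (x * t)))).
Proof.
pose w (a : R) i : RT -> C := if i == i0 then (fun t => G0 t * cexpi (a * t)) else
   if J i then g i else (fun t => g i t * cexpi (a * t)).
have iw a i : c1int (w a i).
  by rewrite /w; case: ifP => _; [exact: c1int_exp|case: ifP => _ //; exact: c1int_exp].
have e a (eta : E) : shM eta * cexpi (a * \sum_i eta i) = \prod_i w a i (shr eta i).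
  rewrite (bigID J) /= mulrDr cexpiD.
  rewrite (_ : cexpi (a * \sum_(i | ~~ J i) eta i) = \prod_(i | i != i0) (if J i then 1 else cexpi (a * eta i))); last first.
    rewrite mulr_sumr big_mkcond /= cexpi_sum (bigD1 i0) //= Ji0 /= cexpi0 mul1r.
    by apply: eq_bigr => i _; case: (J i) => //=; rewrite cexpi0.
  rewrite [in RHS](bigD1 i0) //= /shM {1}/w eqxx shr_sum mulrACA -big_split /=; congr (_ * _).
  apply: eq_bigr => i ni; rewrite /w (negbTE ni) shr_neq //.
  by case: (J i); rewrite ?mulr1.
have iP a : cint (fun eta : E => \prod_i w a i (eta i)) by exact: cint_prod1.
split.
  have [i1 _] := cint_shr (iP 0).
  rewrite (_ : shM = fun eta => \prod_i w 0 i (shr eta i)) //.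
  by apply/funext => eta; rewrite -e mul0r cexpi0 mulr1.
have [_ e2] := cint_shr (iP (2 * pi * x)).
transitivity (Cint (fun eta : E => \prod_i w (2 * pi * x) i (shr eta i))).
  by congr Cint; apply/funext => eta; rewrite -e mulrA.
rewrite e2 Cint_prod1 // (bigD1 i0) //=; congr (_ * _).
  by congr C1; apply/funext => t; rewrite /w eqxx mulrA.
apply: eq_bigr => i ni; rewrite /w (negbTE ni); case: (J i) => //.
by congr C1; apply/funext => t; rewrite mulrA.
Qed.
End shear.

Lemma prod_block (d n : nat) (j0 : 'I_d) (S : comPzRingType) (h : ptJ d n -> S) :
  \prod_jk h jk = (\prod_k h (j0, k)) * \prod_(j | j != j0) \prod_k h (j, k).
Proof.
transitivity (\prod_j \prod_k h (j, k)); last by rewrite (bigD1 j0).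
by rewrite pair_bigA /=; apply: eq_bigr => -[j k].
Qed.

(** * The operator on Gaussian inputs *)

Section tm.
Variables (R : realType) (l d n : nat) (j0 : 'I_d).
Local Notation C := (R[i]).
Local Notation K := (ptK l d n).
Local Notation PJ := (ptJ d n).
Local Notation E := (fspace R K).
Local Notation EL := (fspace R 'I_l).

Definition te (jk : PJ) (i : 'I_l) : K := (i, jk).
Lemma te_bij : bijective (fun jb : PJ * 'I_l => te jb.1 jb.2).
Proof. by exists (fun k : K => (k.2, k.1)); case. Qed.

Lemma kap2_std : kap2 1 0 = 1 :> C.
Proof.
rewrite /kap2; apply: cplx_eq => /=.
  rewrite /gU -[RHS]integral_gex1; apply: eq_Rintegral => t _.
  by rewrite mulr0 mul0r cos0 mulr1.
rewrite /gV (_ : (fun t => _) = fun=> 0); first by rewrite Rintegral_cst // mul0r.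
by apply/funext => t; rewrite mulr0 mul0r sin0 mulr0.
Qed.

Lemma hgF_std t : hgF 1 0 t = cR (gex 1 t) :> C.
Proof.
rewrite /hgF kap2_std mul1r /gD expr1n expr0n addr0 divr1 mulr1 mulr0 !mul0r oppr0 cexpi0 mulr1.
by rewrite /gex mulr1.
Qed.

Lemma hg_std t : hg 1 0 0 t = cR (gex 1 t) :> C.
Proof. by rewrite /hg mulr0 !mul0r addr0 cexpi0 mulr1. Qed.

Lemma gex_pow (t : R) : \prod_(i < l) cR (gex 1 t) = cR (gex l%:R t) :> C.
Proof.
rewrite -cR_prod; congr cR; rewrite prodr_const card_ord /gex -expRM_natl; congr expR; ring.
Qed.

(** Outside block [j0] every input is [exp(- pi t^2)], which is its own transform; the [l] outputs
    multiply to a Gaussian of rate [l]. *)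
Lemma std_block (y : R) :
  cint (fun eta : EL => \prod_i hgF 1 0 (0 - eta i)) /\
  Cint (fun eta : EL => (\prod_i hgF 1 0 (0 - eta i)) * cexpi (2 * pi * (y * \sum_i eta i))) = cR (gex l%:R y) :> C.
Proof.
have e1 : (fun eta : EL => \prod_i hgF 1 0 (0 - eta i)) = (fun eta : EL => \prod_i hg 1 0 0 (eta i)) :> (EL -> C).
  apply/funext => eta; apply: eq_bigr => i _; rewrite hgF_std hg_std.
  by rewrite /gex sub0r sqrrN.
split; first by rewrite e1; apply: (@cint_prod1 R 'I_l (fun=> hg 1 0 0)) => i; exact: c1int_hg.
transitivity (Cint (fun eta : EL => \prod_i hg 1 0 y (eta i))).
  congr Cint; apply/funext => eta; have := congr1 (fun f => f eta) e1; rewrite /= => ->.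
  rewrite mulr_sumr mulr_sumr cexpi_sum -big_split /=; apply: eq_bigr => i _.
  by rewrite hg_exp add0r.
rewrite (@Cint_prod1 R 'I_l (fun=> hg 1 0 y)); last by move=> i; exact: c1int_hg.
by rewrite -gex_pow; apply: eq_bigr => i _; rewrite C1_hg // hgF_std.
Qed.

Variables (b g c : 'I_l -> 'I_n -> R).
Hypothesis b0 : forall i k, 0 < b i k.
(** Parameters on block [j0] with a default elsewhere: rate 1, no chirp, no modulation. *)
Definition ext (f : 'I_n -> R) (z : R) (jk : PJ) : R := if jk.1 == j0 then f jk.2 else z.
Definition tf (i : 'I_l) : (PJ -> R) -> C := cgauss (ext (b i) 1) (ext (g i) 0) (ext (c i) 0).

Lemma ext_gt0 i jk : 0 < ext (b i) 1 jk.
Proof. by rewrite /ext; case: eqP. Qed.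

Lemma tf_Schwartz i : Schwartz (tf i).
Proof. by apply: cgauss_Schwartz => jk; exact: ext_gt0. Qed.

Variables (m : E -> C) (m0 : ('I_l * 'I_n -> R) -> C).
Hypothesis mE : forall xi, m xi = m0 (vblock xi j0).
Variables (T : Type) (s : seq T) (a : T -> C) (M : T -> 'I_n -> EL -> C).
Hypothesis iM : forall r k, cint (M r k).
Hypothesis m0E : forall v, m0 v * \prod_i \prod_k hgF (b i k) (g i k) (c i k - v (i, k)) =
  \sum_(r <- s) a r * \prod_k M r k (fun i => v (i, k)).

(** [T_m] sees only the product of the multiplier with the input transforms, which [m0E] prescribes
    as a sum of products over the [n] components. Each product integrates componentwise; the sum
    serves the superposition of bumps. *)
Lemma Tm_formula (x : PJ -> R) : Tm m tf x =
  \sum_(r <- s) a r * ((\prod_k Cint (fun eta : EL => M r k eta * cexpi (2 * pi * (x (j0, k) * \sum_i eta i)))) *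
    \prod_(j | j != j0) \prod_k cR (gex l%:R (x (j, k)))).
Proof.
pose G r (jk : PJ) (eta : EL) : C :=
  (if jk.1 == j0 then M r jk.2 eta else \prod_i hgF 1 0 (0 - eta i)) * cexpi (2 * pi * (x jk * \sum_i eta i)).
have iG r jk : cint (G r jk).
  apply: cint_mul_bdd; first by case: eqP => _; [exact: iM|exact: (std_block 0).1].
    apply: cmf_cexpi; apply: measurable_funM => //; apply: measurable_funM => //.
    by apply: measurable_sum => i; exact: measurable_coord.
  by move=> eta; rewrite cabs_cexpi.
have GE (xi : E) : m xi * (\prod_(i < l) FT (tf i) (xi_i xi i)) * cexpi (2 * pi * dotp x (xi_sum xi)) =
    \sum_(r <- s) a r * \prod_jk G r jk (blk te xi jk).
  rewrite mE.
  have FTE i : FT (tf i) (xi_i xi i) = (\prod_k hgF (b i k) (g i k) (c i k - vblock xi j0 (i, k))) *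
      \prod_(j | j != j0) \prod_k hgF 1 0 (0 - xi (i, (j, k))).
    rewrite /tf FT_cgauss; last by move=> jk; exact: ext_gt0.
    rewrite (prod_block j0); congr (_ * _).
      by apply: eq_bigr => k _; rewrite /ext /= eqxx.
    by apply: eq_bigr => j /negbTE jj; apply: eq_bigr => k _; rewrite /ext /= jj.
  rewrite (eq_bigr _ (fun i _ => FTE i)) big_split /= mulrA m0E.
  rewrite -mulrA mulr_suml; apply: eq_bigr => r _; rewrite -mulrA; congr (_ * _).
  rewrite /G big_split /=.
  rewrite (_ : \prod_jk cexpi _ = cexpi (2 * pi * dotp x (xi_sum xi))); last first.
    by rewrite -cexpi_sum; congr cexpi; rewrite /dotp mulr_sumr.
  rewrite mulrA; congr (_ * _).
  rewrite [in RHS](prod_block j0) /=; congr (_ * _); first by rewrite eqxx.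
  rewrite exchange_big /=; apply: eq_bigr => j /negbTE jj; rewrite jj exchange_big /=.
  by apply: eq_bigr => k _.
rewrite /Tm; rewrite (_ : (fun xi => _) = fun xi : E => \sum_(r <- s) a r * \prod_jk G r jk (blk te xi jk)); last first.
  by apply/funext => xi; rewrite GE.
have iP r : cint (fun xi : E => \prod_jk G r jk (blk te xi jk)) := @cint_blocks R K PJ 'I_l te te_bij (G r) (iG r).
have [_ ->] := @Cint_sum R K T s (fun r xi => a r * \prod_jk G r jk (blk te xi jk)) (fun r => cintZ (a r) (iP r)).
apply: eq_bigr => r _; rewrite CintZ //; congr (_ * _).
rewrite (@Cint_blocks R K PJ 'I_l te te_bij (G r) (iG r)).
rewrite (prod_block j0); congr (_ * _).
  by apply: eq_bigr => k _; congr Cint; apply/funext => eta; rewrite /G /= eqxx.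
apply: eq_bigr => j /negbTE jj; apply: eq_bigr => k _.
rewrite -(std_block (x (j, k))).2; congr Cint; apply/funext => eta.
by rewrite /G /= jj.
Qed.

Lemma Lpnorm_tf i (p : R) : 0 < p -> Lpnorm p (tf i) =
  (((\prod_k (b i k * p) `^ (- (1 / 2))) * \prod_(j | j != j0) \prod_(k < n) p `^ (- (1 / 2))) `^ p^-1)%:E.
Proof.
move=> p0; rewrite /Lpnorm -poweR_EFin; congr poweR.
rewrite (_ : (fun x => _) = (fun x : PJ -> R => ((1 * \prod_jk gex (ext (b i) 1 jk) (x jk)) `^ p)%:E)); last first.
  by apply/funext => x; rewrite mul1r /tf cabs_cgauss // => jk; exact: ext_gt0.
rewrite (@integ_gauss_prod R PJ 1 p (ext (b i) 1)) //; last by move=> jk; exact: ext_gt0.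
congr EFin; rewrite powR1 mul1r.
rewrite (prod_block j0); congr (_ * _).
  by apply: eq_bigr => k _; rewrite /ext /= eqxx.
by apply: eq_bigr => j /negbTE jj; apply: eq_bigr => k _; rewrite /ext /= jj mul1r.
Qed.
End tm.

(** * Gliding hump *)

Lemma double_sub1_gt0 (R : realType) (z : R) : 1 < z -> 0 < 2 * z - 1.
Proof. by move=> h; lra. Qed.

Section hump.
Context d (X : measurableType d) (R : realType) (mu : {measure set X -> \bar R}).
Variables (T : Type) (F : T -> X -> R).
Hypothesis F0 : forall t x, 0 <= F t x.
Hypothesis mF : forall t, measurable_fun setT (F t).

Fixpoint maxl (s : seq T) (x : X) : R := if s is t :: s' then Num.max (F t x) (maxl s' x) else 0.
Definition minl (t : T) (s : seq T) (x : X) : R := \sum_(t' <- s) Num.min (F t x) (F t' x).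
Fixpoint pairl (s : seq T) (x : X) : R := if s is t :: s' then minl t s' x + pairl s' x else 0.

Lemma min_ge0 t t' x : 0 <= Num.min (F t x) (F t' x).
Proof. by rewrite le_min !F0. Qed.

Lemma maxl_ge0 s x : 0 <= maxl s x.
Proof. by elim: s => //= t s IH; rewrite le_max F0. Qed.

Lemma minl_ge0 t s x : 0 <= minl t s x.
Proof. by apply: sumr_ge0 => t' _; exact: min_ge0. Qed.

Lemma pairl_ge0 s x : 0 <= pairl s x.
Proof. by elim: s => //= t s IH; rewrite addr_ge0 // minl_ge0. Qed.

Lemma min_maxl t s x : Num.min (F t x) (maxl s x) <= minl t s x.
Proof.
elim: s => [|t' s IH] /=; first by rewrite /minl big_nil ge_min lexx orbT.
rewrite /minl big_cons -/(minl t s x).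
have h1 := min_ge0 t t' x; have h2 := minl_ge0 t s x.
case: (leP (F t' x) (maxl s x)) => h.
  by apply: le_trans IH _; rewrite lerDr.
by rewrite lerDl.
Qed.

(** Induction on [a + b = max a b + min a b]. The maximum costs only [r^(1/u)] in [L^u], and the
    pairwise minima are what sparse scales make small. *)
Lemma sum_maxl s x : \sum_(t <- s) F t x <= maxl s x + pairl s x.
Proof.
elim: s => [|t s IH] /=; first by rewrite big_nil addr0.
rewrite big_cons; have h := min_maxl t s x.
have e : Num.max (F t x) (maxl s x) + Num.min (F t x) (maxl s x) = F t x + maxl s x by rewrite addrC addr_min_max.
lra.
Qed.

Lemma measurable_maxl s : measurable_fun setT (maxl s).
Proof. by elim: s => [|t s IH] /=; [exact: measurable_cst|exact: measurable_maxr]. Qed.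

Lemma measurable_minl t s : measurable_fun setT (minl t s).
Proof. by apply: measurable_sum => t'; exact: measurable_minr. Qed.

Lemma measurable_pairl s : measurable_fun setT (pairl s).
Proof.
elim: s => [|t s IH] /=; first exact: measurable_cst.
by apply: measurable_funD => //; exact: measurable_minl.
Qed.

Variable u : R.
Hypothesis u1 : 1 < u.
Let u0 : 0 < u. Proof. by rewrite (lt_trans _ u1). Qed.

Lemma pint_maxl (A : R) (s : seq T) : (forall t, pint mu u (F t) <= (A `^ u)%:E)%E ->
  (pint mu u (maxl s) <= ((size s)%:R * A `^ u)%:E)%E.
Proof.
move=> h; elim: s => [|t s IH] /=.
  rewrite /pint mul0r (eq_integral (fun=> 0%:E)) ?integral0 // => x _.
  by rewrite normr0 powR0 // gt_eqF.
apply: (@le_trans _ _ (pint mu u (F t) + pint mu u (maxl s))%E); last first.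
  by rewrite -natr1 mulrDl mul1r addrC EFinD; apply: leeD.
rewrite /pint -ge0_integralD //; [|exact: measurable_powf|by apply: measurable_powf; exact: measurable_maxl].
apply: ge0_le_integral => //.
- by apply: measurable_powf; exact: (measurable_maxl (t :: s)).
- by apply: emeasurable_funD; apply: measurable_powf => //; exact: measurable_maxl.
move=> x _; rewrite -EFinD lee_fin.
by case: (leP (F t x) (maxl s x)) => _; rewrite ?lerDr ?lerDl powR_ge0.
Qed.

(** With [m = min a b], the power [m^u] is the geometric mean of [m] and [m^(2 u - 1)]; compare it
    with a weighted arithmetic mean and use [m <= b] in one term, [m <= a] in the other. *)
Lemma min_pow (a b eta : R) : 0 <= a -> 0 <= b -> 0 < eta ->
  Num.min a b `^ u <= (eta^-1 * b + eta * a `^ (2 * u - 1)) / 2.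
Proof.
move=> a0 b0 e0; set m := Num.min a b.
have v0 := double_sub1_gt0 u1.
have m0 : 0 <= m by rewrite le_min a0.
have ma : m <= a by rewrite ge_min lexx.
have mb : m <= b by rewrite ge_min lexx orbT.
have h : (eta^-1 * m + eta * m `^ (2 * u - 1)) / 2 <= (eta^-1 * b + eta * a `^ (2 * u - 1)) / 2.
  rewrite ler_pM2r ?invr_gt0 //; apply: lerD; first by rewrite ler_wpM2l // invr_ge0 ltW.
  by rewrite ler_wpM2l ?(ltW e0) // ge0_ler_powR ?nnegrE // ltW.
apply: le_trans h; have [->|mn] := eqVneq m 0.
  by rewrite powR0 ?gt_eqF // mulr0 add0r divr_ge0 // mulr_ge0 ?powR_ge0 // ltW.
set q := m `^ (2 * u - 1); set r := m `^ u.
have q0 : 0 <= q by exact: powR_ge0.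
have r0 : 0 <= r by exact: powR_ge0.
have rq : r ^+ 2 = m * q.
  rewrite /r /q -powR_mulrn ?powR_ge0 // -powRrM -[X in _ = X * _](powRr1 m0) -powRD ?mn ?implybT //.
  by congr powR; ring.
have ei : eta^-1 * eta = 1 by rewrite mulVf // gt_eqF.
have ei0 : 0 < eta^-1 by rewrite invr_gt0.
have x0 : 0 <= (eta^-1 * m + eta * q) / 2 by rewrite divr_ge0 // addr_ge0 // mulr_ge0 // ltW.
rewrite -(@ler_pXn2r _ 2) ?nnegrE // rq.
have := sqr_ge0 (eta^-1 * m - eta * q).
have -> : m * q = (eta^-1 * m) * (eta * q) by rewrite mulrACA ei mul1r.
move: (eta^-1 * m) (eta * q) => A B; rewrite expr2; nra.
Qed.

(** The exponents 1 and [2 u - 1] have mean [u], so a tiny [L^1] norm of the later bump beats a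
    large [L^(2 u - 1)] norm of the earlier one; [eta] balances the two terms. *)
Lemma pint_min (t t' : T) (de D ep : R) : 0 < de -> 0 < D ->
  (pint mu (2 * u - 1) (F t) <= (D `^ (2 * u - 1))%:E)%E -> (pint mu 1 (F t') <= ep%:E)%E ->
  ep <= de `^ u * (de `^ u / D `^ (2 * u - 1)) ->
  (pint mu u (fun x => Num.min (F t x) (F t' x)) <= (de `^ u)%:E)%E.
Proof.
move=> de0 D0 pD pe he.
set P := D `^ (2 * u - 1) in pD he *; have P0 : 0 < P by exact: powR_gt0.
set Q := de `^ u in he *; have Q0 : 0 < Q by exact: powR_gt0.
pose eta := Q / P; have eta0 : 0 < eta by rewrite divr_gt0.
have mt := measurable_powf (2 * u - 1) (mF t); have mt' := measurable_powf 1 (mF t').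
apply: (@le_trans _ _ (\int[mu]_x ((eta^-1 / 2)%:E * (`|F t' x| `^ 1)%:E + (eta / 2)%:E * (`|F t x| `^ (2 * u - 1))%:E))%E).
  apply: ge0_le_integral => //.
  - by apply: measurable_powf; exact: measurable_minr.
  - by apply: emeasurable_funD; exact: measurable_funeM.
  move=> x _; rewrite -!EFinM -EFinD lee_fin powRr1 // !(ger0_norm (F0 _ _)) (ger0_norm (min_ge0 _ _ _)).
  apply: le_trans (min_pow (F0 t x) (F0 t' x) eta0) _.
  by apply: le_of_eq; ring.
rewrite ge0_integralD //; first last.
- exact: measurable_funeM.
- by move=> x _; rewrite mule_ge0 ?lee_fin ?powR_ge0 // divr_ge0 // ltW.
- exact: measurable_funeM.
- by move=> x _; rewrite mule_ge0 ?lee_fin ?powR_ge0 // divr_ge0 // invr_ge0 ltW.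
rewrite !ge0_integralZl ?lee_fin //; [|by rewrite divr_ge0 // ltW|by rewrite divr_ge0 // invr_ge0 ltW].
apply: (@le_trans _ _ ((eta^-1 / 2)%:E * ep%:E + (eta / 2)%:E * P%:E)%E).
  apply: leeD; apply: lee_wpmul2l => //; rewrite lee_fin divr_ge0 // ?invr_ge0 ltW //.
rewrite -!EFinM -EFinD lee_fin.
have h1 : eta^-1 / 2 * ep <= Q / 2.
  rewrite mulrAC ler_pM2r ?invr_gt0 // mulrC ler_pdivrMr //; exact: he.
have h2 : eta / 2 * P = Q / 2 by rewrite /eta mulrAC divfK ?gt_eqF.
by rewrite h2; lra.
Qed.

Lemma pint0 v : 0 < v -> pint mu v (fun=> 0 : R) = 0%E.
Proof.
move=> v0; rewrite /pint (eq_integral (fun=> 0%:E)) ?integral0 // => x _.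
by rewrite normr0 powR0 // gt_eqF.
Qed.

Lemma pint_pairl (de : R) (r : rel T) (s : seq T) : 0 < de ->
  (forall t t', r t t' -> pint mu u (fun x => Num.min (F t x) (F t' x)) <= (de `^ u)%:E)%E ->
  pairwise r s -> (pint mu u (pairl s) <= (((size s ^ 2).+1%:R * de) `^ u)%:E)%E.
Proof.
move=> de0 h.
have mn t s' : all (r t) s' -> (pint mu u (minl t s') <= (((size s').+1%:R * de) `^ u)%:E)%E.
  elim: s' => [|t' s' IH] /=.
    move=> _; rewrite (_ : minl t [::] = fun=> 0); first by rewrite pint0 // lee_fin powR_ge0.
    by apply/funext => x; rewrite /minl big_nil.
  move=> /andP[rt rs]; rewrite (_ : minl t (t' :: s') = fun x => Num.min (F t x) (F t' x) + minl t s' x); last first.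
    by apply/funext => x; rewrite /minl big_cons.
  rewrite -[(size s').+2%:R]natr1 mulrDl mul1r addrC.
  apply: pintD => //; [exact: ltW|by rewrite mulr_gt0 // ltr0n|exact: measurable_minr|exact: measurable_minl|exact: h|exact: IH].
elim: s => [|t s IH] /=.
  by move=> _; rewrite pint0 // lee_fin powR_ge0.
move=> /andP[rt /IH{}IH].
apply: (@le_trans _ _ ((((size s).+1%:R * de + (size s ^ 2).+1%:R * de) `^ u)%:E)).
  apply: pintD => //; [exact: ltW|by rewrite mulr_gt0 // ltr0n|by rewrite mulr_gt0 // ltr0n|exact: measurable_minl|exact: measurable_pairl|exact: mn].
apply: le_powRE; [exact: ltW|by rewrite addr_ge0 // mulr_ge0 // ltW|].
rewrite -mulrDl ler_wpM2r ?(ltW de0) // -natrD ler_nat.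
by rewrite -!mulnn; lia.
Qed.
End hump.

Lemma pairwise_choice (r : rel nat) (n : nat) (N1 : nat) :
  (forall N, exists N0, forall N', (N0 <= N')%N -> r N N') ->
  exists s : seq nat, [/\ size s = n, pairwise r s & all (leq N1) s].
Proof.
move=> h; elim: n => [|n [s [ss rs ls]]]; first by exists [::].
have [N0 hN0] : exists N0, forall N', (N0 <= N')%N -> all (r^~ N') s.
  elim: s {ss rs ls} => [|N s [N0 IH]]; first by exists 0%N.
  have [N2 h2] := h N; exists (maxn N0 N2) => N'; rewrite geq_max => /andP[a1 a2] /=.
  by rewrite h2 // IH.
exists (rcons s (maxn N0 N1)); split; first by rewrite size_rcons ss.
  by rewrite pairwise_rcons hN0 ?leq_maxl // rs.
by rewrite all_rcons leq_maxr ls.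
Qed.

(** * Selection of sparse scales *)

Section hump_family.
Context d (X : measurableType d) (R : realType) (mu : {measure set X -> \bar R}).
Variables (I : Type) (F : I -> nat -> X -> R) (u A : R) (D e : nat -> R).
Hypotheses (F0 : forall k t x, 0 <= F k t x) (mF : forall k t, measurable_fun setT (F k t)).
Hypotheses (u1 : 1 < u) (A0 : 0 < A) (D0 : forall N, 0 < D N).
Hypothesis FA : forall k N, (pint mu u (F k N) <= (A `^ u)%:E)%E.
Hypothesis FD : forall k N, (pint mu (2 * u - 1) (F k N) <= (D N `^ (2 * u - 1))%:E)%E.
Hypothesis Fe : forall k N, (pint mu 1 (F k N) <= (e N)%:E)%E.
Hypothesis e0 : forall ep : R, 0 < ep -> exists N0, forall N, (N0 <= N)%N -> e N <= ep.

Lemma gliding_hump (n N1 : nat) : exists s : seq nat,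
  [/\ size s = n.+1, pairwise (fun N N' => N.*2 < N')%N s, all (leq N1) s &
   forall k, (pint mu u (fun x => (\sum_(N <- s) F k N x)%R) <= (((A + 1) * n.+1%:R `^ u^-1) `^ u)%:E)%E].
Proof.
have u0 : 0 < u by rewrite (lt_trans _ u1).
(* For [n + 1] bumps the pairwise minima add up to at most [((n + 1)^2 + 1) de], which this choice
   makes equal to 1. *)
pose de : R := (n.+1 ^ 2).+1%:R^-1; have de0 : 0 < de by rewrite invr_gt0 ltr0n.
pose r (N N' : nat) := (e N' <= de `^ u * (de `^ u / D N `^ (2 * u - 1))) && (N.*2 < N')%N.
have [s [ss rs ls]] : exists s : seq nat, [/\ size s = n.+1, pairwise r s & all (leq N1) s].
  apply: pairwise_choice => N.
  have P0 : 0 < de `^ u * (de `^ u / D N `^ (2 * u - 1)) by rewrite mulr_gt0 ?powR_gt0 // divr_gt0 ?powR_gt0.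
  have [N0 h] := @e0 _ P0.
  by exists (maxn N0 N.*2.+1) => N'; rewrite geq_max /r => /andP[a1 a2]; rewrite h.
exists s; split => //; first by apply: sub_pairwise rs => N N' /andP[].
move=> k.
have r1 : 0 < n.+1%:R `^ u^-1 * A by rewrite mulr_gt0 // powR_gt0 // ltr0n.
have pM := pint_maxl (mF k) u1 s (FA k).
have pP : (pint mu u (pairl (F k) s) <= (1 `^ u)%:E)%E.
  have := @pint_pairl _ X R mu nat (F k) (mF k) u u1 de r s de0 _ rs.
  rewrite ss /de mulfV ?pnatr_eq0 //; apply => t t' /andP[ht _].
  exact: (pint_min (F0 k) (mF k) u1 de0 (D0 t) (FD k t) (Fe k t') ht).
have pM' : (pint mu u (maxl (F k) s) <= ((n.+1%:R `^ u^-1 * A) `^ u)%:E)%E.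
  by rewrite powRM ?powR_ge0 ?(ltW A0) // -powRrM mulVf ?gt_eqF // powRr1 // -ss.
have mM := measurable_maxl (mF k) s; have mP := measurable_pairl (mF k) s.
apply: (@le_trans _ _ (pint mu u (fun x => maxl (F k) s x + pairl (F k) s x))).
  apply: (pint_le mu (ltW u0)); [by apply: measurable_sum => t; exact: mF|exact: measurable_funD|].
  move=> x; rewrite !ger0_norm; [exact: sum_maxl|by rewrite addr_ge0 // ?maxl_ge0 ?pairl_ge0|by rewrite sumr_ge0].
apply: le_trans (pintD (ltW u1) r1 ltr01 mM mP pM' pP) _.
apply: le_powRE; [exact: ltW|by rewrite addr_ge0 // ltW|].
have : 1 `^ u^-1 <= n.+1%:R `^ u^-1 by rewrite ge0_ler_powR ?invr_ge0 ?nnegrE ?ler1n // ltW.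
by rewrite powR1 mulrDl mul1r mulrC; lra.
Qed.
End hump_family.

(** * Gaussians of the sum of the frequencies *)

Section shl.
Variables (R : realType) (l n : nat) (i0 : 'I_l) (J : pred 'I_l).
Hypothesis Ji0 : J i0.
Local Notation B := ('I_l * 'I_n)%type.
Local Notation E := (fspace R B).
Local Notation EL := (fspace R 'I_l).

Definition slice (x : B -> R) (k : 'I_n) : 'I_l -> R := fun i => x (i, k).
Definition sgm (xi : 'I_l -> R) : R := \sum_(i | J i) xi i.
Definition sgw (k : 'I_n) : B -> R := fun b => (J b.1 && (b.2 == k))%:R.

Lemma dotp_sgw (x : B -> R) k : dotp x (sgw k) = sgm (slice x k).
Proof.
transitivity (\sum_i \sum_k' x (i, k') * sgw k (i, k')).
  by rewrite pair_bigA /=; apply: eq_bigr => -[i k'].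
rewrite /sgm [RHS]big_mkcond; apply: eq_bigr => i _; rewrite (bigD1 k) //= big1 => [|k' /negbTE nk].
  by rewrite /sgw /= eqxx andbT addr0 /slice; case: (J i); rewrite ?mulr1 ?mulr0.
by rewrite /sgw /= nk andbF mulr0.
Qed.

Lemma sum_slices (F : B -> R) : \sum_b F b = \sum_k \sum_i F (i, k).
Proof. by rewrite exchange_big pair_bigA /=; apply: eq_bigr => -[i k]. Qed.

Definition shl (a : R) (c : 'I_l -> R) : seq (qitem R B) :=
  [seq (a, sgw k, 0) | k <- index_enum 'I_n] ++ [seq (c b.1, dlt R b, 0) | b <- index_enum B].

Lemma qf_shl a c x : qf (shl a c) x =
  \sum_k (a * sgm (slice x k) ^+ 2 + \sum_i c i * slice x k i ^+ 2).
Proof.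
rewrite /qf /shl big_cat /= !big_map /= big_split /=; congr (_ + _).
  by apply: eq_bigr => k _; rewrite /lin /= dotp_sgw subr0.
by rewrite sum_slices; apply: eq_bigr => k _; apply: eq_bigr => i _; rewrite /lin /= dotp_dlt subr0.
Qed.

Lemma qd_shl a c b x : qd (shl a c) b x =
  a * (2 * sgm (slice x b.2) * (J b.1)%:R) + c b.1 * (2 * x b).
Proof.
rewrite /qd /shl big_cat /= !big_map /=; congr (_ + _).
  rewrite (bigD1 b.2) //= big1 => [|k /negbTE nk].
    by rewrite /lin /= dotp_sgw subr0 addr0 /sgw eqxx andbT.
  by rewrite /sgw eq_sym nk andbF !mulr0.
rewrite (bigD1 b) //= big1 => [|b' /negbTE nb].
  by rewrite /lin /= dotp_dlt subr0 addr0 /dlt eqxx mulr1.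
by rewrite /dlt eq_sym nb !mulr0.
Qed.

Lemma qh_shl_le a c b' b : `|qh (shl a c) b' b| <= 2 * `|a| + 2 * `|c b.1|.
Proof.
rewrite /qh /shl big_cat /= !big_map /=; apply: le_trans (ler_normD _ _) _; apply: lerD.
  rewrite (bigD1 b.2) //= big1 => [|k /negbTE nk].
    rewrite addr0 -mulrA mulrCA 2!normrM (@ger0_norm _ 2) // ler_wpM2l // -[leRHS]mulr1 ler_wpM2l //.
    by rewrite /sgw -natrM ger0_norm // lern1; case: andb; case: andb.
  by rewrite /sgw [b.2 == k]eq_sym nk andbF !(mulr0, mul0r).
rewrite (bigD1 b) //= big1 => [|b'' /negbTE nb].
  rewrite addr0 /dlt eqxx mulr1 !normrM mulrCA (@ger0_norm _ 2) // ler_wpM2l // -[leRHS]mulr1 ler_wpM2l //.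
  by case: eqP; rewrite ?normr1 ?normr0.
by rewrite /dlt [b == _]eq_sym nb !(mulr0, mul0r).
Qed.

Variables (al : R) (w : 'I_l -> R).
Hypotheses (al0 : 0 <= al) (w1 : forall i, 1 <= w i).
(** Lower bound of the exponent through which its derivatives are controlled. A large [al] means
    concentration near the hyperplane [sgm = 0], a large [w i] concentration near [xi_i = 0]. *)
Definition yq (xi : 'I_l -> R) : R := al * sgm xi ^+ 2 + \sum_i w i * xi i ^+ 2.
(** The exponent carries a factor [pi] and [qcond] asks it to dominate [2 Y], hence [pi / 2]. *)
Definition Yq (rho : R) (x : E) : R := pi / 2 * \sum_k yq (fun i => rho * slice x k i).

Lemma yq_ge0 xi : 0 <= yq xi.
Proof. by apply: addr_ge0; [rewrite mulr_ge0 ?sqr_ge0|apply: sumr_ge0 => i _; rewrite mulr_ge0 ?sqr_ge0 // (le_trans _ (w1 i))]. Qed.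

Lemma Yq_ge0 rho x : 0 <= Yq rho x.
Proof. by rewrite mulr_ge0 ?divr_ge0 ?pi_ge0 // sumr_ge0 // => k _; exact: yq_ge0. Qed.

Lemma yq_scale rho xi : yq (fun i => rho * xi i) = rho ^+ 2 * yq xi.
Proof.
rewrite /yq /sgm -mulr_sumr exprMn mulrDr mulrCA; congr (_ + _).
by rewrite mulr_sumr; apply: eq_bigr => i _; rewrite exprMn mulrCA.
Qed.

Lemma measurable_slice (k : 'I_n) : measurable_fun setT (fun x : E => slice x k : EL).
Proof. by apply: measurable_fspace => i; exact: measurable_coord. Qed.

Lemma measurable_sgm : measurable_fun setT (sgm : EL -> R).
Proof.
rewrite (_ : sgm = fun x : EL => \sum_i (if J i then x i else 0)); last by apply/funext => x; rewrite /sgm big_mkcond.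
by apply: measurable_sum => i; case: (J i); [exact: measurable_coord|exact: measurable_cst].
Qed.

Lemma measurable_yq : measurable_fun setT (yq : EL -> R).
Proof.
apply: measurable_funD.
  by apply: measurable_funM => //; apply: measurable_funX; exact: measurable_sgm.
by apply: measurable_sum => i; apply: measurable_funM => //; apply: measurable_funX; exact: measurable_coord.
Qed.

Lemma measurable_Yq rho : measurable_fun setT (Yq rho).
Proof.
apply: measurable_funM => //; apply: measurable_sum => k.
rewrite (_ : (fun x => _) = fun x : E => rho ^+ 2 * yq (slice x k)); last by apply/funext => x; rewrite yq_scale.
apply: measurable_funM => //.
exact: (@measurableT_comp _ _ _ _ _ _ (yq : EL -> R) _ (fun x : E => slice x k : EL) measurable_yq (measurable_slice k)).
Qed.

Lemma yq_le_Yq rho x k : yq (fun i => rho * slice x k i) <= Yq rho x.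
Proof.
have p1 : 1 <= pi / 2 :> R by exact: pihalf_ge1.
apply: (@le_trans _ _ (\sum_k yq (fun i => rho * slice x k i))).
  by rewrite (bigD1 k) //= lerDl sumr_ge0 // => k' _; exact: yq_ge0.
by rewrite /Yq ler_peMl // sumr_ge0 // => k' _; exact: yq_ge0.
Qed.

Section cond.
Variables (N Cc be0 ga0 : R) (c c' : 'I_l -> R).
Hypotheses (C1 : 1 <= Cc) (N1 : 1 <= N).
Hypothesis Hq : forall xi, yq xi <= be0 * sgm xi ^+ 2 + \sum_i c i * xi i ^+ 2.
Hypothesis Hs : forall xi, `|be0| * `|sgm xi| <= Cc * N * (1 + yq xi) /\ `|ga0| * `|sgm xi| <= Cc * N * (1 + yq xi).
Hypothesis Hc : forall i xi, `|c i| * `|xi i| <= Cc * N * (1 + yq xi) /\ `|c' i| * `|xi i| <= Cc * N * (1 + yq xi).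
Hypothesis Hh : forall i, [/\ `|be0| <= Cc * N ^+ 2, `|ga0| <= Cc * N ^+ 2, `|c i| <= Cc * N ^+ 2 & `|c' i| <= Cc * N ^+ 2].

Lemma qd_shl_le rho a (f : 'I_l -> R) lam x b : 0 < rho -> rho * N <= lam ->
  (forall xi, `|a| * `|sgm xi| <= Cc * N * (1 + yq xi)) ->
  (forall i xi, `|f i| * `|xi i| <= Cc * N * (1 + yq xi)) ->
  `|qd (shl (pi * rho ^+ 2 * a) (fun i => pi * rho ^+ 2 * f i)) b x| <= lam * (4 * pi * Cc * (1 + Yq rho x)).
Proof.
move=> r0 rl h1 h2; rewrite qd_shl.
pose xi := fun i => rho * slice x b.2 i; set Y := Yq rho x.
have yY : yq xi <= Y := yq_le_Yq rho x b.2.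
have p0 : 0 < pi :> R := pi_gt0 R.
have NY : Cc * N * (1 + yq xi) <= Cc * N * (1 + Y).
  by rewrite ler_wpM2l ?lerD2l // mulr_ge0 // (le_trans ler01).
have e1 : `|pi * rho ^+ 2 * a * (2 * sgm (slice x b.2) * (J b.1)%:R)| <= 2 * pi * (rho * (Cc * N * (1 + Y))).
  have -> : pi * rho ^+ 2 * a * (2 * sgm (slice x b.2) * (J b.1)%:R) = (2 * pi * rho) * (a * sgm xi) * (J b.1)%:R.
    by rewrite /xi {2}/sgm -mulr_sumr -/(sgm _); ring.
  rewrite normrM -[leRHS]mulr1; apply: ler_pM => //; last by case: (J _); rewrite ?normr1 ?normr0.
  rewrite normrM ger0_norm; last by rewrite mulr_ge0 ?(ltW r0) // mulr_ge0 // ltW.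
  rewrite -[leLHS]mulrA ler_wpM2l //; first by rewrite mulr_ge0 // ltW.
  by rewrite ler_wpM2l ?(ltW r0) // normrM (le_trans (h1 xi)).
have e2 : `|pi * rho ^+ 2 * f b.1 * (2 * x b)| <= 2 * pi * (rho * (Cc * N * (1 + Y))).
  have -> : pi * rho ^+ 2 * f b.1 * (2 * x b) = (2 * pi * rho) * (f b.1 * xi b.1).
    rewrite /xi /slice -surjective_pairing; ring.
  rewrite normrM ger0_norm; last by rewrite mulr_ge0 ?(ltW r0) // mulr_ge0 // ltW.
  rewrite -[leLHS]mulrA ler_wpM2l //; first by rewrite mulr_ge0 // ltW.
  by rewrite ler_wpM2l ?(ltW r0) // normrM (le_trans (h2 b.1 xi)).
apply: le_trans (ler_normD _ _) _; apply: le_trans (lerD e1 e2) _.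
have P0 : 0 <= 4 * pi * Cc * (1 + Y).
  exact: mulr_ge0 (mulr_ge0 (mulr_ge0 (ler0n _ 4) (ltW p0)) (le_trans ler01 C1)) (addr_ge0 ler01 (Yq_ge0 _ _)).
have -> : 2 * pi * (rho * (Cc * N * (1 + Y))) + 2 * pi * (rho * (Cc * N * (1 + Y))) = rho * N * (4 * pi * Cc * (1 + Y)).
  move: (pi : R) => q; ring.
exact: ler_wpM2r.
Qed.

Lemma qh_shl_bound rho a (f : 'I_l -> R) lam x b b' : 0 < rho -> rho * N <= lam ->
  `|a| <= Cc * N ^+ 2 -> (forall i, `|f i| <= Cc * N ^+ 2) ->
  `|qh (shl (pi * rho ^+ 2 * a) (fun i => pi * rho ^+ 2 * f i)) b b'| <= lam ^+ 2 * (4 * pi * Cc * (1 + Yq rho x)).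
Proof.
move=> r0 rl h1 h2; apply: le_trans (qh_shl_le _ _ _ _) _.
have p0 : 0 < pi :> R := pi_gt0 R.
have q0 : 0 <= pi * rho ^+ 2 by rewrite mulr_ge0 ?sqr_ge0 // ltW.
have P0 : 0 <= 4 * pi * Cc := mulr_ge0 (mulr_ge0 (ler0n _ 4) (ltW p0)) (le_trans ler01 C1).
apply: (@le_trans _ _ ((rho * N) ^+ 2 * (4 * pi * Cc))).
  have -> : (rho * N) ^+ 2 * (4 * pi * Cc) = 2 * (pi * rho ^+ 2 * (Cc * N ^+ 2)) + 2 * (pi * rho ^+ 2 * (Cc * N ^+ 2)).
    move: (pi : R) => q; ring.
  by apply: lerD; rewrite normrM (ger0_norm q0) ler_wpM2l // ler_wpM2l.
apply: ler_pM => //; first exact: sqr_ge0.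
  by apply: lerXn2r => //; rewrite nnegrE ?mulr_ge0 ?(le_trans _ rl) // ?(ltW r0) ?(le_trans _ N1) // mulr_ge0 // ltW // (lt_le_trans _ N1).
by rewrite ler_peMr // lerDl Yq_ge0.
Qed.

(** A dilation by [rho] multiplies each derivative by [rho] and the form itself has steepness [N],
    so a derivative costs [rho N], replaced by 1 if smaller. *)
Lemma qcond_shl rho lam : 0 < rho -> 1 <= lam -> rho * N <= lam ->
  qcond (shl (pi * rho ^+ 2 * be0) (fun i => pi * rho ^+ 2 * c i))
        (shl (pi * rho ^+ 2 * ga0) (fun i => pi * rho ^+ 2 * c' i)) lam (4 * pi * Cc) (Yq rho).
Proof.
move=> r0 l1 rl; split => //; [exact: measurable_Yq|exact: Yq_ge0| |split].
- move=> x _; rewrite qf_shl /Yq mulrA (_ : 2 * (pi / 2) = pi); last by rewrite mulrC divfK.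
  rewrite mulr_sumr; apply: ler_sum => k _.
  apply: (@le_trans _ _ (pi * (be0 * sgm (fun i => rho * slice x k i) ^+ 2 + \sum_i c i * (rho * slice x k i) ^+ 2))).
    by rewrite ler_wpM2l ?pi_ge0 //; exact: Hq.
  apply: le_of_eq; rewrite mulrDr; congr (_ + _).
    by rewrite /sgm -mulr_sumr; move: (pi : R) => q; ring.
  by rewrite mulr_sumr; apply: eq_bigr => i _; move: (pi : R) => q; ring.
- by move=> x b _; apply: qd_shl_le => // [xi|i xi]; [case: (Hs xi)|case: (Hc i xi)].
- by move=> x b _; apply: qd_shl_le => // [xi|i xi]; [case: (Hs xi)|case: (Hc i xi)].
- by move=> x b b' _; apply: qh_shl_bound => // [|i]; [case: (Hh b.1)|case: (Hh i)].
- by move=> x b b' _; apply: qh_shl_bound => // [|i]; [case: (Hh b.1)|case: (Hh i)].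
Qed.
End cond.
End shl.

Lemma lee_prod (R : realType) (I : finType) (f g : I -> \bar R) :
  (forall i, 0 <= f i <= g i)%E -> (\prod_i f i <= \prod_i g i)%E.
Proof.
move=> h; suff [] : (0 <= \prod_i f i)%E /\ (\prod_i f i <= \prod_i g i)%E by [].
apply: (big_ind2 (fun x y : \bar R => (0 <= x)%E /\ (x <= y)%E)) => [|x1 x2 y1 y2 [a1 a2] [b1 b2]|i _].
- by split.
- by split; [exact: mule_ge0|exact: lee_pmul].
- by have /andP[] := h i.
Qed.

(** * Volume of the concentration set *)

Section shear_integral.
Variables (R : realType) (l n : nat) (i0 : 'I_l) (J : pred 'I_l).
Hypothesis Ji0 : J i0.
Local Notation B := ('I_l * 'I_n)%type.
Local Notation E := (fspace R B).
Local Notation EL := (fspace R 'I_l).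
Local Notation mu := (@mu_fspace R B).
Local Notation leb := (@lebesgue_measure R).
Local Notation RT := (measurableTypeR R).

(** Gaussian cut off to [[-2 l, 2 l]], an interval containing all coordinates and partial sums over
    [i] of a point of the annulus. Its integral stays bounded even at rate 0. *)
Definition hb (a t : R) : R := \1_(`[(- (2 * l%:R))%R, (2 * l%:R)%R]%classic) t * gex a t.

Lemma hb_ge0 a t : 0 <= hb a t.
Proof. by rewrite mulr_ge0 ?gex_ge0 // indicE. Qed.

Lemma measurable_hb a : measurable_fun setT (hb a : RT -> R).
Proof. by apply: measurable_funM; [exact: measurable_indic|exact: measurable_gex]. Qed.

Lemma hb_int a : 0 <= a -> (\int[leb]_t (hb a t)%:E <= (4 * l%:R)%:E)%E.
Proof.
move=> a0; apply: (@le_trans _ _ (\int[leb]_t (\1_(`[(- (2 * l%:R))%R, (2 * l%:R)%R]%classic) t)%:E)%E).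
  apply: ge0_le_integral => //.
  - by move=> t _; rewrite lee_fin hb_ge0.
  - by apply/measurable_EFinP; exact: measurable_hb.
  - by apply/measurable_EFinP; exact: measurable_indic.
  move=> t _; rewrite lee_fin /hb ler_piMr // ?indicE //.
  by rewrite /gex -expR0 ler_expR oppr_le0 mulr_ge0 ?sqr_ge0 // mulr_ge0 ?pi_ge0.
rewrite integral_indic // setIT.
have h := @lebesgue_measure_itv R (`[(- (2 * l%:R))%R, (2 * l%:R)%R]); rewrite /= in h.
apply: (@eq_ind_r _ _ (fun z => (z <= _)%E) _ _ h).
rewrite lte_fin; case: ifP => _; last by rewrite lee_fin mulr_ge0.
by rewrite -EFinB lee_fin opprK -mulrDl; rewrite -natrD.
Qed.

Lemma hb_int_pos a : 0 < a -> (\int[leb]_t (hb a t)%:E <= (a `^ (- (1 / 2)))%:E)%E.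
Proof.
move=> a0; rewrite -(integral_gex a0); apply: ge0_le_integral => //.
- by move=> t _; rewrite lee_fin hb_ge0.
- by apply/measurable_EFinP; exact: measurable_hb.
- by apply/measurable_EFinP; exact: measurable_gex.
by move=> t _; rewrite lee_fin /hb ler_piMl ?gex_ge0 // indicE lern1 leq_b1.
Qed.

Variables (al : R) (w : 'I_l -> R) (rho : R).
Hypotheses (al0 : 0 <= al) (w1 : forall i, 1 <= w i) (rho0 : 0 < rho).

Definition hsl (xi : 'I_l -> R) : R :=
  hb (al * rho ^+ 2 / 4) (sgm J xi) * \prod_(i | i != i0) hb (w i * rho ^+ 2 / 4) (xi i).

Lemma hsl_ge0 xi : 0 <= hsl xi.
Proof. by rewrite mulr_ge0 ?hb_ge0 // prodr_ge0 // => i _; exact: hb_ge0. Qed.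

Lemma measurable_hsl : measurable_fun setT (hsl : EL -> R).
Proof.
apply: measurable_funM.
  exact: (@measurableT_comp _ _ _ _ _ _ (hb (al * rho ^+ 2 / 4) : RT -> R) _ (sgm J : EL -> R) (measurable_hb _) (@measurable_sgm R l J)).
rewrite (_ : (fun xi => _) = fun xi : EL => \prod_i (if i != i0 then hb (w i * rho ^+ 2 / 4) (xi i) else 1)); last first.
  by apply/funext => xi; rewrite -big_mkcond.
apply: measurable_prod => i _; case: (i != i0); last exact: measurable_cst.
exact: (@measurableT_comp _ _ _ _ _ _ (hb (w i * rho ^+ 2 / 4) : RT -> R) _ (fun xi : EL => xi i) (measurable_hb _) (measurable_coord i)).
Qed.

(** [Y] is split in two. One half gives the factors [hb]; the other is at least [pi rho^2 / 16],
    because all weights are at least 1 and [|x|^2 >= 1/4] on the annulus. *)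
Lemma annY_le (x : E) : annY (Yq J al w rho) x <= expR (- (pi * rho ^+ 2 / 16)) * \prod_k hsl (slice x k).
Proof.
rewrite /annY indicE; case: (boolP (x \in _)) => [xa|_]; last first.
  by rewrite mul0r mulr_ge0 ?expR_ge0 // prodr_ge0 // => k _; exact: hsl_ge0.
rewrite mul1r; move: xa; rewrite inE /ann /= => /andP[x1 x4].
have xb b : `|x b| <= 2.
  have := le_trans (sqr_coord_le x b) x4; rewrite -real_normK ?num_real //.
  by have := normr_ge0 (x b); move: `|x b| => a; nra.
have l1 : 1 <= l%:R :> R by rewrite ler1n; case: (l) i0 => // -[].
have xl b : `|x b| <= 2 * l%:R by rewrite (le_trans (xb b)) // ler_peMr.
have hbE a t : `|t| <= 2 * l%:R -> hb a t = gex a t.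
  by move=> tl; rewrite /hb indicE mem_set ?mul1r //= in_itv /= -ler_norml.
have hE k : hsl (slice x k) = expR (- (pi * (al * rho ^+ 2 / 4) * sgm J (slice x k) ^+ 2 +
    \sum_(i | i != i0) pi * (w i * rho ^+ 2 / 4) * slice x k i ^+ 2)).
  rewrite /hsl hbE.
    rewrite opprD expRD -sumrN expR_sum; congr (_ * _); apply: eq_bigr => i _.
    by rewrite hbE //; exact: xl.
  apply: le_trans (ler_norm_sum _ _ _) _; apply: (@le_trans _ _ (\sum_(i < l) 2)); last first.
    by rewrite sumr_const card_ord mulr_natr.
  by rewrite big_mkcond; apply: ler_sum => i _; case: (J i) => //; exact: xb.
rewrite (eq_bigr _ (fun k _ => hE k)) -expR_sum -expRD ler_expR sumrN -opprD lerN2.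
pose S := \sum_k sgm J (slice x k) ^+ 2; pose W := \sum_k \sum_i w i * slice x k i ^+ 2.
have YE : Yq J al w rho x = pi / 2 * (rho ^+ 2 * (al * S + W)).
  rewrite /Yq; congr (_ * _); rewrite /S /W mulr_sumr -big_split /= mulr_sumr.
  by apply: eq_bigr => k _; rewrite yq_scale.
have W4 : 1 / 4 <= W.
  apply: le_trans x1 _; rewrite /sqnorm sum_slices; apply: ler_sum => k _; apply: ler_sum => i _.
  by rewrite ler_peMl // sqr_ge0.
have XE : \sum_k (pi * (al * rho ^+ 2 / 4) * sgm J (slice x k) ^+ 2 +
    \sum_(i | i != i0) pi * (w i * rho ^+ 2 / 4) * slice x k i ^+ 2) <= pi / 4 * (rho ^+ 2 * (al * S + W)).
  rewrite /S /W mulr_sumr -big_split /= mulr_sumr mulr_sumr; apply: ler_sum => k _.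
  rewrite mulrDr mulrDr; apply: lerD.
    by apply: le_of_eq; move: (pi : R) => q; ring.
  rewrite mulr_sumr mulr_sumr [leRHS](bigD1 i0) //= -[leLHS]add0r; apply: lerD.
    by rewrite mulr_ge0 ?divr_ge0 ?pi_ge0 // mulr_ge0 ?sqr_ge0 // mulr_ge0 ?sqr_ge0 // (le_trans _ (w1 i0)).
  apply: ler_sum => i _.
  by apply: le_of_eq; move: (pi : R) => q; ring.
rewrite YE; apply: le_trans (lerD (lexx _) XE) _.
have S0 : 0 <= S by apply: sumr_ge0 => k _; exact: sqr_ge0.
have aS : 0 <= al * S by rewrite mulr_ge0.
have p0 : 0 <= pi * rho ^+ 2 :> R by rewrite mulr_ge0 ?sqr_ge0 // pi_ge0.
have h := ler_wpM2l p0 (lerD aS W4); rewrite add0r in h.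
move: h; rewrite -!mulrA; move: (pi : R) (rho ^+ 2) (al * S + W) => q r y; lra.
Qed.

Lemma integral_hsl (g : 'I_l -> R) : (\int[leb]_t (hb (al * rho ^+ 2 / 4) t)%:E <= (g i0)%:E)%E ->
  (forall i, i != i0 -> \int[leb]_t (hb (w i * rho ^+ 2 / 4) t)%:E <= (g i)%:E)%E ->
  (integ (fun xi : 'I_l -> R => (hsl xi)%:E) <= (\prod_i g i)%:E)%E.
Proof.
move=> g0 g1.
pose h i : RT -> R := if i == i0 then hb (al * rho ^+ 2 / 4) else hb (w i * rho ^+ 2 / 4).
have h0 i t : 0 <= h i t by rewrite /h; case: ifP => _; exact: hb_ge0.
have mh i : measurable_fun setT (h i) by rewrite /h; case: ifP => _; exact: measurable_hb.
have hE (xi : EL) : hsl xi = \prod_i h i (shr i0 J xi i).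
  rewrite [RHS](bigD1 i0) //= /h eqxx shr_sum //; congr (_ * _).
  by apply: eq_bigr => i ni; rewrite (negbTE ni) shr_neq.
have mP : measurable_fun setT (fun xi : EL => (\prod_i h i (xi i))%:E).
  by apply/measurable_EFinP; apply: measurable_prod => i _; exact: (measurableT_comp (mh i) (measurable_coord i)).
have P0 (xi : EL) : (0 <= (\prod_i h i (xi i))%:E)%E by rewrite lee_fin prodr_ge0.
rewrite integE; [|by move=> xi; rewrite lee_fin hsl_ge0|by apply/measurable_EFinP; exact: measurable_hsl].
rewrite (eq_integral (fun xi : EL => (\prod_i h i (shr i0 J xi i))%:E)); last by move=> xi _; rewrite hE.
rewrite (@shrP R 'I_l i0 J (fun xi : EL => (\prod_i h i (xi i))%:E)) //.
rewrite -integE // (@integ_prod R 'I_l h) // -prodEFin.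
apply: lee_prod => i; rewrite /h; case: eqP => [->|/eqP ni]; rewrite ?g0 ?g1 ?andbT //;
  by rewrite integral_ge0 // => t _; rewrite lee_fin hb_ge0.
Qed.

Lemma pint_annY (g : 'I_l -> R) : (\int[leb]_t (hb (al * rho ^+ 2 / 4) t)%:E <= (g i0)%:E)%E ->
  (forall i, i != i0 -> \int[leb]_t (hb (w i * rho ^+ 2 / 4) t)%:E <= (g i)%:E)%E ->
  (pint mu 1 (annY (Yq J al w rho)) <= (expR (- (pi * rho ^+ 2 / 16)) * (\prod_i g i) ^+ n)%:E)%E.
Proof.
move=> g0 g1.
have mH : measurable_fun setT (fun x : E => \prod_k hsl (slice x k)).
  apply: measurable_prod => k _.
  exact: (@measurableT_comp _ _ _ _ _ _ (hsl : EL -> R) _ (fun x : E => slice x k : EL) measurable_hsl (measurable_slice k)).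
have H0 (x : E) : 0 <= \prod_k hsl (slice x k) by apply: prodr_ge0 => k _; exact: hsl_ge0.
have mA : measurable_fun setT (annY (Yq J al w rho) : E -> R).
  apply: measurable_funM; first by apply: measurable_indic; exact: measurable_ann.
  apply: (measurableT_comp (@measurable_expR R)).
  rewrite (_ : (fun x => _) = fun x : E => 0 - Yq J al w rho x); last by apply/funext => x; rewrite sub0r.
  by apply: measurable_funB => //; exact: measurable_Yq.
rewrite pint1.
apply: (@le_trans _ _ (\int[mu]_x ((expR (- (pi * rho ^+ 2 / 16)))%:E * (\prod_k hsl (slice x k))%:E)%E)%E).
  apply: ge0_le_integral => //.
  - by apply/measurable_EFinP; exact: measurableT_comp.
  - by apply: measurable_funeM; exact/measurable_EFinP.
  move=> x _; rewrite -EFinM lee_fin ger0_norm; first exact: annY_le.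
  by rewrite mulr_ge0 ?expR_ge0 // indicE.
rewrite ge0_integralZl //; first last.
- by move=> x _; rewrite lee_fin.
- exact/measurable_EFinP.
rewrite EFinM; apply: lee_pmul => //; first by rewrite integral_ge0 // => x _; rewrite lee_fin.
rewrite -integE //; last exact/measurable_EFinP.
pose be (k : 'I_n) (i : 'I_l) : B := (i, k).
have be_bij : bijective (fun jb : 'I_n * 'I_l => be jb.1 jb.2) by exists (fun b => (b.2, b.1)); case.
have := @ge0_integ_blocks R B 'I_n 'I_l be be_bij (fun=> hsl) (fun=> hsl_ge0) (fun=> measurable_hsl).
move=> h; apply: (@le_trans _ _ (\prod_(k < n) integ (fun xi : 'I_l -> R => (hsl xi)%:E))%E).
  by rewrite -h.
rewrite (_ : (\prod_i g i) ^+ n = \prod_(k < n) \prod_i g i); last by rewrite prodr_const card_ord.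
rewrite -prodEFin; apply: lee_prod => k.
rewrite integral_hsl // andbT integE; [|by move=> x; rewrite lee_fin hsl_ge0|by apply/measurable_EFinP; exact: measurable_hsl].
by rewrite integral_ge0 // => x _; rewrite lee_fin hsl_ge0.
Qed.
End shear_integral.

(** * Multipliers with explicit Gaussian output *)

Section shear_test.
Variables (R : realType) (l d n : nat) (j0 : 'I_d) (i0 : 'I_l) (J : pred 'I_l).
Hypothesis Ji0 : J i0.
Local Notation C := (R[i]).
Local Notation B := ('I_l * 'I_n)%type.
Local Notation EB := (fspace R B).
Local Notation EL := (fspace R 'I_l).
Local Notation PJ := (ptJ d n).

Definition cge (X Y : R) : C := cR (expR X) * cexpi Y.

Lemma cgeM X Y X' Y' : cge X Y * cge X' Y' = cge (X + X') (Y + Y').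
Proof. by rewrite /cge expRD cRM cexpiD mulrACA. Qed.

Lemma cge_sum (T : Type) (s : seq T) (P : pred T) (X Y : T -> R) :
  \prod_(i <- s | P i) cge (X i) (Y i) = cge (\sum_(i <- s | P i) X i) (\sum_(i <- s | P i) Y i).
Proof.
elim: s => [|i s IH]; first by rewrite !big_nil /cge expR0 cexpi0 mulr1.
by rewrite !big_cons; case: (P i); rewrite IH // cgeM.
Qed.

Lemma hgE (b g t : R) : hg b g 0 t = cge (- (pi * b * t ^+ 2)) (pi * g * t ^+ 2).
Proof. by rewrite /hg /cge /gex mul0r addr0. Qed.

Lemma hgFE (b g t : R) : hgF b g t =
  kap2 b g * cge (- (pi * b / gD b g * t ^+ 2)) (- (pi * g / gD b g * t ^+ 2)).
Proof. by []. Qed.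

Variables (be0 ga0 : R) (be b g : 'I_l -> R).
Hypotheses (be00 : 0 < be0) (be_gt0 : forall i, 0 < be i) (b0 : forall i, 0 < b i).

(** Exponents left to the multiplier: the prescribed ones minus those already supplied by the input
    transforms. At [i0] nothing is prescribed, because that variable is replaced by the sum over
    [J]; the coefficient there is negative. [cp] plays the same role for the phases. *)
Definition cq i : R := (if i == i0 then 0 else be i) - b i / gD (b i) (g i).
Definition cp i : R := g i / gD (b i) (g i).

Definition smul (v : B -> R) : C :=
  cR (expR (- qf (shl n J (pi * be0) (fun i => pi * cq i)) (v : EB))) *
  cexpi (qf (shl n J (pi * ga0) (fun i => pi * cp i)) (v : EB)).

Definition spiece : EL -> C := shM i0 J (hg be0 ga0 0) (fun i => hg (be i) 0 0).

Lemma smulE v : smul v * \prod_i \prod_(k < n) hgF (b i) (g i) (0 - v (i, k)) =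
  (\prod_i kap2 (b i) (g i)) ^+ n * \prod_(k < n) spiece (fun i => v (i, k)).
Proof.
have -> : smul v = \prod_(k < n) cge
    (- (pi * be0 * sgm J (slice v k) ^+ 2 + \sum_i pi * cq i * slice v k i ^+ 2))
    (pi * ga0 * sgm J (slice v k) ^+ 2 + \sum_i pi * cp i * slice v k i ^+ 2).
  by rewrite cge_sum /smul !qf_shl sumrN.
rewrite exchange_big -big_split /= -[n in _ ^+ n]card_ord -prodr_const -big_split /=; apply: eq_bigr => k _.
rewrite (eq_bigr (fun i => kap2 (b i) (g i) * cge (- (pi * b i / gD (b i) (g i) * slice v k i ^+ 2))
   (- (pi * g i / gD (b i) (g i) * slice v k i ^+ 2)))); last first.
  by move=> i _; rewrite hgFE sub0r sqrrN.
rewrite big_split /= mulrCA; congr (_ * _).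
rewrite /spiece /shM hgE; rewrite [in RHS](eq_bigr (fun i => cge (- (pi * be i * slice v k i ^+ 2)) 0)); last first.
  by move=> i _; rewrite hgE mulr0 mul0r.
rewrite !cge_sum !cgeM -/(sgm J (slice v k)); congr cge; last first.
  rewrite big1_eq addr0 -addrA -big_split /= big1 ?addr0 // => i _.
  by rewrite /cp; move: (pi : R) (gD _ _)^-1 => q z; ring.
rewrite opprD -addrA; congr (_ + _).
rewrite -sumrN -big_split /= (bigD1 i0) //= [RHS]big_mkcond [RHS](bigD1 i0) //= eqxx /=; congr (_ + _).
  by rewrite /cq eqxx; move: (pi : R) (gD _ _)^-1 => q z; ring.
rewrite big_mkcond [RHS]big_mkcond; apply: eq_bigr => i _; rewrite /cq; case: (i == i0) => //=.
by move: (pi : R) (gD _ _)^-1 => q z; ring.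
Qed.

Lemma spiece_int (x : R) :
  cint spiece /\ Cint (fun eta : EL => spiece eta * cexpi (2 * pi * (x * \sum_i eta i))) =
  hgF be0 ga0 x * \prod_(i | i != i0) (if J i then hgF (be i) 0 0 else hgF (be i) 0 x).
Proof.
have [h1 h2] := @shM_int R 'I_l i0 J Ji0 (hg be0 ga0 0) (fun i => hg (be i) 0 0)
   (c1int_hg ga0 0 be00) (fun i => c1int_hg 0 0 (be_gt0 i)) x.
split => //; rewrite h2; congr (_ * _).
  rewrite -(C1_hg ga0 x be00); congr C1; apply/funext => t; by rewrite hg_exp add0r.
apply: eq_bigr => i _; case: (J i); first by rewrite C1_hg.
rewrite -(C1_hg 0 x (be_gt0 i)); congr C1; apply/funext => t; by rewrite hg_exp add0r.
Qed.

(** Rate of the Gaussian modulus of the output in each variable of block [j0]; [samp] is its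
    amplitude per component. Variables of [J] other than [i0] enter the amplitude only. *)
Definition srate : R := be0 / gD be0 ga0 + \sum_(i | (i != i0) && ~~ J i) (be i)^-1.
Definition samp : R := (\prod_i gD (b i) (g i) `^ (- (1 / 4))) *
  (gD be0 ga0 `^ (- (1 / 4)) * \prod_(i | i != i0) be i `^ (- (1 / 2))).

Lemma srate_gt0 : 0 < srate.
Proof.
rewrite ltr_wpDr ?sumr_ge0 //; last by rewrite divr_gt0 // gD_gt0.
by move=> i _; rewrite invr_ge0 ltW.
Qed.

Lemma samp_ge0 : 0 <= samp.
Proof.
rewrite mulr_ge0 ?prodr_ge0 // => [i _|]; first exact: powR_ge0.
by rewrite mulr_ge0 ?powR_ge0 // prodr_ge0 // => i _; exact: powR_ge0.
Qed.

Lemma gD_real (z : R) : 0 < z -> gD z 0 `^ (- (1 / 4)) = z `^ (- (1 / 2)).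
Proof.
move=> z0; rewrite /gD expr0n addr0 -(powR_mulrn 2 (ltW z0)) -powRrM; congr powR; by field.
Qed.

Lemma cabs_spiece (x : R) : cabs (hgF be0 ga0 x * \prod_(i | i != i0) (if J i then hgF (be i) 0 0 else hgF (be i) 0 x)) =
  gD be0 ga0 `^ (- (1 / 4)) * \prod_(i | i != i0) be i `^ (- (1 / 2)) * gex srate x.
Proof.
rewrite cabsM cabs_hgF //.
rewrite (_ : cabs (\prod_(i | i != i0) _) = (\prod_(i | i != i0) be i `^ (- (1 / 2))) *
   \prod_(i | i != i0) (if J i then 1 else gex (be i)^-1 x)); last first.
  rewrite -big_filter cabs_prod big_filter -big_split /=; apply: eq_bigr => i _.
  have e : be i / gD (be i) 0 = (be i)^-1.
    by rewrite /gD expr0n addr0 expr2 invfM mulrA divff ?mul1r // gt_eqF.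
  case: (J i); rewrite cabs_hgF // gD_real //.
    by rewrite expr0n !mulr0 oppr0 expR0.
  by congr (_ * _); rewrite /gex -e mulrA.
rewrite mulrACA; congr (_ * _).
transitivity (gex (be0 / gD be0 ga0) x * \prod_(i | (i != i0) && ~~ J i) gex (be i)^-1 x).
  by congr (_ * _); [rewrite /gex mulrA|rewrite [RHS]big_mkcondr /=; apply: eq_bigr => i _; case: (J i)].
rewrite /gex -expR_sum -expRD; congr expR; rewrite /srate sumrN -mulr_suml -mulr_sumr -opprD.
by move: (pi : R) (\sum_(_ | _) _) (be0 / _) => q z y; ring.
Qed.

Variable m : (ptK l d n -> R) -> C.
Hypothesis mE : forall xi, m xi = smul (vblock xi j0).
Let f i := tf j0 (fun i (_ : 'I_n) => b i) (fun i _ => g i) (fun _ _ => 0) i.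

Lemma cabs_stest (x : PJ -> R) :
  cabs (Tm m f x) = samp ^+ n * \prod_jk gex (ext j0 (fun _ : 'I_n => srate) l%:R jk) (x jk).
Proof.
rewrite /f (@Tm_formula R l d n j0 _ _ _ (fun i k => b0 i) m smul mE unit [:: tt]
   (fun=> (\prod_i kap2 (b i) (g i)) ^+ n) (fun _ _ => spiece)); first last.
- by move=> v; rewrite big_seq1; exact: smulE.
- by move=> _ _; exact: (spiece_int 0).1.
rewrite big_seq1 !cabsM.
rewrite (_ : cabs (_ ^+ n) = (\prod_i gD (b i) (g i) `^ (- (1 / 4))) ^+ n); last first.
  rewrite -[n in _ ^+ n]card_ord -prodr_const cabs_prod prodr_const card_ord cabs_prod; congr (_ ^+ n).
  by apply: eq_bigr => i _; rewrite cabs_kap2.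
rewrite !cabs_prod.
rewrite (eq_bigr _ (fun k _ => congr1 (@cabs R) (spiece_int (x (j0, k))).2)).
rewrite (eq_bigr _ (fun k _ => cabs_spiece (x (j0, k)))).
rewrite big_split /= prodr_const card_ord -mulrA mulrA -exprMn -/samp; congr (_ * _).
rewrite [in RHS](prod_block j0); congr (_ * _); first by apply: eq_bigr => k _; rewrite /ext /= eqxx.
rewrite -big_filter cabs_prod big_filter; apply: eq_bigr => j /negbTE jj; rewrite cabs_prod.
by apply: eq_bigr => k _; rewrite /ext /= jj cabs_cR ger0_norm // gex_ge0.
Qed.

Definition Kd (p : R) : R := \prod_(j < d | j != j0) \prod_(k < n) p `^ (- (1 / 2)).

Lemma Kd_gt0 (p : R) : 0 < p -> 0 < Kd p.
Proof. by move=> p0; apply: prodr_gt0 => j _; apply: prodr_gt0 => k _; rewrite powR_gt0. Qed.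

Lemma Lpnorm_stest (p : R) : 0 < p ->
  Lpnorm p (Tm m f) = (samp ^+ n * ((srate * p) `^ (- (1 / 2)) ^+ n * Kd (l%:R * p)) `^ p^-1)%:E.
Proof.
move=> p0; have l0 : 0 < l%:R :> R by rewrite ltr0n; case: (l) i0 => // -[].
rewrite /Lpnorm.
rewrite (_ : (fun x => _) = (fun x : PJ -> R => ((samp ^+ n * \prod_jk gex (ext j0 (fun _ : 'I_n => srate) l%:R jk) (x jk)) `^ p)%:E)); last first.
  by apply/funext => x; rewrite cabs_stest.
have A0 : 0 <= samp ^+ n by rewrite exprn_ge0 // samp_ge0.
rewrite (@integ_gauss_prod R PJ _ p _ A0 p0); last first.
  by move=> jk; rewrite /ext; case: ifP => // _; exact: srate_gt0.
have -> : \prod_(k : PJ) (ext j0 (fun _ : 'I_n => srate) l%:R k * p) `^ (- (1 / 2)) =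
    (srate * p) `^ (- (1 / 2)) ^+ n * Kd (l%:R * p).
  rewrite (prod_block j0) /ext /= eqxx prodr_const card_ord; congr (_ * _).
  by apply: eq_bigr => j /negbTE ->.
have K0 : 0 <= (srate * p) `^ (- (1 / 2)) ^+ n * Kd (l%:R * p).
  by rewrite mulr_ge0 ?exprn_ge0 ?powR_ge0 // ltW // Kd_gt0 // mulr_gt0.
rewrite poweR_EFin powRM ?powR_ge0 // -powRrM divff ?gt_eqF // powRr1 //.
Qed.

Lemma Lpnorm_ftest i (p : R) : 0 < p ->
  Lpnorm p (f i) = (((b i * p) `^ (- (1 / 2)) ^+ n * Kd p) `^ p^-1)%:E.
Proof.
move=> p0; rewrite /f (@Lpnorm_tf R l d n j0 _ _ _ (fun i k => b0 i)) //.
by rewrite prodr_const card_ord.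
Qed.
End shear_test.

(** The maximum is at most [N (1 + rho)]. The power of [N] comes out and the Gaussian absorbs that
    of [1 + rho], so that the supremum over dilations is harmless. *)
Lemma exp_rho_bound (R : realType) (sg c : R) : 0 < c ->
  exists M : R, 0 < M /\ forall rho N, 0 < rho -> 1 <= N ->
  Num.max 1 (rho * N) `^ sg * expR (- (c * rho ^+ 2)) <= M * N `^ (Num.max sg 0).
Proof.
move=> c0; pose k := (Num.truncn (Num.max sg 0)).+1; pose be := Num.min c 1.
have be0 : 0 < be <= 1 by rewrite /be lt_min c0 ltr01 /= ge_min lexx orbT.
have /andP[b0 b1] := be0.
exists (2 ^+ k * ((be^-1) ^+ k * (k ^ k)%:R)); split.
  by rewrite mulr_gt0 ?exprn_gt0 // mulr_gt0 ?exprn_gt0 ?invr_gt0 // ltr0n expn_gt0.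
move=> rho N r0 N1; set lam := Num.max 1 _.
have l1 : 1 <= lam by rewrite le_max lexx.
have N0 : 0 < N by rewrite (lt_le_trans _ N1).
have lN : lam <= N * (1 + rho) by rewrite ge_max mulrDr mulr1 [N * _]mulrC lerDr (ltW N0) andbT -[leLHS]addr0 lerD // mulr_ge0 // ltW.
have y0 : 0 <= rho ^+ 2 by rewrite sqr_ge0.
have h1 : lam `^ sg <= N `^ (Num.max sg 0) * (1 + rho) `^ (Num.max sg 0).
  rewrite -powRM ?(ltW N0) ?addr_ge0 ?(ltW r0) //.
  apply: (@le_trans _ _ (lam `^ (Num.max sg 0))); first by rewrite ler_powR // le_max lexx.
  have m0 : 0 <= Num.max sg 0 by rewrite le_max lexx orbT.
  exact: (ge0_ler_powR m0 (le_trans ler01 l1) (le_trans (le_trans ler01 l1) lN) lN).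
have h2 : (1 + rho) `^ (Num.max sg 0) <= 2 ^+ k * (1 + rho ^+ 2) ^+ k.
  apply: (@le_trans _ _ ((1 + rho) `^ k%:R)).
    by rewrite ler_powR ?lerDl ?(ltW r0) // ltW // truncnS_gt.
  rewrite powR_mulrn ?addr_ge0 ?(ltW r0) // -exprMn; apply: lerXn2r; rewrite ?nnegrE ?mulr_ge0 ?addr_ge0 ?(ltW r0) //.
  by have := sqr_ge0 (rho - 1); nra.
have h3 : expR (- (c * rho ^+ 2)) <= expR (- (be * rho ^+ 2)).
  by rewrite ler_expR lerN2 ler_wpM2r // /be ge_min lexx.
have h4 := exp_poly_le k be0 y0.
have P1 : 0 <= N `^ (Num.max sg 0) := powR_ge0 _ _.
apply: (@le_trans _ _ (N `^ (Num.max sg 0) * (2 ^+ k * (1 + rho ^+ 2) ^+ k) * expR (- (be * rho ^+ 2)))).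
  apply: ler_pM; [exact: powR_ge0|exact: expR_ge0| |exact: h3].
  by apply: (le_trans h1); apply: ler_wpM2l.
rewrite -[leLHS]mulrA [leRHS]mulrC ler_wpM2l // -mulrA ler_wpM2l // exprn_ge0 //.
Qed.

Lemma measurable_annY (R : realType) (K : finType) (Y : fspace R K -> R) :
  measurable_fun setT Y -> measurable_fun setT (annY Y).
Proof.
move=> mY; apply: measurable_funM; first by apply: measurable_indic; exact: measurable_ann.
apply: (measurableT_comp (@measurable_expR R)).
rewrite (_ : (fun x => _) = fun x => 0 - Y x); last by apply/funext => x; rewrite sub0r.
exact: measurable_funB.
Qed.

(** [annY Y] takes values in [[0, 1]], so raising it to the power [v] only decreases its
    integral. *)
Lemma pint_annY_root (R : realType) (K : finType) (Y : fspace R K -> R) (v be : R) :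
  measurable_fun setT Y -> (forall x, 0 <= Y x) -> 0 <= be -> 1 <= v ->
  (pint (@mu_fspace R K) 1 (annY Y) <= be%:E)%E ->
  (pint (@mu_fspace R K) v (annY Y) <= ((be `^ v^-1) `^ v)%:E)%E.
Proof.
move=> mY Y0 be0 v1 pA; have v0 : 0 < v by rewrite (lt_le_trans _ v1).
rewrite -powRrM mulVf ?gt_eqF // (powRr1 be0); apply: le_trans pA.
apply: ge0_le_integral => //.
- exact: measurable_powf (measurable_annY mY).
- exact: measurable_powf (measurable_annY mY).
move=> x _; rewrite lee_fin.
have a0 : 0 <= annY Y x by rewrite mulr_ge0 ?expR_ge0 // indicE.
rewrite (ger0_norm a0) (powRr1 a0).
have a1 : annY Y x <= 1.
  rewrite -[leRHS]mulr1; apply: ler_pM; rewrite ?expR_ge0 ?indicE ?lern1 ?leq_b1 //.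
  by rewrite -expR0 ler_expR oppr_le0 Y0.
have [->|nz] := eqVneq (annY Y x) 0; first by rewrite powR0 // gt_eqF.
by apply: ge1r_powR => //; rewrite lt_neqAle eq_sym nz a0.
Qed.

(** * Norm of the sheared Gaussian multipliers *)

Section shear_norm.
Variables (R : realType) (l d n : nat).
Local Notation C := (R[i]).
Local Notation B := ('I_l * 'I_n)%type.
Local Notation EB := (fspace R B).
Local Notation mu := (@mu_fspace R B).
Local Notation leb := (@lebesgue_measure R).

(** [Gn] collects directions in which the form is at least [N^2], that is, of width [1 / N]; the
    index [i0] stands for the sum over [J]. Each of them shrinks the volume by [lam^(- n)]. The
    other conditions feed [qcond_shl]. *)
Definition shear_ok (i0 : 'I_l) (J Gn : pred 'I_l) (N Cc al : R) (w : 'I_l -> R) (be0 ga0 : R) (be b g : 'I_l -> R) :=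
 [/\ 0 <= al, forall i, 1 <= w i,
     forall xi, yq J al w xi <= be0 * sgm J xi ^+ 2 + \sum_i cq i0 be b g i * xi i ^+ 2,
     forall xi, `|be0| * `|sgm J xi| <= Cc * N * (1 + yq J al w xi) /\ `|ga0| * `|sgm J xi| <= Cc * N * (1 + yq J al w xi) &
  [/\ forall i xi, `|cq i0 be b g i| * `|xi i| <= Cc * N * (1 + yq J al w xi) /\ `|cp b g i| * `|xi i| <= Cc * N * (1 + yq J al w xi),
     forall i, [/\ `|be0| <= Cc * N ^+ 2, `|ga0| <= Cc * N ^+ 2, `|cq i0 be b g i| <= Cc * N ^+ 2 & `|cp b g i| <= Cc * N ^+ 2],
     Gn i0 -> N ^+ 2 <= al & forall i, i != i0 -> Gn i -> N ^+ 2 <= w i]].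

Lemma hb_gain (a rho N lam : R) (G : bool) : (0 < l)%N -> 0 < rho -> 1 <= N -> lam = Num.max 1 (rho * N) -> 0 <= a ->
  (G -> N ^+ 2 <= a) ->
  (\int[leb]_t (hb l (a * rho ^+ 2 / 4) t)%:E <= (4 * l%:R * (if G then lam^-1 else 1))%:E)%E.
Proof.
move=> l0 r0 N1 -> a0; have N0 : 0 < N by rewrite (lt_le_trans _ N1).
have l1 : 1 <= l%:R :> R by rewrite ler1n.
have h0 : 0 <= a * rho ^+ 2 / 4 by rewrite divr_ge0 // mulr_ge0 // sqr_ge0.
case: G => [/(_ isT) Na|_]; last by rewrite mulr1; exact: hb_int.
case: (leP (rho * N) 1) => h; first by rewrite invr1 mulr1; exact: hb_int.
have rN0 : 0 < rho * N by rewrite mulr_gt0.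
have q0 : 0 < (rho * N) ^+ 2 / 4 by rewrite divr_gt0 // exprn_gt0.
have qa : (rho * N) ^+ 2 / 4 <= a * rho ^+ 2 / 4.
  by rewrite ler_pM2r ?invr_gt0 // exprMn mulrC ler_wpM2r // sqr_ge0.
apply: le_trans (hb_int_pos _ (lt_le_trans q0 qa)) _; rewrite lee_fin.
have e1 : (a * rho ^+ 2 / 4) `^ (- (1 / 2)) <= ((rho * N) ^+ 2 / 4) `^ (- (1 / 2)).
  rewrite !powRN lef_pV2 ?posrE ?powR_gt0 ?(lt_le_trans q0 qa) //.
  by rewrite ge0_ler_powR ?nnegrE // ltW.
have e2 : ((rho * N) ^+ 2 / 4) `^ (- (1 / 2)) = 2 * (rho * N)^-1.
  have -> : (rho * N) ^+ 2 / 4 = (rho * N / 2) `^ 2%:R.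
    by rewrite powR_mulrn ?divr_ge0 ?(ltW rN0) //; field.
  rewrite -powRrM (_ : 2%:R * - (1 / 2) = - 1); last by field.
  rewrite powRN powRr1 ?divr_ge0 ?(ltW rN0) //; by field; rewrite gt_eqF ?gt_eqF.
apply: (le_trans e1); rewrite e2 ler_wpM2r ?invr_ge0 ?(ltW rN0) //; lra.
Qed.

(** [lam^s] is the price of the derivatives, [lam^(- n #|Gn| / v)] the volume of the concentration
    set in [L^v], and the exponential the smallness of the Gaussian on the annulus after a large
    dilation. *)
Lemma gp_shear (s Cc : R) (Th : EB -> C) : 0 < s -> 1 <= Cc -> Schwartz Th ->
  (forall eta, FT Th eta != 0 -> 1 / 2 <= enorm eta <= 2) ->
  exists C0 : R, 0 < C0 /\ forall i0 (J Gn : pred 'I_l) N al w be0 ga0 be b g rho,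
  J i0 -> shear_ok i0 J Gn N Cc al w be0 ga0 be b g -> 1 <= N -> 0 < rho ->
  exists G : EB -> C, GP s (fun x : EB => smul i0 J be0 ga0 be b g (fun k => rho * x k) * FT Th x) G /\
    forall v, 1 <= v -> (pint mu v (fun x => cabs (G x)) <=
      ((C0 * (Num.max 1 (rho * N) `^ (s - (n * #|Gn|)%:R / v) * expR (- (pi / (16 * v) * rho ^+ 2)))) `^ v)%:E)%E.
Proof.
move=> s0 C1 sTh supp.
have c01 : 1 <= 4 * pi * Cc.
  have p2 := @pi_ge2 R; nra.
have [C0 [C00 hC]] := gauss_block s0 c01 sTh supp.
pose K : R := (4 * l%:R) ^+ (n * l) + 1.
have K1 : 1 <= K by rewrite lerDr exprn_ge0 // mulr_ge0.
exists (C0 * K); split; first by rewrite mulr_gt0 // (lt_le_trans _ K1).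
move=> i0 J Gn N al w be0 ga0 be b g rho Ji0 [al0 w1 Hq Hs [Hc Hh Ga Gw]] N1 r0.
have l0 : (0 < l)%N := leq_ltn_trans (leq0n _) (ltn_ord i0).
set lam := Num.max 1 (rho * N).
have l1 : 1 <= lam by rewrite le_max lexx.
have lp : 0 < lam by rewrite (lt_le_trans _ l1).
have rl : rho * N <= lam by rewrite le_max lexx orbT.
have qc := @qcond_shl R l n J al w al0 w1 N Cc be0 ga0 (cq i0 be b g) (cp b g) C1 N1 Hq Hs Hc Hh rho lam r0 l1 rl.
have [G [gG pG]] := hC _ _ _ _ qc.
exists G; split.
  move: gG; congr GP; apply/funext => x; rewrite /smul !qf_shl; congr (cR (expR (- _)) * cexpi _ * _).
    apply: eq_bigr => k _; congr (_ + _); first by rewrite /slice /sgm -mulr_sumr; move: (pi : R) => q; ring.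
    by apply: eq_bigr => i _; rewrite /slice; move: (pi : R) => q; ring.
  apply: eq_bigr => k _; congr (_ + _); first by rewrite /slice /sgm -mulr_sumr; move: (pi : R) => q; ring.
  by apply: eq_bigr => i _; rewrite /slice; move: (pi : R) => q; ring.
move=> v v1; have v0 : 0 < v by rewrite (lt_le_trans _ v1).
pose gg i := 4 * l%:R * (if Gn i then lam^-1 else 1).
have g0 : (\int[leb]_t (hb l (al * rho ^+ 2 / 4) t)%:E <= (gg i0)%:E)%E.
  exact: (@hb_gain al rho N lam (Gn i0)).
have g1 i : i != i0 -> (\int[leb]_t (hb l (w i * rho ^+ 2 / 4) t)%:E <= (gg i)%:E)%E.
  by move=> ni; apply: (@hb_gain (w i) rho N lam (Gn i)) => //; [rewrite (le_trans _ (w1 i))|exact: Gw].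
have pA := @pint_annY R l n i0 J Ji0 al w rho al0 w1 gg g0 g1.
set be1 := expR _ * _ in pA.
have gE : \prod_i gg i = (4 * l%:R) ^+ l * lam^-1 ^+ #|Gn|.
  by rewrite /gg big_split /= prodr_const card_ord; congr (_ * _); rewrite -big_mkcond /= prodr_const.
have q0 : 0 < 4 * l%:R :> R by rewrite mulr_gt0 // ltr0n.
have be10 : 0 < be1.
  rewrite /be1 gE mulr_gt0 ?expR_gt0 // exprn_gt0 // mulr_gt0 ?exprn_gt0 // invr_gt0 //.
have b0 : 0 < be1 `^ v^-1 by rewrite powR_gt0.
have pv : (pint mu v (annY (Yq J al w rho)) <= ((be1 `^ v^-1) `^ v)%:E)%E.
  exact: pint_annY_root (measurable_Yq J al w rho) (Yq_ge0 J al0 w1 rho) (ltW be10) v1 pA.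
apply: le_trans (pG v _ v1 b0 pv) _; apply: le_powRE; [exact: ltW| |].
  by rewrite !mulr_ge0 ?powR_ge0 // ltW.
rewrite -[leLHS]mulrA -[leRHS]mulrA ler_wpM2l ?(ltW C00) //.
have lE : lam `^ (s - (n * #|Gn|)%:R / v) = lam `^ s * (lam^-1 ^+ (#|Gn| * n)) `^ v^-1.
  rewrite powRD; last by rewrite (gt_eqF lp) implybT.
  congr (_ * _).
  rewrite powRN mulnC powRrM powR_mulrn ?(ltW lp) // exprVn.
  by rewrite -[in RHS]powR_inv1 ?exprn_ge0 ?(ltW lp) // -powRrM mulN1r powRN.
have eE : expR (- (pi / (16 * v) * rho ^+ 2)) = expR (- (pi * rho ^+ 2 / 16)) `^ v^-1.
  rewrite -expRM; congr expR; move: (pi : R) => q; field; by rewrite gt_eqF.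
rewrite lE eE /be1 gE exprMn -!exprM powRM ?expR_ge0 //; last by rewrite mulr_ge0 ?exprn_ge0 ?invr_ge0 // ltW.
rewrite powRM ?exprn_ge0 ?invr_ge0 ?(ltW lp) ?(ltW q0) //.
have KK : ((4 * l%:R) ^+ (l * n)) `^ v^-1 <= K.
  apply: (@le_trans _ _ (K `^ v^-1)).
    have v0' : 0 <= v^-1 by rewrite invr_ge0 ltW.
    have qK : (4 * l%:R) ^+ (l * n) <= K by rewrite /K mulnC lerDl.
    exact: (ge0_ler_powR v0' (exprn_ge0 _ (ltW q0)) (le_trans ler01 K1) qK).
  by rewrite -[leRHS](powRr1 (le_trans ler01 K1)) ler_powR // invf_le1.
set a1 := lam `^ s; set a2 := expR _ `^ _; set a3 := _ `^ v^-1 in KK *; set a4 := (lam^-1 ^+ _) `^ _.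
have -> : a1 * (a2 * (a3 * a4)) = a3 * (a1 * a4 * a2) by ring.
by rewrite ler_wpM2r // !mulr_ge0 // powR_ge0.
Qed.
End shear_norm.

(** * Upper bounds for single multipliers and for sums *)

Section upper.
Variables (R : realType) (l d n : nat).
Local Notation C := (R[i]).
Local Notation B := ('I_l * 'I_n)%type.
Local Notation EB := (fspace R B).
Local Notation mu := (@mu_fspace R B).
Variables (u : R) (s : 'I_d -> R) (Theta : 'I_d -> EB -> C) (j0 : 'I_d).
Hypotheses (u1 : 1 < u) (s0 : forall j, 0 < s j) (Ts : forall j, Schwartz (Theta j)).
Hypothesis Tsupp : forall j eta, FT (Theta j) eta != 0 -> 1 / 2 <= enorm eta <= 2.

Lemma integ_pint (v : R) (G : EB -> C) : cint G ->
  integ (fun x : EB => (cabs (G x) `^ v)%:E) = pint mu v (fun x => cabs (G x)).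
Proof.
move=> iG; have mG := rint_meas (cint_cabs iG).
rewrite integE; first by apply: eq_integral => x _; rewrite ger0_norm // cabs_ge0.
  by move=> x; rewrite lee_fin powR_ge0.
by apply/measurable_EFinP; exact: (measurableT_comp (measurable_powR _) mG).
Qed.

Lemma Anorm_shear (Cc : R) (q : nat) : 1 <= Cc ->
  exists CA : R, 0 < CA /\ forall i0 (J Gn : pred 'I_l) N al w be0 ga0 be b g (m : (ptK l d n -> R) -> C),
  J i0 -> shear_ok i0 J Gn N Cc al w be0 ga0 be b g -> 1 <= N -> #|Gn| = q ->
  (forall xi, m xi = smul i0 J be0 ga0 be b g (vblock xi j0)) ->
  (Anorm u s Theta m <= (CA * N `^ (Num.max (s j0 - (n * q)%:R / u) 0))%:E)%E.
Proof.
move=> C1; have [CT [CT0 hA]] := Anorm_le u1 s0 Ts Tsupp j0.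
have [C0 [C00 hG]] := @gp_shear R l n (s j0) Cc (Theta j0) (s0 j0) C1 (Ts j0) (@Tsupp j0).
have u0 : 0 < u by rewrite (lt_trans _ u1).
have c0 : 0 < pi / (16 * u) :> R by rewrite divr_gt0 ?pi_gt0 // mulr_gt0.
have [M [M0 hM]] := @exp_rho_bound R (s j0 - (n * q)%:R / u) _ c0.
exists (CT * (C0 * M)); split; first by rewrite !mulr_gt0.
move=> i0 J Gn N al w be0 ga0 be b g m Ji0 ok N1 qE mE.
rewrite -!mulrA mulrA -[(CT * C0 * _)]mulrA.
have N0 : 0 < N by rewrite (lt_le_trans _ N1).
apply: (hA (smul i0 J be0 ga0 be b g) m _ mE); first by rewrite !mulr_gt0 // powR_gt0.
move=> k; have r0 : 0 < (2 : R) ^ k by rewrite exprz_gt0.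
have [G [[g1 g2 g3] pG]] := hG i0 J Gn N al w be0 ga0 be b g _ Ji0 ok N1 r0.
exists G; split => //; rewrite integ_pint //; apply: le_trans (pG u (ltW u1)) _.
apply: le_powRE; [exact: ltW|by rewrite !mulr_ge0 ?powR_ge0 ?expR_ge0 // ltW|].
by rewrite ler_wpM2l ?(ltW C00) // qE; exact: hM.
Qed.

Lemma GP_sum (t : R) (s' : seq nat) (F G : nat -> EB -> C) : (forall N, GP t (F N) (G N)) ->
  GP t (fun x => \sum_(N <- s') F N x) (fun x => \sum_(N <- s') G N x).
Proof.
move=> h; elim: s' => [|N s' IH].
  by have := GP_scale 0 (h 0%N); congr GP; apply/funext => x; rewrite big_nil mul0r.
by have := GP_add (h N) IH; congr GP; apply/funext => x; rewrite big_cons.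
Qed.

Lemma cabs_sum (s' : seq nat) (z : nat -> C) : cabs (\sum_(N <- s') z N) <= \sum_(N <- s') cabs (z N).
Proof.
elim: s' => [|N s' IH]; first by rewrite !big_nil cabs0.
by rewrite !big_cons; apply: le_trans (cabsD _ _) _; rewrite lerD2l.
Qed.

(** The pieces need a uniform [L^u] bound [A], some finite [L^(2 u - 1)] bound, and [L^1] bounds
    tending to 0, all of them independent of the dilation [k]. *)
Lemma Anorm_hump (mN : nat -> EB -> C) (A : R) (D e : nat -> R) : 0 < A -> (forall N, 0 < D N) ->
  (forall ep : R, 0 < ep -> exists N0, forall N, (N0 <= N)%N -> e N <= ep) ->
  (forall (k : int) N, exists G : EB -> C,
    [/\ GP (s j0) (fun x => mN N (fun b => 2 ^ k * x b) * FT (Theta j0) x) G,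
     (pint mu u (fun x => cabs (G x)) <= (A `^ u)%:E)%E,
     (pint mu (2 * u - 1) (fun x => cabs (G x)) <= (D N `^ (2 * u - 1))%:E)%E &
     (pint mu 1 (fun x => cabs (G x)) <= (e N)%:E)%E]) ->
  exists CA : R, 0 < CA /\ forall r N1, exists s' : seq nat,
   [/\ size s' = r.+1, pairwise (fun N N' => N.*2 < N')%N s', all (leq N1) s' &
    forall m : (ptK l d n -> R) -> C, (forall xi, m xi = \sum_(N <- s') mN N (vblock xi j0)) ->
    (Anorm u s Theta m <= (CA * r.+1%:R `^ u^-1)%:E)%E].
Proof.
move=> A0 D0 e0 h; have [CT [CT0 hA]] := Anorm_le u1 s0 Ts Tsupp j0.
have u0 : 0 < u by rewrite (lt_trans _ u1).
have /choice [G hG] : forall kN : int * nat, exists G : EB -> C,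
    [/\ GP (s j0) (fun x => mN kN.2 (fun b => 2 ^ kN.1 * x b) * FT (Theta j0) x) G,
     (pint mu u (fun x => cabs (G x)) <= (A `^ u)%:E)%E,
     (pint mu (2 * u - 1) (fun x => cabs (G x)) <= (D kN.2 `^ (2 * u - 1))%:E)%E &
     (pint mu 1 (fun x => cabs (G x)) <= (e kN.2)%:E)%E].
  by case=> k N; exact: h.
pose F (k : int) N x := cabs (G (k, N) x).
have mF k N : measurable_fun setT (F k N) by case: (hG (k, N)) => -[_ /cint_cabs/rint_meas].
exists (CT * (A + 1)); split; first by rewrite mulr_gt0 // addr_gt0.
move=> r N1.
have [s' [ss ps as' hs]] := @gliding_hump _ EB R mu int F u A D e (fun k N x => cabs_ge0 _) mF u1 A0 D0
   (fun k N => let: And4 _ x _ _ := hG (k, N) in x) (fun k N => let: And4 _ _ x _ := hG (k, N) in x)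
   (fun k N => let: And4 _ _ _ x := hG (k, N) in x) e0 r N1.
exists s'; split => // m mE; rewrite -mulrA.
apply: (hA (fun v => \sum_(N <- s') mN N v) m _ mE); first by rewrite mulr_gt0 // addr_gt0.
move=> k.
have gp N : GP (s j0) (fun x => mN N (fun b => 2 ^ k * x b) * FT (Theta j0) x) (G (k, N)) by case: (hG (k, N)).
have := GP_sum s' gp.
rewrite (_ : (fun x => \sum_(N <- s') _) = blockF Theta (fun v => \sum_(N <- s') mN N v) j0 k); last first.
  by apply/funext => x; rewrite /blockF mulr_suml.
move=> [g1 g2 g3]; exists (fun x => \sum_(N <- s') G (k, N) x); split => //.
rewrite integ_pint //; apply: le_trans (hs k).
apply: (pint_le mu (ltW u0)); first exact: rint_meas (cint_cabs g2).
  by apply: measurable_sum => N; exact: mF.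
move=> x; rewrite !ger0_norm ?cabs_ge0 ?cabs_sum // sumr_ge0 // => N _; exact: cabs_ge0.
Qed.
End upper.

(** * Comparison of exponents *)

Section mono.
Variables (R : realType) (X : R -> R).
Hypothesis X0 : forall N, 1 <= N -> 0 < X N.
Implicit Types (f g : R -> R).

(** Exact constant times a power of the scale [X N]. Closure under products, powers and inverses
    reduces each limit [N -> oo] to arithmetic of exponents. *)
Definition mono f (e : R) := exists c, 0 < c /\ forall N, 1 <= N -> f N = c * X N `^ e.

Lemma mono_eq f e e' : mono f e -> e = e' -> mono f e'.
Proof. by move=> h <-. Qed.

Lemma mono_cst c : 0 < c -> mono (fun=> c) 0.
Proof. by move=> c0; exists c; split => // N _; rewrite powRr0 mulr1. Qed.

Lemma mono_id : mono X 1.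
Proof. by exists 1; split => // N N1; rewrite mul1r powRr1 // ltW // X0. Qed.

Lemma monoM f g e e' : mono f e -> mono g e' -> mono (fun N => f N * g N) (e + e').
Proof.
move=> [c [c0 hc]] [c' [c0' hc']]; exists (c * c'); split; first exact: mulr_gt0.
move=> N N1; rewrite hc // hc' // powRD; first by rewrite mulrACA.
by rewrite (gt_eqF (X0 N1)) implybT.
Qed.

Lemma mono_gt0 f e N : mono f e -> 1 <= N -> 0 < f N.
Proof. by move=> [c [c0 hc]] N1; rewrite hc // mulr_gt0 // powR_gt0 // X0. Qed.

Lemma mono_pow f e r : mono f e -> mono (fun N => f N `^ r) (e * r).
Proof.
move=> [c [c0 hc]]; exists (c `^ r); split; first by rewrite powR_gt0.
by move=> N N1; rewrite hc // powRM ?(ltW c0) ?powR_ge0 // powRrM.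
Qed.

Lemma mono_ext f g e : mono f e -> (forall N, 1 <= N -> g N = f N) -> mono g e.
Proof. by move=> [c [c0 hc]] h; exists c; split => // N N1; rewrite h // hc. Qed.

Lemma monoV f e : mono f e -> mono (fun N => (f N)^-1) (- e).
Proof.
move=> h; have := mono_pow (-1) h; rewrite mulrN1 => h'; apply: (mono_ext h') => N N1.
by rewrite powR_inv1 // ltW // (mono_gt0 h).
Qed.

Lemma mono_prodl (I : Type) (s : seq I) (P : pred I) (f : I -> R -> R) (e : I -> R) :
  (forall i, P i -> mono (f i) (e i)) ->
  mono (fun N => \prod_(i <- s | P i) f i N) (\sum_(i <- s | P i) e i).
Proof.
move=> h; elim: s => [|i s IH].
  by rewrite big_nil; apply: (mono_ext (mono_cst ltr01)) => N _; rewrite big_nil.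
rewrite big_cons; case: ifP => Pi; last by apply: (mono_ext IH) => N _; rewrite big_cons Pi.
by apply: (mono_ext (monoM (h i Pi) IH)) => N _; rewrite big_cons Pi.
Qed.

Lemma monoX f e k : mono f e -> mono (fun N => f N ^+ k) (k%:R * e).
Proof.
move=> h; have := mono_pow k%:R h; rewrite mulrC => h'; apply: (mono_ext h') => N N1.
by rewrite powR_mulrn // ltW // (mono_gt0 h).
Qed.

Lemma mono_le f g e e' : (forall N, 1 <= N -> N <= X N) ->
  mono f e -> mono g e' -> (forall N, 1 <= N -> f N <= g N) -> e <= e'.
Proof.
move=> XN [c [c0 hc]] [c' [c0' hc']] fg; rewrite leNgt; apply/negP => ee.
have de : 0 < e - e' by rewrite subr_gt0.
(* At this [N] the factor [X N ^ (e - e')] is at least [c' / c + 1], whereas the inequality bounds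
   it by [c' / c]. *)
pose N := (c' / c + 1) `^ (e - e')^-1.
have K1 : 1 <= c' / c + 1 by rewrite lerDr divr_ge0 // ltW.
have N1 : 1 <= N.
  rewrite -[leLHS](powRr0 (c' / c + 1)); apply: ler_powR => //.
  by rewrite invr_ge0 ltW.
have XN0 := X0 N1.
have h := fg N N1; rewrite hc // hc' // in h.
have : c * X N `^ (e - e') <= c'.
  rewrite -(@ler_pM2r _ (X N `^ e')) ?powR_gt0 // -mulrA -powRD; first by rewrite subrK.
  by rewrite (gt_eqF XN0) implybT.
have : c' / c + 1 <= X N `^ (e - e').
  apply: (@le_trans _ _ (N `^ (e - e'))).
    by rewrite /N -powRrM mulVf ?gt_eqF // powRr1 // (le_trans _ K1).
  by apply: ge0_ler_powR; rewrite ?nnegrE ?(ltW de) ?(ltW XN0) ?XN // (le_trans _ N1).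
move=> h1 h2; have : c * (c' / c) = c' by rewrite mulrC divfK // gt_eqF.
have := ler_wpM2l (ltW c0) h1; move: (c' / c) (_ `^ _) h2 => q z; nra.
Qed.
End mono.

Section bound.
Variables (R : realType) (l d n : nat).
Local Notation C := (R[i]).
Local Notation B := ('I_l * 'I_n)%type.
Variables (u : R) (s : 'I_d -> R) (Theta : 'I_d -> (B -> R) -> C) (pp : 'I_l -> R) (p Cst : R).
Definition multiplier_bound := forall m : (ptK l d n -> R) -> C, (Anorm u s Theta m < +oo)%E ->
  forall f : 'I_l -> (ptJ d n -> R) -> C, (forall i, Schwartz (f i)) ->
  (Lpnorm p (Tm m f) <= Cst%:E * Anorm u s Theta m * \prod_(i < l) Lpnorm (pp i) (f i))%E.
Hypothesis Hmain : multiplier_bound.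

Lemma Anorm_ge0 (m : (ptK l d n -> R) -> C) : (0 <= Anorm u s Theta m)%E.
Proof.
apply: (@le_trans _ _ (sobnorm u s (Fm Theta m (fun=> 0)))).
  by apply: le_ereal_inf_tmp => _ [G _ <-]; exact: poweR_ge0.
by apply: ereal_sup_ubound; exists (fun=> 0).
Qed.

(** Passage from extended reals to reals. The constant of the hypothesis has no sign, hence
    [|Cst| + 1]. *)
Lemma real_bound (m : (ptK l d n -> R) -> C) f (a t : R) (ph : 'I_l -> R) : (forall i, Schwartz (f i)) ->
  (Anorm u s Theta m <= a%:E)%E -> (t%:E <= Lpnorm p (Tm m f))%E ->
  (forall i, Lpnorm (pp i) (f i) = (ph i)%:E) -> (forall i, 0 <= ph i) -> t <= (`|Cst| + 1) * a * \prod_i ph i.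
Proof.
move=> sf hA ht hf ph0.
have A0 := Anorm_ge0 m.
have Aoo : (Anorm u s Theta m < +oo)%E by rewrite (le_lt_trans hA) // ltry.
rewrite -lee_fin; apply: (le_trans ht); apply: (le_trans (Hmain Aoo sf)).
rewrite (eq_bigr _ (fun i _ => hf i)) prodEFin EFinM; apply: lee_wpmul2r; first by rewrite lee_fin prodr_ge0.
rewrite EFinM; apply: (@le_trans _ _ ((`|Cst| + 1)%:E * Anorm u s Theta m)%E).
  by apply: lee_wpmul2r => //; rewrite lee_fin; apply: le_trans (ler_norm _) _; rewrite lerDl.
by apply: lee_wpmul2l => //; rewrite lee_fin addr_ge0.
Qed.
End bound.

(** * Admissible parameters of the test multipliers *)

Section quad_ineq.
Variables (R : realType) (l : nat).
Implicit Type xi : 'I_l -> R.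

Lemma sum_sqr_le (P : pred 'I_l) xi : (\sum_(i | P i) xi i) ^+ 2 <= l%:R * \sum_(i | P i) xi i ^+ 2.
Proof.
pose x i := if P i then xi i else 0.
have -> : \sum_(i | P i) xi i = \sum_i x i by rewrite big_mkcond.
have -> : \sum_(i | P i) xi i ^+ 2 = \sum_i x i ^+ 2.
  by rewrite big_mkcond; apply: eq_bigr => i _; rewrite /x; case: (P i); rewrite ?expr0n.
set S := \sum_i x i; set Q := \sum_i x i ^+ 2.
have : 0 <= \sum_i \sum_j (x i - x j) ^+ 2 by apply: sumr_ge0 => i _; apply: sumr_ge0 => j _; exact: sqr_ge0.
have -> : \sum_i \sum_j (x i - x j) ^+ 2 = 2 * (l%:R * Q - S ^+ 2).
  transitivity (\sum_(i < l) (l%:R * x i ^+ 2 - 2 * x i * S + Q)).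
    apply: eq_bigr => i _.
    transitivity (\sum_(j < l) (x i ^+ 2 - 2 * x i * x j + x j ^+ 2)); first by apply: eq_bigr => j _; ring.
    rewrite big_split sumrB /=; congr (_ - _ + _); first by rewrite sumr_const card_ord mulr_natl.
    by rewrite mulr_sumr.
  rewrite big_split sumrB /= -mulr_sumr -mulr_suml -mulr_sumr sumr_const card_ord -/S -/Q -mulr_natl; ring.
by rewrite pmulr_rge0 // subr_ge0.
Qed.

(** The multiplier has coefficient [- 1] at [i0]. Raising it to [+ 1] costs [2 xi_i0^2], which is
    paid by the sum over [J] with coefficient 4 and by the other variables with coefficient [4 l].
    This is the origin of [4 l + 2]. *)
Lemma shear_coord (i0 : 'I_l) (J : pred 'I_l) xi : J i0 ->
  2 * xi i0 ^+ 2 <= 4 * sgm J xi ^+ 2 + 4 * l%:R * \sum_(i | J i && (i != i0)) xi i ^+ 2.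
Proof.
move=> Ji0; have h := sum_sqr_le (fun i => J i && (i != i0)) xi.
rewrite -mulrA; move: h.
have -> : sgm J xi = xi i0 + \sum_(i | J i && (i != i0)) xi i by rewrite /sgm (bigD1 i0).
move: (xi i0) (\sum_(i | _) xi i) (l%:R * _) => a b c h.
have := sqr_ge0 (a + 2 * b); nra.
Qed.

Lemma abs_le1D (x y : R) : x ^+ 2 <= y -> `|x| <= 1 + y.
Proof.
have := sqr_ge0 (`|x| - 1); rewrite -(real_normK (num_real x)); move: `|x| => a; nra.
Qed.

Lemma abs_sgm_le (J : pred 'I_l) xi : (0 < l)%N -> `|sgm J xi| <= l%:R * (1 + \sum_i xi i ^+ 2).
Proof.
move=> l0; have h := sum_sqr_le J xi.
have l1 : 1 <= l%:R :> R by rewrite ler1n.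
have Q : \sum_(i | J i) xi i ^+ 2 <= \sum_i xi i ^+ 2.
  by rewrite big_mkcond; apply: ler_sum => i _; case: (J i) => //; exact: sqr_ge0.
apply: le_trans (abs_le1D h) _; rewrite mulrDr mulr1; apply: lerD => //.
by rewrite ler_wpM2l // (le_trans _ l1).
Qed.
End quad_ineq.

Section okC.
Variables (R : realType) (l : nat) (I : {set 'I_l}) (i0 : 'I_l) (N : R).
Hypotheses (i0I : i0 \notin I) (N1 : 1 <= N).
Let A : R := 4 * l%:R + 2.
(** For [i] in [I] the input transform is a multiple of [exp(- pi N^2 xi^2)] in each variable and
    the prescribed profile [exp(- 2 pi N^2 xi^2)], so the multiplier keeps coefficient [N^2]. The
    remaining inputs are standard Gaussians. *)
Definition beC (N : R) : 'I_l -> R := fun i => if i \in I then 2 * N ^+ 2 else A.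
Definition bC (N : R) : 'I_l -> R := fun i => if i \in I then (N ^+ 2)^-1 else 1.
Definition wC (N : R) : 'I_l -> R := fun i => if i \in I then N ^+ 2 else 1.

Lemma cqC i : cq i0 (beC N) (bC N) (fun=> 0) i = if i \in I then N ^+ 2 else if i == i0 then - 1 else A - 1.
Proof.
have N0 : 0 < N by rewrite (lt_le_trans _ N1).
rewrite /cq /beC /bC /gD expr0n addr0; case: ifP => [/eqP ->|ni].
  by rewrite (negbTE i0I) expr1n divr1 sub0r.
case: ifP => iI; last by rewrite expr1n divr1.
have -> : (N ^+ 2)^-1 / (N ^+ 2)^-1 ^+ 2 = N ^+ 2.
  by field; rewrite gt_eqF.
by ring.
Qed.

(** The sum is over the complement of [I]. Of its coefficient [6 N^2], the part [2 N^2] gives the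
    lower bound and the rest dominates the 4 of [shear_coord]. Directions of width [1 / N] are this
    sum and every [xi_i] with [i] in [I]. *)
Lemma okC : shear_ok i0 (fun i => i \notin I) (fun i => (i == i0) || (i \in I)) N (4 * l%:R + 6)
  (2 * N ^+ 2) (wC N) (6 * N ^+ 2) 0 (beC N) (bC N) (fun=> 0).
Proof.
have N0 : 0 < N by rewrite (lt_le_trans _ N1).
have N2 : 1 <= N ^+ 2 by rewrite expr_ge1 // ltW.
have l1 : 1 <= l%:R :> R by rewrite ler1n (leq_ltn_trans (leq0n _) (ltn_ord i0)).
have Cc0 : 0 <= 4 * l%:R + 6 :> R by lra.
have n6 : `|6 * N ^+ 2| = 6 * N ^+ 2 by apply: ger0_norm; apply: mulr_ge0 => //; exact: sqr_ge0.
have w1 i : 1 <= wC N i by rewrite /wC; case: ifP.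
have al0 : 0 <= 2 * N ^+ 2 by rewrite mulr_ge0 // sqr_ge0.
set J : pred 'I_l := fun i => i \notin I.
have y0 xi := yq_ge0 J al0 w1 xi.
have ys xi : 2 * N ^+ 2 * sgm J xi ^+ 2 <= yq J (2 * N ^+ 2) (wC N) xi.
  by rewrite /yq lerDl sumr_ge0 // => i _; rewrite mulr_ge0 ?sqr_ge0 // (le_trans _ (w1 i)).
have yi xi i : wC N i * xi i ^+ 2 <= yq J (2 * N ^+ 2) (wC N) xi.
  rewrite /yq (bigD1 i) //= addrCA lerDl addr_ge0 //; first by rewrite mulr_ge0 // sqr_ge0.
  by rewrite sumr_ge0 // => j _; rewrite mulr_ge0 ?sqr_ge0 // (le_trans _ (w1 j)).
have cp0 i : cp (bC N) (fun=> 0) i = 0 by rewrite /cp mul0r.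
split => //.
- move=> xi; rewrite (eq_bigr _ (fun i _ => congr1 (fun z => z * xi i ^+ 2) (cqC i))) /yq.
  have h := @shear_coord R l i0 J xi i0I.
  have -> : \sum_i (if i \in I then N ^+ 2 else if i == i0 then - 1 else A - 1) * xi i ^+ 2 =
     \sum_i wC N i * xi i ^+ 2 + (4 * l%:R * \sum_(i | J i && (i != i0)) xi i ^+ 2 - 2 * xi i0 ^+ 2).
    rewrite (bigD1 i0) //= [in RHS](bigD1 i0) //= eqxx (negbTE i0I) {1}/wC (negbTE i0I).
    have -> : \sum_(i | i != i0) (if i \in I then N ^+ 2 else if i == i0 then - 1 else A - 1) * xi i ^+ 2 =
        \sum_(i | i != i0) wC N i * xi i ^+ 2 + 4 * l%:R * \sum_(i | J i && (i != i0)) xi i ^+ 2.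
      rewrite big_mkcondl /= mulr_sumr -big_split /=; apply: eq_bigr => i ni.
      rewrite (negbTE ni) /J /wC; case: (i \in I) => /=; first by rewrite mulr0 addr0.
      by rewrite /A; ring.
    by ring.
  have := ler_wpM2r (sqr_ge0 (sgm J xi)) N2.
  move: h; move: (\sum_(i < l) _) (4 * l%:R * _) (xi i0 ^+ 2) (sgm J xi ^+ 2) => a b c e; nra.
- move=> xi; split; last by rewrite normr0 mul0r; exact: mulr_ge0 (mulr_ge0 Cc0 (ltW N0)) (addr_ge0 ler01 (y0 xi)).
  have h : `|N * sgm J xi| <= 1 + yq J (2 * N ^+ 2) (wC N) xi.
    apply: abs_le1D; apply: le_trans (ys xi); rewrite exprMn.
    by have := sqr_ge0 (sgm J xi); nra.
  rewrite normrM (gtr0_norm N0) in h.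
  rewrite n6.
  have := normr_ge0 (sgm J xi); have := y0 xi; move: h; move: (yq _ _ _ _) `|sgm J xi| => y z h y00 z0.
  have : N * (N * z) <= N * (1 + y) by rewrite ler_wpM2l // ltW.
  have : 0 <= N * (1 + y) by rewrite mulr_ge0 ?addr_ge0 // ltW.
  nra.
split => //.
- move=> i xi; rewrite cp0 normr0 mul0r; split; last exact: mulr_ge0 (mulr_ge0 Cc0 (ltW N0)) (addr_ge0 ler01 (y0 xi)).
  rewrite cqC; have := yi xi i; rewrite /wC; have := y0 xi; move: (yq _ _ _ _) => y y00.
  have P1 : 1 + y <= N * (1 + y) by rewrite ler_peMl // addr_ge0.
  case: ifP => iI hy.
    have h : `|N * xi i| <= 1 + y by apply: abs_le1D; rewrite exprMn.
    rewrite normrM (gtr0_norm N0) in h.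
    rewrite ger0_norm ?sqr_ge0 //; have := ler_wpM2l (ltW N0) h; move: `|xi i| => z; nra.
  have h : `|xi i| <= 1 + y by apply: abs_le1D; rewrite mul1r in hy.
  have c1 : `|if i == i0 then - 1 else A - 1| <= 4 * l%:R + 6.
    by case: ifP => _; rewrite ?normrN1 ?ger0_norm /A; lra.
  rewrite -mulrA; apply: ler_pM => //; exact: le_trans h P1.
- move=> i; rewrite cqC cp0 normr0; split.
  + by rewrite n6; apply: ler_wpM2r; [exact: sqr_ge0|lra].
  + by rewrite mulr_ge0 ?sqr_ge0 // addr_ge0 // mulr_ge0.
  + case: ifP => _; first by rewrite ger0_norm ?sqr_ge0 // ler_peMl ?sqr_ge0 //; lra.
    apply: (@le_trans _ _ (4 * l%:R + 6)); first by case: ifP => _; rewrite ?normrN1 ?ger0_norm /A; lra.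
    by rewrite ler_peMr // addr_ge0 // mulr_ge0.
  + by rewrite mulr_ge0 ?sqr_ge0 // addr_ge0 // mulr_ge0.
- by move=> _; rewrite ler_peMl ?sqr_ge0 // ler1n.
- by move=> i /negbTE ->; rewrite /wC => /= ->.
Qed.

Lemma card_okC : #|[pred i | (i == i0) || (i \in I)]| = (1 + #|I|)%N.
Proof. by transitivity #|i0 |: I|; [apply: eq_card => i; rewrite !inE|rewrite cardsU1 i0I]. Qed.
End okC.

Section okD.
Variables (R : realType) (l : nat) (I : {set 'I_l}) (i0 : 'I_l) (N : R).
Hypotheses (N1 : 1 <= N).
Let A : R := 4 * l%:R + 2.
(** Together with [gDD] chosen so that [b / gD = 1] and [g / gD = N] on [I]: the input transform is,
    up to a constant, the unit Gaussian times the chirp [exp(- pi i N xi^2)]. *)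
Definition bD (N : R) : 'I_l -> R := fun i => if i \in I then (1 + N ^+ 2)^-1 else 1.
Definition gDD (N : R) : 'I_l -> R := fun i => if i \in I then N / (1 + N ^+ 2) else 0.

Lemma gD_D i : gD (bD N i) (gDD N i) = bD N i.
Proof.
have W0 : 0 < 1 + N ^+ 2 by rewrite ltr_pwDl // sqr_ge0.
rewrite /gD /bD /gDD; case: ifP => _; last by rewrite expr1n expr0n addr0.
by field; rewrite gt_eqF.
Qed.

Lemma bD_gt0 i : 0 < bD N i.
Proof. by rewrite /bD; case: ifP => // _; rewrite invr_gt0 ltr_pwDl // sqr_ge0. Qed.

Lemma cqD i : cq i0 (fun=> A) (bD N) (gDD N) i = if i == i0 then - 1 else A - 1.
Proof.
rewrite /cq gD_D divff; last by rewrite gt_eqF // bD_gt0.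
by case: ifP; rewrite ?sub0r.
Qed.

Lemma cpD i : cp (bD N) (gDD N) i = if i \in I then N else 0.
Proof.
have W0 : 0 < 1 + N ^+ 2 by rewrite ltr_pwDl // sqr_ge0.
rewrite /cp gD_D /gDD /bD; case: ifP => _; last by rewrite mul0r.
by field; rewrite gt_eqF.
Qed.

(** Here nothing concentrates: the lower bound is the Euclidean form and [N] enters through the
    phases alone, at a cost of [N] per derivative and with no gain in volume. *)
Lemma okD : shear_ok i0 predT pred0 N (4 * l%:R + 6) 0 (fun=> 1) 4 (4 * N) (fun=> A) (bD N) (gDD N).
Proof.
have N0 : 0 < N by rewrite (lt_le_trans _ N1).
have N2 : 1 <= N ^+ 2 by rewrite expr_ge1 // ltW.
have NN : N <= N ^+ 2 by rewrite expr2 ler_peMl // ltW.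
have l0 : (0 < l)%N := leq_ltn_trans (leq0n _) (ltn_ord i0).
have l1 : 1 <= l%:R :> R by rewrite ler1n.
have yE xi : yq predT 0 (fun=> 1) xi = \sum_(i < l) xi i ^+ 2 :> R.
  by rewrite /yq mul0r add0r; apply: eq_bigr => i _; rewrite mul1r.
have y0 xi : 0 <= \sum_(i < l) xi i ^+ 2 :> R by apply: sumr_ge0 => i _; exact: sqr_ge0.
have yi xi i : xi i ^+ 2 <= \sum_(i < l) xi i ^+ 2 :> R.
  by rewrite (bigD1 i) //= lerDl sumr_ge0 // => j _; exact: sqr_ge0.
split => //.
- move=> xi; rewrite (eq_bigr _ (fun i _ => congr1 (fun z => z * xi i ^+ 2) (cqD i))) yE.
  have h := @shear_coord R l i0 predT xi isT.
  have -> : \sum_i (if i == i0 then - 1 else A - 1) * xi i ^+ 2 =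
     \sum_i xi i ^+ 2 + (4 * l%:R * \sum_(i | predT i && (i != i0)) xi i ^+ 2 - 2 * xi i0 ^+ 2).
    rewrite (bigD1 i0) //= [in RHS](bigD1 i0) //= eqxx.
    have -> : \sum_(i | i != i0) (if i == i0 then - 1 else A - 1) * xi i ^+ 2 =
        \sum_(i | i != i0) xi i ^+ 2 + 4 * l%:R * \sum_(i | i != i0) xi i ^+ 2.
      rewrite mulr_sumr -big_split /=; apply: eq_bigr => i ni.
      by rewrite (negbTE ni) /A; ring.
    by ring.
  by move: h; move: (\sum_(i < l) _) (4 * l%:R * _) (xi i0 ^+ 2) (sgm _ xi ^+ 2) => a b c e; lra.
- move=> xi; rewrite yE; have h := abs_sgm_le predT xi l0.
  have Y0 := y0 xi; move: h; move: (\sum_(i < l) _) Y0 `|sgm _ xi| => y Y0 z h.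
  have P0 : 0 <= l%:R * (1 + y) by rewrite mulr_ge0 // addr_ge0.
  have P1 : l%:R * (1 + y) <= N * (l%:R * (1 + y)) by rewrite ler_peMl.
  have Q0 : 0 <= N * (1 + y) by rewrite mulr_ge0 ?addr_ge0 // ltW.
  split; first by rewrite ger0_norm //; move: P1; lra.
  rewrite ger0_norm ?mulr_ge0 ?(ltW N0) //; have := ler_wpM2l (ltW N0) h; lra.
split => //.
- move=> i xi; rewrite cqD cpD yE.
  have h : `|xi i| <= 1 + \sum_(i < l) xi i ^+ 2 by apply: abs_le1D; exact: yi.
  have Y0 := y0 xi; move: h; move: (\sum_(i < l) _) Y0 => y Y0 h.
  have P1 : 1 + y <= N * (1 + y) by rewrite ler_peMl // addr_ge0.
  have Q0 : 0 <= N * (1 + y) by rewrite mulr_ge0 ?addr_ge0 // ltW.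
  split.
    have c1 : `|if i == i0 then - 1 else A - 1| <= 4 * l%:R + 6.
      by case: ifP => _; rewrite ?normrN1 ?ger0_norm /A; lra.
    by rewrite -mulrA; apply: ler_pM => //; exact: le_trans h P1.
  case: ifP => _; last by rewrite normr0 mul0r -mulrA mulr_ge0 // addr_ge0 // mulr_ge0.
  rewrite (gtr0_norm N0); apply: (@le_trans _ _ (N * (1 + y))); first by rewrite ler_wpM2l // ltW.
  by rewrite -mulrA ler_peMl //; lra.
- move=> i; rewrite cqD cpD.
  have q0 : 0 <= l%:R * N ^+ 2 by rewrite mulr_ge0 // sqr_ge0.
  split.
  + rewrite ger0_norm //; lra.
  + rewrite ger0_norm ?mulr_ge0 ?(ltW N0) //; lra.
  + apply: (@le_trans _ _ (4 * l%:R + 6)); first by case: ifP => _; rewrite ?normrN1 ?ger0_norm /A; lra.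
    by rewrite ler_peMr // addr_ge0 // mulr_ge0.
  + case: ifP => _; rewrite ?normr0 ?(gtr0_norm N0); lra.
Qed.
End okD.

(** * The two families of non-strict inequalities *)

Section necessary.
Variables (R : realType) (l d n : nat).
Local Notation C := (R[i]).
Local Notation B := ('I_l * 'I_n)%type.
Local Notation EB := (fspace R B).
Variables (u : R) (s : 'I_d -> R) (Theta : 'I_d -> EB -> C) (pp : 'I_l -> R) (p Cst : R) (j0 : 'I_d).
Hypotheses (n0 : (0 < n)%N) (u1 : 1 < u) (s0 : forall j, 0 < s j) (Ts : forall j, Schwartz (Theta j)).
Hypothesis Tsupp : forall j eta, FT (Theta j) eta != 0 -> 1 / 2 <= enorm eta <= 2.
Hypotheses (p0 : 0 < p) (pp0 : forall i, 0 < pp i).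
Hypothesis Hmain : multiplier_bound u s Theta pp p Cst.

Let nR0 : 0 < n%:R :> R. Proof. by rewrite ltr0n. Qed.
Let u0 : 0 < u. Proof. by rewrite (lt_trans _ u1). Qed.

Section fixI.
Variables (I : {set 'I_l}) (i0 : 'I_l).
Let A : R := 4 * l%:R + 2.
Let A0 : 0 < A. Proof. by rewrite ltr_wpDl // mulr_ge0. Qed.
Let C1 : 1 <= 4 * l%:R + 6 :> R. Proof. by have : 0 <= l%:R :> R by []; lra. Qed.
Let l0 : (0 < l)%N := leq_ltn_trans (leq0n _) (ltn_ord i0).
Let lp0 (z : R) : 0 < z -> 0 < l%:R * z. Proof. by move=> z0; rewrite mulr_gt0 // ltr0n. Qed.

Lemma sum_setI (x : 'I_l -> R) : \sum_i (if i \in I then x i else 0) = \sum_(i in I) x i.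
Proof. by rewrite [RHS]big_mkcond. Qed.

(** Per component the output has amplitude [1 / N] and spread [N], so its norm is of order
    [N^(n (1/p - 1))]; an input in [I] has norm of order [N^(n / p_i)], and the multiplier norm is
    at most of order [N] to the power [s - n (1 + #|I|) / u]. The hypothesis that this last exponent
    is positive makes the maximum with 0 in [Anorm_shear] equal to it. *)
Lemma cond_conj (i0I : i0 \notin I) : 0 < s j0 - (n * (1 + #|I|))%:R / u ->
  n%:R * ((1 / p - 1) + (1 + #|I|)%:R / u - \sum_(i in I) 1 / pp i) <= s j0.
Proof.
move=> sg0.
have [CA [CA0 hA]] := @Anorm_shear R l d n u s Theta j0 u1 s0 Ts Tsupp _ (1 + #|I|)%N C1.
have X0 (N : R) : 1 <= N -> 0 < N by move=> h; rewrite (lt_le_trans _ h).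
have m2 : mono (fun N : R => N) (fun N => N ^+ 2) (2%:R * 1) := monoX X0 2 (mono_id X0).
have m6 : mono (fun N : R => N) (fun N => 6 * N ^+ 2) (0 + 2%:R * 1) by apply: (monoM X0 (mono_cst _ _)).
have mb i : mono (fun N : R => N) (fun N => bC I N i) (if i \in I then - (2%:R * 1) else 0).
  by rewrite /bC; case: ifP => _; [exact: monoV m2|exact: mono_cst].
have mbe i : mono (fun N : R => N) (fun N => beC I N i) (if i \in I then 0 + 2%:R * 1 else 0).
  by rewrite /beC; case: ifP => _; [exact: (monoM X0 (mono_cst _ _))|exact: mono_cst].
have b0 (N : R) i : 1 <= N -> 0 < bC I N i by move=> N1; have := @mono_gt0 R (fun N => N) X0 _ _ N (mb i) N1.
have be0 (N : R) i : 1 <= N -> 0 < beC I N i by move=> N1; have := @mono_gt0 R (fun N => N) X0 _ _ N (mbe i) N1.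
pose J : pred 'I_l := fun i => i \notin I.
pose sa (N : R) := samp i0 (6 * N ^+ 2) 0 (beC I N) (bC I N) (fun=> 0).
pose sr (N : R) := srate i0 J (6 * N ^+ 2) 0 (beC I N).
have ms : mono (fun N : R => N) sa (-1).
  have h := monoM X0 (mono_prodl X0 (index_enum 'I_l) (fun i (_ : predT i) => mono_pow (- (1 / 2)) (mb i)))
    (monoM X0 (mono_pow (- (1 / 2)) m6) (mono_prodl X0 (index_enum 'I_l) (fun i (_ : i != i0) => mono_pow (- (1 / 2)) (mbe i)))).
  apply: mono_eq (mono_ext h _) _ => [N N1|].
    rewrite /sa /samp; congr (_ * (_ * _)); first by apply: eq_bigr => i _; rewrite gD_real // b0.
    by rewrite gD_real // (@mono_gt0 R (fun N => N) X0 _ _ _ m6).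
  rewrite (bigD1 i0) //= (negbTE i0I) mul0r add0r addrCA -big_split /= big1 ?addr0; first by lra.
  by move=> i _; case: ifP => _; lra.
have mr : mono (fun N : R => N) sr (-2).
  have h := monoM X0 (mono_cst (fun N : R => N) (_ : 0 < 6^-1 + (\sum_(i | (i != i0) && ~~ J i) 2^-1) :> R)) (monoV X0 m2).
  apply: mono_eq (mono_ext (h _) _) _ => [|N N1|]; last by lra.
    by rewrite ltr_wpDr ?invr_gt0 // sumr_ge0.
  have N0 := X0 _ N1.
  rewrite /sr /srate [RHS]mulrDl; congr (_ + _); first by rewrite /gD; field; rewrite gt_eqF.
  rewrite mulr_suml; apply: eq_bigr => i /andP[_ iI]; rewrite negbK in iI.
  by rewrite /beC iI invfM.
have mT := monoM X0 (monoX X0 n ms) (mono_pow p^-1 (monoM X0 (monoX X0 n (mono_pow (- (1 / 2))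
    (monoM X0 mr (mono_cst (fun N : R => N) p0)))) (mono_cst (fun N : R => N) (Kd_gt0 n j0 (lp0 p0))))).
have mf i := mono_pow (pp i)^-1 (monoM X0 (monoX X0 n (mono_pow (- (1 / 2))
    (monoM X0 (mb i) (mono_cst (fun N : R => N) (pp0 i))))) (mono_cst (fun N : R => N) (Kd_gt0 n j0 (pp0 i)))).
have Cp : 0 < `|Cst| + 1 by rewrite ltr_wpDl.
set sg := s j0 - _ in sg0.
have mR := monoM X0 (monoM X0 (mono_cst (fun N : R => N) Cp) (monoM X0 (mono_cst (fun N : R => N) CA0) (mono_pow sg (mono_id X0))))
   (mono_prodl X0 (index_enum 'I_l) (fun i (_ : predT i) => mf i)).
have := mono_le X0 (fun N _ => lexx N) mT mR.
have hle (x y : R) : x = n%:R * (1 / p - 1) -> y = sg + n%:R * \sum_(i in I) 1 / pp i -> x <= y ->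
    n%:R * ((1 / p - 1) + (1 + #|I|)%:R / u - \sum_(i in I) 1 / pp i) <= s j0.
  move=> -> ->; rewrite /sg natrM !mulrDr !mulrN.
  have -> : n%:R * ((1 + #|I|)%:R / u) = n%:R * (1 + #|I|)%:R / u :> R by rewrite mulrA.
  by move: (n%:R * (1 + #|I|)%:R / u) (n%:R * \sum_(i in I) _) (n%:R * (1 / p)) => a b c; lra.
move=> h; apply: (hle _ _ _ _ (h _)); clear h.
- by field; rewrite gt_eqF.
- rewrite mul1r !add0r; congr (_ + _); rewrite -sum_setI mulr_sumr; apply: eq_bigr => i _.
  by case: ifP => _; [field; rewrite gt_eqF|rewrite !(mul0r, mulr0, addr0)].
move=> N N1; have N0 := X0 _ N1.
have Ji0 : J i0 by [].
have q6 : 0 < 6 * N ^+ 2 := @mono_gt0 R (fun N => N) X0 _ _ _ m6 N1.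
pose m := fun xi : ptK l d n -> R => smul i0 J (6 * N ^+ 2) 0 (beC I N) (bC I N) (fun=> 0) (vblock xi j0).
have mE xi : m xi = smul i0 J (6 * N ^+ 2) 0 (beC I N) (bC I N) (fun=> 0) (vblock xi j0) by [].
have b0' i := b0 N i N1; have be0' i := be0 N i N1.
have hAm := hA i0 J _ N _ _ _ _ _ _ _ m Ji0 (okC i0I N1) N1 (card_okC i0I) mE.
rewrite -/sg (_ : Num.max sg 0 = sg) in hAm; last by rewrite max_l // ltW.
have hT := Lpnorm_stest Ji0 q6 be0' b0' mE p0.
apply: (real_bound Hmain _ hAm _ (fun i => Lpnorm_ftest n j0 (fun=> 0) b0' i (pp0 i))).
- by move=> i; apply: tf_Schwartz.
- by rewrite hT.
- by move=> i; exact: powR_ge0.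
Qed.

(** The multiplier removes the chirps of the inputs in [I] and puts one on the sum of all
    frequencies. In powers of [1 + N^2] and per component, the output has amplitude [(#|I| - 1) / 4]
    and spread [1 / 2], an input in [I] has spread [1 / 2], and the whole multiplier norm has
    exponent at most [s / 2]. *)
Lemma cond_chirp : n%:R * (#|I|%:R / 2 - 1 / 2 + 1 / p - \sum_(i in I) 1 / pp i) <= s j0.
Proof.
have [CA [CA0 hA]] := @Anorm_shear R l d n u s Theta j0 u1 s0 Ts Tsupp _ 0%N C1.
(* With this scale instead of [N] all constants are exact powers: the chirp rate [4 N] next to decay
   4 gives [gD 4 (4 N) = 16 X N]. *)
pose X (N : R) := 1 + N ^+ 2.
have X0 (N : R) : 1 <= N -> 0 < X N by move=> _; rewrite ltr_pwDl // sqr_ge0.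
have XN (N : R) : 1 <= N -> N <= X N by rewrite /X => h; nra.
have mV := monoV X0 (mono_id X0).
have mb i : mono X (fun N => bD I N i) (if i \in I then - 1 else 0).
  by rewrite /bD; case: ifP => _; [exact: mV|exact: mono_cst].
have m16 : mono X (fun N => 16 * X N) (0 + 1) by apply: (monoM X0 (mono_cst _ _) (mono_id X0)).
have gE (N : R) : gD 4 (4 * N) = 16 * X N by rewrite /gD /X; ring.
pose sa (N : R) := samp i0 4 (4 * N) (fun=> A) (bD I N) (gDD I N).
pose sr (N : R) := srate i0 predT 4 (4 * N) (fun=> A : R).
have ms : mono X sa ((#|I|%:R - 1) / 4).
  have h := monoM X0 (mono_prodl X0 (index_enum 'I_l) (fun i (_ : predT i) => mono_pow (- (1 / 4)) (mb i)))
    (monoM X0 (mono_pow (- (1 / 4)) m16) (mono_cst X (_ : 0 < \prod_(i | i != i0) A `^ (- (1 / 2))))).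
  apply: mono_eq (mono_ext (h _) _) _ => [|N N1|].
  - by apply: prodr_gt0 => i _; rewrite powR_gt0.
  - rewrite /sa /samp gE; congr (_ * (_ * _)); apply: eq_bigr => i _; by rewrite gD_D.
  rewrite (eq_bigr (fun i => if i \in I then 1 / 4 else 0)); last by move=> i _; case: ifP => _; lra.
  by rewrite (sum_setI (fun=> 1 / 4)) sumr_const -mulr_natl; lra.
have mr : mono X sr (-1).
  have h := monoM X0 (mono_cst X (_ : 0 < 4 :> R)) (monoV X0 m16).
  apply: mono_eq (mono_ext (h _) _) _ => // [N N1|]; last by lra.
  by rewrite /sr /srate gE big_pred0 ?addr0 // => i; rewrite andbF.
have mT := monoM X0 (monoX X0 n ms) (mono_pow p^-1 (monoM X0 (monoX X0 n (mono_pow (- (1 / 2))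
    (monoM X0 mr (mono_cst X p0)))) (mono_cst X (Kd_gt0 n j0 (lp0 p0))))).
have mf i := mono_pow (pp i)^-1 (monoM X0 (monoX X0 n (mono_pow (- (1 / 2))
    (monoM X0 (mb i) (mono_cst X (pp0 i))))) (mono_cst X (Kd_gt0 n j0 (pp0 i)))).
have Cp : 0 < `|Cst| + 1 by rewrite ltr_wpDl.
have mR := monoM X0 (monoM X0 (mono_cst X Cp) (monoM X0 (mono_cst X CA0) (mono_pow (s j0 / 2) (mono_id X0))))
   (mono_prodl X0 (index_enum 'I_l) (fun i (_ : predT i) => mf i)).
have := mono_le X0 XN mT mR.
have hle (x y : R) : x = n%:R * ((#|I|%:R - 1) / 4 + 1 / (2 * p)) -> y = s j0 / 2 + n%:R / 2 * \sum_(i in I) 1 / pp i -> x <= y ->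
    n%:R * (#|I|%:R / 2 - 1 / 2 + 1 / p - \sum_(i in I) 1 / pp i) <= s j0.
  move=> -> ->; have -> : 1 / (2 * p) = 1 / p / 2 by field; rewrite gt_eqF.
  move: (\sum_(i in I) _) (1 / p) => a b; rewrite !mulrDr !mulrN; lra.
move=> h; apply: (hle _ _ _ _ (h _)); clear h.
- by field; rewrite gt_eqF.
- rewrite mul1r !add0r; congr (_ + _); rewrite -sum_setI mulr_sumr; apply: eq_bigr => i _.
  by case: ifP => _; [field; rewrite gt_eqF|rewrite !(mul0r, mulr0, addr0)].
move=> N N1; have N0 : 0 < N by rewrite (lt_le_trans _ N1).
have q4 : 0 < 4 :> R by [].
pose m := fun xi : ptK l d n -> R => smul i0 predT 4 (4 * N) (fun=> A) (bD I N) (gDD I N) (vblock xi j0).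
have mE xi : m xi = smul i0 predT 4 (4 * N) (fun=> A) (bD I N) (gDD I N) (vblock xi j0) by [].
have b0' i := bD_gt0 I N i.
have hAm : (Anorm u s Theta m <= (CA * X N `^ (s j0 / 2))%:E)%E.
  apply: le_trans (hA i0 predT pred0 N _ _ _ _ _ _ _ m isT (okD I i0 N1) N1 (card0 _) mE) _.
  rewrite lee_fin ler_wpM2l ?(ltW CA0) // muln0 mul0r subr0 max_l ?(ltW (s0 j0)) //.
  have -> : N `^ s j0 = (N ^+ 2) `^ (s j0 / 2).
    by rewrite -(powR_mulrn 2 (ltW N0)) -powRrM; congr powR; field.
  apply: ge0_ler_powR; rewrite ?nnegrE ?sqr_ge0 ?(ltW (X0 N N1)) //; first by rewrite divr_ge0 // ltW.
  by rewrite /X lerDr.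
have hT := Lpnorm_stest (isT : predT i0) q4 (fun=> A0) b0' mE p0.
apply: (real_bound Hmain _ hAm _ (fun i => Lpnorm_ftest n j0 (gDD I N) b0' i (pp0 i))).
- by move=> i; apply: tf_Schwartz.
- by rewrite hT.
- by move=> i; exact: powR_ge0.
Qed.
End fixI.
End necessary.

(** * The strict inequality l/u < s/n *)

Section centered.
Variables (R : realType) (B : finType) (b1 : B).
Local Notation EB := (fspace R B).
Local Notation mu := (@mu_fspace R B).
Local Notation leb := (@lebesgue_measure R).
Local Notation RT := (measurableTypeR R).

Let c : B -> R := dlt R b1.
(** Gaussian bump of width [1 / M] at a unit vector, an interior point of the annulus. *)
Definition cent (M : R) (v : B -> R) : R := expR (- (pi * M ^+ 2 * \sum_b (v b - c b) ^+ 2)).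

Definition cList (M rho : R) : seq (qitem R B) :=
  [seq (pi * M ^+ 2, (fun b' => rho * dlt R b b'), c b) | b <- index_enum B].
Definition Zc (rho : R) (x : B -> R) : R := \sum_b (rho * x b - c b) ^+ 2.
Definition Yc (M rho : R) (x : EB) : R := pi / 2 * (M ^+ 2 * Zc rho x).

Lemma Zc_ge0 rho x : 0 <= Zc rho x.
Proof. by apply: sumr_ge0 => b _; exact: sqr_ge0. Qed.

Lemma Yc_ge0 M rho x : 0 <= Yc M rho x.
Proof. by rewrite mulr_ge0 ?divr_ge0 ?pi_ge0 // mulr_ge0 ?sqr_ge0 ?Zc_ge0. Qed.

Lemma measurable_Zc rho : measurable_fun setT (Zc rho : EB -> R).
Proof.
apply: measurable_sum => b; apply: measurable_funX; apply: measurable_funB => //.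
by apply: measurable_funM => //; exact: measurable_coord.
Qed.

Lemma lin_cList M rho b x : lin (pi * M ^+ 2, (fun b' => rho * dlt R b b'), c b) x = rho * x b - c b.
Proof.
rewrite /lin /= -(dotp_dlt x b) /dotp mulr_sumr; congr (_ - _); apply: eq_bigr => b' _; ring.
Qed.

Lemma qf_cList M rho x : qf (cList M rho) x = pi * M ^+ 2 * Zc rho x.
Proof.
rewrite /qf big_map /Zc mulr_sumr; apply: eq_bigr => b _; by rewrite lin_cList.
Qed.

Lemma qd_cList M rho b x : qd (cList M rho) b x = pi * M ^+ 2 * (2 * (rho * x b - c b) * rho).
Proof.
rewrite /qd big_map (bigD1 b) //= big1 => [|b' /negbTE nb]; last by rewrite /dlt eq_sym nb !mulr0.
by rewrite lin_cList /dlt eqxx mulr1 addr0.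
Qed.

Lemma qh_cList M rho b b' : `|qh (cList M rho) b' b| <= pi * M ^+ 2 * (2 * rho ^+ 2).
Proof.
rewrite /qh big_map (bigD1 b) //= big1 => [|b'' /negbTE nb]; last by rewrite /dlt [b == _]eq_sym nb !(mulr0, mul0r).
rewrite /dlt eqxx mulr1 addr0.
have -> : pi * M ^+ 2 * (2 * rho * (rho * (b' == b)%:R)) = pi * M ^+ 2 * (2 * rho ^+ 2) * (b' == b)%:R.
  by move: (pi : R) => q; ring.
have P0 : 0 <= pi * M ^+ 2 * (2 * rho ^+ 2) := mulr_ge0 (mulr_ge0 (pi_ge0 R) (sqr_ge0 _)) (mulr_ge0 (ler0n _ 2) (sqr_ge0 _)).
by rewrite normrM (ger0_norm P0) -[leRHS]mulr1 ler_wpM2l //; case: eqP; rewrite ?normr1 ?normr0.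
Qed.

Lemma qd_nil b (x : EB) : qd ([::] : seq (qitem R B)) b x = 0. Proof. by rewrite /qd big_nil. Qed.
Lemma qh_nil b b' : qh ([::] : seq (qitem R B)) b b' = 0. Proof. by rewrite /qh big_nil. Qed.

Lemma qcond_cList M rho lam : 1 <= M -> 0 < rho -> 1 <= lam -> M * rho <= lam ->
  qcond (cList M rho) [::] lam (2 * pi) (Yc M rho).
Proof.
move=> M1 r0 l1 rl.
have M0 : 0 < M by rewrite (lt_le_trans _ M1).
have p0 : 0 < pi :> R := pi_gt0 R.
have P0 x : 0 <= 2 * pi * (1 + Yc M rho x) by rewrite mulr_ge0 ?addr_ge0 ?Yc_ge0 // mulr_ge0 // ltW.
have P1 x : 2 * pi <= 2 * pi * (1 + Yc M rho x) by rewrite ler_peMr ?lerDl ?Yc_ge0 // mulr_ge0 // ltW.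
have lp : 0 <= lam by rewrite (le_trans _ l1).
split => //.
- by apply: measurable_funM => //; apply: measurable_funM => //; exact: measurable_Zc.
- exact: Yc_ge0.
- by move=> x _; rewrite qf_cList /Yc; move: (pi : R) (Zc _ _) => a z; apply: le_of_eq; field.
split.
- move=> x b _; rewrite qd_cList.
  have h : `|M * (rho * x b - c b)| <= 1 + Yc M rho x.
    apply: abs_le1D; rewrite exprMn /Yc.
    apply: (@le_trans _ _ (M ^+ 2 * Zc rho x)).
      by rewrite ler_wpM2l ?sqr_ge0 // /Zc (bigD1 b) //= lerDl sumr_ge0 // => b' _; exact: sqr_ge0.
    by rewrite ler_peMl ?pihalf_ge1 // mulr_ge0 ?sqr_ge0 ?Zc_ge0.
  have -> : pi * M ^+ 2 * (2 * (rho * x b - c b) * rho) = (2 * pi * (M * rho)) * (M * (rho * x b - c b)).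
    by move: (pi : R) => q; ring.
  rewrite normrM ger0_norm; last by rewrite mulr_ge0 // mulr_ge0 // ltW.
  apply: (@le_trans _ _ (2 * pi * (M * rho) * (1 + Yc M rho x))).
    by rewrite ler_wpM2l // mulr_ge0 // mulr_ge0 // ltW.
  have -> : 2 * pi * (M * rho) * (1 + Yc M rho x) = M * rho * (2 * pi * (1 + Yc M rho x)).
    by move: (pi : R) => q; ring.
  exact: ler_wpM2r.
- by move=> x b _; rewrite qd_nil normr0 mulr_ge0.
- move=> x b b' _; apply: (le_trans (qh_cList _ _ _ _)).
  have -> : pi * M ^+ 2 * (2 * rho ^+ 2) = (M * rho) ^+ 2 * (2 * pi) by move: (pi : R) => q; ring.
  apply: ler_pM => //; [exact: sqr_ge0|by rewrite mulr_ge0 // ltW|].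
  by apply: lerXn2r => //; rewrite nnegrE // mulr_ge0 // ltW.
- by move=> x b b' _; rewrite qh_nil normr0 mulr_ge0 // sqr_ge0.
Qed.

Lemma sum_c2 : \sum_b c b ^+ 2 = 1.
Proof.
rewrite (bigD1 b1) //= big1 => [|b /negbTE nb]; first by rewrite /c /dlt eqxx expr1n addr0.
by rewrite /c /dlt nb expr0n.
Qed.

(** Triangle inequality for the distance of [rho x] to a unit vector, in the form suited to large
    [rho]; the next lemma is the form for small [rho]. *)
Lemma Zc_lower rho x : rho ^+ 2 / 2 * sqnorm x - 1 <= Zc rho x.
Proof.
rewrite /Zc /sqnorm -[X in _ - X]sum_c2 mulr_sumr -sumrB; apply: ler_sum => b _.
by have := sqr_ge0 (rho * x b - 2 * c b); nra.
Qed.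

Lemma Zc_lower' rho x : 1 / 2 - rho ^+ 2 * sqnorm x <= Zc rho x.
Proof.
have e : 1 / 2 = \sum_b c b ^+ 2 / 2 by rewrite -mulr_suml sum_c2.
rewrite e /Zc /sqnorm mulr_sumr -sumrB; apply: ler_sum => b _.
by have := sqr_ge0 (2 * rho * x b - c b); nra.
Qed.

Lemma integ_cgex M rho : 0 < M -> 0 < rho ->
  integ (fun x : B -> R => (\prod_b gex (M ^+ 2 / 4) (rho * x b - c b))%:E) = ((2 / (rho * M)) ^+ #|B|)%:E.
Proof.
move=> M0 r0; have q0 : 0 < M ^+ 2 / 4 by rewrite divr_gt0 // exprn_gt0.
have mg b : measurable_fun setT (fun t : RT => gex (M ^+ 2 / 4) (rho * t - c b)).
  apply: (measurableT_comp (@measurable_gex R _)); apply: measurable_funB => //; exact: measurable_funM.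
rewrite (@integ_prod R B (fun b t => gex (M ^+ 2 / 4) (rho * t - c b)) (fun b t => gex_ge0 _ _) mg).
rewrite -prodr_const -prodEFin; apply: eq_bigr => b _.
have me : measurable_fun setT (fun t : R => (gex (M ^+ 2 / 4) t)%:E) by apply/measurable_EFinP; exact: measurable_gex.
have h := @ge0_integral_affine R rho (- c b) (fun t => (gex (M ^+ 2 / 4) t)%:E) r0 me
   (fun t => gex_ge0 _ _).
rewrite integral_gex // in h.
have i0 : (0 <= \int[leb]_t (gex (M ^+ 2 / 4) (rho * t - c b))%:E)%E by apply: integral_ge0 => t _; rewrite lee_fin gex_ge0.
move: h i0; case: (\int[leb]_t _)%E => [r| |] //=; last by rewrite gt0_muley // lte_fin.
rewrite -EFinM => -[h] _; congr EFin; apply: (mulfI (lt0r_neq0 r0)); rewrite h.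
have -> : M ^+ 2 / 4 = (M / 2) `^ 2%:R.
  by rewrite powR_mulrn ?divr_ge0 ?(ltW M0) //; field.
rewrite -powRrM (_ : 2%:R * - (1 / 2) = - 1); last by field.
by rewrite powRN powRr1 ?divr_ge0 ?(ltW M0) //; field; rewrite !gt_eqF.
Qed.

(** For [rho >= 1/8] half of the exponent is integrated exactly, giving [(2 / (rho M))^q], and the
    other half yields the decay in [rho]. For [rho < 1/8] the dilated annulus lies within [1/4] of
    the origin, away from the centre of the bump, and [exp(- M^2 / 4)] beats [M^(- q)]. *)
Lemma pint_Yc : exists K : R, 0 < K /\ forall M rho, 1 <= M -> 0 < rho ->
  (pint mu 1 (annY (Yc M rho)) <= (K * M ^- #|B| * expR (- (pi / 32 * rho ^+ 2)))%:E)%E.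
Proof.
set q := #|B|.
pose K1 : R := expR (pi / 4) * 16 ^+ q.
pose K2 : R := 4 ^+ q * (4 ^+ q * (q ^ q)%:R) * expR (pi / 32).
have K10 : 0 < K1 by rewrite mulr_gt0 ?expR_gt0 // exprn_gt0.
have K20 : 0 < K2.
  by rewrite mulr_gt0 ?expR_gt0 // mulr_gt0 ?exprn_gt0 // mulr_gt0 ?exprn_gt0 // ltr0n expn_gt0; case: (q).
exists (K1 + K2); split; first exact: addr_gt0.
move=> M rho M1 r0; have M0 : 0 < M by rewrite (lt_le_trans _ M1).
have p0 : 0 < pi :> R := pi_gt0 R.
have mYc : measurable_fun setT (Yc M rho).
  by apply: measurable_funM => //; apply: measurable_funM => //; exact: measurable_Zc.
have mA := measurable_annY mYc.
have A0 x : 0 <= annY (Yc M rho) x by rewrite mulr_ge0 ?expR_ge0 // indicE.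
have MM : 1 <= M ^+ 2 by rewrite expr_ge1 // ltW.
have I0 : 0 <= M ^- q by rewrite invr_ge0 exprn_ge0 // ltW.
rewrite pint1.
case: (leP (8^-1) rho) => hr.
  apply: (@le_trans _ _ ((K1 * M ^- q * expR (- (pi / 32 * rho ^+ 2)))%:E)); last first.
    by rewrite lee_fin ler_wpM2r // ler_wpM2r // lerDl ltW.
  pose P (x : EB) := \prod_b gex (M ^+ 2 / 4) (rho * x b - c b).
  have P0 x : 0 <= P x by apply: prodr_ge0 => b _; exact: gex_ge0.
  have mP : measurable_fun setT P.
    apply: measurable_prod => b _; apply: (measurableT_comp (@measurable_gex R _)).
    by apply: measurable_funB => //; apply: measurable_funM => //; exact: measurable_coord.
  set E1 := expR (pi / 4) * expR (- (pi / 32 * rho ^+ 2)).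
  have E10 : 0 <= E1 by rewrite mulr_ge0 ?expR_ge0.
  apply: (@le_trans _ _ (\int[mu]_x (E1%:E * (P x)%:E))%E).
    apply: ge0_le_integral => //.
    - by apply/measurable_EFinP; exact: measurableT_comp.
    - by apply: measurable_funeM; exact/measurable_EFinP.
    move=> x _; rewrite -EFinM lee_fin (ger0_norm (A0 x)) /annY indicE.
    case: (boolP (x \in _)) => [|_]; last by rewrite mul0r mulr_ge0.
    rewrite inE /ann /= => /andP[x1 x4]; rewrite mul1r.
    rewrite /E1 /P /gex -expR_sum -!expRD ler_expR sumrN -mulr_sumr -/(Zc rho x) /Yc.
    have z0 := Zc_ge0 rho x; have zl := Zc_lower rho x.
    have r2 : 0 <= rho ^+ 2 := sqr_ge0 _.
    have z1 : rho ^+ 2 / 8 - 1 <= Zc rho x.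
      by apply: le_trans zl; rewrite lerD2r -mulrA ler_wpM2l //; lra.
    have z2 : rho ^+ 2 / 8 - 1 <= M ^+ 2 * Zc rho x by apply: (le_trans z1); rewrite ler_peMl.
    have := ler_wpM2l (ltW p0) z2; move: (M ^+ 2) (Zc rho x) (rho ^+ 2) (pi : R) => a z r q'.
    rewrite !mulrBr !mulr1 -!mulrA; nra.
  rewrite ge0_integralZl //; [|by apply/measurable_EFinP|by move=> x _; rewrite lee_fin].
  rewrite -integE; [|by move=> x; rewrite lee_fin|by apply/measurable_EFinP].
  rewrite integ_cgex // -EFinM lee_fin /E1 /K1 -/q.
  set e1 := expR (pi / 4); set e2 := expR _.
  have -> : e1 * 16 ^+ q / M ^+ q * e2 = e1 * e2 * (16 ^+ q / M ^+ q) by ring.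
  rewrite ler_wpM2l // -exprVn -exprMn; apply: lerXn2r; rewrite ?nnegrE.
  - by rewrite divr_ge0 // mulr_ge0 // ltW.
  - by rewrite mulr_ge0 // invr_ge0 ltW.
  by rewrite invfM mulrA ler_wpM2r ?invr_ge0 ?(ltW M0) // ler_pdivrMr //; lra.
apply: (@le_trans _ _ ((K2 * M ^- q * expR (- (pi / 32 * rho ^+ 2)))%:E)); last first.
  by rewrite lee_fin ler_wpM2r // ler_wpM2r // lerDr ltW.
have r1 : rho ^+ 2 <= 64^-1 by move: r0 hr; nra.
set E2 := expR (- (M ^+ 2 * 4^-1)).
have hb : mu (@box R B 2) = ((2 *+ 2) ^+ #|B|)%:E by apply: mu_box.
apply: (@le_trans _ _ (\int[mu]_x (E2%:E * (\1_(@box R B 2) x)%:E))%E).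
  apply: ge0_le_integral => //.
  - by apply/measurable_EFinP; exact: measurableT_comp.
  - by apply: measurable_funeM; apply/measurable_EFinP; apply: measurable_indic; exact: measurable_box.
  move=> x _; rewrite -EFinM lee_fin (ger0_norm (A0 x)) /annY [\1_(@ann R B) _]indicE.
  case: (boolP (x \in @ann R B)) => [|_]; last by rewrite mul0r mulr_ge0 ?expR_ge0 // indicE.
  rewrite inE /ann /= => /andP[x1 x4]; rewrite mul1r.
  have -> : \1_(@box R B 2) x = 1 :> R.
    rewrite indicE mem_set // /box /= => b.
    have := le_trans (sqr_coord_le x b) x4; rewrite -real_normK ?num_real //.
    by have := normr_ge0 (x b); move: `|x b| => a; nra.
  rewrite mulr1 /E2 ler_expR lerN2 /Yc.
  have zl := Zc_lower' rho x.
  have z1 : 1 / 4 <= Zc rho x.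
    apply: le_trans zl; have := sqr_ge0 rho; move: x4 (sqnorm_ge0 x) r1; move: (rho ^+ 2) (sqnorm x) => a b; nra.
  have z2 : M ^+ 2 * 4^-1 <= M ^+ 2 * Zc rho x by rewrite ler_wpM2l ?sqr_ge0 //; lra.
  apply: (le_trans z2); rewrite ler_peMl ?pihalf_ge1 // mulr_ge0 ?sqr_ge0 ?Zc_ge0 //.
rewrite ge0_integralZl //; first last.
- by rewrite lee_fin expR_ge0.
- by apply/measurable_EFinP; apply: measurable_indic; exact: measurable_box.
rewrite integral_indic ?setIT //; last exact: measurable_box.
rewrite [X in (_ * X)%E](_ : _ = (4 ^+ q)%:E); last by apply: (etrans hb); congr ((_ ^+ _)%:E); ring.
rewrite -EFinM lee_fin.
have be : 0 < (4^-1 : R) <= 1 by rewrite invr_gt0 ltr0n /= invf_le1 // ler1n.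
have := @exp_poly_le R 4^-1 (M ^+ 2) q be (sqr_ge0 _).
rewrite invrK mulrC [_^-1 * _]mulrC -/E2 => h.
have Mq : M ^+ q <= (1 + M ^+ 2) ^+ q.
  by apply: lerXn2r; rewrite ?nnegrE ?(ltW M0) ?addr_ge0 ?sqr_ge0 //; nra.
have h1 : E2 * M ^+ q <= 4 ^+ q * (q ^ q)%:R.
  by apply: le_trans h; rewrite ler_wpM2l ?expR_ge0.
have h2 : E2 <= 4 ^+ q * (q ^ q)%:R * M ^- q by rewrite ler_pdivlMr // exprn_gt0.
have h3 : 1 <= expR (pi / 32) * expR (- (pi / 32 * rho ^+ 2)).
  rewrite -expRD -expR0 ler_expR subr_ge0 -[leRHS]mulr1 ler_wpM2l ?divr_ge0 ?(ltW p0) //; lra.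
rewrite /K2; set X1 := 4 ^+ q in h1 h2 *; set X2 := (q ^ q)%:R in h1 h2 *.
have -> : X1 * (X1 * X2) * expR (pi / 32) * M ^- q * expR (- (pi / 32 * rho ^+ 2)) =
   (X1 * X2 * M ^- q) * X1 * (expR (pi / 32) * expR (- (pi / 32 * rho ^+ 2))) by ring.
have X10 : 0 <= X1 by exact: exprn_ge0.
apply: (@le_trans _ _ (X1 * X2 * M ^- q * X1)); first exact: ler_wpM2r.
by rewrite ler_peMr // mulr_ge0 // (le_trans _ h2) // expR_ge0.
Qed.
End centered.

(** * Real Gaussians and growth of powers *)

Section onedim_extra.
Variable R : realType.
Local Notation C := (R[i]).
Local Notation leb := (@lebesgue_measure R).
Local Notation RT := (measurableTypeR R).

Lemma kap2_real (b : R) : 0 < b -> kap2 b 0 = cR (b `^ (- (1 / 2))).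
Proof.
move=> b0; rewrite /kap2; apply: cplx_eq => /=.
  transitivity (\int[leb]_t gex b t); last by rewrite /Rintegral integral_gex.
  by apply: eq_Rintegral => t _; rewrite mulr0 mul0r cos0 mulr1.
rewrite /gV (_ : (fun t => _) = fun=> 0); first by rewrite Rintegral_cst // mul0r.
by apply/funext => t; rewrite mulr0 mul0r sin0 mulr0.
Qed.

Lemma hgF_real (b t : R) : 0 < b -> hgF b 0 t = cR (b `^ (- (1 / 2)) * gex b^-1 t).
Proof.
move=> b0; rewrite hgFE kap2_real // /cge mulr0 !mul0r oppr0 cexpi0 mulr1 -cRM /gex.
have -> : pi * b / gD b 0 = pi / b :> R; last by [].
by rewrite /gD expr0n addr0 expr2 invfM -mulrA [b * _]mulrA divff ?mul1r // gt_eqF.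
Qed.

Lemma C1_trans (c : R) (g : RT -> C) : c1int g ->
  c1int (fun t => g (t - c)) /\ C1 (fun t => g (t - c)) = C1 g.
Proof.
move=> [g1 g2].
pose phi : RT -> RT := fun t => t - c.
have mphi : measurable_fun setT phi by apply: measurable_funB.
have phiP (f : RT -> \bar R) : (forall x, 0 <= f x)%E -> measurable_fun setT f ->
    (\int[leb]_x f (phi x) = \int[leb]_x f x)%E.
  by move=> f0 mf; exact: (@ge0_integral_shift R (- c) f mf f0).
split; first by split; [exact: (transfer_rint mphi phiP g1)|exact: (transfer_rint mphi phiP g2)].
by rewrite /C1 (transfer_Rintegral phiP (rint_meas g1)) (transfer_Rintegral phiP (rint_meas g2)).
Qed.

Lemma C1_centered (be c x : R) : 0 < be ->
  c1int (fun t => cR (gex be (t - c)) : C) /\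
  C1 (fun t => cR (gex be (t - c)) * cexpi (2 * pi * (x * t))) =
  cexpi (2 * pi * (x * c)) * cR (be `^ (- (1 / 2)) * gex be^-1 x).
Proof.
move=> b0.
have e0 t : hg be 0 0 (t - c) = cR (gex be (t - c)) :> C.
  by rewrite /hg mulr0 !mul0r addr0 cexpi0 mulr1.
split.
  rewrite (_ : (fun t => _) = fun t => hg be 0 0 (t - c)); last by apply/funext => t; rewrite e0.
  exact: (C1_trans c (c1int_hg 0 0 b0)).1.
rewrite -hgF_real // -C1_hg // -(C1_trans c (c1int_hg 0 x b0)).2 -C1Z; last exact: (C1_trans c (c1int_hg 0 x b0)).1.
congr C1; apply/funext => t; rewrite -e0.
have -> : hg be 0 x (t - c) = hg be 0 0 (t - c) * cexpi (2 * pi * (x * (t - c))) by rewrite hg_exp add0r.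
rewrite [RHS]mulrCA -cexpiD.
by congr (_ * cexpi _); ring.
Qed.
End onedim_extra.

Lemma powR_nat_to0 (R : realType) (C sg : R) : 0 <= C -> sg < 0 ->
  forall ep : R, 0 < ep -> exists N0, forall N, (N0 <= N)%N -> C * N.+1%:R `^ sg <= ep.
Proof.
move=> C0 sg0 ep ep0.
have [->|Cn] := eqVneq C 0; first by exists 0%N => N _; rewrite mul0r ltW.
have ns : 0 < - sg by rewrite oppr_gt0.
exists (Num.truncn ((C / ep) `^ (- sg)^-1)) => N hN.
have h : (C / ep) `^ (- sg)^-1 <= N.+1%:R.
  by rewrite ltW // (lt_le_trans (truncnS_gt _)) // ler_nat.
have h2 : C / ep <= N.+1%:R `^ (- sg).
  have q0 : 0 <= C / ep by rewrite divr_ge0 // ltW.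
  rewrite [leLHS](_ : _ = ((C / ep) `^ (- sg)^-1) `^ (- sg)); last by rewrite -powRrM mulVf ?gt_eqF // powRr1.
  by apply: ge0_ler_powR; rewrite ?nnegrE ?powR_ge0 // ltW.
rewrite -[sg]opprK powRN ler_pdivrMr //.
by move: h2; rewrite ler_pdivrMr // mulrC.
Qed.

Lemma powR_nat_contra (R : realType) (a b e e' : R) : 0 < a -> e' < e ->
  (forall r : nat, a * r.+1%:R `^ e <= b * r.+1%:R `^ e') -> False.
Proof.
move=> a0 ee h.
have b0 : 0 <= b.
  by have := h 0%N; rewrite !powR1 !mulr1 => ab; rewrite (le_trans _ ab) // ltW.
have sg0 : e' - e < 0 by rewrite subr_lt0.
have a2 : 0 < a / 2 by rewrite divr_gt0.
have [N0 /(_ N0 (leqnn _)) hN] := powR_nat_to0 b0 sg0 a2.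
have := h N0; have -> : N0.+1%:R `^ e' = N0.+1%:R `^ (e' - e) * N0.+1%:R `^ e :> R.
  by rewrite -powRD ?subrK // pnatr_eq0 implybT.
rewrite mulrA ler_pM2r // => h2; have := le_trans h2 hN; lra.
Qed.

Lemma Lpnorm_lower (R : realType) (K : finType) (p : R) (g : (K -> R) -> R[i]) (G h : fspace R K -> R) : 0 < p ->
  (forall x, cabs (g x) = G x) -> measurable_fun setT G -> measurable_fun setT h ->
  (forall x, 0 <= h x <= G x) ->
  (poweR (integ (fun x => (h x `^ p)%:E)) p^-1 <= Lpnorm p g)%E.
Proof.
move=> p0 gG mG mh hG.
have i0 (f : fspace R K -> R) : (0 <= integ (fun x => (f x `^ p)%:E))%E.
  by apply: iter_int_ge0 => x; rewrite lee_fin powR_ge0.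
rewrite /Lpnorm; apply: gt0_ler_poweR; rewrite ?invr_ge0 ?(ltW p0) //.
- by rewrite in_itv /= leey andbT.
- by rewrite in_itv /= leey andbT; exact: i0.
apply: iter_int_le.
- by move=> x; rewrite lee_fin powR_ge0.
- by apply/measurable_EFinP; exact: (measurableT_comp (measurable_powR _) mh).
- apply/measurable_EFinP; rewrite (_ : (fun x => _) = fun x => G x `^ p); last by apply/funext => x; rewrite gG.
  exact: (measurableT_comp (measurable_powR _) mG).
move=> x; have /andP[h0 hx] := hG x; rewrite lee_fin gG.
by apply: ge0_ler_powR; rewrite ?nnegrE ?(ltW p0) // (le_trans h0).
Qed.

Lemma double_sub1_gt1 (R : realType) (z : R) : 1 < z -> 1 < 2 * z - 1.
Proof. by move=> h; lra. Qed.

Lemma gexD (R : realType) (a b t : R) : gex a t * gex b t = gex (a + b) t.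
Proof. by rewrite /gex -expRD; congr expR; move: (pi : R) => q; ring. Qed.

Lemma cR_sum (R : realType) (T : Type) (s : seq T) (f : T -> R) :
  cR (\sum_(i <- s) f i) = \sum_(i <- s) cR (f i) :> R[i].
Proof.
elim: s => [|i s IH]; first by rewrite !big_nil.
by rewrite !big_cons -IH; apply: cplx_eq; rewrite ?creD ?cimD /= ?addr0.
Qed.

Lemma big_const_seq_size (R : realType) (T : Type) (x : R) (s : seq T) :
  \sum_(i <- s) x = (size s)%:R * x.
Proof.
elim: s => [|i s IH]; first by rewrite big_nil mul0r.
by rewrite big_cons IH /= -natr1 mulrDl mul1r addrC.
Qed.

Lemma cR_prod_cond (R : realType) (T : Type) (s : seq T) (P : pred T) (f : T -> R) :
  cR (\prod_(i <- s | P i) f i) = \prod_(i <- s | P i) cR (f i) :> R[i].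
Proof. by rewrite -big_filter cR_prod big_filter. Qed.

(** * Superposed bumps at a point of the annulus *)

Section case3.
Variables (R : realType) (l d n : nat).
Local Notation C := (R[i]).
Local Notation B := ('I_l * 'I_n)%type.
Local Notation EB := (fspace R B).
Local Notation EL := (fspace R 'I_l).
Local Notation PJ := (ptJ d n).
Local Notation mu := (@mu_fspace R B).
Variables (u : R) (s : 'I_d -> R) (Theta : 'I_d -> EB -> C) (pp : 'I_l -> R) (p Cst : R) (j0 : 'I_d).
Hypotheses (n0 : (0 < n)%N) (l0 : (0 < l)%N).
Hypotheses (u1 : 1 < u) (s0 : forall j, 0 < s j) (Ts : forall j, Schwartz (Theta j)).
Hypothesis Tsupp : forall j eta, FT (Theta j) eta != 0 -> 1 / 2 <= enorm eta <= 2.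
Hypotheses (p0 : 0 < p) (pp0 : forall i, 0 < pp i) (pE : 1 / p = \sum_i 1 / pp i).
Hypothesis Hmain : multiplier_bound u s Theta pp p Cst.

Let b1 : B := (Ordinal l0, Ordinal n0).
Let c : B -> R := dlt R b1.
Let q := #|{: B}|.
Let u0 : 0 < u. Proof. by rewrite (lt_trans _ u1). Qed.

Definition mC (N : nat) (v : B -> R) : C := cR (cent b1 N.+1%:R v).

(** With [M = N + 1], the derivatives cost [M^s] and the volume of the bump in dimension [q = l n]
    gives [M^(- q / v)]; the factor in [rho] is bounded. *)
Lemma gp_cent : exists C0 : R, 0 < C0 /\ forall (rho : R) N, 0 < rho ->
  exists G : EB -> C, GP (s j0) (fun x => mC N (fun b => rho * x b) * FT (Theta j0) x) G /\
  forall v, 1 <= v -> (pint mu v (fun x => cabs (G x)) <=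
    ((C0 * (N.+1%:R `^ (s j0 - q%:R / v) * (Num.max 1 (rho * 1) `^ s j0 * expR (- (pi / (32 * v) * rho ^+ 2))))) `^ v)%:E)%E.
Proof.
have c01 : 1 <= 2 * pi :> R by have := @pi_ge2 R; lra.
have [C0 [C00 hC]] := gauss_block (s0 j0) c01 (Ts j0) (@Tsupp j0).
have [K [K0 hK]] := @pint_Yc R B b1.
exists (C0 * (K + 1)); split; first by rewrite mulr_gt0 // addr_gt0.
move=> rho N r0; set M : R := N.+1%:R.
have M1 : 1 <= M by rewrite ler1n.
have M0 : 0 < M by rewrite (lt_le_trans _ M1).
set lam0 := Num.max 1 (rho * 1).
have lam01 : 1 <= lam0 by rewrite le_max lexx.
have l1 : 1 <= M * lam0 by rewrite -[leLHS]mulr1 ler_pM.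
have rl : M * rho <= M * lam0 by rewrite ler_wpM2l ?(ltW M0) // le_max mulr1 lexx orbT.
have [G [gG pG]] := hC _ _ _ _ (qcond_cList b1 M1 r0 l1 rl).
exists G; split.
  move: gG; congr GP; apply/funext => x; congr (_ * _).
  rewrite qf_cList /qf big_nil cexpi0 mulr1 /mC /cent -/M.
  by [].
move=> v v1; have v0 : 0 < v by rewrite (lt_le_trans _ v1).
set be := K * M ^- q * expR (- (pi / 32 * rho ^+ 2)).
have be0 : 0 < be by rewrite mulr_gt0 ?expR_gt0 // mulr_gt0 // invr_gt0 exprn_gt0.
have mY : measurable_fun setT (Yc b1 M rho).
  by apply: measurable_funM => //; apply: measurable_funM => //; exact: measurable_Zc.
have pv := pint_annY_root mY (Yc_ge0 b1 M rho) (ltW be0) v1 (hK M rho M1 r0).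
have b0 : 0 < be `^ v^-1 by rewrite powR_gt0.
apply: le_trans (pG v _ v1 b0 pv) _; apply: le_powRE; [exact: ltW| |].
  by rewrite !mulr_ge0 ?powR_ge0 // ltW.
rewrite -[leLHS]mulrA -[leRHS]mulrA ler_wpM2l ?(ltW C00) //.
rewrite powRM ?(ltW M0) ?(le_trans ler01 lam01) //.
have eE : expR (- (pi / (32 * v) * rho ^+ 2)) = expR (- (pi / 32 * rho ^+ 2)) `^ v^-1.
  rewrite -expRM; congr expR; move: (pi : R) => a; field; by rewrite gt_eqF.
have M0' : 0 <= M ^- q by rewrite invr_ge0 exprn_ge0 // ltW.
have lE : M `^ (s j0 - q%:R / v) = M `^ s j0 * (M ^- q) `^ v^-1.
  rewrite powRD; last by rewrite (gt_eqF M0) implybT.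
  congr (_ * _); rewrite powRN powRrM powR_mulrn ?(ltW M0) //.
  by rewrite -[in RHS]powR_inv1 ?exprn_ge0 ?(ltW M0) // -powRrM mulN1r powRN.
have KM0 : 0 <= K * M ^- q by rewrite mulr_ge0 // ltW.
rewrite eE lE /be powRM ?expR_ge0 // powRM ?(ltW K0) //.
have KK : K `^ v^-1 <= K + 1.
  have K1 : 1 <= K + 1 by rewrite lerDr ltW.
  have K01 : 0 <= K + 1 := le_trans ler01 K1.
  apply: (@le_trans _ _ ((K + 1) `^ v^-1)).
    by apply: ge0_ler_powR; rewrite ?nnegrE ?invr_ge0 ?(ltW v0) ?(ltW K0) // lerDl.
  by rewrite -[leRHS](powRr1 K01) ler_powR // invf_le1.
set a1 := M `^ _; set a2 := lam0 `^ _; set a3 := _ `^ v^-1 in KK *; set a4 := (M ^- q) `^ _; set a5 := _ `^ v^-1.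
have -> : a1 * a2 * (a3 * a4 * a5) = a3 * (a1 * a4 * (a2 * a5)) by ring.
by apply: ler_wpM2r => //; rewrite !mulr_ge0 ?powR_ge0.
Qed.

Let q0 : 0 < q%:R :> R.
Proof. by rewrite ltr0n; apply/card_gt0P; exists b1. Qed.

(** For [s <= q / u] the [L^u] norms of the pieces stay bounded, and their [L^1] norms tend to 0
    because [s < q]. *)
Lemma cent_hump : s j0 <= q%:R / u -> exists CA : R, 0 < CA /\ forall r N1, exists s' : seq nat,
   [/\ size s' = r.+1, pairwise (fun N N' => N.*2 < N')%N s', all (leq N1) s' &
    forall m : (ptK l d n -> R) -> C, (forall xi, m xi = \sum_(N <- s') mC N (vblock xi j0)) ->
    (Anorm u s Theta m <= (CA * r.+1%:R `^ u^-1)%:E)%E].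
Proof.
move=> su; have [C0 [C00 hG]] := gp_cent.
have v1 := double_sub1_gt1 u1.
have cv v : 0 < v -> 0 < pi / (32 * v) :> R by move=> v0; rewrite divr_gt0 ?pi_gt0 // mulr_gt0.
have bd v : 1 <= v -> exists M : R, 0 < M /\ forall rho, 0 < rho ->
    Num.max 1 (rho * 1) `^ s j0 * expR (- (pi / (32 * v) * rho ^+ 2)) <= M.
  move=> w1; have w0 : 0 < v by rewrite (lt_le_trans _ w1).
  have [M [M0 hM]] := @exp_rho_bound R (s j0) _ (cv v w0); exists M; split => // rho r0.
  by have := hM rho 1 r0 (lexx _); rewrite powR1 (mulr1 M).
have [M1 [M10 h1]] := bd u (ltW u1); have [M2 [M20 h2]] := bd _ (ltW v1); have [M3 [M30 h3]] := bd 1 (lexx _).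
pose D N := C0 * (N.+1%:R `^ (s j0 - q%:R / (2 * u - 1)) * M2).
pose e N := (C0 * M3) * N.+1%:R `^ (s j0 - q%:R).
have A0 : 0 < C0 * M1 by rewrite mulr_gt0.
have D0 N : 0 < D N by rewrite /D !mulr_gt0 // powR_gt0.
have sq : s j0 - q%:R < 0.
  by rewrite subr_lt0 (le_lt_trans su) // ltr_pdivrMr // ltr_pMr.
have e0 := powR_nat_to0 (ltW (mulr_gt0 C00 M30)) sq.
apply: (Anorm_hump u1 s0 Ts Tsupp A0 D0 e0) => k N.
have r0 : 0 < (2 : R) ^ k by rewrite exprz_gt0.
have [G [gG pG]] := hG _ N r0; exists G.
have Q0 v : 0 <= C0 * (N.+1%:R `^ (s j0 - q%:R / v) * (Num.max 1 (2 ^ k * 1) `^ s j0 * expR (- (pi / (32 * v) * (2 ^ k) ^+ 2)))).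
  by rewrite !mulr_ge0 ?powR_ge0 ?expR_ge0 // ltW.
split => //.
- apply: le_trans (pG u (ltW u1)) _; apply: le_powRE; [exact: ltW|exact: Q0|].
  rewrite ler_wpM2l ?(ltW C00) // -[leRHS]mul1r; apply: ler_pM; rewrite ?mulr_ge0 ?powR_ge0 ?expR_ge0 //; last exact: h1.
  by rewrite -[leRHS](powRr0 (N.+1%:R : R)) ler_powR ?ler1n // subr_le0.
- apply: le_trans (pG _ (ltW v1)) _; apply: le_powRE; [by rewrite ltW // (lt_trans _ v1)|exact: Q0|].
  by rewrite ler_wpM2l ?(ltW C00) // ler_wpM2l ?powR_ge0 //; exact: h2.
- apply: le_trans (pG 1 (lexx _)) _; rewrite (powRr1 (Q0 _)) lee_fin divr1 /e -[leRHS]mulrA ler_wpM2l ?(ltW C00) //.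
  by rewrite [leRHS]mulrC ler_wpM2l ?powR_ge0 //; exact: h3.
Qed.

Lemma mC_prod N (v : B -> R) : mC N v = \prod_i \prod_k cR (gex (N.+1%:R ^+ 2) (v (i, k) - c (i, k))).
Proof.
rewrite (eq_bigr _ (fun i _ => esym (cR_prod _ _))) -cR_prod; congr cR.
rewrite /cent mulr_sumr -sumrN expR_sum.
by rewrite pair_bigA /=; apply: eq_bigr => -[i k] _.
Qed.

Section lower.
Variables (s' : seq nat) (L : R) (m : (ptK l d n -> R) -> C).
Hypothesis L1 : 1 <= L.
Hypothesis sL : forall N, N \in s' -> N.+1%:R <= L.
Hypothesis mE : forall xi, m xi = \sum_(N <- s') mC N (vblock xi j0).
Let L0 : 0 < L. Proof. by rewrite (lt_le_trans _ L1). Qed.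
Let bL : R := (L ^+ 2)^-1.
Let bL0 : 0 < bL. Proof. by rewrite invr_gt0 exprn_gt0. Qed.

(** Inputs modulated to the common centre and spread over [L]. Their transforms have width [1 / L],
    at most the width of any selected bump, so each bump acts on them essentially as the constant
    1. *)
Definition fC (i : 'I_l) := tf j0 (fun _ (_ : 'I_n) => bL) (fun (_ : 'I_l) _ => 0) (fun i k => c (i, k)) i.
Let bN (N : nat) : R := N.+1%:R ^+ 2 + L ^+ 2.
Let bN0 N : 0 < bN N. Proof. by rewrite ltr_pwDr ?sqr_ge0 // exprn_gt0. Qed.
Definition MC (N : nat) (k : 'I_n) (eta : EL) : C := \prod_i cR (gex (bN N) (eta i - c (i, k))).
Definition gC (N : nat) (t : R) : R := bN N `^ (- (1 / 2)) * gex (bN N)^-1 t.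

Lemma MC_int N k : cint (MC N k) /\ forall x : R,
  Cint (fun eta : EL => MC N k eta * cexpi (2 * pi * (x * \sum_i eta i))) =
  (\prod_(i < l) cexpi (2 * pi * (x * c (i, k)))) * cR (gC N x ^+ l).
Proof.
split; first by apply: (@cint_prod1 R 'I_l (fun i t => cR (gex (bN N) (t - c (i, k))))) => i; exact: (C1_centered (c (i, k)) 0 (bN0 N)).1.
move=> x; transitivity (Cint (fun eta : EL => \prod_i (cR (gex (bN N) (eta i - c (i, k))) * cexpi (2 * pi * (x * eta i))))).
  by congr Cint; apply/funext => eta; rewrite /MC mulr_sumr mulr_sumr cexpi_sum -big_split.
rewrite (@Cint_prod1 R 'I_l (fun i t => cR (gex (bN N) (t - c (i, k))) * cexpi (2 * pi * (x * t)))); last first.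
  move=> i; rewrite (_ : (fun t => _) = fun t => cR (gex (bN N) (t - c (i, k))) * cexpi ((2 * pi * x) * t)).
    by apply: c1int_exp; exact: (C1_centered (c (i, k)) 0 (bN0 N)).1.
  by apply/funext => t; rewrite mulrA.
rewrite (eq_bigr _ (fun i _ => (C1_centered (c (i, k)) x (bN0 N)).2)) big_split /=; congr (_ * _).
by rewrite -cR_prod prodr_const card_ord.
Qed.

Definition SC (x : fspace R PJ) : R := \sum_(N <- s') ((\prod_k gC N (x (j0, k)) ^+ l) *
  \prod_(j | j != j0) \prod_k gex l%:R (x (j, k))).

Lemma SC_ge0 x : 0 <= SC x.
Proof.
apply: sumr_ge0 => N _; apply: mulr_ge0; apply: prodr_ge0 => k _.
  by rewrite exprn_ge0 // mulr_ge0 ?powR_ge0 ?gex_ge0.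
by apply: prodr_ge0 => k' _; exact: gex_ge0.
Qed.

Lemma measurable_SC : measurable_fun setT SC.
Proof.
have mg a jk : measurable_fun setT (fun x : fspace R PJ => gex a (x jk)).
  exact: (measurableT_comp (@measurable_gex R a) (measurable_coord jk)).
apply: measurable_sum => N; apply: measurable_funM.
  by apply: measurable_prod => k _; apply: measurable_funX; apply: measurable_funM.
rewrite (_ : (fun x => _) = fun x : fspace R PJ => \prod_j (if j != j0 then \prod_k gex l%:R (x (j, k)) else 1)); last first.
  by apply/funext => x; rewrite -big_mkcond.
by apply: measurable_prod => j _; case: (j != j0) => //; apply: measurable_prod => k _.
Qed.

Lemma cabs_kapL : cabs (kap2 bL 0) = L.
Proof.
rewrite kap2_real // cabs_cR ger0_norm ?powR_ge0 // /bL.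
rewrite -(powR_mulrn 2 (ltW L0)) -powRN -powRrM (_ : - 2%:R * - (1 / 2) = 1); last by field.
by rewrite powRr1 // ltW.
Qed.

Lemma cabs_TC x : cabs (Tm m fC x) = L ^+ (l * n) * SC x.
Proof.
rewrite /fC (@Tm_formula R l d n j0 (fun _ _ => bL) (fun _ _ => 0) (fun i k => c (i, k)) (fun _ _ => bL0) m
   (fun v => \sum_(N <- s') mC N v) mE nat s' (fun=> \prod_(i < l) \prod_(k < n) kap2 bL 0) MC (fun N k => (MC_int N k).1)); last first.
  move=> v; rewrite mulr_suml; apply: eq_bigr => N _.
  rewrite (eq_bigr (fun i => \prod_(k < n) kap2 bL 0 * \prod_k cR (gex (L ^+ 2) (v (i, k) - c (i, k))))); last first.
    move=> i _; rewrite -big_split /=; apply: eq_bigr => k _; rewrite kap2_real // hgF_real // cRM; congr (_ * cR _).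
    by rewrite /bL invrK /gex; congr expR; move: (pi : R) => z; ring.
  rewrite big_split /= mulrCA; congr (_ * _).
  transitivity (\prod_i \prod_k cR (gex (bN N) (v (i, k) - c (i, k)))); last by rewrite /MC exchange_big.
  rewrite mC_prod -big_split /=; apply: eq_bigr => i _; rewrite -big_split /=.
  by apply: eq_bigr => k _; rewrite -cRM gexD.
set a0 := \prod_(i < l) _.
(* The modulation is the same for all bumps, so the pieces add without cancellation. *)
pose ph := \prod_k \prod_(i < l) cexpi (2 * pi * (x (j0, k) * c (i, k))).
rewrite (_ : \sum_(N <- s') _ = a0 * ph * cR (SC x)).
  rewrite !cabsM cabs_cR ger0_norm ?SC_ge0 // /a0 /ph !cabs_prod.
  rewrite (eq_bigr (fun=> L ^+ n)); last first.
    move=> i _; rewrite (eq_bigr (fun=> L)); last by move=> k _; exact: cabs_kapL.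
    by rewrite prodr_const card_ord.
  rewrite (eq_bigr (fun=> 1) (P := predT) (F1 := fun k => cabs _)); last first.
    by move=> k _; rewrite cabs_prod big1 // => i _; exact: cabs_cexpi.
  by rewrite big1_eq mulr1 prodr_const card_ord -exprM mulnC.
rewrite /SC cR_sum mulr_sumr; apply: eq_bigr => N _.
rewrite (eq_bigr _ (fun k _ => (MC_int N k).2 (x (j0, k)))) big_split /= -/ph -mulrA; congr (_ * _).
rewrite -mulrA; congr (_ * _); rewrite cRM cR_prod; congr (_ * _).
by rewrite cR_prod_cond; apply: eq_bigr => j _; rewrite cR_prod.
Qed.

(** Because [L^2 <= bN N <= 2 L^2], all pieces have comparable amplitude and width whatever their
    scale. *)
Lemma gC_lower N t : N \in s' -> (2 `^ (- (1 / 2)) / L) * gex (L ^+ 2)^-1 t <= gC N t.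
Proof.
move=> /sL NL; rewrite /gC; apply: ler_pM; rewrite ?gex_ge0 //.
- by rewrite divr_ge0 ?powR_ge0 // ltW.
- have -> : 2 `^ (- (1 / 2)) / L = (2 * L ^+ 2) `^ (- (1 / 2)).
    rewrite powRM ?sqr_ge0 // -(powR_mulrn 2 (ltW L0)) -powRrM (_ : 2%:R * - (1 / 2) = -1); last by field.
    by rewrite powR_inv1 // ltW.
  rewrite !powRN lef_pV2 ?posrE ?powR_gt0 //; last by rewrite mulr_gt0 // exprn_gt0.
  have h2 : 0 <= 1 / 2 :> R by [].
  have h3 : 0 <= 2 * L ^+ 2 := mulr_ge0 (ler0n R 2) (sqr_ge0 L).
  apply: (ge0_ler_powR h2 (ltW (bN0 N)) h3).
  rewrite /bN (_ : 2 * L ^+ 2 = L ^+ 2 + L ^+ 2); last by ring.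
  by rewrite lerD2r; apply: lerXn2r; rewrite ?nnegrE // ltW.
rewrite /gex ler_expR lerN2 ler_wpM2r ?sqr_ge0 // ler_wpM2l ?pi_ge0 // lef_pV2 ?posrE ?exprn_gt0 //.
by rewrite lerDr sqr_ge0.
Qed.

Let A1 : R := (size s')%:R * (2 `^ (- (1 / 2))) ^+ (l * n).
Definition hC (x : fspace R PJ) : R := A1 * \prod_jk gex (ext j0 (fun _ : 'I_n => l%:R * (L ^+ 2)^-1) l%:R jk) (x jk).

Lemma hC_le x : 0 <= hC x <= L ^+ (l * n) * SC x.
Proof.
have A10 : 0 <= A1 by rewrite mulr_ge0 // exprn_ge0 // powR_ge0.
apply/andP; split; first by rewrite mulr_ge0 // prodr_ge0 // => jk _; exact: gex_ge0.
set W := \prod_(j | j != j0) \prod_k gex l%:R (x (j, k)).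
have W0 : 0 <= W by apply: prodr_ge0 => j _; apply: prodr_ge0 => k _; exact: gex_ge0.
set V := \prod_(k < n) gex (l%:R * (L ^+ 2)^-1) (x (j0, k)).
have -> : hC x = A1 * (V * W).
  congr (_ * _); rewrite (prod_block j0) /V /W; congr (_ * _); first by apply: eq_bigr => k _; rewrite /ext /= eqxx.
  by apply: eq_bigr => j /negbTE jj; apply: eq_bigr => k _; rewrite /ext /= jj.
pose X := ((2 `^ (- (1 / 2)) / L) ^+ l) ^+ n * V * W.
have hX N : N \in s' -> X <= (\prod_k gC N (x (j0, k)) ^+ l) * W.
  move=> Ns; apply: ler_wpM2r => //.
  have -> : ((2 `^ (- (1 / 2)) / L) ^+ l) ^+ n * V = \prod_(k < n) ((2 `^ (- (1 / 2)) / L) * gex (L ^+ 2)^-1 (x (j0, k))) ^+ l.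
    rewrite -[n in _ ^+ n]card_ord -prodr_const -big_split /=; apply: eq_bigr => k _; rewrite [RHS]exprMn; congr (_ * _).
    by rewrite /gex -expRM_natl; congr expR; move: (pi : R) => z; ring.
  have g0 k : 0 <= 2 `^ (- (1 / 2)) / L * gex (L ^+ 2)^-1 (x (j0, k)).
    by rewrite mulr_ge0 ?gex_ge0 // divr_ge0 ?powR_ge0 // ltW.
  apply: ler_prod => k _; rewrite exprn_ge0 //=; apply: lerXn2r; rewrite ?nnegrE //; last exact: gC_lower.
  by rewrite mulr_ge0 ?powR_ge0 ?gex_ge0.
have SX : (size s')%:R * X <= SC x.
  rewrite /SC -(big_const_seq_size X s').
  by rewrite big_seq [leRHS]big_seq; apply: ler_sum => N Ns; exact: hX.
apply: (@le_trans _ _ (L ^+ (l * n) * ((size s')%:R * X))); last first.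
  by rewrite ler_wpM2l // exprn_ge0 // ltW.
rewrite /X /A1 -exprM exprMn exprVn.
have Ln : L ^+ (l * n) != 0 by rewrite expf_neq0 // gt_eqF.
apply: le_of_eq.
by move: (L ^+ _) Ln ((2 `^ _) ^+ _) => y y0 z; field.
Qed.

Lemma Lpnorm_TC : ((A1 * (((l%:R * (L ^+ 2)^-1) * p) `^ (- (1 / 2)) ^+ n * Kd n j0 (l%:R * p)) `^ p^-1)%:E <= Lpnorm p (Tm m fC))%E.
Proof.
have mh : measurable_fun setT hC.
  apply: measurable_funM => //; apply: measurable_prod => jk _.
  exact: (measurableT_comp (@measurable_gex R _) (measurable_coord jk)).
have mS : measurable_fun setT (fun x => L ^+ (l * n) * SC x).
  by apply: measurable_funM => //; exact: measurable_SC.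
have A10 : 0 <= A1 by rewrite mulr_ge0 // exprn_ge0 // powR_ge0.
have lR : 0 < l%:R :> R by rewrite ltr0n.
apply: le_trans (Lpnorm_lower p0 cabs_TC mS mh hC_le).
have e0 jk : 0 < ext j0 (fun _ : 'I_n => l%:R * (L ^+ 2)^-1) l%:R jk :> R.
  by rewrite /ext; case: ifP => // _; rewrite mulr_gt0.
rewrite /hC (@integ_gauss_prod R PJ A1 p _ A10 p0 e0).
have -> : \prod_(k : PJ) (ext j0 (fun _ : 'I_n => l%:R * (L ^+ 2)^-1) l%:R k * p) `^ (- (1 / 2)) =
    ((l%:R * (L ^+ 2)^-1) * p) `^ (- (1 / 2)) ^+ n * Kd n j0 (l%:R * p).
  rewrite (prod_block j0) /ext /= eqxx prodr_const card_ord; congr (_ * _).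
  by apply: eq_bigr => j /negbTE ->.
have P0 : 0 <= (l%:R * (L ^+ 2)^-1 * p) `^ (- (1 / 2)) ^+ n * Kd n j0 (l%:R * p).
  by rewrite mulr_ge0 ?exprn_ge0 ?powR_ge0 // ltW // Kd_gt0 // mulr_gt0.
rewrite poweR_EFin (powRM _ (powR_ge0 A1 p) P0) -(powRrM A1) divff ?gt_eqF // powRr1 //.
Qed.

Lemma Lpnorm_fC i : Lpnorm (pp i) (fC i) = (((bL * pp i) `^ (- (1 / 2)) ^+ n * Kd n j0 (pp i)) `^ (pp i)^-1)%:E.
Proof.
rewrite /fC (@Lpnorm_tf R l d n j0 _ _ _ (fun _ _ => bL0)) //.
by rewrite prodr_const card_ord.
Qed.
End lower.

(** The lower bound for the output and the product of the input norms both scale like [L^(n / p)],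
    by the relation between [p] and the [p_i]. The selected scales, over which there is no control,
    therefore cancel, leaving [r + 1] against [(r + 1)^(1 / u)]. *)
Lemma strict_lu : q%:R / u < s j0.
Proof.
rewrite ltNge; apply/negP => su; have [CA [CA0 hA]] := cent_hump su.
have X0 (N : R) : 1 <= N -> 0 < N by move=> h; rewrite (lt_le_trans _ h).
have lR : 0 < l%:R :> R by rewrite ltr0n.
have m2 : mono (fun N : R => N) (fun N => N ^+ 2) (2%:R * 1) := monoX X0 2 (mono_id X0).
have mV := monoV X0 m2.
have mT := mono_pow p^-1 (monoM X0 (monoX X0 n (mono_pow (- (1 / 2))
    (monoM X0 (monoM X0 (mono_cst (fun N : R => N) lR) mV) (mono_cst (fun N : R => N) p0)))) (mono_cst (fun N : R => N) (Kd_gt0 n j0 (mulr_gt0 lR p0)))).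
have mf i := mono_pow (pp i)^-1 (monoM X0 (monoX X0 n (mono_pow (- (1 / 2))
    (monoM X0 mV (mono_cst (fun N : R => N) (pp0 i))))) (mono_cst (fun N : R => N) (Kd_gt0 n j0 (pp0 i)))).
have mR := mono_prodl X0 (index_enum 'I_l) (fun i (_ : predT i) => mf i).
have eT : (n%:R * ((0 - 2%:R * 1 + 0) * - (1 / 2)) + 0) * p^-1 = n%:R / p by field; rewrite gt_eqF.
have eR : \sum_(i | predT i) (n%:R * ((- (2%:R * 1) + 0) * - (1 / 2)) + 0) * (pp i)^-1 = n%:R / p.
  rewrite -[X in _ = _ * X]mul1r pE mulr_sumr; apply: eq_bigr => i _; field; by rewrite gt_eqF.
have [cT [cT0 hT]] := mono_eq mT eT; have [cR' [cR0 hR]] := mono_eq mR eR.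
pose K0 : R := 2 `^ (- (1 / 2)) ^+ (l * n).
have K00 : 0 < K0 by rewrite exprn_gt0 // powR_gt0.
have a0 : 0 < K0 * cT by rewrite mulr_gt0.
have u11 : u^-1 < 1 by rewrite invf_lt1.
apply: (@powR_nat_contra R (K0 * cT) ((`|Cst| + 1) * CA * cR') 1 u^-1 a0 u11) => r.
have [s' [ss _ _ hm]] := hA r 0%N.
(* Any common upper bound of the numbers [N + 1] would serve; the sum is one. *)
pose L : R := (\sum_(N <- s') N.+1)%:R.
have L1 : 1 <= L by rewrite ler1n /L; case: (s') ss => // N s'' _; rewrite big_cons addSn.
have sL N : N \in s' -> N.+1%:R <= L.
  by move=> Ns; rewrite ler_nat (big_rem N) //= leq_addr.
pose m := fun xi : ptK l d n -> R => \sum_(N <- s') mC N (vblock xi j0).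
have mE xi : m xi = \sum_(N <- s') mC N (vblock xi j0) by [].
have sf i : Schwartz (fC L i) by apply: tf_Schwartz => i' k; rewrite invr_gt0 exprn_gt0 // X0.
have := real_bound Hmain sf (hm m mE) (Lpnorm_TC L1 sL mE) (fun i => Lpnorm_fC L1 i) (fun i => powR_ge0 _ _).
rewrite ss hT // hR // powRr1 //.
have LL : 0 < L `^ (n%:R / p) by rewrite powR_gt0 // X0.
rewrite -/K0 => h; rewrite -(ler_pM2r LL); apply: le_trans (le_trans h _).
  by apply: le_of_eq; ring.
by apply: le_of_eq; ring.
Qed.
End case3.

(** * The strict inequality 1/p - 1/u' < s/n *)

Lemma powR_sum_disjoint (R : realType) (T : Type) (r : T -> T -> bool) (s : seq T) (F : T -> R) (p : R) : 0 < p ->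
  (forall t, 0 <= F t) -> (forall t t', r t t' -> F t = 0 \/ F t' = 0) -> pairwise r s ->
  (\sum_(t <- s) F t) `^ p = \sum_(t <- s) F t `^ p.
Proof.
move=> p0 F0 h; elim: s => [|t s IH] /=; first by rewrite !big_nil powR0 // gt_eqF.
move=> /andP[rt /IH IHs]; rewrite !big_cons.
have [->|Ft] := eqVneq (F t) 0; first by rewrite add0r IHs powR0 ?add0r // gt_eqF.
have z : \sum_(j <- s) F j = 0.
  elim: s rt {IH IHs} => [|t' s IH] /=; first by rewrite big_nil.
  by move=> /andP[/h[e|e] a]; [rewrite e eqxx in Ft|rewrite big_cons e add0r IH].
by rewrite -IHs z addr0 powR0 ?addr0 // gt_eqF.
Qed.

(** Read with [a = s], [nu = n / u] and [np = n / p]: at or below the critical exponent necessarily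
    [p < 1], and the exponent of the [L^1] norms of the normalised pieces is negative. *)
Lemma exponent_gap (R : realType) (a nu n np : R) : nu < n -> nu < a -> a - nu <= np - n ->
  a - n < np - n /\ 0 < np - n.
Proof. by move=> *; split; lra. Qed.

Section case4.
Variables (R : realType) (l d n : nat).
Local Notation C := (R[i]).
Local Notation B := ('I_l * 'I_n)%type.
Local Notation EB := (fspace R B).
Local Notation PJ := (ptJ d n).
Local Notation mu := (@mu_fspace R B).
Local Notation leb := (@lebesgue_measure R).
Local Notation RT := (measurableTypeR R).
Variables (u : R) (s : 'I_d -> R) (Theta : 'I_d -> EB -> C) (pp : 'I_l -> R) (p Cst : R) (j0 : 'I_d).
Hypotheses (n0 : (0 < n)%N) (l0 : (0 < l)%N).
Hypotheses (u1 : 1 < u) (s0 : forall j, 0 < s j) (Ts : forall j, Schwartz (Theta j)).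
Hypothesis Tsupp : forall j eta, FT (Theta j) eta != 0 -> 1 / 2 <= enorm eta <= 2.
Hypotheses (p0 : 0 < p) (pp0 : forall i, 0 < pp i).
Hypothesis Hmain : multiplier_bound u s Theta pp p Cst.
Hypothesis slu : n%:R / u < s j0.

Let u0 : 0 < u. Proof. by rewrite (lt_trans _ u1). Qed.
Let nR0 : 0 < n%:R :> R. Proof. by rewrite ltr0n. Qed.
Let i0 : 'I_l := Ordinal l0.
Let I0 : {set 'I_l} := finset.set0.
Let i0I : i0 \notin I0. Proof. by rewrite finset.in_set0. Qed.
Let J : pred 'I_l := fun i => i \notin I0.
Let A : R := 4 * l%:R + 2.
Let A0 : 0 < A. Proof. by rewrite ltr_wpDl // mulr_ge0. Qed.
(** Normalisation. With [M = N + 1], the unnormalised output has amplitude of order [M^(- n)] and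
    spread [M]; this factor makes its [L^p] norm of order 1 for every [N]. *)
Let an (N : nat) : R := N.+1%:R `^ (n%:R - n%:R / p).
Let an0 N : 0 < an N. Proof. by rewrite powR_gt0. Qed.
Let be6 (N : nat) : R := 6 * N.+1%:R ^+ 2.
Let be60 N : 0 < be6 N. Proof. by rewrite mulr_gt0 // exprn_gt0. Qed.

Let bE N : bC I0 N = fun=> 1 :> R. Proof. by apply/funext => i; rewrite /bC finset.in_set0. Qed.
Let beE N : beC I0 N = fun=> A :> R. Proof. by apply/funext => i; rewrite /beC finset.in_set0. Qed.

Definition mS (N : nat) (v : B -> R) : C :=
  cR (an N) * smul i0 J (be6 N) 0 (fun=> A) (fun=> 1) (fun=> 0) v.

(** The assumed inequality says that [an N] at least compensates the growth [N^(s - n / u)] of the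
    multiplier norm. The bound [slu] ensures that this exponent is positive, so that the maximum in
    the estimate over dilations equals it. *)
Lemma shear_hump : s j0 <= n%:R * (1 / p - 1 + 1 / u) -> exists CA : R, 0 < CA /\ forall r N1, exists s' : seq nat,
   [/\ size s' = r.+1, pairwise (fun N N' => N.*2 < N')%N s', all (leq N1) s' &
    forall m : (ptK l d n -> R) -> C, (forall xi, m xi = \sum_(N <- s') mS N (vblock xi j0)) ->
    (Anorm u s Theta m <= (CA * r.+1%:R `^ u^-1)%:E)%E].
Proof.
move=> su.
have C1 : 1 <= 4 * l%:R + 6 :> R by have : 0 <= l%:R :> R by []; lra.
have [C0 [C00 hG]] := @gp_shear R l n (s j0) _ (Theta j0) (s0 j0) C1 (Ts j0) (@Tsupp j0).
have v1 := double_sub1_gt1 u1.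
have bd v : 1 <= v -> exists M : R, 0 < M /\ forall rho N, 0 < rho -> 1 <= N ->
    Num.max 1 (rho * N) `^ (s j0 - n%:R / v) * expR (- (pi / (16 * v) * rho ^+ 2)) <= M * N `^ (Num.max (s j0 - n%:R / v) 0).
  move=> w1; apply: exp_rho_bound; rewrite divr_gt0 ?pi_gt0 // mulr_gt0 // (lt_le_trans _ w1) //.
have [M1 [M10 h1]] := bd u (ltW u1); have [M2 [M20 h2]] := bd _ (ltW v1); have [M3 [M30 h3]] := bd 1 (lexx _).
set s2 := Num.max (s j0 - n%:R / (2 * u - 1)) 0 in h2.
set s3 := Num.max (s j0 - n%:R / 1) 0 in h3.
pose D (N : nat) : R := an N * (C0 * (M2 * N.+1%:R `^ s2)).
pose e (N : nat) : R := (C0 * M3) * N.+1%:R `^ (n%:R - n%:R / p + s3).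
have P1 : 0 < C0 * M1 by rewrite mulr_gt0.
have D0 N : 0 < D N by rewrite /D !mulr_gt0 // powR_gt0.
have npE : n%:R * (1 / p - 1 + 1 / u) = n%:R / p - n%:R + n%:R / u by rewrite !mulrDr !mul1r mulrN mulr1.
have su' : s j0 - n%:R / u <= n%:R / p - n%:R by rewrite npE in su; lra.
have nu : n%:R / u < n%:R by rewrite ltr_pdivrMr // ltr_pMr.
have sq : n%:R - n%:R / p + s3 < 0.
  have [h4 h5] := exponent_gap nu slu su'.
  by rewrite -(opprB (n%:R / p)) addrC subr_lt0 /s3 divr1 gt_max h4 h5.
have e0 := powR_nat_to0 (ltW (mulr_gt0 C00 M30)) sq.
apply: (Anorm_hump u1 s0 Ts Tsupp P1 D0 e0) => k N.
have r0 : 0 < (2 : R) ^ k by rewrite exprz_gt0.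
have N1 : 1 <= N.+1%:R :> R by rewrite ler1n.
have ok := okC i0I N1; rewrite bE beE in ok.
have [G [gG pG]] := hG i0 J _ _ _ _ _ _ _ _ _ _ i0I ok N1 r0.
have qE : #|[pred i | (i == i0) || (i \in I0)]| = 1%N by rewrite card_okC // cards0.
rewrite qE muln1 in pG.
exists (fun x => cR (an N) * G x).
have [_ iG _] := gG.
have Z v M sg : 1 <= v -> 0 < M -> Num.max 1 (2 ^ k * N.+1%:R) `^ (s j0 - n%:R / v) * expR (- (pi / (16 * v) * (2 ^ k) ^+ 2)) <= M * N.+1%:R `^ sg ->
    (pint mu v (fun x => cabs (cR (an N) * G x)%R) <= ((an N * (C0 * (M * N.+1%:R `^ sg))) `^ v)%:E)%E.
  move=> w1 M0 hM; have w0 : 0 <= v by rewrite (le_trans _ w1).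
  have Q0 : 0 <= C0 * (M * N.+1%:R `^ sg) by rewrite !mulr_ge0 ?powR_ge0 // ltW.
  have := @cpintZ _ _ v (cR (an N)) (C0 * (M * N.+1%:R `^ sg)) G w1 Q0 iG.
  rewrite cabs_cR (gtr0_norm (an0 N)); apply.
  apply: le_trans (pG v w1) _; apply: le_powRE => //.
    by rewrite !mulr_ge0 ?powR_ge0 ?expR_ge0 // ltW.
  by rewrite ler_wpM2l // ltW.
split.
- by have := GP_scale (cR (an N)) gG; congr GP; apply/funext => x; rewrite mulrA.
- apply: le_trans (Z u M1 _ (ltW u1) M10 (h1 _ _ r0 N1)) _; apply: le_powRE; [exact: ltW| |].
    by rewrite !mulr_ge0 ?powR_ge0 // ltW.
  rewrite max_l; last by rewrite subr_ge0 ltW.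
  have -> : an N * (C0 * (M1 * N.+1%:R `^ (s j0 - n%:R / u))) = C0 * M1 * (an N * N.+1%:R `^ (s j0 - n%:R / u)) by ring.
  rewrite ler_piMr ?(ltW P1) // /an -powRD; last by rewrite pnatr_eq0 implybT.
  by rewrite -[leRHS](powRr0 (N.+1%:R : R)) ler_powR //; lra.
- exact: (Z _ M2 _ (ltW v1) M20 (h2 _ _ r0 N1)).
- apply: le_trans (Z 1 M3 _ (lexx _) M30 (h3 _ _ r0 N1)) _.
  rewrite powRr1; last by rewrite !mulr_ge0 ?powR_ge0 // ltW.
  rewrite lee_fin /e powRD; last by rewrite pnatr_eq0 implybT.
  by apply: le_of_eq; rewrite /an; ring.
Qed.

Definition fS (i : 'I_l) := tf j0 (fun (_ : 'I_l) (_ : 'I_n) => 1) (fun (_ : 'I_l) _ => 0) (fun (_ : 'I_l) _ => 0) i : (PJ -> R) -> C.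
Let kS : R := 6 `^ (- (1 / 2)) * \prod_(i | i != i0) A `^ (- (1 / 2)).
Let kS0 : 0 < kS. Proof. by rewrite mulr_gt0 ?powR_gt0 //; apply: prodr_gt0 => i _; rewrite powR_gt0. Qed.

Section sum.
Variables (s' : seq nat) (m : (ptK l d n -> R) -> C).
Hypothesis mE : forall xi, m xi = \sum_(N <- s') mS N (vblock xi j0).

Definition WS (x : fspace R PJ) : R := \prod_(j | j != j0) \prod_k gex l%:R (x (j, k)).
Definition SS (x : fspace R PJ) : R := \sum_(N <- s') an N * ((\prod_k (kS / N.+1%:R * gex (be6 N)^-1 (x (j0, k)))) * WS x).

(** With [I] empty the sum runs over all frequencies, so only its own Gaussian depends on [x]; the
    other variables are constants collected in [kS]. *)
Lemma piece_S N (x : R) :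
  hgF (be6 N) 0 x * \prod_(i | i != i0) (if J i then hgF A 0 0 else hgF A 0 x) = cR (kS / N.+1%:R * gex (be6 N)^-1 x).
Proof.
rewrite hgF_real // (eq_bigr (fun=> cR (A `^ (- (1 / 2))))); last first.
  by move=> i _; rewrite /J finset.in_set0 /= hgF_real // /gex expr0n mulr0 oppr0 expR0 mulr1.
rewrite -cR_prod_cond -cRM; congr cR; rewrite mulrAC; congr (_ * _).
rewrite /kS mulrAC; congr (_ * _); rewrite /be6 powRM //.
congr (_ * _); rewrite -(powR_mulrn 2 (ler0n R N.+1)) -powRrM (_ : 2%:R * - (1 / 2) = -1); last by field.
by rewrite powR_inv1.
Qed.

Lemma WS_ge0 x : 0 <= WS x.
Proof. by apply: prodr_ge0 => j _; apply: prodr_ge0 => k _; exact: gex_ge0. Qed.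

Lemma term_ge0 N x : 0 <= an N * ((\prod_k (kS / N.+1%:R * gex (be6 N)^-1 (x (j0, k)))) * WS x).
Proof.
rewrite mulr_ge0 ?(ltW (an0 N)) // mulr_ge0 ?WS_ge0 //; apply: prodr_ge0 => k _.
by rewrite mulr_ge0 ?gex_ge0 // divr_ge0 // ltW.
Qed.

Lemma cabs_TS x : cabs (Tm m fS x) = SS x.
Proof.
have one0 : (0 : R) < 1 by [].
have sp N := @spiece_int R l i0 J i0I (be6 N) 0 (fun=> A) (be60 N) (fun=> A0).
rewrite /fS (@Tm_formula R l d n j0 (fun _ _ => 1) (fun _ _ => 0) (fun _ _ => 0) (fun _ _ => one0) m
   (fun v => \sum_(N <- s') mS N v) mE nat s' (fun N => cR (an N)) (fun N _ => spiece i0 J (be6 N) 0 (fun=> A)) (fun N _ => (sp N 0).1)); last first.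
  move=> v; rewrite mulr_suml; apply: eq_bigr => N _; rewrite /mS -mulrA; congr (_ * _).
  rewrite smulE.
  by rewrite big1 ?expr1n ?mul1r // => i _; exact: kap2_std.
rewrite -[RHS]ger0_norm; last by apply: sumr_ge0 => N _; exact: term_ge0.
rewrite -cabs_cR; congr cabs; rewrite /SS cR_sum; apply: eq_bigr => N _.
rewrite cRM; congr (_ * _); rewrite cRM; congr (_ * _).
  rewrite cR_prod; apply: eq_bigr => k _; rewrite -piece_S; exact: (sp N (x (j0, k))).2.
by rewrite cR_prod_cond; apply: eq_bigr => j _; rewrite cR_prod.
Qed.

Lemma measurable_SS : measurable_fun setT SS.
Proof.
have mg a jk : measurable_fun setT (fun x : fspace R PJ => gex a (x jk)).
  exact: (measurableT_comp (@measurable_gex R a) (measurable_coord jk)).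
apply: measurable_sum => N; apply: measurable_funM => //; apply: measurable_funM.
  by apply: measurable_prod => k _; apply: measurable_funM.
rewrite (_ : WS = fun x : fspace R PJ => \prod_j (if j != j0 then \prod_k gex l%:R (x (j, k)) else 1)); last first.
  by apply/funext => x; rewrite -big_mkcond.
by apply: measurable_prod => j _; case: (j != j0) => //; apply: measurable_prod => k _.
Qed.

(** Range on which the output of piece [N] is bounded below. The shift by one matters: [2 N < N']
    gives [2 (N + 1) <= N' + 1], so the half-open intervals of selected scales are disjoint. *)
Let itv (N : nat) : set R := `[N.+1%:R, (2 * N.+1%:R)%R[%classic.
Let gS (N : nat) (jk : PJ) : R -> R := if jk.1 == j0 then \1_(itv N) else gex l%:R.
(** On that range [x < 2 M] with [M = N + 1], and [pi (2 M)^2 / (6 M^2)] is [2 pi / 3]. *)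
Let cS (N : nat) : R := N.+1%:R `^ (- (n%:R / p)) * (kS * expR (- (2 / 3 * pi))) ^+ n.
Definition FS (N : nat) (x : fspace R PJ) : R := cS N * \prod_jk gS N jk (x jk).

Let cS0 N : 0 < cS N. Proof. by rewrite mulr_gt0 ?powR_gt0 // exprn_gt0 // mulr_gt0 ?expR_gt0. Qed.
Let gS0 N jk t : 0 <= gS N jk t. Proof. by rewrite /gS; case: ifP => _; [rewrite indicE|exact: gex_ge0]. Qed.

Lemma FS_ge0 N x : 0 <= FS N x.
Proof. by rewrite mulr_ge0 ?(ltW (cS0 N)) // prodr_ge0. Qed.

Let mgS N jk : measurable_fun setT (gS N jk : RT -> R).
Proof. by rewrite /gS; case: ifP => _; [apply: measurable_indic; exact: measurable_itv|exact: measurable_gex]. Qed.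

Lemma measurable_FS N : measurable_fun setT (FS N).
Proof.
apply: measurable_funM => //; apply: measurable_prod => jk _.
exact: (measurableT_comp (mgS N jk) (measurable_coord jk)).
Qed.

Lemma FS_split N x : FS N x = cS N * ((\prod_k \1_(itv N) (x (j0, k))) * WS x).
Proof.
congr (_ * _); rewrite (prod_block j0) /WS; congr (_ * _); first by apply: eq_bigr => k _; rewrite /gS /= eqxx.
by apply: eq_bigr => j /negbTE jj; apply: eq_bigr => k _; rewrite /gS /= jj.
Qed.

Lemma FS_le N x : FS N x <= an N * ((\prod_k (kS / N.+1%:R * gex (be6 N)^-1 (x (j0, k)))) * WS x).
Proof.
rewrite FS_split /cS.
have M0 : 0 < N.+1%:R :> R by rewrite ltr0n.
have -> : N.+1%:R `^ (- (n%:R / p)) = an N * (N.+1%:R ^+ n)^-1 :> R.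
  rewrite /an -(powR_mulrn n (ltW M0)) -powRN -powRD; last by rewrite (gt_eqF M0) implybT.
  by congr powR; ring.
rewrite -!mulrA ler_wpM2l ?(ltW (an0 N)) // !mulrA ler_wpM2r ?WS_ge0 //.
rewrite -exprVn -exprMn -[n in _ ^+ n]card_ord -prodr_const -big_split /=.
apply: ler_prod => k _; rewrite indicE.
have P0 : 0 <= N.+1%:R^-1 * (kS * expR (- (2 / 3 * pi))) by apply: mulr_ge0; [rewrite invr_ge0 ltW|exact: mulr_ge0 (ltW kS0) (expR_ge0 _)].
rewrite mulr_ge0 //=; case: (boolP (x (j0, k) \in itv N)) => [|_]; last first.
  by rewrite mulr0 mulr_ge0 ?gex_ge0 // divr_ge0 // ltW.
rewrite inE /itv /= in_itv /= => /andP[x1 x2]; rewrite mulr1 mulrA [N.+1%:R^-1 * _]mulrC ler_wpM2l ?divr_ge0 ?(ltW kS0) //.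
rewrite /gex ler_expR lerN2 /be6 [leRHS]mulrC -[leLHS]mulrA ler_wpM2l ?pi_ge0 //.
have x0 : 0 <= x (j0, k) by rewrite (le_trans _ x1).
rewrite mulrC ler_pdivrMr ?mulr_gt0 ?exprn_gt0 //.
by move: x1 x2 x0 M0; move: (x (j0, k)) (N.+1%:R : R) => a b; nra.
Qed.

Lemma FS_disj N N' x : (N.*2 < N')%N -> FS N x = 0 \/ FS N' x = 0.
Proof.
move=> NN; rewrite !FS_split; pose k : 'I_n := Ordinal n0.
have z M : x (j0, k) \notin itv M -> cS M * ((\prod_k \1_(itv M) (x (j0, k))) * WS x) = 0.
  by move=> h; rewrite (bigD1 k) //= indicE (negbTE h) !(mul0r, mulr0).
case: (boolP (x (j0, k) \in itv N)) => [h1|/z]; last by left.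
case: (boolP (x (j0, k) \in itv N')) => [h2|/z]; last by right.
exfalso; move: h1 h2; rewrite !inE /itv /= !in_itv /= => /andP[_ h1] /andP[h2 _].
have := le_lt_trans h2 h1; rewrite -natrM ltr_nat; lia.
Qed.

Let be : R := ((kS * expR (- (2 / 3 * pi))) ^+ n) `^ p * Kd n j0 (l%:R * p).

Lemma integ_FS N : integ (fun x : PJ -> R => (FS N x `^ p)%:E) = be%:E.
Proof.
have lR : 0 < l%:R :> R by rewrite ltr0n.
have M0 : 0 < N.+1%:R :> R by rewrite ltr0n.
pose gp (jk : PJ) : R -> R := if jk.1 == j0 then \1_(itv N) else gex (l%:R * p).
have gp0 jk t : 0 <= gp jk t by rewrite /gp; case: ifP => _; [rewrite indicE|exact: gex_ge0].
have mgp jk : measurable_fun setT (gp jk : RT -> R).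
  by rewrite /gp; case: ifP => _; [apply: measurable_indic; exact: measurable_itv|exact: measurable_gex].
have e x : FS N x `^ p = cS N `^ p * \prod_jk gp jk (x jk).
  rewrite /FS powRM ?(ltW (cS0 N)) ?prodr_ge0 //; congr (_ * _); rewrite powR_prod //; apply: eq_bigr => jk _.
  rewrite /gS /gp; case: ifP => _; last by rewrite /gex -expRM; congr expR; move: (pi : R) => q; ring.
  by rewrite indicE; case: (_ \in _); rewrite ?powR1 // powR0 // gt_eqF.
have mP : measurable_fun setT (fun x : fspace R PJ => (\prod_jk gp jk (x jk))%:E).
  by apply/measurable_EFinP; apply: measurable_prod => jk _; exact: (measurableT_comp (mgp jk) (measurable_coord jk)).
have P0 (x : PJ -> R) : (0 <= (\prod_jk gp jk (x jk))%:E)%E by rewrite lee_fin prodr_ge0.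
rewrite (_ : (fun x => _) = fun x : fspace R PJ => ((cS N `^ p)%:E * (\prod_jk gp jk (x jk))%:E)%E); last first.
  by apply/funext => x; rewrite e EFinM.
rewrite integE; [|by move=> x; rewrite mule_ge0 // lee_fin powR_ge0|exact: measurable_funeM].
rewrite ge0_integralZl ?lee_fin ?powR_ge0 // -integE //.
rewrite (@integ_prod R PJ gp) //.
have I1 : (\int[leb]_t (\1_(itv N) t)%:E = (N.+1%:R)%:E :> \bar R)%E.
  rewrite integral_indic ?setIT //; last exact: measurable_itv.
  have h := @lebesgue_measure_itv R (`[N.+1%:R, (2 * N.+1%:R)%R[); rewrite /= in h.
  apply: (etrans h); rewrite lte_fin ltr_pMl // ltr1n /=.
  by rewrite -EFinB; congr EFin; ring.
have I2 : (\prod_jk \int[leb]_t (gp jk t)%:E = (N.+1%:R ^+ n * Kd n j0 (l%:R * p))%:E)%E.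
  rewrite (eq_bigr (fun jk => (if jk.1 == j0 then N.+1%:R else (l%:R * p) `^ (- (1 / 2)))%:E)); last first.
    move=> jk _; rewrite /gp; case: ifP => _; first exact: I1.
    by rewrite integral_gex // mulr_gt0.
  rewrite prodEFin; congr EFin.
  rewrite (prod_block j0) /= eqxx prodr_const card_ord; congr (_ * _).
  by apply: eq_bigr => j /negbTE ->.
apply: (etrans (congr1 (fun z => _ * z)%E I2)); rewrite -EFinM; congr EFin.
have w0 : 0 <= (kS * expR (- (2 / 3 * pi))) ^+ n := exprn_ge0 _ (mulr_ge0 (ltW kS0) (expR_ge0 _)).
rewrite /be /cS (powRM p (powR_ge0 _ _) w0) -(powRrM N.+1%:R) mulNr divfK ?gt_eqF //.
rewrite powRN powR_mulrn ?(ltW M0) //.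
have Mn : N.+1%:R ^+ n != 0 :> R by rewrite expf_neq0 // gt_eqF.
by move: (N.+1%:R ^+ n) Mn (_ `^ p) (Kd _ _ _) => a a0 b c; field.
Qed.

(** The lower bounds have disjoint supports, so their [p]-th powers add up. This works for every
    positive [p], as it must, since here [p < 1]. *)
Lemma Lpnorm_TS : pairwise (fun N N' => N.*2 < N')%N s' ->
  ((((size s')%:R * be) `^ p^-1)%:E <= Lpnorm p (Tm m fS))%E.
Proof.
move=> ps.
have mh : measurable_fun setT (fun x => \sum_(N <- s') FS N x).
  by apply: measurable_sum => N; exact: measurable_FS.
have hle x : 0 <= \sum_(N <- s') FS N x <= SS x.
  apply/andP; split; first by apply: sumr_ge0 => N _; exact: FS_ge0.
  by apply: ler_sum => N _; exact: FS_le.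
apply: le_trans (Lpnorm_lower p0 cabs_TS measurable_SS mh hle).
rewrite (_ : (fun x => _) = fun x : fspace R PJ => (\sum_(N <- s') (FS N x `^ p)%:E)%E); last first.
  apply/funext => x; rewrite sumEFin; congr EFin.
  apply: (@powR_sum_disjoint R nat (fun N N' => N.*2 < N')%N) => // [N|N N']; first exact: FS_ge0.
  exact: FS_disj.
rewrite integ_sum; first last.
- by move=> N; apply/measurable_EFinP; exact: (measurableT_comp (measurable_powR _) (measurable_FS N)).
- by move=> N x; rewrite lee_fin powR_ge0.
rewrite (eq_bigr (fun=> be%:E)); last by move=> N _; exact: integ_FS.
by rewrite sumEFin big_const_seq_size poweR_EFin.
Qed.
End sum.

Lemma strict_pu : n%:R * (1 / p - 1 + 1 / u) < s j0.
Proof.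
rewrite ltNge; apply/negP => su; have [CA [CA0 hA]] := shear_hump su.
pose be : R := ((kS * expR (- (2 / 3 * pi))) ^+ n) `^ p * Kd n j0 (l%:R * p).
have lR : 0 < l%:R :> R by rewrite ltr0n.
have be0 : 0 < be.
  by rewrite mulr_gt0 ?Kd_gt0 ?mulr_gt0 // powR_gt0 // exprn_gt0 // mulr_gt0 ?expR_gt0.
pose ph i := ((\prod_(k < n) (1 * pp i) `^ (- (1 / 2))) * \prod_(j | j != j0) \prod_(k < n) (pp i) `^ (- (1 / 2))) `^ (pp i)^-1.
have a0 : 0 < be `^ p^-1 by rewrite powR_gt0.
(* The negated inequality together with [slu] gives [1 / p > 1], while [1 / u < 1]. *)
have ue : u^-1 < p^-1.
  have h : n%:R / u < n%:R * (1 / p - 1 + 1 / u) := lt_le_trans slu su.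
  rewrite ltr_pM2l // !mul1r in h.
  have : u^-1 < 1 by rewrite invf_lt1.
  lra.
apply: (@powR_nat_contra R (be `^ p^-1) ((`|Cst| + 1) * CA * \prod_i ph i) p^-1 u^-1 a0 ue) => r.
have [s' [ss ps _ hm]] := hA r 0%N.
pose m := fun xi : ptK l d n -> R => \sum_(N <- s') mS N (vblock xi j0).
have mE xi : m xi = \sum_(N <- s') mS N (vblock xi j0) by [].
have one0 : (0 : R) < 1 by [].
have sf i : Schwartz (fS i) by apply: tf_Schwartz.
have hf i : Lpnorm (pp i) (fS i) = (ph i)%:E.
  exact: (@Lpnorm_tf R l d n j0 (fun _ _ => 1) (fun _ _ => 0) (fun _ _ => 0) (fun _ _ => one0) i (pp i) (pp0 i)).
have := real_bound Hmain sf (hm m mE) (Lpnorm_TS mE ps) hf (fun i => powR_ge0 _ _).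
rewrite ss -/be powRM ?(ltW be0) // => h.
rewrite mulrC; apply: (le_trans h).
by apply: le_of_eq; ring.
Qed.
End case4.

(** * Conclusion *)

Theorem theorem1p3 (R : realType) (n l d : nat)
    (pp : 'I_l -> R) (p u u' : R) (s : 'I_d -> R)
    (Theta : 'I_d -> (('I_l * 'I_n) -> R) -> R[i]) :
  (0 < n)%N -> (0 < l)%N -> (0 < d)%N ->
  (forall i, 1 < pp i) ->
  1 / p = \sum_(i < l) 1 / pp i ->
  1 < u -> 1 / u + 1 / u' = 1 ->
  (forall j, 0 < s j) ->
  (forall j, Schwartz (Theta j)) ->
  (forall j eta, FT (Theta j) eta != 0 -> 1 / 2 <= enorm eta <= 2) ->
  (exists Cst : R, forall m : (ptK l d n -> R) -> R[i],
      (Anorm u s Theta m < +oo)%E ->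
      forall f : 'I_l -> (ptJ d n -> R) -> R[i],
        (forall i, Schwartz (f i)) ->
        (Lpnorm p (Tm m f)
           <= Cst%:E * Anorm u s Theta m * \prod_(i < l) Lpnorm (pp i) (f i))%E) ->
  (forall (j : 'I_d) (I : {set 'I_l}),
      1 / p - 1 / 2 - \sum_(i in I) (1 / pp i - 1 / 2) <= s j / n%:R /\
      1 / p - 1 / u' - \sum_(i in I) (1 / pp i - 1 / u) <= s j / n%:R) /\
  (forall j : 'I_d, l%:R / u < s j / n%:R /\ 1 / p - 1 / u' < s j / n%:R).
Proof.
move=> n0 l0 d0 pp1 pE u1 uu s0 Ts Tsupp [Cst Hmain].
have pp0 i : 0 < pp i by rewrite (lt_trans _ (pp1 i)).
have p0 : 0 < p.
  have : 0 < 1 / p.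
    rewrite pE (bigD1 (Ordinal l0)) //= ltr_pwDl ?divr_gt0 // sumr_ge0 // => i _.
    by rewrite divr_ge0 // ltW.
  by rewrite div1r invr_gt0.
have nR0 : 0 < n%:R :> R by rewrite ltr0n.
have u0 : 0 < u by rewrite (lt_trans _ u1).
have u'E : 1 / u' = 1 - 1 / u by apply/eqP; rewrite eq_sym subr_eq addrC uu.
have lu j : l%:R / u < s j / n%:R.
  have := strict_lu j n0 l0 u1 s0 Ts Tsupp p0 pp0 pE Hmain.
  by rewrite card_prod !card_ord natrM ltr_pdivlMr // mulrAC.
have lun j : n%:R * (l%:R / u) < s j.
  by have := lu j; rewrite ltr_pdivlMr // mulrC.
have pu j : 1 / p - 1 / u' < s j / n%:R.
  have slu : n%:R / u < s j.
    apply: le_lt_trans (lun j); rewrite ler_wpM2l ?(ltW nR0) // ler_peMl ?invr_ge0 ?(ltW u0) // ler1n //.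
  have := strict_pu n0 l0 u1 s0 Ts Tsupp p0 pp0 Hmain slu.
  by rewrite u'E ltr_pdivlMr // mulrC opprB [1 / u - 1]addrC addrA.
split=> [j I|j]; last by split.
have np x : n%:R * x <= s j -> x <= s j / n%:R by rewrite ler_pdivlMr // mulrC.
split.
  apply: np; apply: le_trans (cond_chirp j u1 s0 Ts Tsupp p0 pp0 Hmain I (Ordinal l0)).
  rewrite ler_wpM2l ?(ltW nR0) // sumrB sumr_const -[_ *+ #|I|]mulr_natl.
  by move: (#|I|%:R : R) => a; lra.
have eI : 1 / p - 1 / u' - \sum_(i in I) (1 / pp i - 1 / u) =
    (1 / p - 1) + (1 + #|I|)%:R / u - \sum_(i in I) 1 / pp i.
  rewrite u'E sumrB sumr_const -[_ *+ #|I|]mulr_natl natrD mulrDl mul1r.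
  by move: (#|I|%:R : R) (\sum_(i in I) _) => a b; field; rewrite !gt_eqF.
rewrite eI.
(* If some index lies outside [I] then [1 + #|I| <= l], and the strict bound by [l / u] makes the
   multiplier exponent in [cond_conj] positive. *)
have [/existsP[i0 i0I]|/existsPn hI] := boolP [exists i0, i0 \notin I].
  apply: np; apply: (cond_conj u1 s0 Ts Tsupp p0 pp0 Hmain i0I).
  rewrite subr_gt0; apply: le_lt_trans (lun j); rewrite natrM mulrA ler_pM2r ?invr_gt0 // ler_pM2l // ler_nat.
  by have := max_card (mem (i0 |: I)); rewrite cardsU1 i0I card_ord.
(* For the full set the expression is [(1 + l) / u - 1], which is below [l / u]; the strict
   inequality already covers it. *)
have iI i : i \in I by have := hI i; rewrite negbK.
have -> : #|I| = l by rewrite -[RHS]card_ord; apply: eq_card => i; rewrite iI.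
have -> : \sum_(i in I) 1 / pp i = 1 / p by rewrite pE; apply: eq_bigl => i; rewrite iI.
have u1' : 1 / u < 1 by rewrite ltr_pdivrMr // mul1r.
have := lu j; rewrite natrD mulrDl mul1r.
by move: (1 / p) (l%:R / u) (s j / n%:R) => a b c; rewrite -[u^-1]div1r; lra.
Qed.
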